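(* Let $(\theta_n,\mu_n)_{n\ge 0}$ be the joint dual averaging iterates with importance sampling defined in the context, and let $\bar\theta_n=\frac1n\sum_{k=0}^{n-1}\theta_k$. Assume: (a) $f:\Theta\to\mathbb R$ is convex, continuously differentiable, and twice continuously differentiable in a neighborhood of $\theta^\star$; the problem $\min_{\theta\in\Theta} f(\theta)$ has a unique minimizer $\theta^\star$, and $\nabla^2 f(\theta^\star)$ is symmetric positive definite; $\Theta$ is bounded. (b) For every $x\in\mathbb R^r$ the function $\mu\mapsto \ell(x,\mu)$ is logarithmically convex and differentiable. (c) The problem $\min_{\mu\in\mathcal M} v(\theta^\star,\mu)$ has a unique minimizer $\mu^\star$, and $\nabla^2_\mu v(\theta^\star,\mu^\star)$ is symmetric positive definite; $\mathcal M$ is bounded; there are constants $G_M,H_M<\infty$ such that for all $\theta\in\Theta$, $\mu\in\mathcal M$: $\mathbb E_{X\sim\mathbb P}[\|G(\theta,X)\|^2\ell(X,\mu)]\le G_M^2$ and $\mathbb E_{X\sim\mathbb P}[\|P_{A_a^\theta}G(\theta,X)\|^4\|\nabla_\mu\ell(X,\mu)\|^2]\le H_M^2$. (d) There is $c_1>0$ such that for all $\theta\in\Theta$, $\mu\in\mathcal M$: $f(\theta)-f(\theta^\star)\ge c_1\|\theta-\theta^\star\|^2$ and $v(\theta^\star,\mu)-v(\theta^\star,\mu^\star)\ge c_1\|\mu-\mu^\star\|^2$. There are $c_2,c_3<\infty$ such that for all $\theta\in\Theta$, $\mu\in\mathcal M$: $\|\nabla f(\theta)-\nabla f(\theta^\star)\|\le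 c_2\|\theta-\theta^\star\|$ and $\|\nabla_\mu v(\theta^\star,\mu)-\nabla_\mu v(\theta^\star,\mu^\star)\|\le c_2\|\mu-\mu^\star\|$; and $\|\nabla_\mu v(\theta,\mu)-\nabla_\mu v(\theta^\star,\mu)\|\le c_3\|\theta-\theta^\star\|^2$ for all $\mu\in\mathcal M$ and all $\theta\in\Theta$ with $A_a^\star\theta=b_a^\star$, $A_i^\star\theta<b_i^\star$. (e) $-\nabla f(\theta^\star)=A_a^{\star\top}\lambda_1$ for some $\lambda_1\in\mathbb R^{p_1}_{++}$ and $-\nabla_\mu v(\theta^\star,\mu^\star)=C_a^{\star\top}\lambda_2$ for some $\lambda_2\in\mathbb R^{p_2}_{++}$. (f) There exist $c,\varepsilon>0$ such that $\|\nabla f(\theta)-\nabla f(\theta^\star)-\nabla^2f(\theta^\star)(\theta-\theta^\star)\|\le c\|\theta-\theta^\star\|^2$ for all $\theta\in\Theta$ with $\|\theta-\theta^\star\|\le\varepsilon$, and there exist $c,\varepsilon>0$ such that $\|\nabla_\mu v(\theta^\star,\mu)-\nabla_\mu v(\theta^\star,\mu^\star)-\nabla^2_\mu v(\theta^\star,\mu^\star)(\mu-\mu^\star)\|\le c\|\mu-\mu^\star\|^2$ for all $\mu\in\mathcal M$ with $\|\mu-\mu^\star\|\le\varepsilon$. There exists $\rho>0$ such that $x^\top\nabla^2f(\theta^\star)x\ge\rho\|x\|^2$ for all $x\in\mathrm{Ker}(A_a^\star)$ and $y^\top\nabla^2_\mu v(\theta^\star,\mu^\star)y\ge\rho\|y\|^2$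 for all $y\in\mathrm{Ker}(C_a^\star)$. (g) With $\xi_k=\begin{bmatrix}G_k-\nabla f(\theta_k)\\ H_k-\nabla_\mu v(\theta_k,\mu_k)\end{bmatrix}$, for all $t\in\mathbb R^{s+m}$ and $\varepsilon>0$, as $n\to\infty$ in probability, $$\frac1n\sum_{k=0}^{n-1}\mathbb E\big[(t^\top\xi_k)^2\mathbf 1_{\{|t^\top\xi_k|>\varepsilon\sqrt n\}}\,\big|\,\mathcal F_k\big]\to0,\qquad t^\top\Big(\frac1n\sum_{k=0}^{n-1}\mathbb E[\xi_k\xi_k^\top|\mathcal F_k]\Big)t\to t^\top\begin{bmatrix}\Sigma_1&0\\0&\Sigma_2\end{bmatrix}t,$$ where $\Sigma_1=\mathrm{Var}_{X\sim\mathbb P_{\mu^\star}}[G_{\mu^\star}(\theta^\star,X)]$ and $\Sigma_2=\mathrm{Var}_{X\sim\mathbb P}[H(\theta^\star,\mu^\star,X)]$. Then, as $n\to\infty$, $$\sqrt n\,P_{A_a^\star}\nabla f(\bar\theta_n)\overset{d}{\to}\mathcal N\Big(0,\ \mathrm{Var}_{X\sim\mathbb P_{\mu^\star}}\big[P_{A_a^\star}G_{\mu^\star}(\theta^\star,X)\big]\Big),$$ where $\mu^\star$ satisfies $$\mu^\star=\arg\min_{\mu\in\mathcal M}\ \mathrm{Tr}\Big(\mathrm{Var}_{X\sim\mathbb P_\mu}\big[P_{A_a^\star}G_\mu(\theta^\star,X)\big]\Big).$$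
   Context: Notation: $\|\cdot\|$ is the Euclidean norm; $\mathbb R_{++}=\{x\in\mathbb R:x>0\}$; $B^\dagger$ is the Moore–Penrose pseudoinverse of $B$; vector inequalities are componentwise; $\mathrm{Var}$ of a random vector is its covariance matrix. Setup. $\Theta=\{\theta\in\mathbb R^s: A\theta\le b\}$ with $A\in\mathbb R^{p\times s}$, $b\in\mathbb R^p$, and $\mathcal M=\{\mu\in\mathbb R^m: C\mu\le d\}$ for a matrix $C$ and vector $d$. $\mathbb P$ is a probability distribution on $\mathcal X\subseteq\mathbb R^r$, $F:\mathbb R^s\times\mathbb R^r\to\mathbb R$, $f(\theta)=\mathbb E_{X\sim\mathbb P}[F(\theta,X)]$, $G(\theta,x)=\nabla_\theta F(\theta,x)$, and $\nabla f(\theta)=\mathbb E_{X\sim\mathbb P}[G(\theta,X)]$. $(\mathbb P_\mu)_{\mu\in\mathcal M}$ is a family of probability distributions with $\mathbb P\ll\mathbb P_\mu$ (the importance sampling family), with likelihood ratio $\ell(x,\mu)=\frac{d\mathbb P}{d\mathbb P_\mu}(x)$; put $G_\mu(\theta,x)=\ell(x,\mu)G(\theta,x)$. Active constraints. For $\theta\in\Theta$, $A_a^\theta,b_a^\theta$ (resp. $A_i^\theta,b_i^\theta$) collect the rows of $A$, entries of $b$ of the constraints that are active, $A_a^\theta\theta=b_a^\theta$ (resp. inactive, $A_i^\theta\theta<b_i^\theta$). For $\theta=\theta^\star$ write $A_a^\star,b_a^\star,A_i^\star,b_i^\star$; $p_1$ is the dimension of $b_a^\star$. Similarly $C_a^\star,d_a^\star$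 (resp. $C_i^\star,d_i^\star$) are the active (resp. inactive) parts of $C,d$ at $\mu^\star$: $C_a^\star\mu^\star=d_a^\star$, $C_i^\star\mu^\star<d_i^\star$; $p_2$ is the dimension of $d_a^\star$. For a matrix $B$, $P_B=I-B^\top(BB^\top)^\dagger B$ is the orthogonal projector onto $\mathrm{Ker}(B)$ (and $P_B=I$ if $B$ has no rows). Importance sampling objective. $v(\theta,\mu)=\mathbb E_{X\sim\mathbb P}[\|P_{A_a^\theta}G(\theta,X)\|^2\ell(X,\mu)]$ and $H(\theta,\mu,x)=\|P_{A_a^\theta}G(\theta,x)\|^2\nabla_\mu\ell(x,\mu)$. Algorithm. Let $\alpha_n=\alpha/n^\gamma$ ($n\ge1$) with $\alpha>0$, $\gamma\in(1/2,1)$, and let $(\theta_0,\mu_0)\in\Theta\times\mathcal M$ be deterministic. For $n\ge0$, $$(\theta_{n+1},\mu_{n+1})=\arg\min_{(\theta,\mu)\in\Theta\times\mathcal M}\Big\{\sum_{k=0}^n\alpha_{k+1}\big(\langle G_k,\theta\rangle+\langle H_k,\mu\rangle\big)+\tfrac12\|\theta-\theta_0\|^2+\tfrac12\|\mu-\mu_0\|^2\Big\},$$ where $G_k=G_{\mu_k}(\theta_k,X_{k+1}^{(\mu_k)})$, $H_k=H(\theta_k,\mu_k,X_{k+1})$, $\mathcal F_n=\sigma(X_k^{(\mu_{k-1})},X_k: k\le n)$, and, conditionally on $\mathcal F_k$, $X_{k+1}^{(\mu_k)}\sim\mathbb P_{\mu_k}$ and $X_{k+1}\sim\mathbb P$ are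 independent. *)

(* Defs.v *)
From mathcomp Require Export all_boot all_order all_algebra.
From mathcomp Require Export all_classical all_reals all_analysis.
Export Order.TTheory GRing.Theory Num.Theory.
Export numFieldNormedType.Exports.

Set Implicit Arguments.
Unset Strict Implicit.
Unset Printing Implicit Defensive.

Local Open Scope classical_set_scope.
Local Open Scope ring_scope.

(* R^n (column vectors) with its Borel sigma-algebra; convertible to 'cV[R]_n. *)
Definition borelV (R : realType) (n : nat) :=
  g_sigma_algebraType (@open 'cV[R]_n).

Section LinearAlgebra.
Context {R : realType}.

Definition dotv n (u v : 'cV[R]_n) : R := (u^T *m v) 0 0.

(* The library norm `|u| on matrices is the sup norm. *)
Definition enorm n (u : 'cV[R]_n) : R := Num.sqrt (dotv u u).

Definition grad n (f : 'cV[R]_n -> R) (x : 'cV[R]_n) : 'cV[R]_n :=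
  \col_i 'D_(delta_mx i 0) f x.

Definition hess n (f : 'cV[R]_n -> R) (x : 'cV[R]_n) : 'M[R]_n :=
  \matrix_(i, j) 'D_(delta_mx i 0) (fun y => 'D_(delta_mx j 0) f y) x.

Definition sym_posdef n (S : 'M[R]_n) : Prop :=
  S^T = S /\ forall x : 'cV[R]_n, x != 0 -> 0 < dotv x (S *m x).

Definition is_moore_penrose m n (B : 'M[R]_(m, n)) (X : 'M[R]_(n, m)) : Prop :=
  [/\ B *m X *m B = B, X *m B *m X = X,
      (B *m X)^T = B *m X & (X *m B)^T = X *m B].

(* Over the reals exactly one X satisfies [is_moore_penrose B]; the library's
   [pinvmx] is only some partial inverse and need not be this one. *)
Definition moore_penrose m n (B : 'M[R]_(m, n)) : 'M[R]_(n, m) :=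
  xget 0 [set X | is_moore_penrose B X].

Definition projker m n (B : 'M[R]_(m, n)) : 'M[R]_n :=
  1%:M - B^T *m moore_penrose (B *m B^T) *m B.

Definition polyhedron p n (A : 'M[R]_(p, n)) (b : 'cV[R]_p) : set 'cV[R]_n :=
  [set x | forall i, (A *m x) i 0 <= b i 0].

Definition active p n (A : 'M[R]_(p, n)) (b : 'cV[R]_p) (x : 'cV[R]_n) :
    {set 'I_p} :=
  finset (fun i => (A *m x) i 0 == b i 0).

Definition inactive p n (A : 'M[R]_(p, n)) (b : 'cV[R]_p) (x : 'cV[R]_n) :
    {set 'I_p} :=
  finset (fun i => (A *m x) i 0 < b i 0).

Definition act_mx p n (A : 'M[R]_(p, n)) b x : 'M[R]_(#|active A b x|, n) :=
  rowsub enum_val A.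

Definition act_vec p n (A : 'M[R]_(p, n)) b x : 'cV[R]_(#|active A b x|) :=
  rowsub enum_val b.

Definition inact_mx p n (A : 'M[R]_(p, n)) b x :
    'M[R]_(#|inactive A b x|, n) :=
  rowsub enum_val A.

Definition inact_vec p n (A : 'M[R]_(p, n)) b x :
    'cV[R]_(#|inactive A b x|) :=
  rowsub enum_val b.

End LinearAlgebra.

Section Optimization.
Context {R : realType}.

Definition is_minimizer (T : Type) (D : set T) (g : T -> R) (x : T) : Prop :=
  D x /\ forall y, D y -> g x <= g y.

Definition is_argmin (T : Type) (D : set T) (g : T -> R) (x : T) : Prop :=
  is_minimizer D g x /\ forall y, is_minimizer D g y -> y = x.

(* [lne 0 = -oo], so that zeros of [g] are allowed. *)
Definition log_convex n (D : set 'cV[R]_n) (g : 'cV[R]_n -> R) : Prop :=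
  (forall x, D x -> 0 <= g x) /\
  forall (t : R) (x y : 'cV[R]_n), 0 <= t <= 1 -> D x -> D y ->
    (lne (g (t *: x + (1 - t) *: y))%:E
     <= t%:E * lne (g x)%:E + (1 - t)%:E * lne (g y)%:E)%E.

End Optimization.

Section Probability.
Context {R : realType}.

Definition covmx d (T : measurableType d) (Q : probability T R) n
    (V : T -> 'cV[R]_n) : 'M[R]_n :=
  \matrix_(i, j) fine (covariance Q (fun x => V x i 0) (fun x => V x j 0)).

(* [Y] is a version of the conditional expectation of [Z] given the
   sub-sigma-algebra [FF]. *)
Definition is_cond_exp d (T : measurableType d) (P : probability T R)
    (FF : set (set T)) (Z Y : T -> R) : Prop :=
  [/\ P.-integrable setT (EFin \o Z),
      P.-integrable setT (EFin \o Y),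
      (forall B : set R, measurable B -> FF (Y @^-1` B)) &
      forall A, FF A ->
        (\int[P]_(w in A) (Y w)%:E = \int[P]_(w in A) (Z w)%:E)%E].

Definition cvg_in_proba d (T : measurableType d) (P : probability T R)
    (Z : nat -> T -> R) (c : R) : Prop :=
  forall e : R, 0 < e ->
    (fun n => P [set w | e <= `|Z n w - c|]) @ \oo --> 0%E.

(* The normal law on the line with variance [v]; [normal_prob] takes a standard
   deviation and is not the Dirac measure when the latter is 0. *)
Definition normal1 (m v : R) : set R -> \bar R :=
  if v == 0 then dirac m else normal_prob m (Num.sqrt v).

(* [Q] is N(m, S): every linear form t^T x has law N(t^T m, t^T S t). *)
Definition is_normal n (Q : probability (borelV R n) R)
    (m : 'cV[R]_n) (S : 'M[R]_n) : Prop :=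
  forall (t : 'cV[R]_n) (B : set R), measurable B ->
    Q [set x : 'cV[R]_n | B (dotv t x)] =
    normal1 (dotv t m) (dotv t (S *m t)) B.

Definition cvg_in_law d (T : measurableType d) (P : probability T R) n
    (Z : nat -> T -> 'cV[R]_n) (Q : probability (borelV R n) R) : Prop :=
  (forall k, measurable_fun setT (Z k : T -> borelV R n)) /\
  forall g : 'cV[R]_n -> R, continuous g ->
    (exists K : R, forall x, `|g x| <= K) ->
    (fun k => \int[P]_w g (Z k w)) @ \oo --> \int[Q]_x g x.

End Probability.

Section ImportanceSampling.
Context {R : realType}.
Variables (s m r p : nat).
Variable PP : probability (borelV R r) R.
Variable F : 'cV[R]_s -> borelV R r -> R.
Variable l : borelV R r -> 'cV[R]_m -> R.
Variables (A : 'M[R]_(p, s)) (b : 'cV[R]_p).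

Definition objf (theta : 'cV[R]_s) : R := \int[PP]_x F theta x.

Definition Gfun (theta : 'cV[R]_s) (x : borelV R r) : 'cV[R]_s :=
  grad (F ^~ x) theta.

Definition Gis (mu : 'cV[R]_m) (theta : 'cV[R]_s) (x : borelV R r) :
    'cV[R]_s :=
  l x mu *: Gfun theta x.

Definition PGsq (theta : 'cV[R]_s) (x : borelV R r) : R :=
  enorm (projker (act_mx A b theta) *m Gfun theta x) ^+ 2.

Definition visobj (theta : 'cV[R]_s) (mu : 'cV[R]_m) : R :=
  \int[PP]_x (PGsq theta x * l x mu).

Definition Hfun (theta : 'cV[R]_s) (mu : 'cV[R]_m) (x : borelV R r) :
    'cV[R]_m :=
  PGsq theta x *: grad (l x) mu.

(* [Q] plays the role of P_mu and [lx] that of the density dP/dP_mu. *)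
Definition is_likelihood_ratio (Q : probability (borelV R r) R)
    (lx : borelV R r -> R) : Prop :=
  [/\ measurable_fun setT lx, forall x, 0 <= lx x &
      forall B, measurable B -> PP B = (\int[Q]_(x in B) (lx x)%:E)%E].

End ImportanceSampling.

Section Algorithm.
Context {R : realType}.
Variables (d : measure_display) (Omega : measurableType d).
Variables (s m r : nat).

(* [X1 k] is X_k^(mu_(k-1)) and [X2 k] is X_k, for k >= 1; the values at k = 0
   are not used. *)
Definition history (X1 X2 : nat -> Omega -> borelV R r) (n : nat) :
    set (set Omega) :=
  <<s [set E | exists (k : nat) (B : set (borelV R r)),
         [/\ (0 < k <= n)%N, measurable B &
             E = X1 k @^-1` B \/ E = X2 k @^-1` B]] >>.

Definition dual_averaging_obj (alpha : nat -> R)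
    (Gk : nat -> 'cV[R]_s) (Hk : nat -> 'cV[R]_m)
    (theta0 : 'cV[R]_s) (mu0 : 'cV[R]_m) (n : nat)
    (z : 'cV[R]_s * 'cV[R]_m) : R :=
  \sum_(k < n.+1) alpha k.+1 * (dotv (Gk k) z.1 + dotv (Hk k) z.2)
  + 2^-1 * enorm (z.1 - theta0) ^+ 2 + 2^-1 * enorm (z.2 - mu0) ^+ 2.

Definition noise (f : 'cV[R]_s -> R) (v : 'cV[R]_s -> 'cV[R]_m -> R)
    (theta : nat -> Omega -> 'cV[R]_s) (mu : nat -> Omega -> 'cV[R]_m)
    (Gk : nat -> Omega -> 'cV[R]_s) (Hk : nat -> Omega -> 'cV[R]_m)
    (k : nat) (w : Omega) : 'cV[R]_(s + m) :=
  col_mx (Gk k w - grad f (theta k w))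
         (Hk k w - grad (v (theta k w)) (mu k w)).

Definition average (theta : nat -> Omega -> 'cV[R]_s) (n : nat) (w : Omega) :
    'cV[R]_s :=
  n%:R^-1 *: \sum_(k < n) theta k w.

End Algorithm.

(* Main.v *)
(* Write ts for the minimizer of f. Let Q be the projector onto the kernel
   of the constraints active at ts, G_k the sampled gradients, alpha_k the
   step sizes and eta_k the gradient noise. The iterates are projections of
   theta_0 - sum alpha_j G_j onto Theta, and the Fenchel coupling with ts
   decreases up to a martingale term and square-summable errors; hence
   theta_k -> ts almost surely, and strict complementarity makes exactly the
   constraints active at ts active at theta_k for all large k. From then on
   alpha_k Q G_k = theta_k - theta_{k+1}, so Abel summation shows sum_{k<n}
   Q G_k = o_P(sqrt n). The expansion of grad f at ts is applied both to the
   G_k and to the average; its linear terms cancel and its quadratic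
   remainders are o_P(sqrt n), which leaves
     sqrt n Q grad f(bar theta_n) = - n^{-1/2} sum_{k<n} Q eta_k + o_P(1).
   The central limit theorem for the martingale on the right comes from
   multiplying its characteristic function by the exponential of half the
   accumulated conditional variance. Only test functions cos(c + <t, x>) are
   needed: together with tightness they determine convergence in law by
   Stone-Weierstrass. Finally, by a change of measure, Tr Var_{P_mu}[Q
   G_mu(ts, X)] = v(ts, mu) - |Q grad f(ts)|^2, so both sides have the same
   minimizer over M. *)
From HB Require Import structures.
From mathcomp Require Import finmap.
Require Import Defs.
From mathcomp Require Import measurable_realfun.
From mathcomp Require Import ring lra zify.

Set Implicit Arguments.
Unset Strict Implicit.
Unset Printing Implicit Defensive.

Local Open Scope classical_set_scope.
Local Open Scope ring_scope.

(** * Euclidean vectors and projectors *)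

(** Three obstacles shape the argument. The dual variable may be unbounded: it drifts like T_k times
    - grad f(ts), with T_k the sum of the steps, and its coupling with ts equals half the squared
    distance only inside a radius where the polyhedron agrees with its tangent cone. That radius
    gives convergence and, the drift being in the relative interior of the normal cone,
    identification. Next, identification happens at a random time, so expectations are taken on the
    events that it has held from a fixed N up to n, which are known at time n; there the mean
    squared error is of order alpha_n. The Abel sum then costs alpha_n^(-1/2) = o(sqrt n) because
    gamma < 1, and the Taylor remainders cost sum alpha_k = o(sqrt n) because gamma > 1/2. Last, the
    conditional variances are controlled only in probability, so the martingale is truncated by
    predictable events before its characteristic function is compensated. The phase c in cos(c + <t,
    x>) stands for real and imaginary parts at once, so complex numbers never appear. *)

Section EuclideanSpace.
Context {R : realType}.

Lemma dotvE n (u v : 'cV[R]_n) : dotv u v = \sum_i u i 0 * v i 0.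
Proof. by rewrite /dotv mxE; apply: eq_bigr => i _; rewrite mxE. Qed.

Lemma dotvC n (u v : 'cV[R]_n) : dotv u v = dotv v u.
Proof. by rewrite !dotvE; apply: eq_bigr => i _; rewrite mulrC. Qed.

Lemma dotvDr n (u v w : 'cV[R]_n) : dotv u (v + w) = dotv u v + dotv u w.
Proof. by rewrite /dotv mulmxDr mxE. Qed.

Lemma dotvDl n (u v w : 'cV[R]_n) : dotv (v + w) u = dotv v u + dotv w u.
Proof. by rewrite dotvC dotvDr !(dotvC u). Qed.

Lemma dotvZr n a (u v : 'cV[R]_n) : dotv u (a *: v) = a * dotv u v.
Proof. by rewrite /dotv -scalemxAr mxE. Qed.

Lemma dotvZl n a (u v : 'cV[R]_n) : dotv (a *: u) v = a * dotv u v.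
Proof. by rewrite dotvC dotvZr dotvC. Qed.

Lemma dotvNr n (u v : 'cV[R]_n) : dotv u (- v) = - dotv u v.
Proof. by rewrite -scaleN1r dotvZr mulN1r. Qed.

Lemma dotvNl n (u v : 'cV[R]_n) : dotv (- u) v = - dotv u v.
Proof. by rewrite dotvC dotvNr dotvC. Qed.

Lemma dotvBr n (u v w : 'cV[R]_n) : dotv u (v - w) = dotv u v - dotv u w.
Proof. by rewrite dotvDr dotvNr. Qed.

Lemma dotvBl n (u v w : 'cV[R]_n) : dotv (v - w) u = dotv v u - dotv w u.
Proof. by rewrite dotvDl dotvNl. Qed.

Lemma dotv0r n (u : 'cV[R]_n) : dotv u 0 = 0.
Proof. by rewrite /dotv mulmx0 mxE. Qed.

Lemma dotv0l n (u : 'cV[R]_n) : dotv 0 u = 0.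
Proof. by rewrite dotvC dotv0r. Qed.

Lemma dotv_sumr n (I : Type) (s : seq I) (Q : pred I) (u : 'cV[R]_n) F :
  dotv u (\sum_(i <- s | Q i) F i) = \sum_(i <- s | Q i) dotv u (F i).
Proof.
by apply: (big_morph (dotv u)); [move=> *; exact: dotvDr|exact: dotv0r].
Qed.

Lemma dotv_delta n (i : 'I_n) (u : 'cV[R]_n) : dotv (delta_mx i 0) u = u i 0.
Proof.
rewrite dotvE (bigD1 i)//= mxE !eqxx mul1r big1 ?addr0// => j ji.
by rewrite mxE (negbTE ji) mul0r.
Qed.

Lemma dotv_mulmx m n (B : 'M[R]_(m, n)) u v :
  dotv u (B *m v) = dotv (B^T *m u) v.
Proof. by rewrite /dotv trmx_mul trmxK mulmxA. Qed.

Lemma dotv_ge0 n (u : 'cV[R]_n) : 0 <= dotv u u.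
Proof. by rewrite dotvE sumr_ge0// => i _; rewrite -expr2 sqr_ge0. Qed.

Lemma enorm_ge0 n (u : 'cV[R]_n) : 0 <= enorm u.
Proof. exact: sqrtr_ge0. Qed.

Lemma enorm_sqr n (u : 'cV[R]_n) : enorm u ^+ 2 = dotv u u.
Proof. by rewrite sqr_sqrtr// dotv_ge0. Qed.

Lemma enorm_sqr_ge n (u : 'cV[R]_n) i : u i 0 ^+ 2 <= enorm u ^+ 2.
Proof.
rewrite enorm_sqr dotvE (bigD1 i)//= -expr2 lerDl sumr_ge0// => j _.
by rewrite -expr2 sqr_ge0.
Qed.

Lemma normr_le_enorm n (u : 'cV[R]_n) i : `|u i 0| <= enorm u.
Proof.
by rewrite -(@ler_pXn2r _ 2)// ?nnegrE ?enorm_ge0// -normrX ger0_norm ?sqr_ge0// enorm_sqr_ge.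
Qed.

Lemma enorm0 n : enorm (0 : 'cV[R]_n) = 0.
Proof. by rewrite /enorm dotv0r sqrtr0. Qed.

Lemma enorm0_eq0 n (u : 'cV[R]_n) : enorm u = 0 -> u = 0.
Proof.
move=> u0; apply/matrixP => i j; rewrite mxE ord1; apply/eqP.
by rewrite -normr_le0 -u0 normr_le_enorm.
Qed.

Lemma dotv_eq0 n (u : 'cV[R]_n) : dotv u u = 0 -> u = 0.
Proof. by move=> u0; apply: enorm0_eq0; rewrite /enorm u0 sqrtr0. Qed.

Lemma dotv_CS n (u v : 'cV[R]_n) : `|dotv u v| <= enorm u * enorm v.
Proof.
rewrite -(@ler_pXn2r _ 2)// ?nnegrE ?mulr_ge0 ?enorm_ge0// -normrX.
rewrite ger0_norm ?sqr_ge0// exprMn !enorm_sqr.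
have [v0|v0] := eqVneq (dotv v v) 0.
  by rewrite (dotv_eq0 v0) !dotv0r expr0n/= mulr0.
have vp : 0 < dotv v v by rewrite lt_def v0 dotv_ge0.
have := dotv_ge0 (dotv v v *: u - dotv u v *: v).
rewrite !(dotvBr, dotvBl, dotvZl, dotvZr) (dotvC v u) => h.
rewrite -(ler_pM2l vp).
by lra.
Qed.

Lemma dotv_le n (u v : 'cV[R]_n) : dotv u v <= enorm u * enorm v.
Proof. exact: le_trans (ler_norm _) (dotv_CS _ _). Qed.

Lemma enormD n (u v : 'cV[R]_n) : enorm (u + v) <= enorm u + enorm v.
Proof.
rewrite -(@ler_pXn2r _ 2)// ?nnegrE ?addr_ge0 ?enorm_ge0// sqrrD !enorm_sqr.
rewrite dotvDr !dotvDl (dotvC v u) -!enorm_sqr.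
by have := dotv_le u v; lra.
Qed.

Lemma enormZ n a (u : 'cV[R]_n) : enorm (a *: u) = `|a| * enorm u.
Proof. by rewrite /enorm dotvZl dotvZr mulrA -expr2 sqrtrM ?sqr_ge0// sqrtr_sqr. Qed.

Lemma enormN n (u : 'cV[R]_n) : enorm (- u) = enorm u.
Proof. by rewrite -scaleN1r enormZ normrN1 mul1r. Qed.

Lemma enormB n (u v : 'cV[R]_n) : enorm (u - v) <= enorm u + enorm v.
Proof. by rewrite (le_trans (enormD _ _))// enormN. Qed.

Lemma enorm_sum n (I : Type) (s : seq I) (Q : pred I) (F : I -> 'cV[R]_n) :
  enorm (\sum_(i <- s | Q i) F i) <= \sum_(i <- s | Q i) enorm (F i).
Proof.
elim/big_ind2: _ => [|u a v b ua vb|//]; first by rewrite enorm0.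
by rewrite (le_trans (enormD _ _))// lerD.
Qed.

Lemma enormD_sqr n (u v : 'cV[R]_n) :
  enorm (u + v) ^+ 2 = enorm u ^+ 2 + dotv u v *+ 2 + enorm v ^+ 2.
Proof.
by rewrite !enorm_sqr dotvDr !dotvDl (dotvC v u) mulr2n !addrA.
Qed.

Lemma enorm_le_sum n (u : 'cV[R]_n) : enorm u <= \sum_i `|u i 0|.
Proof.
rewrite {1}[u]matrix_sum_delta (le_trans (enorm_sum _ _ _))//.
apply: ler_sum => i _; rewrite big_ord1 enormZ ler_piMr//.
suff -> : enorm (delta_mx i 0 : 'cV[R]_n) = 1 by [].
by rewrite /enorm dotv_delta mxE !eqxx sqrtr1.
Qed.

Lemma normr_le_mx_norm n (u : 'cV[R]_n) i : `|u i 0| <= `|u|.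
Proof.
rewrite {2}/Num.norm/= mx_normrE.
exact: (@le_bigmax_cond _ _ _ _ (i, 0) (fun _ => true) (fun ij => `|u ij.1 ij.2|)).
Qed.

Lemma enorm_le_mx_norm n (u : 'cV[R]_n) : enorm u <= n%:R * `|u|.
Proof.
rewrite (le_trans (enorm_le_sum _))// (le_trans (ler_sum _ (fun i _ => normr_le_mx_norm u i)))//.
by rewrite sumr_const card_ord mulr_natl.
Qed.

Lemma mulmx_bounded m n (B : 'M[R]_(m, n)) :
  exists2 K, 0 <= K & forall u, enorm (B *m u) <= K * enorm u.
Proof.
exists (\sum_i \sum_j `|B i j|) => [|u]; first by do 2 apply: sumr_ge0 => ? _.
rewrite (le_trans (enorm_le_sum _))// mulr_suml; apply: ler_sum => i _.
rewrite mxE (le_trans (ler_norm_sum _ _ _))// mulr_suml; apply: ler_sum => j _.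
by rewrite normrM ler_wpM2l ?normr_le_enorm.
Qed.

Lemma enorm_trmx_mul_eq0 m n (B : 'M[R]_(m, n)) (u : 'cV[R]_m) :
  B *m (B^T *m u) = 0 -> B^T *m u = 0.
Proof.
by move=> h; apply: dotv_eq0; rewrite dotv_mulmx trmxK h dotv0l.
Qed.

(** [B *m (B^T *m u) = 0] forces |B^T u|^2 = <u, B B^T u> = 0; this is applied to each column of the
    transpose of [X *m B]. *)
Lemma mulmx_trmx_eq0 k m n (X : 'M[R]_(k, m)) (B : 'M[R]_(m, n)) :
  X *m B *m B^T = 0 -> X *m B = 0.
Proof.
move=> h; apply: trmx_inj; rewrite trmx_mul trmx0.
suff col0 (j : 'I_k) : B^T *m col j X^T = 0.
  by apply/matrixP => i j; have /matrixP/(_ i 0) := col0 j; rewrite colE mulmxA -colE !mxE.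
apply: enorm_trmx_mul_eq0; rewrite colE !mulmxA.
have -> : B *m B^T *m X^T = 0.
  by rewrite -(trmx0 R k m) -h !trmx_mul trmxK mulmxA.
by rewrite mul0mx.
Qed.

Lemma gram_unit m n (B : 'M[R]_(m, n)) : row_free B -> B *m B^T \in unitmx.
Proof.
move=> fB; rewrite -row_free_unit -kermx_eq0; apply/eqP.
have h : kermx (B *m B^T) *m B *m B^T = 0 by rewrite -mulmxA mulmx_ker.
have {}h := mulmx_trmx_eq0 h.
by apply: (row_free_inj fB); rewrite h mul0mx.
Qed.

(** With U U^T and L^T L invertible this is the classical pseudoinverse of a full-rank
    factorization; both products collapse to the orthogonal projectors on the ranges of L and of
    U^T. *)
Lemma moore_penrose_factor m n k (L : 'M[R]_(m, k)) (U : 'M[R]_(k, n)) :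
  U *m U^T \in unitmx -> L^T *m L \in unitmx ->
  is_moore_penrose (L *m U)
    (U^T *m invmx (U *m U^T) *m invmx (L^T *m L) *m L^T).
Proof.
move=> uU uL; set X := U^T *m _ *m _ *m _.
have BX : L *m U *m X = L *m invmx (L^T *m L) *m L^T.
  by rewrite /X !mulmxA -(mulmxA L U) -(mulmxA L (U *m U^T)) mulmxV// mulmx1.
have XB : X *m (L *m U) = U^T *m invmx (U *m U^T) *m U.
  by rewrite /X !mulmxA -(mulmxA _ L^T L) -(mulmxA _ (invmx (L^T *m L))) mulVmx// mulmx1.
split.
- by rewrite BX !mulmxA -(mulmxA _ L^T L) -(mulmxA _ (invmx (L^T *m L))) mulVmx// mulmx1.
- by rewrite XB /X !mulmxA -(mulmxA _ U U^T) -(mulmxA _ (U *m U^T)) mulmxV// mulmx1.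
- by rewrite BX !trmx_mul trmxK trmx_inv trmx_mul trmxK mulmxA.
- by rewrite XB !trmx_mul trmxK trmx_inv trmx_mul trmxK mulmxA.
Qed.

(** [moore_penrose] is defined by choice and satisfies its equations only if some X does; the rank
    factorization by [col_base] and [row_base] provides one. *)
Lemma moore_penrose_exists m n (B : 'M[R]_(m, n)) :
  exists X, is_moore_penrose B X.
Proof.
have := @moore_penrose_factor m n (\rank B) (col_base B) (row_base B).
rewrite mulmx_base => h; eexists; apply: h; first exact/gram_unit/row_base_free.
rewrite -[X in _ *m X](trmxK (col_base B)); apply: gram_unit.
by rewrite /row_free mxrank_tr; exact: col_base_full.
Qed.

Lemma moore_penroseP m n (B : 'M[R]_(m, n)) :
  is_moore_penrose B (moore_penrose B).
Proof.
have [X hX] := moore_penrose_exists B.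
by rewrite /moore_penrose; case: xgetP => [Y _ //|/(_ X)].
Qed.

Section Projker.
Variables (m n : nat) (B : 'M[R]_(m, n)).

(** With S the pseudoinverse of B B^T, (1 - B B^T S) B B^T = 0, and [mulmx_trmx_eq0] cancels the
    trailing B^T. *)
Lemma mulmx_projker : B *m projker B = 0.
Proof.
have [h _ _ _] := moore_penroseP (B *m B^T).
rewrite /projker mulmxBr mulmx1 !mulmxA.
set S := moore_penrose _ in h *.
have : (1%:M - B *m B^T *m S) *m B *m B^T = 0.
  by rewrite -mulmxA mulmxBl mul1mx h subrr.
by move/mulmx_trmx_eq0; rewrite mulmxBl mul1mx.
Qed.

(** For Q = B^T S B the identity B Q = B gives Q^T Q = Q^T, whose left side is symmetric. *)
Lemma projker_sym : (projker B)^T = projker B.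
Proof.
have := mulmx_projker; rewrite /projker; set S := moore_penrose _.
set Q := B^T *m S *m B; rewrite mulmxBr mulmx1 => /eqP; rewrite subr_eq0 => /eqP BQ.
have QQ : Q^T *m Q = Q^T.
  by rewrite {1}/Q !trmx_mul trmxK -!mulmxA -BQ.
have : (Q^T *m Q)^T = Q^T *m Q by rewrite trmx_mul trmxK.
by rewrite QQ trmxK linearB /= trmx1 => <-.
Qed.

Lemma projker_idem : projker B *m projker B = projker B.
Proof. by rewrite {1}/projker mulmxBl mul1mx -!mulmxA mulmx_projker !mulmx0 subr0. Qed.

Lemma projker_mul_trmx : projker B *m B^T = 0.
Proof. by rewrite -[LHS]trmxK trmx_mul trmxK projker_sym mulmx_projker trmx0. Qed.

Lemma projker_id (u : 'cV[R]_n) : B *m u = 0 -> projker B *m u = u.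
Proof. by move=> Bu; rewrite /projker mulmxBl mul1mx -!mulmxA Bu !mulmx0 subr0. Qed.

Lemma dotv_projker (u v : 'cV[R]_n) :
  dotv u (projker B *m v) = dotv (projker B *m u) v.
Proof. by rewrite dotv_mulmx projker_sym. Qed.

Lemma enorm_projker (u : 'cV[R]_n) : enorm (projker B *m u) <= enorm u.
Proof.
rewrite -(@ler_pXn2r _ 2)// ?nnegrE ?enorm_ge0//.
have h : dotv (projker B *m u) (u - projker B *m u) = 0.
  by rewrite dotvBr dotv_projker mulmxA projker_idem subrr.
have -> : enorm u ^+ 2 = enorm (projker B *m u + (u - projker B *m u)) ^+ 2.
  by rewrite subrKC.
by rewrite enormD_sqr h mul0rn addr0 lerDl sqr_ge0.
Qed.

(** A Hoffman-type bound: the distance to the kernel of B is controlled linearly by the residuals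
    [B *m u]. In [identification] it is weighed against strict complementarity. *)
Lemma enorm_sub_projker : exists2 K, 0 <= K &
  forall u : 'cV[R]_n, enorm (u - projker B *m u) <= K * \sum_i `|(B *m u) i 0|.
Proof.
have [K K0 hK] := mulmx_bounded (B^T *m moore_penrose (B *m B^T)).
exists K => // u; rewrite /projker mulmxBl mul1mx subKr -[X in enorm X]mulmxA.
by rewrite (le_trans (hK _))// ler_wpM2l// enorm_le_sum.
Qed.

End Projker.
End EuclideanSpace.

(** * Polyhedral projections *)

Section RealSequences.
Context {R : realType}.
Implicit Types u a x : nat -> R.

(** Convergence of a series in Cauchy form: no limit has to be named, and conditionally convergent
    noise series qualify along with absolutely convergent ones. *)
Definition cauchy_partial_sums u := forall e : R, 0 < e -> exists N, forall n m,
  (N <= n)%N -> (n <= m)%N -> `|\sum_(n <= k < m) u k| <= e.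

Definition unbounded_partial_sums u := forall K : R, exists n,
  K <= \sum_(k < n) u k.

Lemma unbounded_partial_sums_from a (K : R) N :
  unbounded_partial_sums a -> exists2 n, (N <= n)%N & K <= \sum_(N <= k < n) a k.
Proof.
move=> /(_ (\sum_(k < N) `|a k| + `|K| + 1))[n hn].
have [Nn|nN] := leqP N n.
  exists n => //; move: hn.
  rewrite -(big_mkord xpredT) (big_cat_nat (n := N))//= -(big_mkord xpredT (fun k => `|a k|)).
  have : \sum_(0 <= i < N) a i <= \sum_(0 <= i < N) `|a i|.
    by apply: ler_sum => i _; exact: ler_norm.
  have := ler_norm K; lra.
exfalso; move: hn; apply/negP; rewrite -ltNge.
have h : \sum_(k < n) a k <= \sum_(k < N) `|a k|.
  rewrite -(big_mkord xpredT a) -(big_mkord xpredT (fun k => `|a k|)).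
  rewrite [leRHS](big_cat_nat (n := n))//= ?(ltnW nN)//.
  rewrite (@le_trans _ _ (\sum_(0 <= i < n) `|a i|))//.
    by apply: ler_sum => i _; exact: ler_norm.
  by rewrite lerDl sumr_ge0.
by have := normr_ge0 K; lra.
Qed.

(** While V exceeds e/2 each step lowers it by at least k a_n, up to [dl]; as the a_n have infinite
    sum, V falls below e/2 at some time after N. From then on it can rise only by a tail of [dl],
    again at most e/2. *)
Lemma descent_cvg0 (V x a dl : nat -> R) :
  (forall n, 0 <= a n) -> unbounded_partial_sums a -> (forall n, 0 <= V n) ->
  (forall n, 0 <= x n) ->
  cauchy_partial_sums dl ->
  (forall n, V n.+1 <= V n - a n * x n + dl n) ->
  (forall e : R, 0 < e -> exists2 k : R, 0 < k & forall n, e < V n -> k <= x n) ->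
  forall e : R, 0 < e -> exists N, forall n, (N <= n)%N -> V n <= e.
Proof.
move=> a0 au V0 x0 dlc Vd hx e e0.
have e20 : 0 < e / 2 by rewrite divr_gt0.
have [N hN] := dlc _ e20.
have [k k0 hk] := hx _ e20.
have mono n m : (n <= m)%N -> V m <= V n + \sum_(n <= i < m) dl i.
  elim: m => [|m IH]; first by rewrite leqn0 => /eqP ->; rewrite big_geq// addr0.
  rewrite leq_eqVlt => /orP[/eqP ->|]; first by rewrite big_geq// addr0.
  rewrite ltnS => nm; rewrite big_nat_recr//= (le_trans (Vd m))//.
  by have := IH nm; have := mulr_ge0 (a0 m) (x0 m); lra.
have [n1 Nn1 Vn1] : exists2 n1, (N <= n1)%N & V n1 <= e / 2.
  apply: contrapT => hno.
  have big n : (N <= n)%N -> e / 2 < V n.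
    by move=> Nn; rewrite ltNge; apply/negP => Vn; apply: hno; exists n.
  (* By time m the forced decrease would exceed V N + e and make V m negative. *)
  have [m Nm am] := unbounded_partial_sums_from ((V N + e) / k) N au.
  have : V m <= V N - k * \sum_(N <= i < m) a i + \sum_(N <= i < m) dl i.
    elim: m Nm {am} => [|m IH]; first by rewrite leqn0 => /eqP ->; rewrite !big_geq// mulr0 subr0 addr0.
    rewrite leq_eqVlt => /orP[/eqP ->|]; first by rewrite !big_geq// mulr0 subr0 addr0.
    rewrite ltnS => Nm; rewrite !big_nat_recr//= (le_trans (Vd m))//.
    have := IH Nm; have := ler_wpM2l (a0 m) (hk m (big m Nm)); lra.
  have := hN N m (leqnn _) Nm; rewrite ler_norml => /andP[_ h1].
  have := V0 m; move: am; rewrite ler_pdivrMr// [_ * k]mulrC; lra.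
exists n1 => n n1n; apply: (le_trans (mono _ _ n1n)).
have := hN n1 n Nn1 n1n; rewrite ler_norml => /andP[_ h1]; lra.
Qed.

(** A Toeplitz lemma with divergent weights: C and the finitely many terms with large [x k] are
    absorbed by e/2 times the total weight, the remaining terms by the other half. *)
Lemma weighted_cesaro a x :
  (forall n, 0 <= a n) -> unbounded_partial_sums a ->
  (forall e : R, 0 < e -> exists N, forall n, (N <= n)%N -> `|x n| <= e) ->
  forall (C e : R), 0 < e -> exists N, forall n, (N <= n)%N ->
    0 < \sum_(k < n) a k /\ C + \sum_(k < n) a k * `|x k| <= e * \sum_(k < n) a k.
Proof.
move=> a0 au xc C e e0; have e20 : 0 < e / 2 by rewrite divr_gt0.
have [N hN] := xc _ e20.
pose C' := `|C| + \sum_(k < N) a k * `|x k|.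
have C'0 : 0 <= C' by rewrite addr_ge0// sumr_ge0// => i _; rewrite mulr_ge0.
have [M NM hM] := unbounded_partial_sums_from (C' / (e / 2) + 1) N au.
exists M => n Mn; have Nn := leq_trans NM Mn.
have hn : C' / (e / 2) + 1 <= \sum_(N <= k < n) a k.
  by rewrite (le_trans hM)// [leRHS](big_cat_nat (n := M))//= lerDl sumr_ge0.
have aN0 : 0 <= \sum_(0 <= k < N) a k by rewrite sumr_ge0.
have c0 : 0 <= C' / (e / 2) by rewrite divr_ge0// ltW.
rewrite -(big_mkord xpredT a) -(big_mkord xpredT (fun k => a k * `|x k|)).
rewrite !(big_cat_nat (n := N) (leq0n N) Nn)/=; split; first lra.
have h1 : \sum_(N <= i < n) a i * `|x i| <= e / 2 * \sum_(N <= i < n) a i.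
  rewrite mulr_sumr big_nat [leRHS]big_nat; apply: ler_sum => i /andP[Ni _].
  by rewrite mulrC ler_wpM2r// hN.
have h2 : C' <= e / 2 * \sum_(N <= i < n) a i.
  by rewrite mulrC -ler_pdivrMr//; lra.
have h3 := mulr_ge0 (ltW e0) aN0.
move: h2; rewrite /C' -!(big_mkord xpredT (fun k => a k * `|x k|)) => h2.
by have := ler_norm C; lra.
Qed.

Lemma cauchy_partial_sumsD u v : cauchy_partial_sums u -> cauchy_partial_sums v ->
  cauchy_partial_sums (fun n => u n + v n).
Proof.
move=> hu hv e e0; have e20 : 0 < e / 2 by rewrite divr_gt0.
have [N1 h1] := hu _ e20; have [N2 h2] := hv _ e20.
exists (maxn N1 N2) => n m; rewrite geq_max => /andP[/h1 {}h1 /h2 {}h2] nm.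
rewrite big_split/= (le_trans (ler_normD _ _))//.
by have := h1 m nm; have := h2 m nm; lra.
Qed.

Lemma cauchy_partial_sumsZ c u : cauchy_partial_sums u ->
  cauchy_partial_sums (fun n => c * u n).
Proof.
move=> hu e e0; have [N h] := hu (e / (`|c| + 1)) (divr_gt0 e0 (ltr_pwDr ltr01 (normr_ge0 c))).
exists N => n m Nn nm; rewrite -mulr_sumr normrM.
have := h n m Nn nm; rewrite ler_pdivlMr ?ltr_pwDr// => {}h.
by have := normr_ge0 (\sum_(n <= i < m) u i); have := normr_ge0 c; nra.
Qed.

Lemma cauchy_partial_sums_bounded u : cauchy_partial_sums u ->
  exists K : R, forall n, `|\sum_(k < n) u k| <= K.
Proof.
move=> /(_ 1 ltr01)[N hN]; exists (\sum_(k < N) `|u k| + 1) => n.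
have [Nn|nN] := leqP N n.
  rewrite -(big_mkord xpredT u) -(big_mkord xpredT (fun k => `|u k|)).
  rewrite (big_cat_nat (n := N) (leq0n N) Nn)/=.
  by rewrite (le_trans (ler_normD _ _))// lerD ?ler_norm_sum// hN.
rewrite (le_trans (ler_norm_sum _ _ _))//.
have -> : \sum_(k < N) `|u k| = \sum_(k < n) `|u k| + \sum_(n <= k < N) `|u k|.
  by rewrite -(big_mkord xpredT (fun k => `|u k|)) (big_cat_nat (n := n))//= ?big_mkord// ltnW.
by rewrite -addrA lerDl addr_ge0// sumr_ge0.
Qed.

End RealSequences.

(** * Projections and their variational inequality *)

Section Projection.
Context {R : realType}.

(** The variational inequality of the projection onto a convex set, kept as a relation because the
    iterates already come as minimizers. *)
Definition is_proj n (D : set 'cV[R]_n) (z x : 'cV[R]_n) :=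
  D x /\ forall y, D y -> dotv (z - x) (y - x) <= 0.

Lemma is_proj_id n (D : set 'cV[R]_n) x : D x -> is_proj D x x.
Proof. by move=> Dx; split => // y _; rewrite subrr dotv0l. Qed.

(** Adding the two variational inequalities gives |x - x'|^2 <= <z - z', x - x'>; Cauchy-Schwarz
    concludes. *)
Lemma is_proj_lipschitz n (D : set 'cV[R]_n) z x z' x' :
  is_proj D z x -> is_proj D z' x' -> enorm (x - x') <= enorm (z - z').
Proof.
move=> [Dx hx] [Dx' hx'].
have h1 := hx _ Dx'; have h2 := hx' _ Dx.
have h : enorm (x - x') ^+ 2 <= dotv (z - z') (x - x').
  rewrite enorm_sqr; move: h1 h2; rewrite !(dotvBl, dotvBr); lra.
have [->|x0] := eqVneq (enorm (x - x')) 0; first exact: enorm_ge0.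
rewrite -(@ler_pM2r _ (enorm (x - x'))) ?lt_def ?x0 ?enorm_ge0//.
by rewrite -expr2 (le_trans h)// dotv_le.
Qed.

Lemma polyhedron_segment p n (A : 'M[R]_(p, n)) b x y t :
  polyhedron A b x -> polyhedron A b y -> 0 <= t <= 1 ->
  polyhedron A b (x + t *: (y - x)).
Proof.
move=> hx hy /andP[t0 t1] i; rewrite mulmxDr -scalemxAr mulmxBr !mxE.
have := hx i; have := hy i; rewrite !mxE; set u := \sum_j _; set v := \sum_j _.
nra.
Qed.

Lemma argmin_is_proj p n (A : 'M[R]_(p, n)) b (S x0 x : 'cV[R]_n) :
  is_minimizer (polyhedron A b)
    (fun y => dotv S y + 2^-1 * enorm (y - x0) ^+ 2) x ->
  is_proj (polyhedron A b) (x0 - S) x.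
Proof.
move=> [Dx hx]; split => // y Dy; set d := y - x.
rewrite leNgt; apply/negP => hd.
set q := dotv _ d in hd.
have d0 : 0 < dotv d d.
  rewrite lt_def dotv_ge0 andbT; apply/negP => /eqP/dotv_eq0 d0.
  by move: hd; rewrite /q d0 dotv0r ltxx.
(* Along x + t d the objective changes by - t q + t^2 |d|^2 / 2, which is negative for 0 < t <= q /
   |d|^2; the cap 1 keeps the point in the polyhedron. *)
pose t := Num.min 1 (q / dotv d d).
have t01 : 0 <= t <= 1.
  by rewrite /t ge_min lexx/= le_min ler01/= divr_ge0 ?ltW.
have t0 : 0 < t by rewrite /t lt_min ltr01 divr_gt0.
have tq : t * dotv d d <= q.
  by rewrite -ler_pdivlMr// /t ge_min lexx orbT.
have := hx _ (polyhedron_segment Dx Dy t01); rewrite -/d.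
have -> : x + t *: d - x0 = (x - x0) + t *: d by rewrite addrAC.
rewrite (enormD_sqr (x - x0) (t *: d)) enormZ exprMn ger0_norm ?(ltW t0)// (enorm_sqr d).
rewrite (dotvDr S) !dotvZr.
have -> : dotv (x - x0) d = - q - dotv S d.
  by rewrite /q !dotvBl; lra.
by nra.
Qed.

End Projection.

Section LocalCone.
Context {R : realType}.
Variables (p n : nat) (A : 'M[R]_(p, n)) (b : 'cV[R]_p) (xs : 'cV[R]_n).
Hypothesis xs_in : polyhedron A b xs.

Lemma act_mxE (u : 'cV[R]_n) k :
  (act_mx A b xs *m u) k 0 = (A *m u) (enum_val k) 0.
Proof. by rewrite /act_mx !mxE; apply: eq_bigr => j _; rewrite mxE. Qed.

Lemma act_mx_eq0 (u : 'cV[R]_n) : act_mx A b xs *m u = 0 <->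
  forall i, i \in active A b xs -> (A *m u) i 0 = 0.
Proof.
split => [h i ia|h].
  by rewrite -(enum_rankK_in ia ia) -act_mxE h mxE.
by apply/matrixP => k j; rewrite ord1 act_mxE h ?mxE// enum_valP.
Qed.

Lemma active_eq i : i \in active A b xs -> (A *m xs) i 0 = b i 0.
Proof. by rewrite inE => /eqP. Qed.

Lemma polyhedron_cone_le x i : polyhedron A b x -> i \in active A b xs ->
  (A *m (x - xs)) i 0 <= 0.
Proof.
by move=> /(_ i) hx /active_eq; rewrite mulmxBr [leLHS]mxE [X in _ + X]mxE => ->; rewrite subr_le0.
Qed.

Lemma inactive_radius : exists2 r : R, 0 < r & forall u, enorm u <= r ->
  forall i, i \notin active A b xs -> (A *m (xs + u)) i 0 < b i 0.
Proof.
have [K K0 hK] := mulmx_bounded A.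
(* The smallest slack of the inactive constraints, with default 1 when every constraint is
   active. *)
pose m := \big[Num.min/1]_(i | i \notin active A b xs) (b i 0 - (A *m xs) i 0).
have m0 : 0 < m.
  rewrite /m; elim/big_ind: _ => // [x y x0 y0|i]; first by rewrite lt_min x0.
  by rewrite inE subr_gt0 lt_neqAle => ->; exact: xs_in.
exists (m / (K + 1) / 2) => [|u hu i hi]; first by rewrite !divr_gt0// ltr_pwDr.
have hm : m <= b i 0 - (A *m xs) i 0 by exact: bigmin_le_cond.
rewrite mulmxDr [X in X < _]mxE -ltrBrDl (lt_le_trans _ hm)//.
apply: (@le_lt_trans _ _ (K * enorm u)).
  by rewrite (le_trans (ler_norm _))// (le_trans (normr_le_enorm _ _)).
move: hu; rewrite -mulrA -invfM ler_pdivlMr ?mulr_gt0 ?ltr_pwDr// => hu.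
by have := enorm_ge0 u; nra.
Qed.

(** Within a fixed radius the polyhedron coincides with its tangent cone at [xs]: the slack of the
    inactive constraints cannot be used up there. *)
Lemma local_cone : exists2 r : R, 0 < r & forall u, enorm u <= r ->
  (forall i, i \in active A b xs -> (A *m u) i 0 <= 0) -> polyhedron A b (xs + u).
Proof.
have [r r0 hr] := inactive_radius; exists r => // u ur hu i.
have [ia|ia] := boolP (i \in active A b xs); last exact/ltW/hr.
by rewrite mulmxDr mxE active_eq// gerDl hu.
Qed.

Definition lyap (z x : 'cV[R]_n) :=
  dotv (z - x) (x - xs) + 2^-1 * enorm (x - xs) ^+ 2.

Lemma lyap_ge z x : is_proj (polyhedron A b) z x ->
  2^-1 * enorm (x - xs) ^+ 2 <= lyap z x.
Proof.
move=> [_ /(_ _ xs_in)]; rewrite -[xs - x]opprB dotvNr oppr_le0 => h.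
by rewrite /lyap lerDr.
Qed.

(* [lyap z x] is the Fenchel coupling of [xs] and [z], whose gradient in [z] is
   [x - xs] and is 1-Lipschitz. *)
Lemma lyap_step z x z' x' :
  is_proj (polyhedron A b) z x -> is_proj (polyhedron A b) z' x' ->
  lyap z' x' <= lyap z x + dotv (z' - z) (x - xs) + 2^-1 * enorm (z' - z) ^+ 2.
Proof.
move=> [Dx hx] [Dx' hx']; have {hx'} h := hx _ Dx'.
have h2 := dotv_ge0 ((x' - x) - (z' - z)).
rewrite /lyap !enorm_sqr; move: h h2.
rewrite !(dotvBl, dotvBr) (dotvC x' x) (dotvC z' z) (dotvC z x) (dotvC z' x)
 (dotvC z x') (dotvC z' x') (dotvC z xs) (dotvC z' xs) (dotvC x xs) (dotvC x' xs).
lra.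
Qed.

(** The polyhedron being locally a cone at [xs], the point xs + 2 (x - xs) is feasible; testing the
    variational inequality with it and with [xs] shows <z - x, x - xs> = 0. *)
Lemma lyap_local r z x :
  (forall u, enorm u <= r ->
  (forall i, i \in active A b xs -> (A *m u) i 0 <= 0) -> polyhedron A b (xs + u)) ->
  is_proj (polyhedron A b) z x -> enorm (x - xs) <= r / 2 ->
  lyap z x = 2^-1 * enorm (x - xs) ^+ 2.
Proof.
move=> hr px xr; apply/eqP; rewrite eq_le lyap_ge// andbT /lyap gerDr.
case: px => Dx hx.
have : polyhedron A b (xs + 2%:R *: (x - xs)).
  apply: hr => [|i ia]; first by rewrite enormZ ger0_norm//; lra.
  by rewrite -scalemxAr mxE pmulr_rle0// polyhedron_cone_le.
move/hx; suff -> : xs + 2%:R *: (x - xs) - x = x - xs by [].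
by rewrite scaler_nat mulr2n [_ - x]addrC addrA [_ + (x - xs)]addrC !addrA; apply/matrixP => i j; rewrite !mxE; lra.
Qed.

(** Near [xs], moving x along the kernel of the active rows stays feasible. Testing with a small
    multiple of the projected residual itself gives |Q (z - x)|^2 <= 0. *)
Lemma proj_ker r z x :
  (forall u, enorm u <= r ->
  (forall i, i \in active A b xs -> (A *m u) i 0 <= 0) -> polyhedron A b (xs + u)) ->
  0 < r -> is_proj (polyhedron A b) z x -> enorm (x - xs) <= r / 2 ->
  projker (act_mx A b xs) *m (z - x) = 0.
Proof.
move=> hr r0 [Dx hx] xr; set Q := projker _.
apply: dotv_eq0; rewrite -dotv_projker mulmxA projker_idem -/Q.
set d := Q *m (z - x).
pose t := (r / 2) / (enorm d + 1).
have d1 : 0 < enorm d + 1 by rewrite ltr_pwDr// enorm_ge0.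
have t0 : 0 < t by rewrite /t !divr_gt0.
have td : enorm (t *: d) <= r / 2.
  rewrite enormZ ger0_norm ?(ltW t0)// /t mulrAC -mulrA ler_piMr ?divr_ge0 ?(ltW r0)//.
  by rewrite ler_pdivrMr// mul1r lerDl.
have : polyhedron A b (xs + ((x - xs) + t *: d)).
  apply: hr => [|i ia]; first by rewrite (le_trans (enormD _ _))//; lra.
  have -> : (A *m (x - xs + t *: d)) i 0 = (A *m (x - xs)) i 0.
    rewrite mulmxDr -scalemxAr [LHS]mxE [X in _ + X]mxE.
    have /act_mx_eq0 -> // : act_mx A b xs *m d = 0.
      by rewrite /d mulmxA mulmx_projker mul0mx.
    by rewrite mulr0 addr0.
  exact: polyhedron_cone_le.
move/hx; rewrite addrA subrKC [_ + t *: d]addrC addrK dotvZr.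
rewrite pmulr_rle0// => h; apply/eqP; rewrite eq_le h/=.
have -> : dotv (z - x) d = dotv d d.
  by rewrite /d -dotv_projker mulmxA projker_idem.
exact: dotv_ge0.
Qed.

(** Let u be the part of x - xs orthogonal to the kernel of the active rows B. The point xs + Q (x -
    xs) is feasible, so <z - x, u> >= 0, whereas <w, u> = <lam, B u> <= - c |u| because the
    multipliers are positive. If z - x is closer than c T to T w, this leaves only u = 0. *)
Lemma identification r w : (forall u, enorm u <= r ->
  (forall i, i \in active A b xs -> (A *m u) i 0 <= 0) -> polyhedron A b (xs + u)) ->
  (exists lam : 'cV[R]_#|active A b xs|,
    (forall i, 0 < lam i 0) /\ w = (act_mx A b xs)^T *m lam) ->
  exists2 c : R, 0 < c & forall z x (T : R), 0 < T -> is_proj (polyhedron A b) z x ->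
    enorm (x - xs) <= r / 2 -> enorm (z - x - T *: w) < c * T ->
    act_mx A b xs *m (x - xs) = 0.
Proof.
move=> hr [lam [lam0 ->]].
set B := act_mx A b xs; have [K K0 hK] := enorm_sub_projker B.
pose m := \big[Num.min/1]_i lam i 0.
have m0 : 0 < m by rewrite /m; elim/big_ind: _ => // x y x0 y0; rewrite lt_min x0.
(* Since |u| <= K sum |B u|, this constant satisfies c |u| <= m sum |B u|, with m the smallest
   multiplier. *)
exists (m / (K + 1)) => [|z x T T0 [Dx hx] xr hw]; first by rewrite divr_gt0// ltr_pwDr.
set u := x - xs - projker B *m (x - xs).
have Bu : B *m u = B *m (x - xs).
  by rewrite /u mulmxBr mulmxA mulmx_projker mul0mx subr0.
have uN i : (B *m u) i 0 <= 0.
  by rewrite Bu act_mxE polyhedron_cone_le// enum_valP.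
have h1 : dotv (B^T *m lam) u <= - (m * \sum_i `|(B *m u) i 0|).
  rewrite dotvC dotv_mulmx trmxK dotvC dotvE mulr_sumr -sumrN; apply: ler_sum => i _.
  rewrite ler0_norm// mulrN opprK; have := uN i.
  have : m <= lam i 0 by exact: bigmin_le_cond.
  nra.
have h2 : 0 <= dotv (z - x) u.
  have : polyhedron A b (xs + projker B *m (x - xs)).
    apply: hr => [|i ia].
      have := enorm_projker B (x - xs); have := enorm_ge0 (x - xs); lra.
    rewrite le_eqVlt; apply/orP; left; apply/eqP.
    by apply/(iffLR (act_mx_eq0 _)) => //; rewrite mulmxA mulmx_projker mul0mx.
  move/hx; have -> : xs + projker B *m (x - xs) - x = - u.
    by rewrite /u; set v := projker B *m _; apply/matrixP => i j; rewrite !mxE; lra.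
  by rewrite dotvNr oppr_le0.
have hKu : enorm u <= K * \sum_i `|(B *m u) i 0| by rewrite Bu; exact: hK.
have [u0|u0] := eqVneq (enorm u) 0; first by rewrite -Bu (enorm0_eq0 u0) mulmx0.
have {u0}u0 : 0 < enorm u by rewrite lt_def u0 enorm_ge0.
exfalso; have := dotv_le (z - x - T *: (B^T *m lam)) u.
rewrite dotvBl dotvZl => h3.
have h4 : enorm (z - x - T *: (B^T *m lam)) * enorm u < m / (K + 1) * T * enorm u.
  by rewrite ltr_pM2r.
have h5 : enorm u * (m / (K + 1)) <= m * \sum_i `|(B *m u) i 0|.
  rewrite mulrA ler_pdivrMr ?ltr_pwDr// mulrC -mulrA ler_wpM2l ?(ltW m0)//.
  by have : 0 <= \sum_i `|(B *m u) i 0| by [rewrite sumr_ge0|]; lra.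
have h6 : T * dotv (B^T *m lam) u <= T * - (enorm u * (m / (K + 1))).
  by rewrite ler_wpM2l ?(ltW T0)// (le_trans h1)// lerN2.
by nra.
Qed.

End LocalCone.

(** * Convergence and identification along a sample path *)

Section PathwiseIdentification.
Context {R : realType}.
Variables (p n : nat) (A : 'M[R]_(p, n)) (b : 'cV[R]_p) (xs : 'cV[R]_n).
Hypothesis xs_in : polyhedron A b xs.
Variables (a : nat -> R) (z x g eta : nat -> 'cV[R]_n) (gs : 'cV[R]_n) (c1 c2 : R).
Hypotheses (a_ge0 : forall k, 0 <= a k) (a_unbounded : unbounded_partial_sums a).
Hypothesis z_step : forall k, z k.+1 = z k - a k *: (g k + eta k).
Hypothesis x_proj : forall k, is_proj (polyhedron A b) (z k) (x k).
Hypotheses (c1_gt0 : 0 < c1)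
  (growth : forall k, c1 * enorm (x k - xs) ^+ 2 <= dotv (g k) (x k - xs)).
Hypothesis lip : forall k, enorm (g k - gs) <= c2 * enorm (x k - xs).
Hypothesis multiplier : exists lam : 'cV[R]_#|active A b xs|,
  (forall i, 0 < lam i 0) /\ - gs = (act_mx A b xs)^T *m lam.
Hypothesis cauchy_eta : forall i, cauchy_partial_sums (fun k => a k * eta k i 0).
Hypothesis cauchy_dot : cauchy_partial_sums (fun k => a k * dotv (eta k) (x k - xs)).
Hypothesis cauchy_sqr : cauchy_partial_sums (fun k => a k ^+ 2 * enorm (g k + eta k) ^+ 2).

Lemma iterates_cvg (e : R) : 0 < e -> exists N, forall k, (N <= k)%N -> enorm (x k - xs) <= e.
Proof.
move=> e0; have [r r0 hr] := local_cone xs_in.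
(* The error of one step of the coupling: the noise enters linearly, the squared increment with
   weight 1/2. *)
pose dl k := (-1) * (a k * dotv (eta k) (x k - xs)) + 2^-1 * (a k ^+ 2 * enorm (g k + eta k) ^+ 2).
have dlc : cauchy_partial_sums dl.
  by apply: cauchy_partial_sumsD; exact: cauchy_partial_sumsZ.
pose V k := lyap xs (z k) (x k).
have Vge k : 2^-1 * enorm (x k - xs) ^+ 2 <= V k by exact: lyap_ge.
have V0 k : 0 <= V k by rewrite (le_trans _ (Vge k))// mulr_ge0// sqr_ge0.
have Vstep k : V k.+1 <= V k - a k * (c1 * enorm (x k - xs) ^+ 2) + dl k.
  apply: (le_trans (lyap_step xs (x_proj k) (x_proj k.+1))).
  have -> : z k.+1 - z k = - (a k *: (g k + eta k)) by rewrite z_step addrC addKr.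
  rewrite enormN enormZ exprMn real_normK ?num_real//.
  rewrite dotvNl dotvZl dotvDl /dl -/(V k).
  by have := ler_wpM2l (a_ge0 k) (growth k); lra.
(* Far from [xs] the distance does not control the coupling. Either the distance exceeds r/2, or V
   is exactly half its square; in both cases the decrease is bounded below. *)
have Vx (e' : R) : 0 < e' -> exists2 k' : R, 0 < k' & forall k, e' < V k -> k' <= c1 * enorm (x k - xs) ^+ 2.
  move=> e'0; exists (c1 * Num.min (2 * e') ((r / 2) ^+ 2)) => [|k hV].
    by rewrite mulr_gt0// lt_min mulr_gt0//= exprn_gt0// divr_gt0.
  rewrite ler_wpM2l ?(ltW c1_gt0)//.
  have [xr|xr] := leP (enorm (x k - xs)) (r / 2).
    rewrite ge_min; apply/orP; left; move: hV.
    by rewrite /V (lyap_local xs_in hr)//; lra.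
  by rewrite ge_min; apply/orP; right; rewrite ler_pXn2r ?nnegrE ?enorm_ge0 ?(ltW xr)// divr_ge0// ltW.
have e2 : 0 < 2^-1 * e ^+ 2 by rewrite mulr_gt0// exprn_gt0.
have [N hN] := @descent_cvg0 _ V (fun k => c1 * enorm (x k - xs) ^+ 2) a dl a_ge0 a_unbounded V0
  (fun k => mulr_ge0 (ltW c1_gt0) (sqr_ge0 _)) dlc Vstep Vx _ e2.
exists N => k Nk; have := hN _ Nk; have := Vge k => h1 h2.
rewrite -(@ler_pXn2r _ 2)// ?nnegrE ?enorm_ge0 ?(ltW e0)//; lra.
Qed.

(** With T the sum of the steps, z_k - x_k + T gs consists of bounded terms, the bounded noise sums
    and the sum of a_j (g_j - gs), which is o(T) by the Lipschitz bound and [iterates_cvg]. The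
    residual is thus eventually closer than c T to - T gs, as [identification] requires. *)
Lemma eventually_active (e : R) : 0 < e -> exists N, forall k, (N <= k)%N ->
  enorm (x k - xs) <= e /\ act_mx A b xs *m (x k - xs) = 0.
Proof.
move=> e0; have [r r0 hr] := local_cone xs_in.
have [c c0 hc] := identification hr multiplier.
have [Keta hKeta] : exists K : R, forall k, enorm (\sum_(j < k) a j *: eta j) <= K.
  have /choice[K hK] : forall i : 'I_n, exists K : R, forall k,
      `|\sum_(j < k) a j * eta j i 0| <= K.
    by move=> i; have [K hK] := cauchy_partial_sums_bounded (cauchy_eta i); exists K.
  exists (\sum_i K i) => k; rewrite (le_trans (enorm_le_sum _))//.
  by apply: ler_sum => i _; rewrite summxE; under eq_bigr do rewrite mxE.
have zE k : z k = z 0%N - \sum_(j < k) a j *: (g j + eta j).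
  elim: k => [|k IH]; first by rewrite big_ord0 subr0.
  by rewrite z_step IH big_ord_recr/= opprD addrA.
pose C := enorm (z 0%N) + enorm xs + e + Keta.
have c20 : 0 < `|c2| + 1 by rewrite ltr_pwDr.
have x_to0 (e' : R) : 0 < e' -> exists N, forall k, (N <= k)%N ->
    `|(`|c2| + 1) * enorm (x k - xs)| <= e'.
  move=> e'0; have [N hN] := iterates_cvg (divr_gt0 e'0 c20).
  exists N => k Nk; rewrite ger0_norm ?mulr_ge0 ?enorm_ge0 ?(ltW c20)//.
  by rewrite mulrC -ler_pdivlMr// hN.
(* Half of the identification constant, because [identification] asks for a strict inequality. *)
have c2' : 0 < c / 2 by rewrite divr_gt0.
have [N1 hN1] := weighted_cesaro a_ge0 a_unbounded x_to0 C c2'.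
have [N2 hN2] := iterates_cvg e0.
have r20 : 0 < r / 2 by rewrite divr_gt0.
have [N3 hN3] := iterates_cvg r20.
exists (maxn N1 (maxn N2 N3)) => k; rewrite !geq_max => /and3P[k1 k2 k3].
split; first exact: hN2.
have [T0 hT] := hN1 _ k1.
apply: (hc (z k) _ _ T0) => //; first exact: hN3.
apply: (@le_lt_trans _ _ (c / 2 * \sum_(j < k) a j)); last first.
  by rewrite ltr_pM2r// gtr_pMr// invf_lt1// ltr1n.
apply: le_trans hT.
have -> : z k - x k - (\sum_(j < k) a j) *: - gs =
  z 0%N - xs - (x k - xs) - \sum_(j < k) a j *: eta j - \sum_(j < k) a j *: (g j - gs).
  rewrite zE scalerN opprK.
  have -> : \sum_(j < k) a j *: (g j - gs) =
      \sum_(j < k) a j *: (g j + eta j) - \sum_(j < k) a j *: eta j - (\sum_(j < k) a j) *: gs.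
    rewrite scaler_suml -!sumrB; apply: eq_bigr => j _.
    by rewrite scalerBr scalerDr addrK.
  by apply/matrixP => i j; rewrite !mxE; lra.
apply: (le_trans (enormB _ _)); apply: lerD.
  apply: (le_trans (enormB _ _)); apply: lerD => //.
  apply: (le_trans (enormB _ _)); apply: lerD; first exact: enormB.
  exact: hN2.
rewrite (le_trans (enorm_sum _ _ _))//; apply: ler_sum => j _.
rewrite enormZ ger0_norm// ler_wpM2l// (le_trans (lip j))//.
rewrite ger0_norm ?mulr_ge0 ?enorm_ge0 ?(ltW c20)// ler_wpM2r ?enorm_ge0//.
by have := ler_norm c2; lra.
Qed.

End PathwiseIdentification.

(** * Borel vectors and disintegration *)

Section BorelVectors.
Context {R : realType}.

Lemma open_borelV n (U : set 'cV[R]_n) : open U -> measurable (U : set (borelV R n)).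
Proof. by move=> oU; exact: sub_sigma_algebra. Qed.

Lemma continuous_measurable_borelV n (g : 'cV[R]_n -> R) :
  continuous g -> measurable_fun setT (g : borelV R n -> R).
Proof.
move=> cg; apply: (measurability _ (RGenOpens.measurableE R)) => _ /= -[_ [x [y ->]] <-].
rewrite setTI; apply: open_borelV.
by apply: open_comp => //; exact: itv_open.
Qed.

Lemma measurable_fun_coord n (i : 'I_n) :
  measurable_fun setT (fun x : borelV R n => (x : 'cV[R]_n) i 0).
Proof. by apply: continuous_measurable_borelV; exact: coord_continuous. Qed.

(** Open cubes with rational centres and radii 1/(k+1) form a countable base; through them
    measurability into [borelV] can be checked on coordinates. *)
Lemma open_cV_countable n (U : set 'cV[R]_n) : open U ->
  U = \bigcup_(qk in [set qk : 'cV[rat]_n * nat |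
        [set x : 'cV[R]_n | forall i, `|x i 0 - ratr (qk.1 i 0)| < qk.2.+1%:R^-1] `<=` U])
      [set x : 'cV[R]_n | forall i, `|x i 0 - ratr (qk.1 i 0)| < qk.2.+1%:R^-1].
Proof.
move=> oU; apply/seteqP; split => [x Ux|x [qk h xqk]]; last exact: h.
have /nbhs_ballP[e /= e0 he] : nbhs x U by exact: open_nbhs_nbhs.
have [k ke] : exists k, k.+1%:R^-1 < e / 2.
  exists (Num.truncn ((e / 2)^-1)); rewrite invf_plt ?posrE ?divr_gt0//.
  exact: truncnS_gt.
have /choice[q hq] : forall i : 'I_n, exists q : rat, `|x i 0 - ratr q| < k.+1%:R^-1.
  move=> i; have k0 : 0 < k.+1%:R^-1 :> R by rewrite invr_gt0.
  have := @rat_in_itvoo R (x i 0 - k.+1%:R^-1) (x i 0 + k.+1%:R^-1).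
  case=> [|q]; first by rewrite ltrD2l gt0_cp.
  by rewrite in_itv/= => /andP[h1 h2]; exists q; rewrite ltr_distlC h1 h2.
exists (\col_i q i, k) => [y /= hy|i]; last by rewrite mxE.
apply: he; split => // i j; rewrite ord1 /ball/=.
have := hy i; have := hq i; rewrite mxE => h1 h2.
rewrite (le_lt_trans (ler_distD (ratr (q i)) _ _))// (distrC (ratr _)).
by move: ke h1 h2; set t := _^-1; lra.
Qed.

Lemma measurable_fun_cV d (T : measurableType d) (D : set T) n (Y : T -> 'cV[R]_n) :
  measurable D -> (forall i, measurable_fun D (fun w => Y w i 0)) ->
  measurable_fun D (Y : T -> borelV R n).
Proof.
move=> mD mY; apply: (@measurability _ _ T (borelV R n) D Y (@open 'cV[R]_n) erefl) => _ [U oU <-].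
rewrite (open_cV_countable oU) preimage_bigcup setI_bigcupr.
rewrite bigcup_mkcond; apply: countable_bigcupT_measurable; first exact: countableP.
move=> qk; case: ifP => _ //.
have -> : D `&` Y @^-1` [set x | forall i, `|x i 0 - ratr (qk.1 i 0)| < qk.2.+1%:R^-1] =
    D `&` \bigcap_(i in [set: 'I_n])
      (fun w => Y w i 0 - ratr (qk.1 i 0)) @^-1` `]- qk.2.+1%:R^-1, qk.2.+1%:R^-1[%classic.
  apply/seteqP; split => w [Dw h]; split => // i; last first.
    by have := h i Logic.I; rewrite /= in_itv/= ltr_norml.
  by move=> _; rewrite /= in_itv/= -ltr_norml; exact: h.
(* In dimension zero the index set is empty and the intersection is the whole space. *)
have [->|/set0P[i0 _]] := eqVneq [set: 'I_n] set0; first by rewrite bigcap_set0 setIT.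
rewrite -bigcapIr; last by exists i0.
apply: fin_bigcap_measurable => [|i _]; first exact: finite_finset.
by apply: measurable_funB => //; exact: measurable_itv.
Qed.

Lemma measurable_mulmx p n (A : 'M[R]_(p, n)) d (T : measurableType d) (D : set T) (Y : T -> 'cV[R]_n) i :
  (forall j, measurable_fun D (fun w => Y w j 0)) ->
  measurable_fun D (fun w => (A *m Y w) i 0).
Proof.
move=> mY; apply: (eq_measurable_fun (fun w => \sum_j A i j * Y w j 0)) => [w _|].
  by rewrite mxE.
by apply: measurable_sum => j; exact: measurable_funM.
Qed.

Lemma measurable_fun_enorm d (T : measurableType d) (D : set T) n (Y : T -> 'cV[R]_n) :
  measurable_fun D (Y : T -> borelV R n) -> measurable_fun D (fun w => enorm (Y w)).
Proof.
move=> mY; rewrite /enorm; under eq_fun do rewrite dotvE.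
apply: (measurableT_comp (continuous_measurable_fun (@sqrt_continuous R))).
apply: measurable_sum => i; apply: measurable_funM;
exact: (measurableT_comp (measurable_fun_coord i)).
Qed.

(* Measurability of a projection [Y = Proj Z] without constructing the
   projection as a function. *)
Lemma measurable_fun_lipschitz d (T : measurableType d) m n
    (Y : T -> 'cV[R]_m) (Z : T -> 'cV[R]_n) :
  measurable_fun setT (Z : T -> borelV R n) ->
  (forall w w', enorm (Y w - Y w') <= enorm (Z w - Z w')) ->
  measurable_fun setT (Y : T -> borelV R m).
Proof.
move=> mZ YZ; apply: (@measurability _ _ T (borelV R m) setT Y (@open 'cV[R]_m) erefl) => _ [U oU <-].
rewrite setTI.
(* A point z lies in V if, for some w and e, it is within e of Z w and the e-ball around Y w lies in
   U. V is open, and the Lipschitz bound makes its preimage under Z equal to that of U under Y. *)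
pose V := [set z : 'cV[R]_n | exists w, exists2 e, 0 < e &
  enorm (z - Z w) < e /\ (forall y, enorm (y - Y w) < e -> U y)].
have -> : Y @^-1` U = Z @^-1` V.
  apply/seteqP; split => w.
    move=> /= Uw; have /nbhs_ballP[e /= e0 he] : nbhs (Y w) U by exact: open_nbhs_nbhs.
    exists w, e => //; rewrite subrr enorm0; split => // y hy.
    apply: he; split => // i j; rewrite ord1 /ball/= distrC.
    have := normr_le_enorm (y - Y w) i; rewrite !mxE => h; exact: le_lt_trans hy.
  move=> /= [w' [e e0 [h1 h2]]]; apply: h2; exact: le_lt_trans h1.
rewrite -[X in measurable X]setTI; apply: mZ => //; apply: open_borelV.
rewrite openE => z [w [e e0 [h1 h2]]]; rewrite /interior.
apply/nbhs_ballP; exists ((e - enorm (z - Z w)) / n.+1%:R) => /=.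
  by rewrite divr_gt0// subr_gt0.
move=> z' [_ zz']; exists w, e => //; split => //.
have : enorm (z' - z) <= n%:R * `|z' - z| by exact: enorm_le_mx_norm.
have : `|z' - z| <= (e - enorm (z - Z w)) / n.+1%:R.
  rewrite {1}/Num.norm/= mx_normrE; apply: bigmax_le => [|[i j] _ /=].
    by rewrite divr_ge0// subr_ge0 ltW.
  by have := zz' i j; rewrite /ball/= distrC !mxE => /ltW.
rewrite ler_pdivlMr// => h3 h4.
have -> : z' - Z w = (z' - z) + (z - Z w) by rewrite addrA subrK.
have n1 : n.+1%:R = n%:R + 1 :> R by rewrite -addn1 natrD.
rewrite (le_lt_trans (enormD _ _))// -ltrBrDr.
have [h0|h0] := eqVneq `|z' - z| 0.
  by rewrite (le_lt_trans h4)// h0 mulr0 subr_gt0.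
have : 0 < `|z' - z| by rewrite lt_def h0/=.
by rewrite n1 in h3; lra.
Qed.

End BorelVectors.

(** * Joint laws built from a conditional kernel *)

Section Disintegration.
Context {R : realType} d d1 d2 (Omega : measurableType d) (T : measurableType d1)
  (S : measurableType d2).
Variables (P : probability Omega R) (Y : Omega -> T) (X : Omega -> S)
  (K : T -> probability S R).
Hypotheses (mY : measurable_fun setT Y) (mX : measurable_fun setT X).
Hypothesis mK : forall B, measurable B -> measurable_fun setT (fun t => K t B).
Hypothesis YXK : forall A B, measurable A -> measurable B ->
  P (Y @^-1` A `&` X @^-1` B) = (\int[P]_(w in Y @^-1` A) K (Y w) B)%E.

Let K' : T -> {measure set S -> \bar R} := K.

HB.instance Definition _ := @isKernel.Build _ _ T S R K' mK.

Let K'T t : K' t [set: S] = 1%E.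
Proof. exact: probability_setT. Qed.

HB.instance Definition _ := Kernel_isProbability.Build _ _ T S R K' K'T.

(** The kernel t -> delta_t x K_t, as the image of K_t under x -> (t, x). The unit factor is the
    source that composition with [lawY] expects. *)
Let graph (ut : unit * T) : {measure set (T * S) -> \bar R} :=
  measure_function_pushforward__canonical__measure_function_Measure
    (K' ut.2) (@pair1_measurable _ _ T S ut.2).

Let mgraph U : measurable U -> measurable_fun setT (fun ut => graph ut U).
Proof.
move=> mU.
have -> : (fun ut => graph ut U) = (fun t => K' t (xsection U t)) \o snd.
  by apply/funext => ut /=; rewrite /pushforward xsectionE.
apply: (@measurableT_comp _ _ _ _ _ _ (fun t => K' t (xsection U t)) _ (@snd unit T)).
  by apply: measurable_fun_xsection_finite_kernel; rewrite inE.
exact: measurable_snd.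
Qed.

HB.instance Definition _ := @isKernel.Build _ _ _ _ R graph mgraph.
Let graphT ut : graph ut setT = 1%E.
Proof. by rewrite /graph /= /pushforward preimage_setT; exact: probability_setT. Qed.
HB.instance Definition _ := Kernel_isProbability.Build _ _ _ _ R graph graphT.

Let lawY (u : unit) : {measure set T -> \bar R} :=
  measure_function_pushforward__canonical__measure_function_Measure P mY.
Let mlawY U : measurable U -> measurable_fun setT (fun u => lawY u U).
Proof. by move=> _; exact: measurable_cst. Qed.
HB.instance Definition _ := @isKernel.Build _ _ _ _ R lawY mlawY.
Let lawYT u : lawY u setT = 1%E.
Proof. by rewrite /lawY /= /pushforward preimage_setT probability_setT. Qed.
HB.instance Definition _ := Kernel_isProbability.Build _ _ _ _ R lawY lawYT.

Lemma measurable_fun_kernel_integral (h : T * S -> \bar R) :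
  measurable_fun setT h -> (forall z, 0 <= h z)%E ->
  measurable_fun setT (fun t => \int[K t]_x h (t, x))%E.
Proof. by move=> mh h0; exact: (measurable_fun_integral_finite_kernel h K'). Qed.

(** The law of (Y, X) and the composition of [lawY] with [graph] agree on rectangles by [YXK], hence
    as measures, rectangles being a generating pi-system. *)
Lemma ge0_disintegration (h : T * S -> \bar R) :
  measurable_fun setT h -> (forall z, 0 <= h z)%E ->
  (\int[P]_w h (Y w, X w) = \int[P]_w \int[K (Y w)]_x h (Y w, x))%E.
Proof.
move=> mh h0.
have mYX : measurable_fun setT (fun w => (Y w, X w)) by exact: measurable_fun_pair.
transitivity (\int[pushforward P (fun w => (Y w, X w))]_z h z)%E.
  by rewrite ge0_integral_pushforward.
transitivity (\int[kcomp lawY graph tt]_z h z)%E.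
  apply: eq_measure_integral => A mA _.
  apply: (@measure_unique _ _ _ [set A `*` B | A in @measurable _ T & B in @measurable _ S]
    (fun=> setT)) => //.
  - exact: measurable_prod_measurableType.
  - move=> _ _ [X1 mX1 [X2 mX2 <-]] [Y1 mY1 [Y2 mY2 <-]].
    exists (X1 `&` Y1); first exact: measurableI.
    by exists (X2 `&` Y2); [exact: measurableI|rewrite setXI].
  - by move=> _; exists setT => //; exists setT => //; rewrite setXTT.
  - by rewrite bigcup_const.
  - move=> _ [A1 mA1 [A2 mA2 <-]].
    transitivity (P (Y @^-1` A1 `&` X @^-1` A2)); first by [].
    rewrite YXK//.
    transitivity (\int[pushforward P Y]_y graph (tt, y) (A1 `*` A2))%E; last by [].
    rewrite ge0_integral_pushforward//=; last 2 first.
    - exact: (measurable_fun_pair2 tt (mgraph (measurableX mA1 mA2))).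
    - by move=> y _; exact: (measure_ge0 (graph (tt, y))).
    rewrite integral_mkcond; apply: eq_integral => w _; rewrite patchE/=.
    rewrite /pushforward; case: ifPn => [/set_mem wA|wA].
      by congr (K (Y w) _); apply/seteqP; split => [x|x []//].
    apply/esym; rewrite (_ : _ @^-1` _ = set0) ?measure0//.
    by apply/seteqP; split => // x [] /= Yw _; move: wA; rewrite notin_setE; apply.
  - move=> _; rewrite [X in (X < _)%E](_ : _ = 1%E) ?ltry//.
    by rewrite /= /pushforward preimage_setT probability_setT.
rewrite integral_kcomp//=.
transitivity (\int[pushforward P Y]_y \int[K' y]_x h (y, x))%E.
  by congr integral; apply/funext => t /=; rewrite ge0_integral_pushforward.
rewrite ge0_integral_pushforward//=; last by move=> y _; apply: integral_ge0.
exact: measurable_fun_kernel_integral.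
Qed.

End Disintegration.

(** * Expectations *)

Notation itg P X := (integrable P setT (EFin \o X)).
Notation Ex P X := (Rintegral P setT X).

Section Expectation.
Context {R : realType} d (T : measurableType d) (P : probability T R).
Implicit Types (X Y : T -> R) (A : set T).

Lemma itg_measurable X : itg P X -> measurable_fun setT X.
Proof. by move=> /integrableP[/measurable_EFinP]. Qed.

Lemma itgD X Y : itg P X -> itg P Y -> itg P (fun w => X w + Y w).
Proof. by move=> hX hY; have := integrableD measurableT hX hY; apply: eq_integrable. Qed.

Lemma itgZ c X : itg P X -> itg P (fun w => c * X w).
Proof. by move=> hX; have := integrableZl measurableT c hX; apply: eq_integrable. Qed.

Lemma itgN X : itg P X -> itg P (fun w => - X w).
Proof. by move=> /(itgZ (-1)); apply: eq_integrable => // w _; rewrite /= mulN1r. Qed.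

Lemma itgB X Y : itg P X -> itg P Y -> itg P (fun w => X w - Y w).
Proof. by move=> hX /itgN; exact: itgD. Qed.

Lemma itg_sum I (s : seq I) (F : I -> T -> R) :
  (forall i, itg P (F i)) -> itg P (fun w => \sum_(i <- s) F i w).
Proof.
move=> hF; elim: s => [|i s IH].
  by apply: eq_integrable (integrable0 P setT) => // w _; rewrite /= big_nil.
by apply: eq_integrable (itgD (hF i) IH) => // w _; rewrite /= big_cons.
Qed.

Lemma itg_le X Y : measurable_fun setT X -> (forall w, `|X w| <= Y w) ->
  itg P Y -> itg P X.
Proof.
move=> mX XY; apply: le_integrable => //; first exact/measurable_EFinP.
by move=> w _; rewrite lee_fin (le_trans (XY w))// ler_norm.
Qed.

Lemma itg_cst c : itg P (fun=> c).
Proof. exact: finite_measure_integrable_cst. Qed.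

Lemma itg_bounded B X : measurable_fun setT X -> (forall w, `|X w| <= B) -> itg P X.
Proof. by move=> mX XB; apply: itg_le XB (itg_cst B). Qed.

Lemma itgM_bounded B X Y : measurable_fun setT X -> (forall w, `|X w| <= B) ->
  itg P Y -> itg P (fun w => X w * Y w).
Proof.
move=> mX XB hY; apply: (@itg_le _ (fun w => B * `|Y w|)).
- by apply: measurable_funM => //; exact: itg_measurable.
- by move=> w; rewrite normrM ler_wpM2r.
- by apply: itgZ; exact: integrable_norm.
Qed.

Lemma itg_norm X : itg P X -> itg P (fun w => `|X w|).
Proof. exact: integrable_norm. Qed.

Lemma itg_sqr X : measurable_fun setT X -> itg P (fun w => X w ^+ 2) -> itg P X.
Proof.
move=> mX h; apply: (itg_le (Y := fun w => 1 + X w ^+ 2)) => //.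
  move=> w; rewrite -real_normK ?num_real//; have := sqr_ge0 (`|X w| - 1); nra.
by apply: itgD => //; exact: itg_cst.
Qed.

Lemma itg_mul X Y : measurable_fun setT X -> measurable_fun setT Y ->
  itg P (fun w => X w ^+ 2) -> itg P (fun w => Y w ^+ 2) ->
  itg P (fun w => X w * Y w).
Proof.
move=> mX mY hX hY; apply: itg_le (itgD hX hY); first exact: measurable_funM.
move=> w; rewrite ler_norml; apply/andP; split.
  have := sqr_ge0 (X w + Y w); have := sqr_ge0 (X w); have := sqr_ge0 (Y w); nra.
have := sqr_ge0 (X w - Y w); have := sqr_ge0 (X w); have := sqr_ge0 (Y w); nra.
Qed.

Lemma ExD X Y : itg P X -> itg P Y -> Ex P (fun w => X w + Y w) = Ex P X + Ex P Y.
Proof. exact: RintegralD. Qed.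

Lemma ExB X Y : itg P X -> itg P Y -> Ex P (fun w => X w - Y w) = Ex P X - Ex P Y.
Proof. exact: RintegralB. Qed.

Lemma ExZ c X : itg P X -> Ex P (fun w => c * X w) = c * Ex P X.
Proof. exact: RintegralZl. Qed.

Lemma Ex_cst c : Ex P (fun=> c) = c.
Proof. by rewrite /Rintegral integral_cst// [X in (_ * X)%E]probability_setT mule1. Qed.

Lemma Ex_sum I (s : seq I) (F : I -> T -> R) : (forall i, itg P (F i)) ->
  Ex P (fun w => \sum_(i <- s) F i w) = \sum_(i <- s) Ex P (F i).
Proof.
move=> hF; elim: s => [|i s IH].
  by rewrite big_nil; under eq_Rintegral do rewrite big_nil; rewrite Ex_cst.
rewrite big_cons -IH -ExD//; last exact: itg_sum.
by apply: eq_Rintegral => w _; rewrite big_cons.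
Qed.

Lemma Ex_le X Y : itg P X -> itg P Y -> (forall w, X w <= Y w) -> Ex P X <= Ex P Y.
Proof. by move=> hX hY XY; apply: le_Rintegral. Qed.

Lemma Ex_ge0 X : (forall w, 0 <= X w) -> 0 <= Ex P X.
Proof. by move=> X0; apply: Rintegral_ge0. Qed.

Lemma Ex_norm X : itg P X -> `|Ex P X| <= Ex P (fun w => `|X w|).
Proof. by move=> hX; exact: le_normr_Rintegral. Qed.

Lemma Ex_norm_le X Y : itg P X -> itg P Y -> (forall w, `|X w| <= Y w) -> `|Ex P X| <= Ex P Y.
Proof. by move=> hX hY XY; rewrite (le_trans (Ex_norm hX))// Ex_le// itg_norm. Qed.

Lemma eq_Ex X Y : X =1 Y -> Ex P X = Ex P Y.
Proof. by move=> XY; apply: eq_Rintegral => w _. Qed.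

Lemma eq_itg X Y : X =1 Y -> itg P X -> itg P Y.
Proof. by move=> XY; apply: eq_integrable => // w _ /=; rewrite XY. Qed.

Lemma ExE X : itg P X -> (\int[P]_w (X w)%:E)%E = (Ex P X)%:E.
Proof. by move=> hX; rewrite fineK//; exact: integrable_fin_num. Qed.

Lemma itg_ge0P X (c : R) : measurable_fun setT X -> (forall w, 0 <= X w) ->
  (\int[P]_w (X w)%:E <= c%:E)%E -> itg P X /\ Ex P X <= c.
Proof.
move=> mX X0 hc.
have iX : itg P X.
  apply/integrableP; split; first exact/measurable_EFinP.
  under eq_integral do rewrite /= ger0_norm//.
  by rewrite (le_lt_trans hc)// ltry.
by split => //; rewrite -lee_fin -ExE.
Qed.

Lemma measurable_indicT A : measurable A -> measurable_fun setT (\1_A : T -> R).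
Proof. by move=> mA; exact: measurable_indic. Qed.

Lemma indic_le1 A w : `|\1_A w : R| <= 1.
Proof. by rewrite indicE; case: (_ \in _); rewrite /= ?normr1 ?normr0. Qed.

Lemma itg_indic A : measurable A -> itg P (\1_A : T -> R).
Proof. by move=> mA; apply: itg_bounded (measurable_indicT mA) (indic_le1 A). Qed.

Lemma Ex_indic A : measurable A -> Ex P (\1_A : T -> R) = fine (P A).
Proof. by move=> mA; rewrite /Rintegral integral_indic// setIT. Qed.

Lemma integral_indicE A X : measurable A -> itg P X ->
  (\int[P]_(w in A) (X w)%:E)%E = (Ex P (fun w => \1_A w * X w))%:E.
Proof.
move=> mA hX; rewrite -ExE; last first.
  exact: itgM_bounded (measurable_indicT mA) (indic_le1 A) hX.
rewrite integral_mkcond; apply: eq_integral => w _.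
by rewrite patchE indicE; case: ifP => _; rewrite ?mul1r ?mul0r.
Qed.

Lemma PrE A : measurable A -> P A = (fine (P A))%:E.
Proof. by move=> mA; rewrite fineK// fin_num_measure. Qed.

Lemma Pr_ge0 A : measurable A -> 0 <= fine (P A).
Proof. by move=> mA; rewrite fine_ge0. Qed.

Lemma Pr_le A B : measurable A -> measurable B -> A `<=` B -> fine (P A) <= fine (P B).
Proof. by move=> mA mB AB; rewrite fine_le ?fin_num_measure// le_measure ?inE. Qed.

Lemma Pr_setU_le A B : measurable A -> measurable B ->
  fine (P (A `|` B)) <= fine (P A) + fine (P B).
Proof.
move=> mA mB; rewrite -lee_fin EFinD -!PrE//; last exact: measurableU.
exact: measureU2.
Qed.

Lemma measurable_ge X Y : measurable_fun setT X -> measurable_fun setT Y ->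
  measurable [set w | X w <= Y w].
Proof.
move=> mX mY; rewrite -[X in measurable X]setTI.
exact: (measurable_fun_ler mX mY measurableT (Y := [set true])).
Qed.

Lemma measurable_gt X Y : measurable_fun setT X -> measurable_fun setT Y ->
  measurable [set w | X w < Y w].
Proof.
move=> mX mY; rewrite -[X in measurable X]setTI.
exact: (measurable_fun_ltr mX mY measurableT (Y := [set true])).
Qed.

Lemma markovE X (a : R) : itg P X -> (forall w, 0 <= X w) -> 0 < a ->
  fine (P [set w | a <= X w]) <= Ex P X / a.
Proof.
move=> hX X0 a0; set A := [set w | _].
have mA : measurable A by apply: measurable_ge => //; exact: itg_measurable.
rewrite ler_pdivlMr// -Ex_indic// mulrC -ExZ; last exact: itg_indic.
apply: Ex_le => //; first by apply: itgZ; exact: itg_indic.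
move=> w; rewrite indicE; case: (boolP (w \in A)) => [/set_mem|_].
  by rewrite mulr1.
by rewrite mulr0.
Qed.

End Expectation.

(** * Orthogonality to a sub-sigma-algebra *)

Section SubSigmaAlgebra.
Context {R : realType} d (T : measurableType d) (P : probability T R).
Variable gens : set (set T).
Hypothesis gens_meas : <<s gens >> `<=` @measurable _ T.

Lemma sub_measurable_fun d' (S : measurableType d') (X : T -> S) :
  measurable_fun setT (X : g_sigma_algebraType gens -> S) -> measurable_fun setT X.
Proof.
move=> mX _ B mB; apply: gens_meas; exact: (mX measurableT B mB).
Qed.

Lemma sum_ltn_min n t : (\sum_(j < n) (j < t)%N = minn n t)%N.
Proof.
elim: n => [|n IH]; first by rewrite big_ord0 min0n.
by rewrite big_ord_recr/= IH; lia.
Qed.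

(** A layer-cake sum: the number of levels (j+1)/(n+1) not above x is the integer part of (n+1) x.
    It transfers identities from indicators to functions with a uniform error. *)
Lemma layer_approx (x : R) n : 0 <= x <= 1 ->
  `|x - n.+1%:R^-1 * \sum_(j < n.+1) (j.+1%:R <= n.+1%:R * x)%R%:R| <= n.+1%:R^-1.
Proof.
move=> /andP[x0 x1]; set y := n.+1%:R * x.
have y0 : 0 <= y by rewrite mulr_ge0.
have n0 : 0 < n.+1%:R :> R by [].
have yn : y <= n.+1%:R by rewrite ler_piMr// ltW.
have /andP[t1 t2] := truncn_itv y0; set t := Num.truncn y in t1 t2.
have -> : \sum_(j < n.+1) (j.+1%:R <= y)%R%:R = t%:R :> R.
  transitivity ((\sum_(j < n.+1) (j < t)%N)%N%:R : R).
    rewrite natr_sum; apply: eq_bigr => j _; congr (_%:R); congr nat_of_bool.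
    apply/idP/idP => h.
      by rewrite -ltnS -(ltr_nat R) (le_lt_trans h).
    by rewrite (le_trans _ t1)// ler_nat.
  rewrite sum_ltn_min; congr (_%:R); apply/minn_idPr.
  by rewrite -(ler_nat R) (le_trans t1).
have -> : x = n.+1%:R^-1 * y by rewrite mulrA mulVf ?mul1r// gt_eqF.
rewrite -mulrBr normrM ger0_norm ?invr_ge0// ler_piMr ?invr_ge0//.
rewrite ger0_norm ?subr_ge0// lerBlDr.
by move: t2; rewrite -addn1 natrD => /ltW; rewrite addrC.
Qed.

Lemma Ex_orthogonal01 (W phi : T -> R) : itg P W ->
  (forall A, <<s gens >> A -> Ex P (fun w => \1_A w * W w) = 0) ->
  measurable_fun setT (phi : g_sigma_algebraType gens -> R) ->
  (forall w, 0 <= phi w <= 1) -> Ex P (fun w => phi w * W w) = 0.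
Proof.
move=> iW hW mphi phi01; apply/eqP; rewrite -normr_le0.
apply/ler_addgt0Pl => e e0; rewrite addr0.
pose m := Ex P (fun w => `|W w|); have m0 : 0 <= m by apply: Ex_ge0.
(* Makes the approximation error 1/(n+1), multiplied by E|W|, at most e. *)
pose n := Num.truncn (m / e).
have hn : m <= e * n.+1%:R.
  by rewrite mulrC -ler_pdivrMr// ltW// truncnS_gt.
pose A j := [set w : T | j.+1%:R <= n.+1%:R * phi w].
have FA j : <<s gens >> (A j).
  have : measurable (A j : set (g_sigma_algebraType gens)); last by [].
  by apply: measurable_ge => //; exact: measurable_funM.
pose ph w := n.+1%:R^-1 * \sum_(j < n.+1) \1_(A j) w : R.
have phE w : `|phi w - ph w| <= n.+1%:R^-1.
  have := layer_approx n (phi01 w); congr (`|_ - _ * _| <= _).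
  by apply: eq_bigr => j _; rewrite indicE mem_setE.
have mph : measurable_fun setT phi by exact: sub_measurable_fun.
have iA j : itg P (fun w => \1_(A j) w * W w).
  exact: (itgM_bounded (measurable_indicT (gens_meas (FA j))) (indic_le1 (A j)) iW).
have phW : Ex P (fun w => ph w * W w) = 0.
  rewrite (_ : Ex P _ = Ex P (fun w => n.+1%:R^-1 * \sum_(j < n.+1) \1_(A j) w * W w)).
    rewrite ExZ; last by exact: itg_sum.
    by rewrite Ex_sum// big1 ?mulr0// => j _; exact: hW.
  by apply: eq_Ex => w; rewrite -mulr_suml mulrA.
have iphW : itg P (fun w => ph w * W w).
  apply: (@eq_itg _ _ _ _ (fun w => n.+1%:R^-1 * \sum_(j < n.+1) \1_(A j) w * W w)).
    by move=> w; rewrite -mulr_suml mulrA.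
  by apply: itgZ; exact: itg_sum.
have iphiW : itg P (fun w => phi w * W w).
  apply: (itgM_bounded (B := 1) mph _ iW) => w.
  by have /andP[h1 h2] := phi01 w; rewrite ger0_norm.
rewrite -[Ex P _]subr0 -phW -ExB//.
apply: (@le_trans _ _ (Ex P (fun w => n.+1%:R^-1 * `|W w|))).
  apply: Ex_norm_le; [exact: itgB|by apply: itgZ; exact: itg_norm|move=> w].
  by rewrite -mulrBl normrM ler_wpM2r.
by rewrite ExZ ?itg_norm// mulrC ler_pdivrMr.
Qed.

Lemma Ex_orthogonal (W phi : T -> R) B : itg P W ->
  (forall A, <<s gens >> A -> Ex P (fun w => \1_A w * W w) = 0) ->
  measurable_fun setT (phi : g_sigma_algebraType gens -> R) ->
  (forall w, `|phi w| <= B) -> Ex P (fun w => phi w * W w) = 0.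
Proof.
move=> iW hW mphi phiB.
pose c := `|B| + 1; have c0 : 0 < c by rewrite ltr_pwDr.
(* An affine change of [phi] into [0, 1]; the constant part is orthogonal to W because the whole
   space belongs to the sigma-algebra. *)
pose psi w := (2 * c)^-1 * (phi w + c).
have psi01 w : 0 <= psi w <= 1.
  have := phiB w; rewrite ler_norml => /andP[h1 h2]; have := ler_norm B.
  move=> hB; rewrite /psi mulr_ge0/= ?invr_ge0 ?mulr_ge0 ?(ltW c0)//; last by rewrite /c; lra.
  by rewrite mulrC ler_pdivrMr ?mulr_gt0// mul1r /c; lra.
have mpsi : measurable_fun setT (psi : g_sigma_algebraType gens -> R).
  by apply: measurable_funM => //; apply: measurable_funD.
have h1 := Ex_orthogonal01 iW hW mpsi psi01.
have mp := sub_measurable_fun mpsi.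
have ipsiW : itg P (fun w => psi w * W w).
  apply: (itgM_bounded (B := 1) mp _ iW) => w.
  by have /andP[h h'] := psi01 w; rewrite ger0_norm.
have W0 : Ex P W = 0.
  rewrite -(hW setT); first by apply: eq_Ex => w; rewrite indicT mul1r.
  exact: (@measurableT _ (g_sigma_algebraType gens)).
rewrite (_ : Ex P _ = Ex P (fun w => 2 * c * (psi w * W w) - c * W w)).
  rewrite ExB ?itgZ// !ExZ// h1 W0 !mulr0 subr0//.
apply: eq_Ex => w; rewrite /psi !mulrA mulfV ?mul1r ?mulrDl ?addrK//.
by rewrite mul1r gt_eqF// addr_gt0.
Qed.

End SubSigmaAlgebra.

(** * Martingale differences *)

Lemma sum_nat_shift (V : nmodType) (F : nat -> V) n j :
  \sum_(n <= k < n + j) F k = \sum_(k < j) F (n + k)%N.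
Proof.
elim: j => [|j IH]; first by rewrite addn0 big_geq// big_ord0.
by rewrite addnS big_nat_recr ?leq_addr//= IH big_ord_recr.
Qed.

Section Martingale.
Context {R : realType} d (T : measurableType d) (P : probability T R).

(** Filtrations are given by generating families, so that [g_sigma_algebraType (gens k)] is a
    measurable type and adaptedness is plain measurability. *)
Definition filtration (gens : nat -> set (set T)) :=
  (forall k, <<s gens k >> `<=` @measurable _ T) /\
  (forall k, <<s gens k >> `<=` <<s gens k.+1 >>).

Definition adapted (gens : nat -> set (set T)) k (X : T -> R) :=
  measurable_fun setT (X : g_sigma_algebraType (gens k) -> R).

Definition martingale_diff (gens : nat -> set (set T)) (eta : nat -> T -> R) :=
  [/\ forall k, adapted gens k.+1 (eta k),
      forall k, itg P (fun w => eta k w ^+ 2) &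
      forall k A, <<s gens k >> A -> Ex P (fun w => \1_A w * eta k w) = 0].

Lemma filtration_le gens k m : filtration gens -> (k <= m)%N ->
  <<s gens k >> `<=` <<s gens m >>.
Proof.
move=> [_ h]; elim: m => [|m IH]; first by rewrite leqn0 => /eqP ->.
rewrite leq_eqVlt => /orP[/eqP -> //|]; rewrite ltnS => /IH km.
exact: subset_trans km (h m).
Qed.

Lemma adapted_le gens k m X : filtration gens -> (k <= m)%N ->
  adapted gens k X -> adapted gens m X.
Proof.
move=> hf km hX _ B mB; exact: (filtration_le hf km (hX measurableT B mB)).
Qed.

Lemma adapted_measurable gens k X : filtration gens -> adapted gens k X ->
  measurable_fun setT X.
Proof. by move=> [h _]; exact: sub_measurable_fun. Qed.

Lemma martingale_diff_measurable gens eta k : filtration gens ->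
  martingale_diff gens eta -> measurable_fun setT (eta k).
Proof. by move=> hf [h _ _]; exact: adapted_measurable (h k). Qed.

Lemma martingale_diff_itg gens eta k : filtration gens ->
  martingale_diff gens eta -> itg P (eta k).
Proof.
move=> hf he; apply: itg_sqr; first exact: martingale_diff_measurable he.
by case: he.
Qed.

Lemma martingale_diff_orthogonal gens eta k (phi : T -> R) B : filtration gens ->
  martingale_diff gens eta -> adapted gens k phi ->
  (forall w, `|phi w| <= B) -> Ex P (fun w => phi w * eta k w) = 0.
Proof.
move=> hf he; have hi := martingale_diff_itg k hf he.
case: he => _ _ he; apply: Ex_orthogonal => //; first by case: hf.
exact: he.
Qed.

Lemma adapted_sum gens k (F : nat -> T -> R) m :
  (forall j, (j < m)%N -> adapted gens k (F j)) ->
  adapted gens k (fun w => \sum_(j < m) F j w).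
Proof.
elim: m => [|m IH] hF.
  by rewrite /adapted; under eq_fun do rewrite big_ord0; exact: measurable_cst.
rewrite /adapted; under eq_fun do rewrite big_ord_recr/=.
apply: measurable_funD; last exact: hF.
by apply: IH => j jm; apply: hF; exact: ltnW.
Qed.

Section Kolmogorov.
Variables (gens : nat -> set (set T)) (eta : nat -> T -> R) (a : R).
Hypotheses (hf : filtration gens) (he : martingale_diff gens eta) (a_gt0 : 0 < a).

Let S m w := \sum_(k < m) eta k w.

Fixpoint stay_below m : set T := if m is m'.+1
  then stay_below m' `&` [set w | `|S m w| < a] else setT.

(** S stopped when |S| first reaches a: the increment of index k is kept as long as |S_j| < a for
    all j <= k, so the crossing increment is included. *)
Let M m w := \sum_(k < m) (\1_(stay_below k) w * eta k w).

Lemma stay_belowP m w : stay_below m w <-> forall j, (j <= m)%N -> `|S j w| < a.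
Proof.
elim: m => [|m IH] /=.
  by split => // _ j; rewrite leqn0 => /eqP ->; rewrite /S big_ord0 normr0.
split=> [[/IH h1 h2] j|h]; last by split; [apply/IH => j jm; exact/h/leqW|exact: h].
by rewrite leq_eqVlt => /orP[/eqP ->//|]; rewrite ltnS => /h1.
Qed.

Lemma adapted_partial_sum m : adapted gens m (S m).
Proof.
apply: adapted_sum => j jm; case: he => h _ _.
exact: adapted_le hf jm (h j).
Qed.

Lemma stay_below_adapted m : <<s gens m >> (stay_below m).
Proof.
elim: m => [|m IH] /=.
  exact: (@measurableT _ (g_sigma_algebraType (gens 0%N))).
apply: (@measurableI _ (g_sigma_algebraType (gens m.+1))).
  by case: hf => _; apply.
apply: measurable_gt => //.
exact: (measurableT_comp (@normr_measurable R setT) (@adapted_partial_sum m.+1)).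
Qed.

Lemma adapted_indic k A : <<s gens k >> A -> adapted gens k (\1_A).
Proof. by move=> mA; apply: measurable_indic. Qed.

Let adapted_M m : adapted gens m (M m).
Proof.
apply: (adapted_sum (F := fun j w => \1_(stay_below j) w * eta j w)) => j jm.
apply: measurable_funM.
  exact: adapted_le hf (ltnW jm) (adapted_indic (@stay_below_adapted j)).
by case: he => h _ _; exact: adapted_le hf jm (h j).
Qed.

Let M_below m w : stay_below m w -> M m w = S m w.
Proof.
elim: m => [|m IH] /=; first by rewrite /M /S !big_ord0.
move=> [h _]; rewrite /M /S !big_ord_recr/= -/(M m w) -/(S m w) IH//.
by rewrite indicE mem_set// mul1r.
Qed.

Let M_stop m w : ~ stay_below m w -> a <= `|M m w|.
Proof.
elim: m => [|m IH] //= h.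
rewrite /M big_ord_recr/= -/(M m w) indicE.
have [hm|hm] := pselect (stay_below m w); last first.
  by rewrite memNset// mul0r addr0 IH.
rewrite mem_set// mul1r M_below// leNgt; apply/negP => h2; apply: h; split => //.
by rewrite /S big_ord_recr.
Qed.

(** [M m] times the indicator of [stay_below m] is bounded by a, so the cross term pairs eta_m with
    a bounded adapted factor and has zero mean. *)
Let M_sqr m : itg P (fun w => M m w ^+ 2) /\
  Ex P (fun w => M m w ^+ 2) <= \sum_(k < m) Ex P (fun w => eta k w ^+ 2).
Proof.
elim: m => [|m [IH1 IH2]].
  rewrite big_ord0 /M; split.
    by apply: (@eq_itg _ _ _ P (fun=> 0)) (itg_cst P 0) => w; rewrite big_ord0 expr0n.
  by rewrite (@eq_Ex _ _ _ P _ (fun=> 0)) ?Ex_cst// => w; rewrite big_ord0 expr0n.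
have Fm := @stay_below_adapted m.
have mA : measurable (stay_below m) by case: hf => h _; exact: h Fm.
pose phi w := \1_(stay_below m) w * M m w.
have phia w : `|phi w| <= a.
  rewrite /phi indicE; have [hm|hm] := pselect (stay_below m w); last first.
    by rewrite memNset// mul0r normr0 ltW.
  rewrite mem_set// mul1r M_below//; apply: ltW.
  by move/stay_belowP : hm; apply.
have aphi : adapted gens m phi.
  by apply: measurable_funM; [exact: (adapted_indic Fm)|exact: adapted_M].
have h0 := martingale_diff_orthogonal hf he aphi phia.
have ietal := martingale_diff_itg m hf he.
have ieta2 : itg P (fun w => eta m w ^+ 2) by case: he.
have i1 : itg P (fun w => phi w * eta m w).
  by apply: (itgM_bounded _ phia ietal); exact: adapted_measurable aphi.
have i2 : itg P (fun w => \1_(stay_below m) w * eta m w ^+ 2).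
  exact: (itgM_bounded (measurable_indicT mA) (indic_le1 _) ieta2).
have ME w : M m.+1 w ^+ 2 = M m w ^+ 2 + (2 * (phi w * eta m w) + \1_(stay_below m) w * eta m w ^+ 2).
  rewrite /phi /M big_ord_recr/= -/(M m w) indicE.
  by case: (_ \in _); rewrite /= ?mul1r ?mul0r; ring.
split.
  by apply: (eq_itg (fun w => esym (ME w))); apply: itgD => //; apply: itgD => //; exact: itgZ.
rewrite (eq_Ex _ ME) ExD//; last by apply: itgD => //; exact: itgZ.
rewrite ExD ?itgZ// ExZ// h0 mulr0 add0r big_ord_recr/= lerD//.
apply: Ex_le => // w; by rewrite ler_piMl ?sqr_ge0// indicE; case: (_ \in _).
Qed.

(** Markov's inequality for the square of the stopped martingale, which stays frozen at absolute
    value at least a after crossing. *)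
Lemma kolmogorov_maximal m :
  fine (P (~` stay_below m)) <= (\sum_(k < m) Ex P (fun w => eta k w ^+ 2)) / a ^+ 2.
Proof.
have mA : measurable (stay_below m) by case: hf => h _; exact: h (@stay_below_adapted m).
have [i1 h1] := M_sqr m.
have a20 : 0 < a ^+ 2 by rewrite exprn_gt0.
apply: (@le_trans _ _ (fine (P [set w | a ^+ 2 <= M m w ^+ 2]))).
  apply: Pr_le; [exact: measurableC|by apply: measurable_ge => //; exact: itg_measurable i1|].
  by move=> w /= /M_stop h; rewrite -[X in _ <= X]real_normK ?num_real// ler_pXn2r ?nnegrE// ltW.
apply: (le_trans (markovE i1 (fun w => sqr_ge0 _) a20)).
by rewrite ler_pM2r ?invr_gt0.
Qed.

End Kolmogorov.

Lemma shift_filtration gens n : filtration gens -> filtration (fun k => gens (n + k)%N).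
Proof. by move=> [h1 h2]; split => k //; rewrite addnS. Qed.

Lemma shift_martingale_diff gens eta n : martingale_diff gens eta ->
  martingale_diff (fun k => gens (n + k)%N) (fun k => eta (n + k)%N).
Proof.
move=> [h1 h2 h3]; split => [k|k|k A] //; last exact: h3.
by rewrite /adapted addnS; exact: h1.
Qed.

(** For a fixed level, the maximal inequality for the martingale restarted at n bounds the
    probability of ever leaving the level after n by a tail of [v]. The intersection over n is
    therefore null, for each of the countably many levels 1/(i+1). *)
Lemma martingale_ae_cauchy gens eta (v : nat -> R) : filtration gens ->
  martingale_diff gens eta ->
  (forall k, Ex P (fun w => eta k w ^+ 2) <= v k) -> cauchy_partial_sums v ->
  {ae P, forall w, cauchy_partial_sums (eta ^~ w)}.
Proof.
move=> hf he hv vc.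
pose bad n i := \bigcup_m ~` stay_below (fun k => eta (n + k)%N) (i.+1%:R^-1 : R) m.
have mbelow n i m : measurable (stay_below (fun k => eta (n + k)%N) (i.+1%:R^-1 : R) m).
  have h := shift_filtration n hf; case: (h) => h' _; apply: (h' m).
  exact: (@stay_below_adapted _ _ _ h (shift_martingale_diff n he) m).
have mbad n i : measurable (bad n i).
  by apply: bigcupT_measurable => m; apply: measurableC; exact: mbelow.
have bad_null i : P (\bigcap_n bad n i) = 0%E.
  have mcap : measurable (\bigcap_n bad n i) by apply: bigcapT_measurable => n; exact: mbad.
  apply/eqP; rewrite eq_le measure_ge0 andbT.
  apply/lee_addgt0Pr => e e0; rewrite add0e.
  have i0 : 0 < (i.+1%:R^-1 : R) ^+ 2 by rewrite exprn_gt0.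
  have [N hN] := vc _ (mulr_gt0 e0 i0).
  apply: (@le_trans _ _ (P (bad N i))).
    by rewrite le_measure ?inE//; apply: bigcap_inf.
  have hcv : P (~` stay_below (fun k => eta (N + k)%N) (i.+1%:R^-1 : R) m) @[m --> \oo] --> P (bad N i).
    apply: nondecreasing_cvg_mu => //.
    - by move=> m; apply: measurableC; exact: mbelow.
    - exact: mbad.
    - move=> m1 m2 m12; apply/subsetPset => w /= h /stay_belowP h2; apply: h.
      have i1 : 0 < (i.+1%:R^-1 : R) by [].
      by apply/(stay_belowP _ i1) => j jm; apply: (h2 i1); exact: leq_trans m12.
  rewrite -(cvg_lim _ hcv)//; apply: lime_le; first by apply/cvg_ex; eexists; exact: hcv.
  near=> m; rewrite PrE ?lee_fin; last by apply: measurableC; exact: mbelow.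
  have i1 : 0 < (i.+1%:R^-1 : R) by [].
  apply: (le_trans (kolmogorov_maximal (shift_filtration N hf) (shift_martingale_diff N he) i1 m)).
  rewrite ler_pdivrMr//.
  have := hN N (N + m)%N (leqnn _) (leq_addr _ _); rewrite ler_norml => /andP[_].
  by apply: le_trans; rewrite sum_nat_shift; apply: ler_sum => k _; exact: hv.
have : {ae P, forall w, forall i, (~` \bigcap_n bad n i) w}.
  apply: ae_foralln => i; exists (\bigcap_n bad n i); split => //.
  - by apply: bigcapT_measurable => n; exact: mbad.
  - exact: bad_null.
  - by move=> w /= /contrapT.
apply: filterS => w hw e e0.
(* The factor 2 pays for comparing two partial sums through the common starting point n. *)
have [i hi] : exists i, 2 * i.+1%:R^-1 <= e.
  exists (Num.truncn (2 / e)); rewrite ler_pdivrMr// mulrC -ler_pdivrMr//.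
  by rewrite ltW// truncnS_gt.
have := hw i; rewrite setC_bigcap => -[n _ hn].
have i1 : 0 < (i.+1%:R^-1 : R) by [].
have hS j : `|\sum_(n <= k < n + j) eta k w| < i.+1%:R^-1.
  apply: contrapT => hj; apply: hn; exists j => //= /(stay_belowP _ i1)/(_ _ (leqnn j)).
  by rewrite -(sum_nat_shift (fun k => eta k w)).
exists n => j m nj jm.
have -> : \sum_(j <= k < m) eta k w =
    \sum_(n <= k < n + (m - n)) eta k w - \sum_(n <= k < n + (j - n)) eta k w.
  rewrite !subnKC//; last exact: leq_trans jm.
  by rewrite (big_cat_nat (n := j) nj jm)/= addrAC subrr add0r.
rewrite (le_trans _ hi)// (le_trans (ler_normB _ _))//.
by have := hS (m - n)%N; have := hS (j - n)%N; set t := _^-1; lra.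
Unshelve. all: by end_near.
Qed.

End Martingale.

(** * Martingale central limit theorem *)

Section TaylorBounds.
Context {R : realType}.
Implicit Types x y : R.

Lemma sin_sub_mvt x : 0 <= x -> exists2 c, 0 <= c <= x & sin x = cos c * x.
Proof.
move=> x0; have [c] := @MVT_segment R sin cos 0 x x0 (fun y _ => is_derive_sin y)
  (continuous_subspaceT (@continuous_sin R)).
by rewrite in_itv/= sin0 !subr0 => hc ->; exists c.
Qed.

Lemma sin_le_id x : 0 <= x -> `|sin x| <= x.
Proof.
move=> x0; have [c _ ->] := sin_sub_mvt x0.
by rewrite normrM (ger0_norm x0) ler_piMl// cos_max.
Qed.

Lemma normr_sin_le x : `|sin x| <= `|x|.
Proof.
have [x0|x0] := leP 0 x; first by rewrite (ger0_norm x0) sin_le_id.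
by rewrite -normrN -sinN (ltr0_norm x0) sin_le_id// oppr_ge0 ltW.
Qed.

Lemma cos_half x : cos x = 1 - 2 * sin (x / 2) ^+ 2.
Proof.
have -> : cos x = cos ((x / 2) *+ 2) by congr cos; rewrite mulr2n -splitr.
by rewrite cos_mulr2n cos2sin2; lra.
Qed.

Lemma one_sub_cos_le x : 1 - cos x <= x ^+ 2 / 2.
Proof.
rewrite cos_half; have := normr_sin_le (x / 2) => h.
have : sin (x / 2) ^+ 2 <= (x / 2) ^+ 2.
  by rewrite -[leLHS]real_normK ?num_real// -[leRHS]real_normK ?num_real// lerXn2r ?nnegrE.
nra.
Qed.

Lemma id_sub_sin_bounds x : 0 <= x -> 0 <= x - sin x <= x ^+ 3 / 2.
Proof.
move=> x0; have [c /andP[c0 cx] ->] := sin_sub_mvt x0.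
have h1 := one_sub_cos_le c; have h2 := cos_le1 c.
have h3 : c ^+ 2 <= x ^+ 2 by rewrite lerXn2r ?nnegrE.
have h4 : x * (1 - cos c) <= x * (x ^+ 2 / 2) by rewrite ler_wpM2l//; lra.
have h5 : 0 <= x * (1 - cos c) by rewrite mulr_ge0// subr_ge0.
by apply/andP; split; rewrite ?exprS ?expr0; lra.
Qed.

Lemma cos_taylor2_cube x : 0 <= cos x - 1 + x ^+ 2 / 2 /\
  cos x - 1 + x ^+ 2 / 2 <= x ^+ 2 /\ cos x - 1 + x ^+ 2 / 2 <= `|x| ^+ 3.
Proof.
have h0 : 0 <= cos x - 1 + x ^+ 2 / 2 by have := one_sub_cos_le x; lra.
have h1 : cos x - 1 + x ^+ 2 / 2 <= x ^+ 2 / 2 by have := cos_le1 x; lra.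
have x20 := sqr_ge0 x.
split => //; split; first by lra.
rewrite -(cos_norm x) in h0 h1 *; rewrite -[x ^+ 2]real_normK ?num_real// in h0 h1 x20 *.
set y := `|x| in h0 h1 x20 *; have y0 : 0 <= y by exact: normr_ge0.
have [yh|yh] := leP (1 / 2) y.
  apply: (le_trans h1); rewrite [leRHS]exprS; nra.
have y20 : 0 <= y / 2 by lra.
have /andP[a1 a2] := id_sub_sin_bounds y20; have a3 := sin_le_id y20.
rewrite cos_half; set s := sin (y / 2) in a1 a2 a3 *.
have : `|s| <= y / 2 by [].
rewrite ler_norml => /andP[b1 b2].
have -> : 1 - 2 * s ^+ 2 - 1 + y ^+ 2 / 2 = 2 * ((y / 2 - s) * (y / 2 + s)) by field.
have h : (y / 2 - s) * (y / 2 + s) <= ((y / 2) ^+ 3 / 2) * y.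
  by apply: ler_pM => //; lra.
apply: (@le_trans _ _ (2 * (((y / 2) ^+ 3 / 2) * y))); first by lra.
have y3 : 0 <= y ^+ 3 by exact: exprn_ge0.
have -> : 2 * ((y / 2) ^+ 3 / 2 * y) = y ^+ 3 * (y / 8) by field.
by rewrite ler_piMr//; lra.
Qed.

Lemma sin_taylor1_cube x : `|sin x - x| <= x ^+ 2 /\ `|sin x - x| <= `|x| ^+ 3.
Proof.
wlog x0 : x / 0 <= x.
  move=> H; have [x0|x0] := leP 0 x; first exact: H.
  have := H (- x); rewrite oppr_ge0 (ltW x0) => /(_ isT).
  by rewrite sinN -opprD !normrN sqrrN.
have /andP[h1 h2] := id_sub_sin_bounds x0.
rewrite distrC (ger0_norm h1) (ger0_norm x0).
have x3 : 0 <= x ^+ 3 by exact: exprn_ge0.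
split; last by lra.
have [x2|x2] := leP x 2.
  apply: (le_trans h2); rewrite exprS expr2; nra.
have := sin_geN1 x; nra.
Qed.

(** Uses the cubic bound for |x| <= e and the quadratic bound beyond, which is the splitting that a
    Lindeberg condition controls. *)
Lemma truncated_bound (h x e : R) : h <= x ^+ 2 -> h <= `|x| ^+ 3 -> 0 <= e ->
  h <= e * x ^+ 2 + x ^+ 2 * \1_[set y : R | e < `|y|] x.
Proof.
move=> h1 h2 e0; rewrite indicE; have [ex|ex] := ltP e `|x|.
  rewrite mem_set//= mulr1; have := sqr_ge0 x; nra.
rewrite memNset/=; last by rewrite ltNge ex.
rewrite mulr0 addr0 (le_trans h2)// exprS real_normK ?num_real//.
by rewrite ler_wpM2r// sqr_ge0.
Qed.

Lemma expRN_taylor (u : R) : 0 <= u -> `|1 - u - expR (- u)| <= u ^+ 2.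
Proof.
move=> u0; have h1 := expR_ge1Dx (- u); have h2 := expR_ge1Dx u.
have h3 : expR (- u) <= 1 - u + u ^+ 2.
  rewrite expRN -div1r ler_pdivrMr ?expR_gt0//.
  have : (1 - u + u ^+ 2) * (1 + u) <= (1 - u + u ^+ 2) * expR u.
    by rewrite ler_wpM2l//; nra.
  apply: le_trans; have : 0 <= u ^+ 3 by exact: exprn_ge0.
  rewrite !exprS expr0; nra.
rewrite ler_norml; apply/andP; split; [lra|have := sqr_ge0 u; lra].
Qed.

Lemma expR_lipschitz (a b m : R) : a <= m -> b <= m ->
  `|expR a - expR b| <= expR m * `|a - b|.
Proof.
wlog ab : a b / b <= a.
  move=> H am bm; have [ab|ab] := leP b a; first exact: H.
  by rewrite distrC (distrC a); apply: H => //; exact: ltW.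
move=> am bm; rewrite !ger0_norm ?subr_ge0// ?ler_expR//.
have -> : expR a - expR b = expR a * (1 - expR (b - a)).
  by rewrite mulrBr mulr1 -expRD subrKC.
apply: ler_pM => //; rewrite ?expR_ge0 ?ler_expR//.
  by rewrite subr_ge0 -expR0 ler_expR subr_le0.
by have := expR_ge1Dx (b - a); lra.
Qed.

End TaylorBounds.

(** * Compensated characteristic function over a finite horizon *)

Section FiniteHorizon.
Context {R : realType} d (T : measurableType d) (P : probability T R).
Variables (gens : nat -> set (set T)) (X v y : nat -> T -> R) (e dl C c : R).
Hypotheses (hf : filtration gens) (hX : martingale_diff P gens X).
Hypotheses (e_ge0 : 0 <= e) (dl_ge0 : 0 <= dl) (C_ge0 : 0 <= C).
Hypotheses (v_ge0 : forall k w, 0 <= v k w) (y_ge0 : forall k w, 0 <= y k w).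
Hypotheses (v_adapted : forall k, adapted gens k (v k))
  (y_adapted : forall k, adapted gens k (y k)).
Hypotheses (v_itg : forall k, itg P (v k)) (y_itg : forall k, itg P (y k)).
Hypothesis v_cond : forall k A, <<s gens k >> A ->
  Ex P (fun w => \1_A w * (X k w ^+ 2 - v k w)) = 0.
Let tail k w : R := X k w ^+ 2 * \1_[set x : R | e < `|x|] (X k w).
Hypothesis y_cond : forall k A, <<s gens k >> A ->
  Ex P (fun w => \1_A w * (tail k w - y k w)) = 0.

Let V k w := \sum_(j < k) v j w.
Let L k w := \sum_(j < k) y j w.
(** A predictable truncation: only v_j and y_j with j <= k enter, and these are known at time k. It
    caps the accumulated variance by C, hence the compensator by exp(C/2), and the accumulated
    Lindeberg terms by [dl]. *)
Let good k : set T := [set w | V k.+1 w <= C] `&` [set w | L k.+1 w <= dl].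
Let chi k w : R := \1_(good k) w.
Let S k w := \sum_(j < k) chi j w * X j w.
Let U k w := \sum_(j < k) chi j w * v j w.

Let sumS (F : nat -> T -> R) k w : \sum_(j < k.+1) F j w = \sum_(j < k) F j w + F k w.
Proof. by rewrite big_ord_recr. Qed.

Let adapted_partial (F : nat -> T -> R) k m : (forall j, adapted gens j (F j)) -> (k <= m.+1)%N ->
  adapted gens m (fun w => \sum_(j < k) F j w).
Proof.
move=> hF km; apply: adapted_sum => j jk.
by apply: (adapted_le hf _ (hF j)); rewrite -ltnS (leq_trans jk).
Qed.

Let good_sigma k : <<s gens k >> (good k).
Proof.
apply: (@measurableI _ (g_sigma_algebraType (gens k))).
  by apply: measurable_ge => //; exact: (@adapted_partial v).
by apply: measurable_ge => //; exact: (@adapted_partial y).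
Qed.

Let chi_adapted k : adapted gens k (chi k).
Proof. exact: (adapted_indic (@good_sigma k)). Qed.

Let chi01 k w : chi k w = 0 \/ (chi k w = 1 /\ good k w).
Proof.
rewrite /chi indicE; case: (boolP (w \in good k)) => [/set_mem|_]; last by left.
by right.
Qed.

(** At the last kept index the truncated sum is below the full one, which [good] bounds; afterwards
    nothing is added. *)
Let partial_le (F : nat -> T -> R) B k w : 0 <= B -> (forall k w, 0 <= F k w) ->
  (forall k, good k w -> \sum_(j < k.+1) F j w <= B) ->
  \sum_(j < k) chi j w * F j w <= B.
Proof.
move=> B0 F0 hB.
have sub j : \sum_(i < j) chi i w * F i w <= \sum_(i < j) F i w.
  apply: ler_sum => i _; rewrite ler_piMl//.
  by case: (chi01 i w) => [->//|[-> _]].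
elim: k => [|k IH]; first by rewrite big_ord0.
rewrite big_ord_recr/=; case: (chi01 k w) => [->|[-> hg]]; first by rewrite mul0r addr0.
rewrite mul1r (le_trans _ (hB _ hg))// sumS lerD2r; exact: sub.
Qed.

Let U_le k w : 0 <= U k w <= C.
Proof.
apply/andP; split.
  by apply: sumr_ge0 => j _; rewrite mulr_ge0.
by apply: partial_le => // j [].
Qed.

Let U_adapted k : adapted gens k (U k.+1).
Proof.
by apply: (@adapted_partial (fun j w => chi j w * v j w)) => // j; apply: measurable_funM; [exact: chi_adapted|exact: v_adapted].
Qed.

Let S_adapted k : adapted gens k (S k).
Proof.
apply: (@adapted_sum _ _ _ _ _ (fun j w => chi j w * X j w)) => j jk.
apply: measurable_funM; first exact: (adapted_le hf (ltnW jk) (@chi_adapted j)).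
by case: hX => h _ _; exact: (adapted_le hf jk (h j)).
Qed.

Let f k w := cos (c + S k w) * expR (U k w / 2).

Let K := expR (C / 2).

Let eU k w : 0 <= expR (U k w / 2) <= K.
Proof.
rewrite expR_ge0/= /K ler_expR ler_pM2r ?invr_gt0//.
by have /andP[] := U_le k w.
Qed.

Let X_meas k : measurable_fun setT (X k).
Proof. exact: martingale_diff_measurable hf hX. Qed.

Let X2_itg k : itg P (fun w => X k w ^+ 2).
Proof. by case: hX. Qed.

Let tail_itg k : itg P (tail k).
Proof.
apply: (itg_le _ _ (@X2_itg k)) => [|w].
  apply: measurable_funM; first exact: measurable_funX.
  apply: (@measurableT_comp _ _ _ _ _ _ (\1_[set x : R | e < `|x|] : R -> R)) => //.
  apply: measurable_indic; rewrite -[X in measurable X]setTI.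
  exact: (measurable_fun_ltr (measurable_cst e) (@normr_measurable R setT) measurableT (Y := [set true])).
rewrite /tail normrM ger0_norm ?sqr_ge0// ler_piMr ?sqr_ge0//.
exact: indic_le1.
Qed.

Let chi_bounded k w (a : R) : `|a| <= K -> `|chi k w * a| <= K.
Proof.
move=> h; rewrite normrM (le_trans _ h)// ler_piMl//; exact: indic_le1.
Qed.

Let cond_v k phi B : adapted gens k phi -> (forall w, `|phi w| <= B) ->
  Ex P (fun w => phi w * X k w ^+ 2) = Ex P (fun w => phi w * v k w).
Proof.
move=> aphi phiB; have mphi := adapted_measurable hf aphi.
apply/eqP; rewrite -subr_eq0 -ExB; last 2 first.
- exact: (itgM_bounded mphi phiB (@X2_itg k)).
- exact: (itgM_bounded mphi phiB (@v_itg k)).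
rewrite (@eq_Ex _ _ _ _ _ (fun w => phi w * (X k w ^+ 2 - v k w))); last by move=> w; rewrite mulrBr.
apply/eqP; apply: (Ex_orthogonal (B := B) (proj1 hf k)) => //; first exact: itgB.
exact: v_cond.
Qed.

Let cond_y k phi B : adapted gens k phi -> (forall w, `|phi w| <= B) ->
  Ex P (fun w => phi w * tail k w) = Ex P (fun w => phi w * y k w).
Proof.
move=> aphi phiB; have mphi := adapted_measurable hf aphi.
apply/eqP; rewrite -subr_eq0 -ExB; last 2 first.
- exact: (itgM_bounded mphi phiB (@tail_itg k)).
- exact: (itgM_bounded mphi phiB (@y_itg k)).
rewrite (@eq_Ex _ _ _ _ _ (fun w => phi w * (tail k w - y k w))); last by move=> w; rewrite mulrBr.
apply/eqP; apply: (Ex_orthogonal (B := B) (proj1 hf k)) => //; first exact: itgB.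
exact: y_cond.
Qed.

Let f_itg k : itg P (f k).
Proof.
apply: (@itg_bounded _ _ _ _ K) => [|w].
  have mS : measurable_fun setT (S k) by exact: (adapted_measurable hf (@S_adapted k)).
  have mU : measurable_fun setT (U k).
    apply: measurable_sum => j; apply: measurable_funM; last exact: itg_measurable.
    exact: (adapted_measurable hf (@chi_adapted j)).
  apply: measurable_funM.
    by apply: (measurableT_comp (continuous_measurable_fun (@continuous_cos R))); exact: measurable_funD.
  by apply: (measurableT_comp (@measurable_expR R)); exact: measurable_funM.
rewrite normrM; have /andP[h1 h2] := eU k w.
by rewrite (ger0_norm h1) (le_trans _ h2)// ler_piMl// cos_max.
Qed.

(* The increment of the compensated characteristic function; the linear term
   vanishes by the martingale property and [X ^+ 2 - v] is conditionally centred. *)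
Let step k : `|Ex P (f k.+1) - Ex P (f k)| <= K * Ex P (fun w => chi k w *
  (2 * e * v k w + 2 * y k w + (e ^+ 2 + dl) * v k w)).
Proof.
(* Both coefficients use U at k+1, which is still known at time k because v_k is. *)
pose phi1 w := chi k w * (expR (U k.+1 w / 2) * cos (c + S k w)).
pose phi2 w := chi k w * (expR (U k.+1 w / 2) * sin (c + S k w)).
pose r1 w := cos (X k w) - 1 + X k w ^+ 2 / 2.
pose r2 w := sin (X k w) - X k w.
pose r3 w := 1 - v k w / 2 - expR (- (v k w / 2)).
have K0 : 0 <= K by exact: expR_ge0.
have aE : adapted gens k (fun w => expR (U k.+1 w / 2)).
  by apply: (measurableT_comp (@measurable_expR R)); apply: measurable_funM => //; exact: U_adapted.
have acS : adapted gens k (fun w => c + S k w) by apply: measurable_funD => //; exact: S_adapted.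
have a1 : adapted gens k phi1.
  apply: measurable_funM; first exact: chi_adapted.
  by apply: measurable_funM => //; apply: (measurableT_comp (continuous_measurable_fun (@continuous_cos R))).
have a2 : adapted gens k phi2.
  apply: measurable_funM; first exact: chi_adapted.
  by apply: measurable_funM => //; apply: (measurableT_comp (continuous_measurable_fun (@continuous_sin R))).
have b1' w : `|expR (U k.+1 w / 2) * cos (c + S k w)| <= K.
  have /andP[h1 h2] := eU k.+1 w.
  by rewrite normrM (ger0_norm h1) (le_trans _ h2)// ler_piMr// cos_max.
have b2' w : `|expR (U k.+1 w / 2) * sin (c + S k w)| <= K.
  have /andP[h1 h2] := eU k.+1 w.
  by rewrite normrM (ger0_norm h1) (le_trans _ h2)// ler_piMr// sin_max.
have b1 w : `|phi1 w| <= K by exact: chi_bounded.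
have b2 w : `|phi2 w| <= K by exact: chi_bounded.
have chi0 w : 0 <= chi k w by case: (chi01 k w) => [->//|[-> _]].
have m1 := adapted_measurable hf a1; have m2 := adapted_measurable hf a2.
have X_itg : itg P (X k) := martingale_diff_itg k hf hX.
have q_itg : itg P (fun w => e * X k w ^+ 2 + tail k w) by apply: itgD => //; exact: itgZ.
have hr1 w : `|r1 w| <= e * X k w ^+ 2 + tail k w.
  have [h0 [h1 h2]] := cos_taylor2_cube (X k w).
  by rewrite /r1 ger0_norm//; exact: truncated_bound.
have hr2 w : `|r2 w| <= e * X k w ^+ 2 + tail k w.
  by have [h1 h2] := sin_taylor1_cube (X k w); exact: truncated_bound.
have r1_itg : itg P r1.
  apply: (itg_le _ hr1 q_itg); apply: measurable_funD.
    apply: measurable_funB => //.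
    exact: (measurableT_comp (continuous_measurable_fun (@continuous_cos R)) (@X_meas k)).
  by apply: measurable_funM => //; exact: measurable_funX.
have r2_itg : itg P r2.
  apply: (itg_le _ hr2 q_itg); apply: measurable_funB => //.
  exact: (measurableT_comp (continuous_measurable_fun (@continuous_sin R)) (@X_meas k)).
(* The addition formula for cos, then cos X = 1 - X^2/2 + r1, sin X = X + r2 and exp(-v/2) = 1 - v/2
   - r3. *)
have fE w : f k.+1 w - f k w = phi1 w * r1 w + (-1) * (phi2 w * r2 w) +
   (-1) * (phi2 w * X k w) + ((-1/2) * (phi1 w * X k w ^+ 2) +
   (1/2) * (phi1 w * v k w)) + phi1 w * r3 w.
  have US : U k.+1 w = U k w + chi k w * v k w by rewrite /U big_ord_recr.
  have SS : S k.+1 w = S k w + chi k w * X k w by rewrite /S big_ord_recr.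
  rewrite /f /phi1 /phi2 /r1 /r2 /r3 US SS.
  case: (chi01 k w) => [->|[-> _]]; first by rewrite !mul0r !mulr0 !addr0 subrr.
  rewrite !mul1r addrA (cosD (c + S k w)) (mulrDl (U k w)) expRD expRN.
  have : expR (v k w / 2) != 0 by rewrite expR_eq0.
  set E1 := expR (U k w / 2); set E2 := expR _; set a := cos (c + _); set a' := sin (c + _) => E20.
  by field.
have gv w : chi k w * v k w <= C.
  case: (chi01 k w) => [->|[-> [/= h _]]]; first by rewrite mul0r.
  by rewrite mul1r (le_trans _ h)// /V sumS lerDr sumr_ge0.
have gy w : chi k w * y k w <= dl.
  case: (chi01 k w) => [->|[-> [_ /= h]]]; first by rewrite mul0r.
  by rewrite mul1r (le_trans _ h)// /L sumS lerDr sumr_ge0.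
have mchi := adapted_measurable hf (@chi_adapted k).
have chi1 w : `|chi k w| <= 1 by exact: indic_le1.
have cv_itg : itg P (fun w => chi k w * v k w) by exact: (itgM_bounded mchi chi1 (@v_itg k)).
have cy_itg : itg P (fun w => chi k w * y k w) by exact: (itgM_bounded mchi chi1 (@y_itg k)).
have acv : adapted gens k (fun w => chi k w * v k w).
  by apply: measurable_funM; [exact: chi_adapted|exact: v_adapted].
have cvC w : `|chi k w * v k w| <= C by rewrite ger0_norm// mulr_ge0.
have cvX_itg : itg P (fun w => chi k w * v k w * X k w ^+ 2).
  exact: (itgM_bounded (adapted_measurable hf acv) cvC (@X2_itg k)).
have cvt_itg : itg P (fun w => chi k w * v k w * tail k w).
  exact: (itgM_bounded (adapted_measurable hf acv) cvC (@tail_itg k)).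
have cvv_itg : itg P (fun w => chi k w * v k w * v k w).
  exact: (itgM_bounded (adapted_measurable hf acv) cvC (@v_itg k)).
have cvy_itg : itg P (fun w => chi k w * v k w * y k w).
  exact: (itgM_bounded (adapted_measurable hf acv) cvC (@y_itg k)).
(* One factor v is exchanged for X^2 by conditioning; then X^2 <= e^2 + tail, and the truncation
   bounds y by [dl]. This makes single conditional variances negligible. *)
have vv : Ex P (fun w => chi k w * v k w * v k w) <= (e ^+ 2 + dl) * Ex P (fun w => chi k w * v k w).
  rewrite -(cond_v acv cvC).
  apply: (@le_trans _ _ (Ex P (fun w => e ^+ 2 * (chi k w * v k w) + chi k w * v k w * tail k w))).
    apply: Ex_le => //; first by apply: itgD => //; exact: itgZ.
    move=> w; rewrite [X in _ <= X + _]mulrC -mulrDr ler_wpM2l ?mulr_ge0//.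
    rewrite /tail indicE; have [ex|ex] := ltP e `|X k w|.
      by rewrite mem_set//= mulr1 lerDr sqr_ge0.
    rewrite memNset/=; last by rewrite ltNge ex.
    by rewrite mulr0 addr0 -[leLHS]real_normK ?num_real// lerXn2r ?nnegrE.
  rewrite ExD ?itgZ// ExZ// (cond_y acv cvC) mulrDl lerD2l -ExZ//.
  apply: Ex_le => //; first exact: itgZ.
  move=> w; have := gy w; case: (chi01 k w) => [->|[-> _]]; first by rewrite !mul0r mulr0.
  by rewrite !mul1r mulrC => h; rewrite ler_wpM2r.
have c_X_itg : itg P (fun w => chi k w * (e * X k w ^+ 2 + tail k w)).
  exact: (itgM_bounded mchi chi1 q_itg).
have Q : Ex P (fun w => chi k w * (e * X k w ^+ 2 + tail k w)) =
    e * Ex P (fun w => chi k w * v k w) + Ex P (fun w => chi k w * y k w).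
  rewrite -(cond_v (@chi_adapted k) chi1) -(cond_y (@chi_adapted k) chi1) -ExZ; last first.
    exact: (itgM_bounded mchi chi1 (@X2_itg k)).
  rewrite -ExD; last 2 first.
  - by apply: itgZ; exact: (itgM_bounded mchi chi1 (@X2_itg k)).
  - exact: (itgM_bounded mchi chi1 (@tail_itg k)).
  by apply: eq_Ex => w; rewrite mulrDr mulrCA.
have phi1_le w : `|phi1 w| <= K * chi k w.
  by rewrite /phi1 normrM mulrC (ger0_norm (chi0 w)) ler_wpM2r.
have phi2_le w : `|phi2 w| <= K * chi k w.
  by rewrite /phi2 normrM mulrC (ger0_norm (chi0 w)) ler_wpM2r.
have i1 : itg P (fun w => phi1 w * r1 w) by exact: (itgM_bounded m1 b1 r1_itg).
have i2 : itg P (fun w => phi2 w * r2 w) by exact: (itgM_bounded m2 b2 r2_itg).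
have i3 : itg P (fun w => phi2 w * X k w) by exact: (itgM_bounded m2 b2 X_itg).
have i4 : itg P (fun w => phi1 w * X k w ^+ 2) by exact: (itgM_bounded m1 b1 (@X2_itg k)).
have i5 : itg P (fun w => phi1 w * v k w) by exact: (itgM_bounded m1 b1 (@v_itg k)).
have mv := itg_measurable (@v_itg k).
have i6 : itg P (fun w => phi1 w * r3 w).
  apply: (@itg_le _ _ _ _ _ (fun w => K * (chi k w * v k w * v k w))); [|move=> w|exact: itgZ].
    apply: measurable_funM => //; apply: measurable_funB.
      by apply: measurable_funB => //; exact: measurable_funM.
    by apply: (measurableT_comp (@measurable_expR R)); apply: measurableT_comp => //; exact: measurable_funM.
  have v20 : 0 <= v k w / 2 by rewrite divr_ge0.
  rewrite normrM -mulrA mulrA; apply: ler_pM => //.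
  apply: (le_trans (expRN_taylor v20)); have := v_ge0 k w; nra.
have B1 : `|Ex P (fun w => phi1 w * r1 w)| <= K * (e * Ex P (fun w => chi k w * v k w) + Ex P (fun w => chi k w * y k w)).
  rewrite -Q -ExZ//; apply: Ex_norm_le => // [|w]; first exact: itgZ.
  by rewrite normrM mulrA; apply: ler_pM.
have B2 : `|Ex P (fun w => phi2 w * r2 w)| <= K * (e * Ex P (fun w => chi k w * v k w) + Ex P (fun w => chi k w * y k w)).
  rewrite -Q -ExZ//; apply: Ex_norm_le => // [|w]; first exact: itgZ.
  by rewrite normrM mulrA; apply: ler_pM.
have B3 : `|Ex P (fun w => phi1 w * r3 w)| <= K * ((e ^+ 2 + dl) * Ex P (fun w => chi k w * v k w)).
  apply: (@le_trans _ _ (K * Ex P (fun w => chi k w * v k w * v k w))); last by rewrite ler_wpM2l.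
  rewrite -ExZ//; apply: Ex_norm_le => // [|w]; first exact: itgZ.
  have v20 : 0 <= v k w / 2 by rewrite divr_ge0.
  rewrite normrM -mulrA mulrA; apply: ler_pM => //.
  apply: (le_trans (expRN_taylor v20)); have := v_ge0 k w; nra.
rewrite -ExB// (eq_Ex _ fE).
have Z3 : Ex P (fun w => phi2 w * X k w) = 0 by exact: (martingale_diff_orthogonal hf hX a2 b2).
have Z4 : Ex P (fun w => phi1 w * X k w ^+ 2) = Ex P (fun w => phi1 w * v k w) by exact: (cond_v a1 b1).
rewrite ExD//; last by do !(apply: itgD || apply: itgZ).
rewrite ExD; [|by do !(apply: itgD || apply: itgZ)|by do !(apply: itgD || apply: itgZ)].
rewrite ExD; [|by do !(apply: itgD || apply: itgZ)|by do !(apply: itgD || apply: itgZ)].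
rewrite ExD; [|by []|exact: itgZ].
rewrite ExD; [|exact: itgZ|exact: itgZ].
rewrite !ExZ// Z3 Z4.
have -> : Ex P (fun w => chi k w * (2 * e * v k w + 2 * y k w + (e ^+ 2 + dl) * v k w)) =
   (2 * e + (e ^+ 2 + dl)) * Ex P (fun w => chi k w * v k w) + 2 * Ex P (fun w => chi k w * y k w).
  rewrite -!ExZ// -ExD ?itgZ//; apply: eq_Ex => w; ring.
move: B1 B2 B3; rewrite !ler_norml.
set E1 := Ex P _; set E2 := Ex P _; set E3 := Ex P _; set E4 := Ex P _; set E5 := Ex P _; set E6 := Ex P _.
move=> /andP[? ?] /andP[? ?] /andP[? ?]; apply/andP; split; lra.
Qed.

(** Summing [step] telescopes on the left and leaves on the right truncated sums of v and y, bounded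
    pointwise by C and [dl]. *)
Lemma compensated_char_bound n :
  `|Ex P (f n) - cos c| <= K * (2 * e * C + 2 * dl + (e ^+ 2 + dl) * C).
Proof.
have K0 : 0 <= K by exact: expR_ge0.
have mchi k := adapted_measurable hf (@chi_adapted k).
have chi1 k w : `|chi k w| <= 1 by exact: indic_le1.
have cv_itg k : itg P (fun w => chi k w * v k w) by exact: (itgM_bounded (mchi k) (chi1 k) (@v_itg k)).
have cy_itg k : itg P (fun w => chi k w * y k w) by exact: (itgM_bounded (mchi k) (chi1 k) (@y_itg k)).
pose g k w := chi k w * (2 * e * v k w + 2 * y k w + (e ^+ 2 + dl) * v k w).
have gE k w : g k w = (2 * e + (e ^+ 2 + dl)) * (chi k w * v k w) + 2 * (chi k w * y k w).
  by rewrite /g; ring.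
have g_itg k : itg P (g k).
  by apply: (eq_itg (fun w => esym (gE k w))); apply: itgD; exact: itgZ.
have -> : cos c = Ex P (f 0%N).
  rewrite -[LHS](Ex_cst P); apply: eq_Ex => w.
  by rewrite /f /S /U !big_ord0 mul0r expR0 addr0 mulr1.
apply: (@le_trans _ _ (K * \sum_(k < n) Ex P (g k))).
  elim: n => [|n IH]; first by rewrite big_ord0 subrr normr0 mulr0.
  rewrite big_ord_recr/= mulrDr (le_trans _ (lerD IH (@step n)))//.
  by rewrite (le_trans _ (ler_normD _ _))// [X in _ <= `|X|]addrC subrKA.
rewrite ler_wpM2l// -Ex_sum// -[leRHS](Ex_cst P).
apply: Ex_le => [||w]; [exact: itg_sum|exact: itg_cst|].
have -> : \sum_(i < n) g i w = (2 * e + (e ^+ 2 + dl)) * U n w + 2 * \sum_(i < n) chi i w * y i w.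
  by rewrite /U !mulr_sumr -big_split/=; apply: eq_bigr => i _; exact: gE.
have /andP[_ h1] := U_le n w.
have h2 : \sum_(i < n) chi i w * y i w <= dl by apply: partial_le => // j [].
have h3 : 0 <= 2 * e + (e ^+ 2 + dl) by rewrite addr_ge0 ?mulr_ge0 ?addr_ge0 ?sqr_ge0.
by have := ler_wpM2l h3 h1; lra.
Qed.

(** Off the three exceptional events no increment is truncated and U_n = V_n lies within [dl] of
    [sg], so the compensator may be replaced by exp(sg/2); on them both expressions are bounded by
    K. *)
Lemma char_bound n (sg : R) : 0 <= sg -> sg <= C ->
  `|expR (sg / 2) * Ex P (fun w => cos (c + \sum_(k < n) X k w)) - cos c| <=
  K * (2 * e * C + 2 * dl + (e ^+ 2 + dl) * C) + K * dl +
  2 * K * (fine (P [set w | dl < `|V n w - sg|]) + fine (P [set w | C < V n w]) +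
    fine (P [set w | dl < L n w])).
Proof.
move=> sg0 sgC; have K0 : 0 <= K by exact: expR_ge0.
pose h w := expR (sg / 2) * cos (c + \sum_(k < n) X k w).
have mcos : measurable_fun setT (fun w => cos (c + \sum_(k < n) X k w)).
  apply: (measurableT_comp (continuous_measurable_fun (@continuous_cos R))).
  by apply: measurable_funD => //; apply: measurable_sum => j; exact: X_meas.
have cos_itg : itg P (fun w => cos (c + \sum_(k < n) X k w)).
  by apply: (itg_bounded P (B := 1) mcos) => w; exact: cos_max.
have h_itg : itg P h by exact: itgZ.
have hK w : `|h w| <= K.
  rewrite normrM ger0_norm ?expR_ge0// (le_trans (ler_piMr _ (cos_max _))) ?expR_ge0//.
  by rewrite ler_expR ler_pM2r ?invr_gt0.
have fK w : `|f n w| <= K.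
  have /andP[h1 h2] := eU n w.
  by rewrite normrM (ger0_norm h1) (le_trans _ h2)// ler_piMl// cos_max.
have mV k : measurable_fun setT (V k) by apply: measurable_sum => j; exact: itg_measurable.
have mL k : measurable_fun setT (L k) by apply: measurable_sum => j; exact: itg_measurable.
set A1 := [set w | dl < `|V n w - sg|]; set A2 := [set w | C < V n w]; set A3 := [set w | dl < L n w].
have mA1 : measurable A1.
  by apply: measurable_gt => //; apply: measurableT_comp => //; exact: measurable_funB.
have mA2 : measurable A2 by exact: measurable_gt.
have mA3 : measurable A3 by exact: measurable_gt.
have hf_close w : `|h w - f n w| <= K * dl + 2 * K * (\1_A1 w + \1_A2 w + \1_A3 w).
  have i0 A : 0 <= \1_A w :> R by rewrite indicE.
  have [[[hw1 hw2] hw3]|hbad] := pselect ((~ A1 w /\ ~ A2 w) /\ ~ A3 w); last first.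
    have : 1 <= \1_A1 w + \1_A2 w + \1_A3 w :> R.
      rewrite leNgt; apply/negP => hlt; apply: hbad.
      have := i0 A1; have := i0 A2; have := i0 A3 => p3 p2 p1.
      by (do 2?split) => hw; move: hlt; [have : \1_A1 w = 1 :> R by rewrite indicE mem_set
        |have : \1_A2 w = 1 :> R by rewrite indicE mem_set
        |have : \1_A3 w = 1 :> R by rewrite indicE mem_set]; lra.
    move=> h1; rewrite (le_trans (ler_normB _ _))//.
    have := hK w; have := fK w; have := mulr_ge0 K0 dl_ge0.
    have : K <= K * (\1_A1 w + \1_A2 w + \1_A3 w) by rewrite ler_peMr.
    lra.
  rewrite (@le_trans _ _ (K * dl))//; last first.
    by rewrite lerDl mulr_ge0 ?mulr_ge0// !addr_ge0.
  have Vn : V n w <= C by rewrite leNgt; apply/negP.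
  have Ln : L n w <= dl by rewrite leNgt; apply/negP.
  have Vs : `|V n w - sg| <= dl by rewrite leNgt; apply/negP.
  have chi1 (j : 'I_n) : chi j w = 1.
    rewrite /chi indicE mem_set//; split => /=.
      rewrite (le_trans _ Vn)// /V -!(big_mkord xpredT (v ^~ w)) [leRHS](big_cat_nat (n := j.+1))//=.
      by rewrite lerDl sumr_ge0.
    rewrite (le_trans _ Ln)// /L -!(big_mkord xpredT (y ^~ w)) [leRHS](big_cat_nat (n := j.+1))//=.
    by rewrite lerDl sumr_ge0.
  have SE : S n w = \sum_(k < n) X k w by apply: eq_bigr => j _; rewrite chi1 mul1r.
  have UE : U n w = V n w by apply: eq_bigr => j _; rewrite chi1 mul1r.
  rewrite /h /f SE UE [_ * cos _]mulrC -mulrBr normrM.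
  rewrite (le_trans (ler_piMl _ (cos_max _)))//.
  have e1 : sg / 2 <= C / 2 by rewrite ler_pM2r ?invr_gt0.
  have e2 : V n w / 2 <= C / 2 by rewrite ler_pM2r ?invr_gt0.
  rewrite (le_trans (expR_lipschitz e1 e2))// ler_wpM2l// -mulrBl normrM distrC.
  rewrite (ger0_norm (_ : 0 <= 2^-1)) ?invr_ge0//; have := normr_ge0 (V n w - sg); lra.
rewrite -ExZ// -/h; have := compensated_char_bound n.
have : `|Ex P h - Ex P (f n)| <= K * dl + 2 * K * (fine (P A1) + fine (P A2) + fine (P A3)).
  rewrite -ExB//.
  have i1 := itg_indic P mA1; have i2 := itg_indic P mA2; have i3 := itg_indic P mA3.
  apply: (@le_trans _ _ (Ex P (fun w => K * dl + 2 * K * (\1_A1 w + \1_A2 w + \1_A3 w)))).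
    apply: Ex_norm_le => //; first exact: itgB.
    by apply: itgD; [exact: itg_cst|apply: itgZ; do !apply: itgD].
  rewrite ExD ?Ex_cst; [|exact: itg_cst|by apply: itgZ; do !apply: itgD].
  rewrite ExZ; last by do !apply: itgD.
  by rewrite ExD ?ExD ?Ex_indic//; apply: itgD.
have := ler_distD (Ex P (f n)) (Ex P h) (cos c).
set a1 := `|_|; set a2 := `|_|; set a3 := `|_|; lra.
Qed.

End FiniteHorizon.

Section ConditionalVersions.
Context {R : realType} d (T : measurableType d) (P : probability T R).

Lemma is_cond_exp_centred (gens : set (set T)) (Z Y : T -> R) :
  <<s gens >> `<=` @measurable _ T ->
  is_cond_exp P <<s gens >> Z Y ->
  [/\ itg P Z, itg P Y, measurable_fun setT (Y : g_sigma_algebraType gens -> R) &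
      forall A, <<s gens >> A -> Ex P (fun w => \1_A w * (Z w - Y w)) = 0].
Proof.
move=> hg [iZ iY mY hA]; split => // [_ B mB|A FA].
  by rewrite setTI; exact: mY.
have mA := hg _ FA.
have := hA _ FA; rewrite !integral_indicE// => -[h].
rewrite (@eq_Ex _ _ _ P _ (fun w => \1_A w * Z w - \1_A w * Y w)); last by move=> w; rewrite mulrBr.
rewrite ExB ?h ?subrr//.
- exact: (itgM_bounded (measurable_indicT mA) (indic_le1 A) iZ).
- exact: (itgM_bounded (measurable_indicT mA) (indic_le1 A) iY).
Qed.

(** A conditional expectation of a nonnegative variable is nonnegative only almost surely, while the
    truncation relies on pointwise monotone partial sums. The positive part is another version. *)
Lemma nonneg_version (gens : set (set T)) (Z Y : T -> R) :
  <<s gens >> `<=` @measurable _ T ->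
  (forall w, 0 <= Z w) -> itg P Z -> itg P Y ->
  measurable_fun setT (Y : g_sigma_algebraType gens -> R) ->
  (forall A, <<s gens >> A -> Ex P (fun w => \1_A w * (Z w - Y w)) = 0) ->
  [/\ itg P (fun w => Num.max (Y w) 0),
      measurable_fun setT ((fun w => Num.max (Y w) 0) : g_sigma_algebraType gens -> R),
      forall A, <<s gens >> A -> Ex P (fun w => \1_A w * (Z w - Num.max (Y w) 0)) = 0 &
      P [set w | Y w < 0] = 0%E].
Proof.
move=> hg Z0 iZ iY mY hA.
have mY' := itg_measurable iY.
set N := [set w | Y w < 0].
have FN : <<s gens >> N.
  by apply: (@measurable_gt _ _ (g_sigma_algebraType gens)).
have mN := hg _ FN.
have maxE w : Num.max (Y w) 0 = Y w - \1_N w * Y w.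
  rewrite indicE; have [Yw|Yw] := ltP (Y w) 0.
    by rewrite mem_set//= mul1r subrr.
  by rewrite memNset ?mul0r ?subr0//= => h; move: (lt_le_trans h Yw); rewrite ltxx.
have iNY : itg P (fun w => \1_N w * Y w).
  exact: (itgM_bounded (measurable_indicT mN) (indic_le1 N) iY).
have iM : itg P (fun w => Num.max (Y w) 0).
  by apply: (eq_itg (fun w => esym (maxE w))); exact: itgB.
have iA A X : measurable A -> itg P X -> itg P (fun w => \1_A w * X w).
  by move=> mA; exact: (itgM_bounded (measurable_indicT mA) (indic_le1 A)).
(* On N inside A one has Z >= 0 and Y < 0, so equality of the two integrals leaves no negative
   mass. *)
have NY0 A : <<s gens >> A -> Ex P (fun w => \1_A w * (\1_N w * Y w)) = 0.
  move=> FA; have mA := hg _ FA.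
  have FAN : <<s gens >> (A `&` N) by exact: (@measurableI _ (g_sigma_algebraType gens)).
  have mAN := hg _ FAN.
  apply/eqP; rewrite eq_le; apply/andP; split.
    rewrite -[leRHS](Ex_cst P); apply: Ex_le; [exact: iA|exact: itg_cst|move=> w].
    rewrite !indicE; case: (w \in A); rewrite /= ?mul0r// mul1r.
    by case: (boolP (w \in N)) => [/set_mem/ltW|_]; rewrite /= ?mul1r ?mul0r.
  have := hA _ FAN.
  rewrite (@eq_Ex _ _ _ P _ (fun w => \1_(A `&` N) w * Z w - \1_A w * (\1_N w * Y w))); last first.
    by move=> w; rewrite indicI/= mulrBr mulrA.
  rewrite ExB; [|exact: iA|exact: iA].
  move/eqP; rewrite subr_eq0 => /eqP <-; apply: Ex_ge0 => w; rewrite mulr_ge0// indicE//.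
split => //.
- exact: measurable_maxr.
- move=> A FA; have mA := hg _ FA.
  rewrite (@eq_Ex _ _ _ P _ (fun w => \1_A w * (Z w - Y w) + \1_A w * (\1_N w * Y w))); last first.
    by move=> w; rewrite maxE -mulrDr opprB addrA addrAC.
  rewrite ExD ?hA ?NY0 ?addr0//; apply: iA => //; exact: itgB.
- have h0 : (\int[P]_w `|(\1_N w * Y w)%:E|)%E = 0%E.
    have hz := NY0 setT (@measurableT _ (g_sigma_algebraType gens)).
    transitivity (-1 * Ex P (fun w => \1_[set: T] w * (\1_N w * Y w)))%:E; last by rewrite hz mulr0.
    rewrite -ExZ; last by exact: iA.
    rewrite -ExE; last by apply: itgZ; exact: iA.
    apply: eq_integral => w _; rewrite indicT mul1r mulN1r/=; congr EFin.
    rewrite ler0_norm// indicE; case: (boolP (w \in N)) => [/set_mem/ltW|_]; rewrite /= ?mul1r ?mul0r//.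
  have mE : measurable_fun setT (EFin \o (fun w => \1_N w * Y w)).
    by apply/measurable_EFinP; exact: (itg_measurable iNY).
  have /ae_eq_integral_abs := h0.
  move=> /(_ measurableT mE)[N' [mN' PN' hN']].
  apply/eqP; rewrite eq_le measure_ge0 andbT -PN' le_measure ?inE// => w Nw.
  apply: hN' => /= /(_ Logic.I) [].
  rewrite indicE mem_set//= mul1r => h; move: Nw; rewrite /N /= h ltxx.
  by [].
Qed.

Lemma cvg_in_proba_real (Z : nat -> T -> R) c : (forall n, measurable_fun setT (Z n)) ->
  cvg_in_proba P Z c <-> (forall e h, 0 < e -> 0 < h ->
    exists N, forall n, (N <= n)%N -> fine (P [set w | e <= `|Z n w - c|]) <= h).
Proof.
move=> mZ.
have mE e n : measurable [set w | e <= `|Z n w - c|].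
  by apply: measurable_ge => //; apply: measurableT_comp => //; exact: measurable_funB.
split=> [h e eta e0 eta0|h e e0].
  have /fine_cvgP[_ /cvgrPdist_le/(_ _ eta0)[N _ hN]] := h e e0.
  exists N => n /hN; rewrite sub0r normrN; apply: le_trans; exact: ler_norm.
apply/fine_cvgP; split; first by near=> n; exact: fin_num_measure.
apply/cvgrPdist_le => eta eta0; have [N hN] := h _ _ e0 eta0.
exists N => // n /hN; rewrite sub0r normrN ger0_norm//; exact: Pr_ge0.
Unshelve. all: by end_near.
Qed.

End ConditionalVersions.

Section MartingaleCLT.
Context {R : realType} d (T : measurableType d) (P : probability T R).
Variables (gens : nat -> set (set T)) (xi : nat -> T -> R) (sg : R).
Hypotheses (hf : filtration gens) (hxi : martingale_diff P gens xi) (sg_ge0 : 0 <= sg).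
Hypothesis lindeberg : forall e, 0 < e -> exists Y : nat -> nat -> T -> R,
  (forall n k, (k < n)%N -> is_cond_exp P <<s gens k >>
     (fun w => xi k w ^+ 2 * \1_[set w' | e * Num.sqrt n%:R < `|xi k w'|] w) (Y n k)) /\
  cvg_in_proba P (fun n w => n%:R^-1 * \sum_(k < n) Y n k w) 0.
Hypothesis variance : exists s : nat -> T -> R,
  (forall k, is_cond_exp P <<s gens k >> (fun w => xi k w ^+ 2) (s k)) /\
  cvg_in_proba P (fun n w => n%:R^-1 * \sum_(k < n) s k w) sg.

(** Passing to positive parts changes the averages only on a finite union of null events. *)
Let bigP n (Y : nat -> T -> R) c e :
  (forall k, (k < n)%N -> measurable_fun setT (Y k) /\ P [set w | Y k w < 0] = 0%E) ->
  fine (P [set w | e <= `|n%:R^-1 * \sum_(k < n) Num.max (Y k w) 0 - c|]) <=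
  fine (P [set w | e <= `|n%:R^-1 * \sum_(k < n) Y k w - c|]).
Proof.
move=> hY.
have mN : measurable (\big[setU/set0]_(k < n) [set w | Y k w < 0]).
  apply: bigsetU_measurable => k _; apply: measurable_gt => //.
  by have [] := hY k (ltn_ord k).
have PN : fine (P (\big[setU/set0]_(k < n) [set w | Y k w < 0])) = 0.
  suff : forall m, (m <= n)%N -> P (\big[setU/set0]_(k < m) [set w | Y k w < 0]) = 0%E by move=> ->.
  elim=> [|m IH] mn; first by rewrite big_ord0 measure0.
  have [mYm Ym] := hY m mn.
  rewrite big_ord_recr/=; apply/eqP; rewrite eq_le measure_ge0 andbT.
  rewrite -[leRHS](adde0 0%E) -{1}(IH (ltnW mn)) -Ym; apply: measureU2.
  - apply: bigsetU_measurable => k _; apply: measurable_gt => //.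
    by have [] := hY k (leq_trans (ltn_ord k) (ltnW mn)).
  - exact: measurable_gt.
have m1 : measurable_fun setT (fun w => \sum_(k < n) Num.max (Y k w) 0).
  have : forall k : 'I_n, measurable_fun setT (fun w => Num.max (Y k w) 0).
    by move=> k; apply: measurable_maxr => //; have [] := hY k (ltn_ord k).
  by move=> h; apply: measurable_sum.
have m2 : measurable_fun setT (fun w => \sum_(k < n) Y k w).
  have : forall k : 'I_n, measurable_fun setT (fun w => Y k w).
    by move=> k; have [] := hY k (ltn_ord k).
  by move=> h; apply: measurable_sum.
have mA1 : measurable [set w | e <= `|n%:R^-1 * \sum_(k < n) Num.max (Y k w) 0 - c|].
  apply: measurable_ge => //; apply: measurableT_comp => //.
  by apply: measurable_funB => //; exact: measurable_funM.
have mA2 : measurable [set w | e <= `|n%:R^-1 * \sum_(k < n) Y k w - c|].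
  apply: measurable_ge => //; apply: measurableT_comp => //.
  by apply: measurable_funB => //; exact: measurable_funM.
have := Pr_setU_le P mA2 mN; rewrite PN addr0; apply: le_trans.
apply: Pr_le => //; first exact: measurableU.
move=> w /= h; have [hN|hN] := pselect ((\big[setU/set0]_(k < n) [set w | Y k w < 0]) w); first by right.
left; move: h; congr (_ <= `|_ * _ - _|); apply: eq_bigr => k _.
apply/max_idPl; rewrite leNgt; apply/negP => Yk; apply: hN.
by rewrite -(bigcup_mkord n (fun k => [set w | Y k w < 0])); exists k => //=.
Qed.

Theorem martingale_clt_cos c :
  (fun n => Ex P (fun w => cos (c + (Num.sqrt n%:R)^-1 * \sum_(k < n) xi k w))) @ \oo -->
  cos c * expR (- (sg / 2)).
Proof.
have [s [s_cond s_cvg]] := variance.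
have sP k := is_cond_exp_centred (proj1 hf k) (s_cond k).
have xi2_ge0 k w : 0 <= xi k w ^+ 2 by exact: sqr_ge0.
pose sp k w := Num.max (s k w) 0.
have spP k : [/\ itg P (sp k), adapted gens k (sp k),
    (forall A, <<s gens k >> A -> Ex P (fun w => \1_A w * (xi k w ^+ 2 - sp k w)) = 0) &
    P [set w | s k w < 0] = 0%E].
  by have [h1 h2 h3 h4] := sP k; exact: nonneg_version (proj1 hf k) _ h1 h2 h3 h4.
have ms k : measurable_fun setT (s k) by have [_ /itg_measurable] := sP k.
have mavgs n : measurable_fun setT (fun w => n%:R^-1 * \sum_(k < n) s k w).
  by apply: measurable_funM => //; apply: measurable_sum.
have {}s_cvg := (cvg_in_proba_real P sg mavgs).1 s_cvg.
(* An accumulated variance within 1 of [sg] does not exceed this C. *)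
pose C := sg + 1; pose K := expR (C / 2); have K0 : 0 < K by exact: expR_gt0.
have C0 : 0 <= C by rewrite addr_ge0.
have key h : 0 < h -> exists N, forall n, (N <= n)%N ->
   `|expR (sg / 2) * Ex P (fun w => cos (c + (Num.sqrt n%:R)^-1 * \sum_(k < n) xi k w)) - cos c| <= h.
  move=> h0.
  have K1 : 0 < K * (4 * C + 4) by rewrite mulr_gt0//; lra.
  (* One parameter t serves as Lindeberg threshold and as tolerance [dl]. As t <= 1, the
     deterministic part of [char_bound] is at most K t (4 C + 3), hence at most h/2. *)
  pose t := Num.min 1 (h / 2 / (K * (4 * C + 4))).
  have t0 : 0 < t by rewrite lt_min ltr01/= !divr_gt0.
  have t1 : t <= 1 by rewrite ge_min lexx.
  have th : K * (2 * t * C + 2 * t + (t ^+ 2 + t) * C) + K * t <= h / 2.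
    have : t * (K * (4 * C + 4)) <= h / 2 by rewrite -ler_pdivlMr// ge_min lexx orbT.
    apply: le_trans; have : t ^+ 2 <= t by rewrite expr2 ler_piMl// ltW.
    have := ltW K0 => K0' tt.
    have : K * (t ^+ 2 * C) <= K * (t * C) by rewrite ler_wpM2l// ler_wpM2r.
    have : 0 <= K * t by rewrite mulr_ge0// ltW.
    lra.
  have [Y [Y_cond Y_cvg]] := lindeberg t0.
  have YP n k (kn : (k < n)%N) := is_cond_exp_centred (proj1 hf k) (Y_cond n k kn).
  have YpP n k : (k < n)%N -> [/\ itg P (fun w => Num.max (Y n k w) 0), adapted gens k (fun w => Num.max (Y n k w) 0),
    (forall A, <<s gens k >> A -> Ex P (fun w => \1_A w * (xi k w ^+ 2 * \1_[set w' | t * Num.sqrt n%:R < `|xi k w'|] w - Num.max (Y n k w) 0)) = 0) &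
    P [set w | Y n k w < 0] = 0%E].
    move=> kn; have [h1 h2 h3 h4] := YP n k kn.
    by apply: (nonneg_version (proj1 hf k) _ h1 h2 h3 h4) => w; rewrite mulr_ge0// indicE.
  have mY n k : (k < n)%N -> measurable_fun setT (Y n k) by move=> kn; have [_ /itg_measurable] := YP n k kn.
  have mavgY n : measurable_fun setT (fun w => n%:R^-1 * \sum_(k < n) Y n k w).
    apply: measurable_funM => //.
    have hm : forall k : 'I_n, measurable_fun setT (fun w => Y n k w) by move=> k; exact: mY.
    exact: measurable_sum.
  have {}Y_cvg := (cvg_in_proba_real P 0 mavgY).1 Y_cvg.
  (* Three exceptional events, each weighted by 2 K, share the other h/2. *)
  have h6 : 0 < h / 2 / (2 * K * 3) by rewrite !divr_gt0// !mulr_gt0.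
  have [N1 hN1] := s_cvg _ _ t0 h6.
  have [N2 hN2] := Y_cvg _ _ t0 h6.
  exists (maxn 1 (maxn N1 N2)) => n; rewrite !geq_max => /and3P[n0 nN1 nN2].
  have n0R : 0 < n%:R :> R by rewrite ltr0n.
  have sn0 : 0 < Num.sqrt n%:R :> R by rewrite sqrtr_gt0.
  (* The rescaled row n, continued by zero because the finite-horizon estimate is stated for
     infinite sequences. *)
  pose X k w := if (k < n)%N then (Num.sqrt n%:R)^-1 * xi k w else 0.
  pose v k w := if (k < n)%N then n%:R^-1 * sp k w else 0.
  pose y k w := if (k < n)%N then n%:R^-1 * Num.max (Y n k w) 0 else 0.
  have nE : n%:R^-1 = (Num.sqrt n%:R)^-1 ^+ 2 :> R by rewrite exprVn sqr_sqrtr// ler0n.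
  have mdX : martingale_diff P gens X.
    have [a1 a2 a3] := hxi; split => [k|k|k A FA]; rewrite /X.
    - by case: (boolP (k < n)%N) => _; [apply: measurable_funM => //; exact: a1|exact: measurable_cst].
    - case: (boolP (k < n)%N) => _; last by apply: (@eq_itg _ _ _ _ (fun=> 0)) (itg_cst P 0) => w; rewrite expr0n.
      by apply: (@eq_itg _ _ _ _ (fun w => n%:R^-1 * xi k w ^+ 2)) (itgZ _ (a2 k)) => w; rewrite exprMn nE.
    - case: (boolP (k < n)%N) => _; last first.
        by rewrite (@eq_Ex _ _ _ P _ (fun=> 0)) ?Ex_cst// => w; rewrite mulr0.
      rewrite (@eq_Ex _ _ _ P _ (fun w => (Num.sqrt n%:R)^-1 * (\1_A w * xi k w))); last by move=> w; rewrite mulrCA.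
      rewrite ExZ ?a3 ?mulr0//.
      have mA : measurable A by exact: (proj1 hf k).
      exact: (itgM_bounded (measurable_indicT mA) (indic_le1 A) (martingale_diff_itg k hf hxi)).
  have v0 k w : 0 <= v k w by rewrite /v; case: (boolP (k < n)%N) => // _; rewrite mulr_ge0// /sp le_max lexx orbT.
  have y0 k w : 0 <= y k w by rewrite /y; case: (boolP (k < n)%N) => // _; rewrite mulr_ge0// le_max lexx orbT.
  have va k : adapted gens k (v k).
    rewrite /v; case: (boolP (k < n)%N) => _; last exact: measurable_cst.
    by apply: measurable_funM => //; have [] := spP k.
  have ya k : adapted gens k (y k).
    rewrite /y; case: (boolP (k < n)%N) => kn; last exact: measurable_cst.
    by apply: measurable_funM => //; have [] := YpP n k kn.
  have vi k : itg P (v k).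
    rewrite /v; case: (boolP (k < n)%N) => _; last exact: itg_cst.
    by apply: itgZ; have [] := spP k.
  have yi k : itg P (y k).
    rewrite /y; case: (boolP (k < n)%N) => kn; last exact: itg_cst.
    by apply: itgZ; have [] := YpP n k kn.
  have vc k A : <<s gens k >> A -> Ex P (fun w => \1_A w * (X k w ^+ 2 - v k w)) = 0.
    move=> FA; rewrite /X /v; case: (boolP (k < n)%N) => kn; last first.
      by rewrite (@eq_Ex _ _ _ P _ (fun=> 0)) ?Ex_cst// => w; rewrite expr0n subr0 mulr0.
    have [i1 _ h3 _] := spP k.
    rewrite (@eq_Ex _ _ _ P _ (fun w => n%:R^-1 * (\1_A w * (xi k w ^+ 2 - sp k w)))); last first.
      by move=> w; rewrite exprMn -nE -mulrBr mulrCA.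
    rewrite ExZ ?h3 ?mulr0//.
    have mA : measurable A by exact: (proj1 hf k).
    apply: (itgM_bounded (measurable_indicT mA) (indic_le1 A)); apply: itgB => //.
    by case: hxi.
  have yc k A : <<s gens k >> A -> Ex P (fun w => \1_A w *
      (X k w ^+ 2 * \1_[set x : R | t < `|x|] (X k w) - y k w)) = 0.
    move=> FA; rewrite /X /y; case: (boolP (k < n)%N) => kn; last first.
      by rewrite (@eq_Ex _ _ _ P _ (fun=> 0)) ?Ex_cst// => w; rewrite expr0n mul0r subr0 mulr0.
    have [i1 _ h3 _] := YpP n k kn; have [i2 _ _ _] := YP n k kn.
    rewrite (@eq_Ex _ _ _ P _ (fun w => n%:R^-1 * (\1_A w *
      (xi k w ^+ 2 * \1_[set w' | t * Num.sqrt n%:R < `|xi k w'|] w - Num.max (Y n k w) 0)))); last first.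
      move=> w; rewrite exprMn -nE -mulrA -mulrBr mulrCA; congr (_ * (_ * (_ * _ - _))).
      have sE : (t < `|(Num.sqrt n%:R)^-1 * xi k w|) = (t * Num.sqrt n%:R < `|xi k w|).
        by rewrite normrM gtr0_norm ?invr_gt0// mulrC ltr_pdivlMr.
      rewrite !indicE; congr (_%:R); congr nat_of_bool.
      by apply/idP/idP => /set_mem h'; apply/mem_set; move: h' => /=; rewrite sE.
    rewrite ExZ ?h3 ?mulr0//.
    have mA : measurable A by exact: (proj1 hf k).
    by apply: (itgM_bounded (measurable_indicT mA) (indic_le1 A)); apply: itgB.
  have := @char_bound R d T P gens X v y t t C c hf mdX (ltW t0) (ltW t0) C0 v0 y0 va ya vi yi vc yc n sg sg_ge0.
  have -> : (fun w => cos (c + \sum_(k < n) X k w)) =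
      (fun w => cos (c + (Num.sqrt n%:R)^-1 * \sum_(k < n) xi k w)).
    apply/funext => w; congr cos; congr (_ + _); rewrite mulr_sumr; apply: eq_bigr => k _.
    by rewrite /X ltn_ord.
  have vS w : \sum_(k < n) v k w = n%:R^-1 * \sum_(k < n) Num.max (s k w) 0.
    by rewrite mulr_sumr; apply: eq_bigr => k _; rewrite /v ltn_ord.
  have yS w : \sum_(k < n) y k w = n%:R^-1 * \sum_(k < n) Num.max (Y n k w) 0.
    by rewrite mulr_sumr; apply: eq_bigr => k _; rewrite /y ltn_ord.
  have mV : measurable_fun setT (fun w => \sum_(k < n) v k w) by apply: measurable_sum => k; exact: itg_measurable.
  have mL : measurable_fun setT (fun w => \sum_(k < n) y k w) by apply: measurable_sum => k; exact: itg_measurable.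
  have mA : measurable [set w | t <= `|\sum_(k < n) v k w - sg|].
    by apply: measurable_ge => //; apply: measurableT_comp => //; exact: measurable_funB.
  have mB : measurable [set w | t <= `|\sum_(k < n) y k w - 0|].
    by apply: measurable_ge => //; apply: measurableT_comp => //; exact: measurable_funB.
  have A_le : fine (P [set w | t <= `|\sum_(k < n) v k w - sg|]) <= h / 2 / (2 * K * 3).
    under eq_set do rewrite vS.
    apply: (le_trans (bigP _ _ _)) (hN1 _ nN1) => k kn; split; first exact: ms.
    by have [] := spP k.
  have B_le : fine (P [set w | t <= `|\sum_(k < n) y k w - 0|]) <= h / 2 / (2 * K * 3).
    under eq_set do rewrite yS.
    apply: (le_trans (bigP _ _ _)) (hN2 _ nN2) => k kn; split; first exact: mY.
    by have [] := YpP n k kn.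
  have q1 : fine (P [set w | t < `|\sum_(j < n) v j w - sg|]) <= h / 2 / (2 * K * 3).
    apply: le_trans A_le; apply: Pr_le => //; last by move=> w /= /ltW.
    by apply: measurable_gt => //; apply: measurableT_comp => //; exact: measurable_funB.
  have q2 : fine (P [set w | C < \sum_(j < n) v j w]) <= h / 2 / (2 * K * 3).
    apply: le_trans A_le; apply: Pr_le => //; first exact: measurable_gt.
    move=> w /=; rewrite /C => h1; rewrite (le_trans t1)// (le_trans _ (ler_norm _))//; lra.
  have q3 : fine (P [set w | t < \sum_(j < n) y j w]) <= h / 2 / (2 * K * 3).
    apply: le_trans B_le; apply: Pr_le => //; first exact: measurable_gt.
    by move=> w /= /ltW h1; rewrite subr0 (le_trans h1)// ler_norm.
  move=> /(_ _)/le_trans; apply; first by rewrite /C lerDl.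
  have K2 : 0 < 2 * K by rewrite mulr_gt0.
  have q : 2 * K * (fine (P [set w | t < `|\sum_(j < n) v j w - sg|]) + fine (P [set w | C < \sum_(j < n) v j w]) +
     fine (P [set w | t < \sum_(j < n) y j w])) <= h / 2.
    apply: (@le_trans _ _ (2 * K * (3 * (h / 2 / (2 * K * 3))))).
      by rewrite ler_wpM2l ?(ltW K2)//; lra.
    by rewrite le_eqVlt; apply/orP; left; apply/eqP; field; rewrite gt_eqF.
  by move: th q; rewrite -/K; lra.
apply/cvgrPdist_le => h h0.
have e0 : 0 < expR (sg / 2) by exact: expR_gt0.
have [N hN] := key _ (mulr_gt0 h0 e0).
exists N => // n /= /hN; set u := Ex P _ => hu.
rewrite -(ler_pM2r e0) -[X in _ * X <= _](gtr0_norm e0) -normrM mulrBl -mulrA -expRD addNr expR0 mulr1.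
by rewrite distrC [u * _]mulrC.
Qed.

End MartingaleCLT.

(** * Characteristic function of the normal law *)

Section Density.
Context {R : realType} d (T : measurableType d).
Variables (nu : {finite_measure set T -> \bar R})
  (mu : {sigma_finite_measure set T -> \bar R}) (h : T -> R).
Hypotheses (mh : measurable_fun setT h)
  (nuE : forall B, measurable B -> nu B = (\int[mu]_(x in B) (h x)%:E)%E).

(** The given density agrees almost everywhere with the Radon-Nikodym derivative, both having the
    same integral over every measurable set. *)
Lemma ge0_integral_density (g : T -> \bar R) : measurable_fun setT g ->
  (forall x, 0 <= g x)%E -> (\int[nu]_x g x = \int[mu]_x (g x * (h x)%:E))%E.
Proof.
move=> mg g0.
have mh' : measurable_fun setT (EFin \o h) by exact/measurable_EFinP.
have numu : nu `<< mu.
  apply/null_content_dominatesP => B mB B0; rewrite nuE//.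
  by apply: null_set_integral => //; exact: measurable_funTS.
rewrite -(Radon_Nikodym_SigmaFinite.change_of_variables numu)//.
have iRN := Radon_Nikodym_SigmaFinite.f_integrable numu.
apply: ae_eq_integral => //.
- by apply: emeasurable_funM => //; exact: measurable_int iRN.
- exact: emeasurable_funM.
have : ae_eq mu setT (Radon_Nikodym_SigmaFinite.f nu mu) (EFin \o h).
  apply: integral_ae_eq => // B _ mB.
  by rewrite -nuE// (Radon_Nikodym_SigmaFinite.f_integral numu).
by apply: filterS => x /= /(_ Logic.I) ->.
Qed.

End Density.

Section IntegralDerivative.
Context {R : realType}.
Notation lam := (@lebesgue_measure R).

(** Integration by parts on the line: the fundamental theorem on [-n, n], whose boundary terms
    vanish, and dominated convergence. *)
Lemma integral_derivative_eq0 (g g' : R -> R) :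
  (forall x, is_derive x (1 : R) g (g' x)) -> continuous g' ->
  lam.-integrable setT (EFin \o g') ->
  g n%:R @[n --> \oo] --> (0 : R) -> g (- n%:R) @[n --> \oo] --> (0 : R) ->
  Rintegral lam setT g' = 0.
Proof.
move=> dg cg ig gp gm.
have cg0 x : {for x, continuous g}.
  by apply/differentiable_continuous/derivable1_diffP; have [] := dg x.
pose D (n : nat) : set R := `[(- n%:R)%R, n%:R%R]%classic.
have key n : (0 < n)%N -> (\int[lam]_(x in D n) (g' x)%:E)%E = (g n%:R - g (- n%:R))%:E.
  move=> n0; rewrite (@continuous_FTC2 _ g' g)//.
  - by rewrite (@lt_trans _ _ 0) ?oppr_lt0 ?ltr0n.
  - exact: continuous_subspaceT.
  - split; first by move=> x _; have [] := dg x.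
      by apply: cvg_at_right_filter; exact: cg0.
    by apply: cvg_at_left_filter; exact: cg0.
  - by move=> x _; rewrite derive1E; have [_ ->] := dg x.
have mg : measurable_fun setT (EFin \o g') by exact: measurable_int ig.
have lim : (\int[lam]_x ((EFin \o g') \_ (D n)) x)%E @[n --> \oo] --> (\int[lam]_x (g' x)%:E)%E.
  have [] // := @dominated_convergence _ _ _ lam setT measurableT
    (fun n => (EFin \o g') \_ (D n)) (EFin \o g') (fun x => `|g' x|%:E).
  - by move=> n; apply/(measurable_restrictT _ (measurable_itv _)); exact: measurable_funTS.
  - apply: aeW => x _; apply: cvg_near_cst; near=> n.
    rewrite patchE mem_set//= /D/= in_itv/=.
    have : `|x| < n%:R by near: n; exact: nbhs_infty_gtr.
    by rewrite ltr_norml => /andP[/ltW -> /ltW ->].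
  - exact: (integrable_norm ig).
  - apply: aeW => x n _; rewrite patchE; case: ifP => _ //=.
    by rewrite normr0 lee_fin.
have lim0 : (\int[lam]_x ((EFin \o g') \_ (D n)) x)%E @[n --> \oo] --> 0%E.
  have : (g n%:R - g (- n%:R))%:E @[n --> \oo] --> (0 - 0)%:E.
    by apply: cvg_EFin; [exact: nearW|apply: cvgB].
  rewrite subrr; apply: cvg_trans; apply: near_eq_cvg; near=> n.
  rewrite -integral_mkcond key//; near: n; exact: nbhs_infty_gt.
by rewrite /Rintegral (cvg_unique _ lim lim0).
Unshelve. all: end_near. Qed.

End IntegralDerivative.

Section GaussianCharacteristic.
Context {R : realType}.
Notation lam := (@lebesgue_measure R).
Variable sg : R.
Hypothesis sg0 : sg != 0.

Let phi := normal_pdf 0 sg.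

Let sg2 : 0 < sg ^+ 2. Proof. by rewrite exprn_even_gt0. Qed.

Let phiE x : phi x = normal_peak sg * expR (- x ^+ 2 / (sg ^+ 2 *+ 2)).
Proof. by rewrite /phi normal_pdfE// /normal_fun subr0. Qed.

Let phi_ge0 x : 0 <= phi x. Proof. exact: normal_pdf_ge0. Qed.

Lemma is_derive_normal_pdf x : is_derive x (1 : R) (normal_pdf 0 sg) (- (x / sg ^+ 2) * normal_pdf 0 sg x).
Proof.
rewrite -/phi (_ : phi = fun x => normal_peak sg * expR (- x ^+ 2 / (sg ^+ 2 *+ 2))); last first.
  by apply/funext => y; rewrite phiE.
apply: is_derive_eq; rewrite /GRing.scale /=.
by field.
Qed.

(** The normal density with twice the deviation dominates x^2 phi, since u <= exp(u) absorbs the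
    square into part of the exponent. The factor obtained is 16/3, and 16 is a rounding. This gives
    both the first moment and the decay at infinity. *)
Let phi_tail x : x ^+ 2 * phi x <= 16%:R * sg ^+ 2 * normal_pdf 0 (2 * sg) x.
Proof.
have sg20 : 2 * sg != 0 by rewrite mulf_neq0.
rewrite phiE (normal_pdfE _ sg20) /normal_fun subr0.
have -> : normal_peak (2 * sg) = 2^-1 * normal_peak sg.
  rewrite /normal_peak (_ : (2 * sg) ^+ 2 * pi *+ 2 = 2 ^+ 2 * (sg ^+ 2 * pi *+ 2)); last by ring.
  by rewrite sqrtrM ?sqr_ge0// sqrtr_sqr ger0_norm// invfM.
have h : x ^+ 2 <= 8 / 3 * sg ^+ 2 * expR (x ^+ 2 / (8 / 3 * sg ^+ 2)).
  rewrite -ler_pdivrMl; last by rewrite mulr_gt0.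
  by rewrite mulrC (le_trans _ (expR_ge1Dx _))// lerDr.
have p0 := normal_peak_ge0 sg.
have -> : expR (- x ^+ 2 / (sg ^+ 2 *+ 2)) =
    expR (- x ^+ 2 / ((2 * sg) ^+ 2 *+ 2)) / expR (x ^+ 2 / (8 / 3 * sg ^+ 2)).
  by rewrite -expRN -expRD; congr expR; field.
set E2 := expR (- x ^+ 2 / ((2 * sg) ^+ 2 *+ 2)); set E1 := expR (_ / (8 / 3 * _)).
have E10 : 0 < E1 by exact: expR_gt0.
have E20 : 0 < E2 by exact: expR_gt0.
have -> : x ^+ 2 * (normal_peak sg * (E2 / E1)) = (x ^+ 2 * (normal_peak sg * E2)) / E1.
  by field; exact: lt0r_neq0.
rewrite ler_pdivrMr//.
have -> : 16 * sg ^+ 2 * (2^-1 * normal_peak sg * E2) * E1 =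
   3 * ((8 / 3 * sg ^+ 2 * E1) * (normal_peak sg * E2)) by field.
have : x ^+ 2 * (normal_peak sg * E2) <= (8 / 3 * sg ^+ 2 * E1) * (normal_peak sg * E2).
  by rewrite ler_wpM2r// mulr_ge0// ltW.
have : 0 <= (8 / 3 * sg ^+ 2 * E1) * (normal_peak sg * E2).
  by apply: mulr_ge0; apply: mulr_ge0 => //; apply: ltW => //; rewrite mulr_gt0.
lra.
Qed.

Let mphi : measurable_fun setT phi. Proof. exact: measurable_normal_pdf. Qed.

Let iphi : lam.-integrable setT (EFin \o phi).
Proof. exact: integrable_normal_pdf. Qed.

Let ixphi : lam.-integrable setT (fun x => (`|x| * phi x)%:E).
Proof.
apply: (@le_integrable _ _ _ lam _ measurableT _
  (fun x => (phi x + 16%:R * sg ^+ 2 * normal_pdf 0 (2 * sg) x)%:E)).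
- by apply/measurable_EFinP; apply: measurable_funM => //; exact: measurableT_comp.
- move=> x _; rewrite lee_fin (@ger0_norm _ (`|x| * phi x)) ?mulr_ge0// ger0_norm.
  + rewrite (le_trans _ (lerD (lexx _) (phi_tail x)))// -[X in X + _]mul1r -mulrDl.
    rewrite ler_wpM2r// -[x ^+ 2]real_normK ?num_real//.
    have := sqr_ge0 (`|x| - 1); rewrite sqrrB1.
    by move: (normr_ge0 x); set u := `|x|; rewrite mulr2n; nra.
  + by rewrite addr_ge0// mulr_ge0 ?normal_pdf_ge0// mulr_ge0// ltW.
- under eq_fun do rewrite EFinD EFinM.
  apply: integrableD => //; apply: integrableZl => //.
  exact: integrable_normal_pdf.
Qed.

Let F c t := Rintegral lam setT (fun x => cos (c + t * x) * phi x).

Let mcos c t : measurable_fun setT (fun x : R => cos (c + t * x)).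
Proof.
apply: measurableT_comp; first exact: (continuous_measurable_fun (@continuous_cos R)).
by apply: measurable_funD => //; exact: measurable_funM.
Qed.

Let mcos1 c t : measurable_fun setT (fun x : R => 1 + cos (c + t * x)).
Proof. exact: measurable_funD (measurable_cst _) (mcos c t). Qed.

Let msin c t : measurable_fun setT (fun x : R => sin (c + t * x)).
Proof.
apply: measurableT_comp; first exact: (continuous_measurable_fun (@continuous_sin R)).
by apply: measurable_funD => //; exact: measurable_funM.
Qed.

Let mxsin c t : measurable_fun setT (fun x : R => x * sin (c + t * x) * phi x).
Proof. by apply: measurable_funM => //; apply: measurable_funM. Qed.

Let icos c t : lam.-integrable setT (fun x => (cos (c + t * x) * phi x)%:E).
Proof.
apply: (@le_integrable _ _ _ lam _ measurableT _ (EFin \o phi)) => //.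
  by apply/measurable_EFinP; exact: measurable_funM (mcos c t) mphi.
move=> x _; rewrite lee_fin normrM ler_piMl//.
by rewrite ler_norml cos_geN1 cos_le1.
Qed.

Let isin c t : lam.-integrable setT (fun x => (x * sin (c + t * x) * phi x)%:E).
Proof.
apply: (@le_integrable _ _ _ lam _ measurableT _ (fun x => (`|x| * phi x)%:E)) => //.
  by apply/measurable_EFinP; exact: mxsin.
move=> x _; rewrite lee_fin !normrM normr_id ler_wpM2r// ler_piMr//.
by rewrite ler_norml sin_geN1 sin_le1.
Qed.

(** The derivative of sin(c + t x) phi(x) has integral zero, and phi' = - (x / sg^2) phi. *)
Let parts c t : Rintegral lam setT (fun x => x * sin (c + t * x) * phi x) = sg ^+ 2 * t * F c t.
Proof.
pose g x := sin (c + t * x) * phi x.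
pose g' x := t * (cos (c + t * x) * phi x) + - (sg ^+ 2)^-1 * (x * sin (c + t * x) * phi x).
have dg x : is_derive x (1 : R) g (g' x).
  have dp := is_derive_normal_pdf x.
  apply: is_derive_eq; rewrite /GRing.scale /= /g' -/(phi x).
  by field.
have ig : lam.-integrable setT (EFin \o g').
  rewrite /comp/g'; under eq_fun do rewrite EFinD !(EFinM t) (EFinM (- _)).
  exact: (integrableD measurableT (integrableZl measurableT _ (icos c t))
    (integrableZl measurableT _ (isin c t))).
have tail (u : nat -> R) : (forall n, u n ^+ 2 = n%:R ^+ 2) -> g (u n) @[n --> \oo] --> (0 : R).
  move=> hu; pose K := 16%:R * sg ^+ 2 * normal_peak (2 * sg).
  have hK n : (0 < n)%N -> `|g (u n)| * n.+1%:R <= 2 * K.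
    move=> n0; have h1 : `|g (u n)| <= phi (u n).
      by rewrite normrM (ger0_norm (phi_ge0 _)) ler_piMl// ler_norml sin_geN1 sin_le1.
    have := phi_tail (u n); rewrite hu => h2.
    have h3 : 16%:R * sg ^+ 2 * normal_pdf 0 (2 * sg) (u n) <= K.
      by rewrite ler_wpM2l// ?normal_pdf_ub ?mulf_neq0// mulr_ge0// ltW.
    rewrite (@le_trans _ _ (phi (u n) * n.+1%:R))// ?ler_wpM2r//.
    rewrite (@le_trans _ _ (2 * (n%:R ^+ 2 * phi (u n))))//; last first.
      by rewrite ler_wpM2l// (le_trans h2).
    rewrite mulrC mulrA ler_wpM2r// -natrX -natrM ler_nat; nia.
  have lim : 2 * K * n.+1%:R^-1 @[n --> \oo] --> (2 * K * 0 : R).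
    by apply: cvgMr; exact: (@cvg_harmonic R).
  rewrite mulr0 in lim.
  apply/norm_cvg0P; apply: (squeeze_cvgr _ (cvg_cst 0) lim).
  near=> n; rewrite normr_ge0/= ler_pdivlMr// hK//; near: n; exact: nbhs_infty_gt.
have g'0 : Rintegral lam setT g' = 0.
  apply: (integral_derivative_eq0 dg) => //.
  - have cphi := @continuous_normal_pdf R 0 sg sg0.
    have ca : continuous (fun x : R => c + t * x).
      by move=> x; apply: cvgD; [exact: cvg_cst|apply: cvgM; [exact: cvg_cst|exact: cvg_id]].
    have cc x : cos (c + t * y) @[y --> x] --> cos (c + t * x).
      by apply: (continuous_cvg _ _ (ca x)); exact: continuous_cos.
    have cs x : sin (c + t * y) @[y --> x] --> sin (c + t * x).
      by apply: (continuous_cvg _ _ (ca x)); exact: continuous_sin.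
    move=> x; apply: cvgD; apply: cvgM; try exact: cvg_cst; apply: cvgM; try exact: cphi.
      exact: cc.
    by apply: cvgM; [exact: cvg_id|exact: cs].
  - by apply: tail.
  - by apply: tail => n; rewrite sqrrN.
move: g'0; rewrite RintegralD//=; last 2 first.
  exact: (integrableZl measurableT _ (icos c t)).
  exact: (integrableZl measurableT _ (isin c t)).
have -> := RintegralZl t measurableT (icos c t).
have -> := RintegralZl (- sg ^- 2) measurableT (isin c t).
rewrite -/(F c t); set I := Rintegral _ _ _ => h.
suff : sg ^+ 2 * (t * F c t + - sg ^- 2 * I) = 0 
  by rewrite mulrDr mulNr mulrN mulVKf ?lt0r_neq0// mulrA => /eqP; rewrite subr_eq0 => /eqP.
by rewrite h mulr0.
Unshelve. all: end_near. Qed.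

Let F0 c : F c 0 = cos c.
Proof.
rewrite /F (_ : (fun x => _) = fun x => cos c * phi x); last first.
  by apply/funext => x; rewrite mul0r addr0.
rewrite RintegralZl// /Rintegral /phi integral_normal_pdf /= mulr1//.
Qed.

Let derF c t : is_derive t (1 : R) (F c) (- (sg ^+ 2 * t) * F c t).
Proof.
pose f (t : R) (x : R) := cos (c + t * x) * phi x.
have df t' x : is_derive t' (1 : R) (f ^~ x) (- (x * sin (c + t' * x) * phi x)).
  rewrite /f; apply: is_derive_eq; rewrite /GRing.scale/=; ring.
have It : (`]t - 1, t + 1[%classic : set R) t.
  by rewrite /= in_itv/=; apply/andP; split; lra.
have B : forall t' x, `]t - 1, t + 1[%classic t' -> setT x -> `|partial1of2 f t' x| <= `|x| * phi x.
  move=> t' x _ _; rewrite partial1of2E; have [_ ->] := df t' x.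
  rewrite normrN !normrM (ger0_norm (phi_ge0 _)) ler_wpM2r// ler_piMr//.
  by rewrite ler_norml sin_geN1 sin_le1.
have D : forall t' x, `]t - 1, t + 1[%classic t' -> setT x -> derivable (f ^~ x) t' 1.
  by move=> t' x _ _; have [] := df t' x.
have I : forall t', `]t - 1, t + 1[%classic t' -> lam.-integrable setT (EFin \o f t').
  by move=> t' _; exact: icos.
have G0 (x : R) : 0 <= `|x| * phi x by rewrite mulr_ge0.
split; first exact: (derivable_under_integral measurableT It I D G0 ixphi B).
have := differentiation_under_integral measurableT It I D G0 ixphi B.
rewrite derive1E => ->.
rewrite mulNr -parts -mulN1r; have <- := RintegralZl (-1) measurableT (isin c t).
apply: eq_Rintegral => x _; rewrite partial1of2E; have [_ ->] := df t x.
by rewrite mulN1r.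
Qed.

(** By differentiation under the integral and [parts], F solves F'(t) = - sg^2 t F(t); D is F times
    the integrating factor, hence constant. *)
Lemma normal_characteristic c t :
  Ex (normal_prob 0 sg) (fun x => cos (c + t * x)) = cos c * expR (- (sg ^+ 2 * t ^+ 2 / 2)).
Proof.
have -> : Ex (normal_prob 0 sg) (fun x => cos (c + t * x)) = F c t.
  pose Q := normal_prob 0 sg : probability _ R.
  have dens (h : R -> R) : measurable_fun setT h -> (forall x, 0 <= h x <= 2) ->
      (* The density formula handles nonnegative integrands, hence the detour through 1 + cos. *)
      Ex Q h = Rintegral lam setT (fun x => h x * phi x).
    move=> mh h0; rewrite /Rintegral.
    have := @ge0_integral_density _ _ _ Q lam phi mphi (fun _ _ => erefl) (EFin \o h).
    rewrite /= => ->//; first exact/measurable_EFinP.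
    by move=> x; rewrite lee_fin; have /andP[] := h0 x.
  have ic1 : itg Q (fun x => 1 + cos (c + t * x)).
    apply: (@itg_bounded _ _ _ Q 2); first exact: mcos1.
    move=> x; rewrite ger0_norm; have := cos_le1 (c + t * x); have := cos_geN1 (c + t * x); lra.
  have : Ex Q (fun x => 1 + cos (c + t * x)) = 1 + F c t.
    rewrite dens; last 2 first.
    - exact: mcos1.
    - by move=> x; have := cos_le1 (c + t * x); have := cos_geN1 (c + t * x) => *; apply/andP; split; lra.
    have e : (fun x => (1 + cos (c + t * x)) * phi x) = (fun x => phi x + cos (c + t * x) * phi x).
      by apply/funext => x; rewrite mulrDl mul1r.
    rewrite e; have -> := RintegralD measurableT iphi (icos c t).
    by rewrite {1}/Rintegral /phi integral_normal_pdf.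
  have -> : Ex Q (fun x => 1 + cos (c + t * x)) = 1 + Ex Q (fun x => cos (c + t * x)).
    have := @ExB _ _ _ Q _ (fun=> 1) ic1 (itg_cst Q 1).
    rewrite Ex_cst => /eqP; rewrite eq_sym subr_eq => /eqP ->; rewrite addrC; congr (_ + _).
    by apply: eq_Ex => x /=; rewrite addrAC subrr add0r.
  by move/addrI.
pose D (u : R) := F c u * expR (sg ^+ 2 * u ^+ 2 / 2).
have dD (u : R) : is_derive u (1 : R) D 0.
  have := derF c u => dF.
  by apply: is_derive_eq; rewrite /GRing.scale/=; field.
have := is_derive_0_is_cst t 0 dD; rewrite /D F0.
rewrite expr0n/= mulr0 mul0r expR0 mulr1 => <-.
by rewrite -[RHS]mulrA -expRD subrr expR0 mulr1.
Qed.

End GaussianCharacteristic.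

(** * Trigonometric polynomials and convergence in law *)

Section TrigonometricApproximation.
Context {R : realType} (n : nat).
Implicit Types (x t : 'cV[R]_n) (f g h : 'cV[R]_n -> R).

(** An entry (a, c, t) is the wave a cos(c + <t, x>). Allowing a phase keeps the family closed under
    products without introducing sines. *)
Definition trig_poly (s : seq (R * R * 'cV[R]_n)) x : R :=
  \sum_(z <- s) z.1.1 * cos (z.1.2 + dotv z.2 x).

Definition trig_limit h : Prop :=
  forall e : R, 0 < e -> exists s, forall x, `|h x - trig_poly s x| <= e.

Lemma trig_poly_bounded s : exists2 B, 0 <= B & forall x, `|trig_poly s x| <= B.
Proof.
exists (\sum_(z <- s) `|z.1.1|); first by apply: sumr_ge0.
move=> x; rewrite (le_trans (ler_norm_sum _ _ _))//; apply: ler_sum => z _.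
by rewrite normrM ler_piMr// ler_norml cos_geN1 cos_le1.
Qed.

Lemma trig_limit_bounded h : trig_limit h -> exists2 B, 0 < B & forall x, `|h x| <= B.
Proof.
move=> /(_ 1 ltr01)[s hs]; have [B B0 hB] := trig_poly_bounded s.
exists (B + 1) => [|x]; first by lra.
rewrite -[h x](subrK (trig_poly s x)) (le_trans (ler_normD _ _))// addrC lerD//.
Qed.

Lemma trig_poly_cat s1 s2 x : trig_poly (s1 ++ s2) x = trig_poly s1 x + trig_poly s2 x.
Proof. exact: big_cat. Qed.

Lemma trig_poly_prod s1 s2 : exists s, forall x, trig_poly s x = trig_poly s1 x * trig_poly s2 x.
Proof.
elim: s1 => [|[[a c] t] s1 [s IH]].
  by exists [::] => x; rewrite /trig_poly big_nil mul0r.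
exists ([seq (a / 2 * z.1.1, c + z.1.2, t + z.2) | z <- s2] ++
  ([seq (a / 2 * z.1.1, c - z.1.2, t - z.2) | z <- s2] ++ s)) => x.
have -> : trig_poly ((a, c, t) :: s1) x = a * cos (c + dotv t x) + trig_poly s1 x.
  by rewrite /trig_poly big_cons.
rewrite !trig_poly_cat IH mulrDl addrA; congr (_ + _).
rewrite /trig_poly !big_map -big_split mulr_sumr; apply: eq_bigr => z _ /=.
rewrite dotvDl dotvBl.
have -> : c + z.1.2 + (dotv t x + dotv z.2 x) = (c + dotv t x) + (z.1.2 + dotv z.2 x) by ring.
have -> : c - z.1.2 + (dotv t x - dotv z.2 x) = (c + dotv t x) - (z.1.2 + dotv z.2 x) by ring.
by rewrite cosD cosB; field.
Qed.

Lemma trig_limit_poly s : trig_limit (trig_poly s).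
Proof. by move=> e e0; exists s => x; rewrite subrr normr0 ltW. Qed.

Lemma trig_limit_ext h h' : h =1 h' -> trig_limit h -> trig_limit h'.
Proof. by move=> /funext ->. Qed.

Lemma trig_limit_cst (a : R) : trig_limit (fun=> a).
Proof.
apply: trig_limit_ext (trig_limit_poly [:: (a, 0, 0)]) => x.
by rewrite /trig_poly big_seq1/= dotv0l addr0 cos0 mulr1.
Qed.

Lemma trig_limit_cos (c : R) t : trig_limit (fun x => cos (c + dotv t x)).
Proof.
apply: trig_limit_ext (trig_limit_poly [:: (1, c, t)]) => x.
by rewrite /trig_poly big_seq1/= mul1r.
Qed.

Lemma trig_limitD f g : trig_limit f -> trig_limit g -> trig_limit (fun x => f x + g x).
Proof.
move=> hf hg e e0; have e20 : 0 < e / 2 by rewrite divr_gt0.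
have [s1 h1] := hf _ e20; have [s2 h2] := hg _ e20.
exists (s1 ++ s2) => x; rewrite trig_poly_cat opprD addrACA (le_trans (ler_normD _ _))//.
by rewrite [leRHS](splitr e) lerD.
Qed.

Lemma trig_limitM f g : trig_limit f -> trig_limit g -> trig_limit (fun x => f x * g x).
Proof.
move=> hf hg e e0.
have [A A0 hA] := trig_limit_bounded hf.
have eg0 : 0 < e / (2 * A) by rewrite divr_gt0// mulr_gt0.
have [s2 h2] := hg _ eg0.
have [B B0 hB] := trig_poly_bounded s2.
have ef0 : 0 < e / (2 * (B + 1)) by rewrite divr_gt0// mulr_gt0//; lra.
have [s1 h1] := hf _ ef0.
have [s hs] := trig_poly_prod s1 s2.
exists s => x; rewrite hs.
have -> : f x * g x - trig_poly s1 x * trig_poly s2 x =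
  f x * (g x - trig_poly s2 x) + (f x - trig_poly s1 x) * trig_poly s2 x by ring.
rewrite (le_trans (ler_normD _ _))// !normrM [leRHS](splitr e) lerD//.
  rewrite (le_trans (ler_pM _ _ (hA x) (h2 x)))//.
  by rewrite le_eqVlt; apply/orP; left; apply/eqP; field; exact: lt0r_neq0.
rewrite (@le_trans _ _ (e / (2 * (B + 1)) * (B + 1)))//.
  by rewrite ler_pM// (le_trans (hB x))//; lra.
by rewrite le_eqVlt; apply/orP; left; apply/eqP; field; apply: lt0r_neq0; lra.
Qed.

Lemma trig_limitZ a f : trig_limit f -> trig_limit (fun x => a * f x).
Proof. by apply: trig_limitM; exact: trig_limit_cst. Qed.

Lemma trig_limit_sum I (r : seq I) (F : I -> 'cV[R]_n -> R) :
  (forall i, trig_limit (F i)) -> trig_limit (fun x => \sum_(i <- r) F i x).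
Proof.
move=> hF; elim: r => [|i r IH].
  by apply: trig_limit_ext (trig_limit_cst 0) => x; rewrite big_nil.
by apply: trig_limit_ext (trig_limitD (hF i) IH) => x; rewrite big_cons.
Qed.

Lemma trig_limit_closed h :
  (forall e, 0 < e -> exists2 f, trig_limit f & forall x, `|h x - f x| <= e) -> trig_limit h.
Proof.
move=> hh e e0; have e20 : 0 < e / 2 by rewrite divr_gt0.
have [f hf hfh] := hh _ e20; have [s hs] := hf _ e20.
exists s => x; rewrite -[h x](subrK (f x)) -addrA (le_trans (ler_normD _ _))//.
by rewrite [leRHS](splitr e) lerD.
Qed.

(** The classical iteration p + (u^2 - p^2)/2, a polynomial in u that tends to |u| uniformly on
    [-1, 1]; it brings absolute values, hence minima and maxima, within reach of products and
    sums. *)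
Fixpoint abs_approx (u : R) j : R :=
  if j is j'.+1 then abs_approx u j' + (u ^+ 2 - abs_approx u j' ^+ 2) / 2 else 0.

Lemma abs_approx_bounds u j : `|u| <= 1 ->
  0 <= abs_approx u j <= `|u| /\ `|u| - abs_approx u j <= 2 / j.+2%:R.
Proof.
move=> u1; have u0 := normr_ge0 u.
elim: j => [|j [/andP[p0 pu] IH]] /=.
  by rewrite lexx u0 subr0 divff ?u1// pnatr_eq0.
rewrite -[u ^+ 2]real_normK ?num_real//.
move: u0 u1 p0 pu IH; move: `|u| (abs_approx u j) => v p v0 v1 p0 pv IH.
have vp1 : 0 <= (v - p) * (v + p) by apply: mulr_ge0; lra.
have vp2 : 0 <= (v - p) * (2 - (v + p)) by apply: mulr_ge0; lra.
split; first by apply/andP; split; lra.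
have -> : v - (p + (v ^+ 2 - p ^+ 2) / 2) = (v - p) * (1 - (v + p) / 2) by field.
have h1 : (v - p) * (1 - (v + p) / 2) <= (v - p) - (v - p) ^+ 2 / 2 by nra.
apply: (le_trans h1).
have -> : (j.+3%:R : R) = j.+2%:R + 1 by rewrite -natr1.
have : (2 : R) <= j.+2%:R by rewrite ler_nat.
move: IH; set y : R := j.+2%:R; set d := v - p => IH y2.
have d1 : d <= 1 by rewrite /d; lra.
have y0 : 0 < y by lra.
(* The map d - d^2/2 increases on [0, 1], so the bound 2/y for d may be inserted; with y = j + 2 the
   result is at most 2/(y + 1). *)
have h2 : d - d ^+ 2 / 2 <= 2 / y - (2 / y) ^+ 2 / 2.
  have : 2 / y <= 1 by rewrite ler_pdivrMr//; lra.
  have : 0 <= d by rewrite /d; lra.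
  move: IH; set z := 2 / y; nra.
apply: (le_trans h2).
have -> : 2 / y - (2 / y) ^+ 2 / 2 = 2 * (y - 1) / y ^+ 2 by field; exact: lt0r_neq0.
rewrite ler_pdivrMr ?exprn_gt0// mulrAC ler_pdivlMr; last by lra.
nra.
Qed.

Lemma trig_limit_norm f : trig_limit f -> trig_limit (fun x => `|f x|).
Proof.
move=> hf; have [B B0 hB] := trig_limit_bounded hf.
have small j : trig_limit (fun x => abs_approx (B^-1 * f x) j).
  have hu := trig_limitZ B^-1 hf.
  elim: j => [|j IH] /=; first exact: trig_limit_cst.
  apply: trig_limit_ext (trig_limitD IH (trig_limitZ 2^-1
    (trig_limitD (trig_limitM hu hu) (trig_limitZ (-1) (trig_limitM IH IH))))) => x.
  by rewrite !expr2; field; exact: lt0r_neq0.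
apply: trig_limit_closed => e e0.
pose j := Num.truncn (2 * B / e).
exists (fun x => B * abs_approx (B^-1 * f x) j); first exact: trig_limitZ.
move=> x; have u1 : `|B^-1 * f x| <= 1.
  by rewrite normrM gtr0_norm ?invr_gt0// mulrC ler_pdivrMr// mul1r.
have [/andP[p0 pu] h] := abs_approx_bounds j u1.
have -> : `|f x| = B * `|B^-1 * f x|.
  by rewrite normrM gtr0_norm ?invr_gt0// mulVKf// lt0r_neq0.
rewrite -mulrBr normrM (gtr0_norm B0) ger0_norm ?subr_ge0//.
have j2 : 2 * B / e <= j.+2%:R.
  have /andP[_ /ltW h2] : j%:R <= 2 * B / e < j.+1%:R.
    by apply: truncn_itv; rewrite divr_ge0 ?mulr_ge0// ltW.
  by rewrite (le_trans h2)// ler_nat.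
rewrite (le_trans (ler_wpM2l (ltW B0) h))//.
rewrite mulrA ler_pdivrMr ?ltr0n// -ler_pdivrMl// mulrC [B * 2]mulrC; exact: j2.
Qed.

Lemma trig_limit_min f g : trig_limit f -> trig_limit g ->
  trig_limit (fun x => Num.min (f x) (g x)).
Proof.
move=> hf hg; apply: trig_limit_ext (trig_limitZ 2^-1 (trig_limitD (trig_limitD hf hg)
  (trig_limitZ (-1) (trig_limit_norm (trig_limitD hf (trig_limitZ (-1) hg)))))) => x.
by rewrite minr_absE !mulN1r mulrC.
Qed.

Lemma trig_limit_max f g : trig_limit f -> trig_limit g ->
  trig_limit (fun x => Num.max (f x) (g x)).
Proof.
move=> hf hg; apply: trig_limit_ext (trig_limitZ 2^-1 (trig_limitD (trig_limitD hf hg)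
  (trig_limit_norm (trig_limitD hf (trig_limitZ (-1) hg))))) => x.
by rewrite maxr_absE !mulN1r mulrC.
Qed.

Lemma box_compact (K : R) : compact [set x : 'cV[R]_n | forall i, `|x i 0| <= K].
Proof.
have -> : [set x : 'cV[R]_n | forall i, `|x i 0| <= K] =
    (fun y : 'rV[R]_n => y^T) @` [set y : 'rV[R]_n | forall i, `[- K, K]%classic (y ord0 i)].
  apply/seteqP; split => [x hx|_ [y hy <-] i].
    exists x^T; rewrite ?trmxK// => i /=.
    by rewrite in_itv/= mxE -ler_norml; exact: hx.
  by have := hy i; rewrite /= in_itv/= -ler_norml mxE.
apply: continuous_compact; last first.
  exact: (@rV_compact R n (fun=> `[- K, K]%classic) (fun=> @segment_compact _ _ _)).
apply: continuous_subspaceT => y.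
move=> U /nbhs_ballP[e e0 hU]; apply/nbhs_ballP; exists e => // z yz.
by apply: hU; split => // i j; rewrite !mxE; apply: yz.2.
Qed.

(** A trigonometric substitute for the squared distance to y. With L = 8 K and both points in the
    box of half-width K the arguments stay in [-1/4, 1/4], where 1 - cos v >= v^2/4 and periodicity
    is invisible. *)
Let bump (L : R) (y x : 'cV[R]_n) : R := \sum_i (1 - cos ((x i 0 - y i 0) / L)).

Let trig_limit_bump L y : trig_limit (bump L y).
Proof.
apply: trig_limit_sum => i.
apply: trig_limit_ext (trig_limitD (trig_limit_cst 1) (trig_limitZ (-1)
  (trig_limit_cos (- (y i 0 / L)) (L^-1 *: delta_mx i 0)))) => x.
by rewrite mulN1r dotvZl dotv_delta; congr (_ - cos _); rewrite mulrBl addrC [L^-1 * _]mulrC.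
Qed.

Let bump_ge0 L y x : 0 <= bump L y x.
Proof. by apply: sumr_ge0 => i _; rewrite subr_ge0 cos_le1. Qed.

Let bump_far (K e : R) (x y : 'cV[R]_n) i : 0 < K -> 0 <= e ->
  (forall j, `|x j 0| <= K) -> (forall j, `|y j 0| <= K) ->
  e <= `|x i 0 - y i 0| -> (e / (8 * K)) ^+ 2 / 4 <= bump (8 * K) y x.
Proof.
move=> K0 e0 hx hy hxy.
rewrite /bump (bigD1 i)//= ler_wpDr//; first by apply: sumr_ge0 => j _; rewrite subr_ge0 cos_le1.
have K80 : 0 < 8 * K by rewrite mulr_gt0.
set v := (x i 0 - y i 0) / (8 * K).
have v4 : `|v| <= 1 / 4.
  rewrite /v normrM normfV (gtr0_norm K80) ler_pdivrMr//.
  rewrite (le_trans (ler_normB _ _))//; have := hx i; have := hy i; lra.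
have ev : e / (8 * K) <= `|v| by rewrite /v normrM normfV (gtr0_norm K80) ler_pM2r ?invr_gt0.
have [_ [_ ]] := cos_taylor2_cube v; rewrite -[v ^+ 2]real_normK ?num_real//.
have ek0 : 0 <= e / (8 * K) by rewrite divr_ge0// ltW.
have := normr_ge0 v; move: v4 ev ek0; set w := `|v|; set u := e / _ => w4 uw u0 w0.
have h1 : w ^+ 3 <= w ^+ 2 / 4 by rewrite exprSr ler_wpM2l ?sqr_ge0//; lra.
have h2 : u ^+ 2 <= w ^+ 2 by rewrite ler_sqr ?nnegrE.
lra.
Qed.

Let bump_continuous L y : continuous (bump L y).
Proof.
apply: (@continuous_big _ _ +%R 0 xpredT) => [u|i _ x]; first exact: add_continuous.
apply: continuousB; first exact: cst_continuous.
apply: (@continuous_comp _ _ _ (fun z : 'cV[R]_n => (z i 0 - y i 0) / L) cos); last exact: continuous_cos.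
apply: continuousM; last exact: cst_continuous.
by apply: continuousB; [exact: coord_continuous|exact: cst_continuous].
Qed.

(** The lattice form of Stone-Weierstrass: each [h y] majorizes g on the box and is within 2 e1 of g
    near y, so a minimum over a finite subcover is uniformly close from above. Clipping at B and - B
    keeps the approximation bounded off the box, where only small mass will be available. *)
Lemma trig_poly_dense g (B K e : R) : continuous g -> (forall x, `|g x| <= B) -> 0 < e ->
  exists s, (forall x, (forall i, `|x i 0| <= K) -> `|g x - trig_poly s x| <= e) /\
    forall x, `|trig_poly s x| <= B + e.
Proof.
wlog K0 : K / 0 < K.
  move=> H cg gB e0; have K10 : 0 < Num.max K 1 by rewrite lt_max ltr01 orbT.
  have [s [h1 h2]] := H (Num.max K 1) K10 cg gB e0.
  by exists s; split => // x hx; apply: h1 => i; rewrite le_max hx.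
move=> cg gB e0.
pose e1 := e / 3; have e10 : 0 < e1 by rewrite divr_gt0.
have B0 : 0 <= B by rewrite (le_trans _ (gB 0)).
pose box := [set x : 'cV[R]_n | forall i, `|x i 0| <= K].
have /choice[F hF] (y : 'cV[R]_n) : exists C : R, box y -> forall x, box x -> g x <= g y + e1 + C * bump (8 * K) y x.
  have [by_|] := pselect (box y); last by exists 0.
  have /cvgrPdist_lt /(_ _ e10) /nbhs_ballP[r /= r0 hr] := cg y.
  pose m := (r / (8 * K)) ^+ 2 / 4.
  have m0 : 0 < m by rewrite divr_gt0// exprn_gt0// divr_gt0// mulr_gt0.
  (* Points of the box at coordinate distance at least r from y have bump at least m, and 2 B bounds
     the oscillation of g. *)
  exists (2 * B / m) => _ x bx.
  have [/existsP[i hi]|] := boolP [exists i, r <= `|x i 0 - y i 0|].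
    have h := bump_far K0 (ltW r0) bx by_ hi.
    have h2 : 2 * B <= 2 * B / m * bump (8 * K) y x.
      by rewrite mulrAC ler_pdivlMr// ler_wpM2l// mulr_ge0.
    have := gB x; have := gB y; rewrite !ler_norml => /andP[? ?] /andP[? ?]; lra.
  rewrite negb_exists => /forallP hi.
  have : ball y r x by split => // i j; rewrite ord1 /ball/= distrC ltNge.
  move=> /hr; rewrite /= ltr_norml => /andP[? ?].
  have : 0 <= 2 * B / m * bump (8 * K) y x 
    by apply: mulr_ge0 => //; apply: divr_ge0; [apply: mulr_ge0|exact: ltW].
  lra.
pose h y x := g y + e1 + F y * bump (8 * K) y x.
pose U (y : 'cV[R]_n) := [set x | h y x - g x < 2 * e1].
have ch y : continuous (fun x => h y x - g x).
  move=> x; apply: continuousB; last exact: cg.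
  apply: continuousD; first exact: cst_continuous.
  by apply: continuousM; [exact: cst_continuous|exact: bump_continuous].
have Uo y : open (U y).
  rewrite (_ : U y = (fun x => h y x - g x) @^-1` [set u | u < 2 * e1])//.
  by apply: open_comp => [x _|]; [exact: ch|exact: open_lt].
have bump0 y : bump (8 * K) y y = 0.
  by rewrite /bump big1// => i _; rewrite subrr mul0r cos0 subrr.
have := @box_compact K; rewrite compact_cover => /(_ _ box U (fun y _ => Uo y)).
case.
  by move=> y by_; exists y => //; rewrite /U/= /h bump0; lra.
move=> D DB cov.
(* The starting value B clips the minimum from above and covers an empty subcover. *)
pose m x := \big[Num.min/B]_(y <- D) h y x.
have tm : trig_limit (fun x => Num.max (m x) (- B)).
  apply: trig_limit_max; last exact: trig_limit_cst.
  rewrite /m; elim: (enum_fset D) => [|y r IH].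
    by apply: trig_limit_ext (trig_limit_cst B) => x; rewrite big_nil.
  apply: trig_limit_ext (trig_limit_min (trig_limitD (trig_limit_cst (g y + e1))
    (trig_limitZ (F y) (trig_limit_bump (8 * K) y))) IH) => x.
  by rewrite big_cons.
have [s hs] := tm e1 e10.
have mB x : m x <= B.
  rewrite /m; elim: (enum_fset D) => [|y r IH]; first by rewrite big_nil.
  by rewrite big_cons ge_min IH orbT.
have mle x y : y \in D -> m x <= h y x.
  rewrite /m => yD; have : y \in enum_fset D by [].
  elim: (enum_fset D) => [//|z r IH]; rewrite in_cons big_cons ge_min => /orP[/eqP ->|/IH ->].
    by rewrite lexx.
  by rewrite orbT.
have mge x : box x -> g x <= m x.
  move=> bx; rewrite /m; have : {subset enum_fset D <= box} by move=> y; exact: DB.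
  elim: (enum_fset D) => [|z r IH] sub.
    by rewrite big_nil; have := gB x; rewrite ler_norml => /andP[].
  rewrite big_cons le_min IH ?andbT; last by move=> y yr; apply: sub; rewrite in_cons yr orbT.
  by apply: hF => //; apply/set_mem/sub; rewrite in_cons eqxx.
exists s; split => x => [bx|].
  have [y yD Uy] := cov x bx.
  have := mle x y yD; have := mge x bx; rewrite /U/= in Uy => h1 h2.
  have e3 : Num.max (m x) (- B) = m x.
    by apply/max_idPl; rewrite (le_trans _ h1)//; have := gB x; rewrite ler_norml => /andP[].
  have := hs x; rewrite e3 !ler_norml => /andP[h3 h4].
  by apply/andP; split; rewrite /e1 in Uy h3 h4 *; lra.
have := hs x; rewrite !ler_norml => /andP[h3 h4].
have : Num.max (m x) (- B) <= B by rewrite ge_max mB; lra.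
have : - B <= Num.max (m x) (- B) by rewrite le_max lexx orbT.
by move=> h1 h2; apply/andP; split; rewrite /e1 in h3 h4 *; lra.
Qed.

End TrigonometricApproximation.

(** * Convergence in law from cosines and tightness *)

Section ConvergenceDetermining.
Context {R : realType} (n : nat).
Implicit Types (Q : probability (borelV R n) R).

Lemma continuous_dotv m (t : 'cV[R]_m) : continuous (dotv t).
Proof.
rewrite (_ : dotv t = fun x => \sum_i t i 0 * x i 0); last by apply/funext => x; exact: dotvE.
apply: (@continuous_big _ _ +%R 0 xpredT) => [u|i _ x]; first exact: add_continuous.
by apply: continuousM; [exact: cst_continuous|exact: coord_continuous].
Qed.

Lemma continuous_cos_dotv m (c : R) (t : 'cV[R]_m) : continuous (fun x => cos (c + dotv t x)).
Proof.
move=> x; apply: (@continuous_comp _ _ _ (fun z => c + dotv t z) cos); last exact: continuous_cos.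
by apply: continuousD; [exact: cst_continuous|exact: continuous_dotv].
Qed.

Lemma measurable_cos_dotv (c : R) t :
  measurable_fun [set: borelV R n] (fun x : 'cV[R]_n => cos (c + dotv t x)).
Proof. by apply: continuous_measurable_borelV; exact: continuous_cos_dotv. Qed.

Lemma itg_cos_dotv Q (c : R) t : itg Q (fun x : 'cV[R]_n => cos (c + dotv t x)).
Proof.
apply: (@itg_bounded _ _ _ Q 1); first exact: measurable_cos_dotv.
by move=> x; rewrite ler_norml cos_geN1 cos_le1.
Qed.

Lemma measurable_trig_poly (s : seq (R * R * 'cV[R]_n)) :
  measurable_fun [set: borelV R n] (trig_poly s).
Proof.
apply: continuous_measurable_borelV.
apply: (@continuous_big _ _ +%R 0 xpredT) => [u|z _ x]; first exact: add_continuous.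
apply: (@continuousM _ _ (fun=> z.1.1) (fun y => cos (z.1.2 + dotv z.2 y))).
  exact: cst_continuous.
exact: continuous_cos_dotv.
Qed.

Lemma measurable_box_compl (K : R) : measurable [set x : borelV R n | exists i, K < `|(x : 'cV[R]_n) i 0|].
Proof.
rewrite (_ : [set x | _] = \bigcup_(i in [set: 'I_n]) [set x : borelV R n | K < `|(x : 'cV[R]_n) i 0|]).
  apply: fin_bigcup_measurable => [|i _]; first exact: finite_finset.
  by apply: measurable_gt => //; apply: measurableT_comp => //; exact: measurable_fun_coord.
by apply/seteqP; split => [x [i hi]|x [i _ hi]]; exists i.
Qed.

(** The function g is replaced by a trigonometric polynomial close to it on a large box and bounded
    by B + 1 everywhere; outside the box both laws have small mass. *)
Theorem cvg_law_trig (Q_ : nat -> probability (borelV R n) R) Q :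
  (forall (c : R) t, Ex (Q_ k) (fun x => cos (c + dotv t x)) @[k --> \oo] -->
     Ex Q (fun x => cos (c + dotv t x))) ->
  (forall e : R, 0 < e -> exists K : R, (\forall k \near \oo,
     fine (Q_ k [set x : 'cV[R]_n | exists i, K < `|x i 0|]) <= e) /\
     fine (Q [set x : 'cV[R]_n | exists i, K < `|x i 0|]) <= e) ->
  forall g : 'cV[R]_n -> R, continuous g -> (exists B : R, forall x, `|g x| <= B) ->
  Ex (Q_ k) g @[k --> \oo] --> Ex Q g.
Proof.
move=> hcos tight g cg [B gB].
have B0 : 0 <= B by rewrite (le_trans _ (gB 0)).
have mg : measurable_fun [set: borelV R n] g by exact: continuous_measurable_borelV.
have ig Q' : itg Q' g by exact: (@itg_bounded _ _ _ Q' B).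
have itp s Q' : itg Q' (trig_poly s).
  have [b _ hb] := @trig_poly_bounded _ _ s; exact: (@itg_bounded _ _ _ Q' b) (measurable_trig_poly s) hb.
have hpoly s : Ex (Q_ k) (trig_poly s) @[k --> \oo] --> Ex Q (trig_poly s).
  have e Q' : Ex Q' (trig_poly s) = \sum_(z <- s) z.1.1 * Ex Q' (fun x => cos (z.1.2 + dotv z.2 x)).
    rewrite /trig_poly Ex_sum; last by move=> z; apply: itgZ; exact: itg_cos_dotv.
    by apply: eq_bigr => z _; rewrite ExZ//; exact: itg_cos_dotv.
  rewrite e; under eq_fun do rewrite e.
  apply: cvg_big => [|z _]; first exact: add_continuous.
  by apply: cvgMr; exact: hcos.
apply/cvgrPdist_le => e e0.
(* For each law the mass outside the box then contributes at most (2 B + 1) e1 <= e/4, and the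
   inside at most e/8. *)
pose e1 := e / (8 * (B + 1)).
have mbox := measurable_box_compl.
have B1 : 0 < B + 1 by lra.
have e10 : 0 < e1 by rewrite divr_gt0// mulr_gt0.
have [K [tK tKQ]] := tight _ e10.
(* The bound 1 limits the polynomial globally, the bound e/8 is the accuracy on the box. *)
have e81 : 0 < Num.min 1 (e / 8) by rewrite lt_min ltr01 divr_gt0.
have [s [s1 s2]] := trig_poly_dense K cg gB e81.
have s3 x : `|g x - trig_poly s x| <= e / 8 + (2 * B + 1) * \1_[set x : 'cV[R]_n | exists i, K < `|x i 0|] x.
  rewrite indicE; have [/set_mem [i hi]|] := boolP (x \in _).
    rewrite mulr1 (le_trans (ler_normB _ _))//; have := gB x; have := s2 x.
    have : Num.min 1 (e / 8) <= 1 by rewrite ge_min lexx.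
    lra.
  move=> /negP xn; rewrite mulr0 addr0 (le_trans (s1 x _)) ?ge_min ?lexx ?orbT// => i.
  by rewrite leNgt; apply/negP => hi; apply: xn; apply/mem_set; exists i.
have close Q' : fine (Q' [set x : 'cV[R]_n | exists i, K < `|x i 0|]) <= e1 ->
    `|Ex Q' g - Ex Q' (trig_poly s)| <= 3 * e / 8.
  move=> h; rewrite -ExB//.
  have ii : itg Q' (fun x : borelV R n => e / 8 + (2 * B + 1) * \1_[set x : 'cV[R]_n | exists i, K < `|x i 0|] x).
    apply: itgD; first exact: itg_cst.
    by apply: itgZ; exact: itg_indic.
  rewrite (le_trans (Ex_norm_le _ ii s3))//; first exact: itgB.
  rewrite ExD; last 2 first.
  - exact: itg_cst.
  - by apply: itgZ; exact: itg_indic.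
  rewrite Ex_cst ExZ; last exact: itg_indic.
  rewrite Ex_indic//.
  have : (2 * B + 1) * fine (Q' [set x : 'cV[R]_n | exists i, K < `|x i 0|]) <= (2 * (B + 1)) * e1.
    by apply: ler_pM => //; [lra|exact: Pr_ge0|lra].
  have -> : 2 * (B + 1) * e1 = e / 4 by rewrite /e1; field; exact: lt0r_neq0.
  by move=> ?; lra.
near=> k.
have h1 := close _ tKQ.
have h2 : `|Ex (Q_ k) g - Ex (Q_ k) (trig_poly s)| <= 3 * e / 8.
  by apply: close; near: k.
have h3 : `|Ex Q (trig_poly s) - Ex (Q_ k) (trig_poly s)| <= e / 8.
  near: k; have /cvgrPdist_le := hpoly s; apply; rewrite divr_gt0//.
move: h1 h2 h3; rewrite !ler_norml => /andP[? ?] /andP[? ?] /andP[? ?].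
by apply/andP; split; lra.
Unshelve. all: end_near. Qed.

End ConvergenceDetermining.

(** * Gaussian laws *)

Section ImageProbability.
Context {R : realType} d d' (T : measurableType d) (S : measurableType d').
Variables (Q : probability T R) (phi : T -> S) (mphi : measurable_fun setT phi).

Let image : set S -> \bar R := pushforward Q phi.

HB.instance Definition _ := Measure.copy image
  (measure_function_pushforward__canonical__measure_function_Measure Q mphi).

Let image_setT : image setT = 1%E.
Proof. by rewrite /image /pushforward preimage_setT probability_setT. Qed.

HB.instance Definition _ := Measure_isProbability.Build _ _ _ image image_setT.

Definition image_prob : probability S R := image.

Lemma image_probE A : image_prob A = Q (phi @^-1` A).
Proof. by []. Qed.

Lemma Ex_image (g : S -> R) : measurable_fun setT g -> itg Q (g \o phi) ->
  Ex image_prob g = Ex Q (g \o phi).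
Proof.
move=> mg ig; rewrite /Rintegral.
by rewrite (@integral_pushforward _ _ _ _ _ _ mphi Q setT)//; exact/measurable_EFinP.
Qed.

End ImageProbability.

Section Uniqueness.
Context {R : realType}.

Lemma probability_tight n (Q : probability (borelV R n) R) (e : R) : 0 < e ->
  exists K0 : R, forall K, K0 <= K ->
    fine (Q [set x : 'cV[R]_n | exists i, K < `|x i 0|]) <= e.
Proof.
move=> e0; pose F (k : nat) := [set x : borelV R n | exists i, k%:R < `|(x : 'cV[R]_n) i 0|].
have mF k : measurable (F k) by exact: measurable_box_compl.
have F0 : \bigcap_k F k = set0.
  apply/seteqP; split => // x hx.
  have [k hk] : exists k : nat, forall i, `|(x : 'cV[R]_n) i 0| <= k%:R.
    exists (Num.truncn (\sum_i `|(x : 'cV[R]_n) i 0|)).+1 => i.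
    rewrite (@le_trans _ _ (\sum_i `|(x : 'cV[R]_n) i 0|))//.
      by rewrite (bigD1 i)//= lerDl sumr_ge0.
    have s0 : 0 <= \sum_i `|(x : 'cV[R]_n) i 0| by apply: sumr_ge0.
    by apply: ltW; have /andP[] := truncn_itv s0.
  by have [i] := hx k Logic.I; rewrite ltNge hk.
have := @nonincreasing_cvg_mu _ _ _ Q F.
rewrite F0 measure0 => /(_ _ mF measurable0) h.
have {}h : Q (F k) @[k --> \oo] --> 0%E.
  apply: h; first by rewrite (le_lt_trans (probability_le1 Q (mF 0%N)))// ltry.
  move=> k m km; apply/subsetPset => x [i hi]; exists i.
  by rewrite (le_lt_trans _ hi)// ler_nat.
have /fine_cvgP[_ /cvgrPdist_le /(_ _ e0)[k _ hk]] := h.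
exists k%:R => K kK; have := hk k (leqnn k).
rewrite /= sub0r normrN ger0_norm ?Pr_ge0//; apply: le_trans.
apply: Pr_le => //; first exact: measurable_box_compl.
by move=> x [i hi]; exists i; exact: le_lt_trans hi.
Qed.

(** The convergence theorem for a constant sequence, with uniqueness of its limit. *)
Lemma Ex_determined n (Q1 Q2 : probability (borelV R n) R) :
  (forall (c : R) (t : 'cV[R]_n), Ex Q1 (fun x => cos (c + dotv t x)) = Ex Q2 (fun x => cos (c + dotv t x))) ->
  forall g : 'cV[R]_n -> R, continuous g -> (exists B : R, forall x, `|g x| <= B) ->
  Ex Q1 g = Ex Q2 g.
Proof.
move=> h g cg bg.
have : Ex Q1 g @[k --> \oo] --> Ex Q2 g.
  apply: (@cvg_law_trig _ _ (fun=> Q1)) => //.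
    by move=> c t; rewrite h; exact: cvg_cst.
  move=> e e0; have [K1 h1] := probability_tight Q1 e0; have [K2 h2] := probability_tight Q2 e0.
  exists (Num.max K1 K2); split; last by apply: h2; rewrite le_max lexx orbT.
  by apply: nearW => _; apply: h1; rewrite le_max lexx.
move=> hc; apply: (@cvg_unique _ (@Rhausdorff R) _ _ _ _ _ hc); exact: cvg_cst.
Qed.

Lemma law_determined (Q1 Q2 : probability (measurableTypeR R) R) :
  (forall c t : R, Ex Q1 (fun x => cos (c + t * x)) = Ex Q2 (fun x => cos (c + t * x))) ->
  forall B, measurable B -> Q1 B = Q2 B.
Proof.
move=> h.
(* The line is embedded as columns of length 1 to reuse the vector statement. *)
pose phi (x : measurableTypeR R) : borelV R 1 := const_mx x.
have mphi : measurable_fun setT phi.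
  apply: measurable_fun_cV => // i.
  by apply: (eq_measurable_fun (fun x : measurableTypeR R => x : R)) => [x _|]; rewrite ?mxE.
have same (g : R -> R) : continuous g -> (exists B : R, forall x, `|g x| <= B) -> Ex Q1 g = Ex Q2 g.
  move=> cg [B gB].
  pose g1 (x : 'cV[R]_1) := g (x 0 0).
  have cg1 : continuous g1.
    by move=> x; apply: (@continuous_comp _ _ _ (fun x : 'cV[R]_1 => x 0 0) g); [exact: coord_continuous|exact: cg].
  have mg : measurable_fun setT (g : measurableTypeR R -> R) by exact: continuous_measurable_fun.
  have e (Q : probability (measurableTypeR R) R) (u : 'cV[R]_1 -> R) :
      continuous u -> (forall x, `|u x| <= B + 1) ->
      Ex (image_prob Q mphi) u = Ex Q (fun x : R => u (const_mx x)).
    move=> cu uB; have mu := continuous_measurable_borelV cu.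
    rewrite Ex_image//; apply: (@itg_bounded _ _ _ Q (B + 1)); last by move=> x; exact: uB.
    exact: measurableT_comp mu mphi.
  have B0 : 0 <= B by rewrite (le_trans _ (gB 0)).
  have := @Ex_determined 1 (image_prob Q1 mphi) (image_prob Q2 mphi) _ g1 cg1.
  rewrite !e//; last 2 first.
  - by move=> x; rewrite (le_trans (gB _))//; lra.
  - by move=> x; rewrite (le_trans (gB _))//; lra.
  have eg (Q : probability (measurableTypeR R) R) : Ex Q (fun x => g1 (const_mx x)) = Ex Q g.
    by apply: eq_Ex => x; rewrite /g1 mxE.
  rewrite !eg; apply; last by exists B => x; exact: gB.
  move=> c t; rewrite !e; try exact: continuous_cos_dotv; last 2 first.
  - by move=> x; rewrite (@le_trans _ _ 1)// ?ler_norml ?cos_geN1 ?cos_le1//; lra.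
  - by move=> x; rewrite (@le_trans _ _ 1)// ?ler_norml ?cos_geN1 ?cos_le1//; lra.
  have d1 (x : R) : dotv t (const_mx x) = t 0 0 * x.
    by rewrite dotvE big_ord1 mxE.
  have ed (Q : probability (measurableTypeR R) R) :
      Ex Q (fun x => cos (c + dotv t (const_mx x))) = Ex Q (fun x => cos (c + t 0 0 * x)).
    by apply: eq_Ex => x; rewrite d1.
  by rewrite !ed h.
have half (a : R) : Q1 `[a, +oo[%classic = Q2 `[a, +oo[%classic.
  (* Ramps equal to 1 on [a, +oo[ and tending pointwise to its indicator; such half-lines form a
     generating pi-system. *)
  pose g k (x : R) := Num.max 0 (Num.min 1 (1 + k%:R * (x - a))).
  have g01 k x : 0 <= g k x <= 1 by rewrite /g le_max lexx ge_max ler01 ge_min lexx.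
  have cgk k : continuous (g k).
    move=> x; apply: (@continuous_max R R (fun=> 0)
      (fun x => Num.min 1 (1 + k%:R * (x - a)))); first exact: cst_continuous.
    apply: (@continuous_min R R (fun=> 1) (fun x => 1 + k%:R * (x - a))); first exact: cst_continuous.
    apply: continuousD; first exact: cst_continuous.
    apply: continuousM; first exact: cst_continuous.
    by apply: continuousB; [exact: cvg_id|exact: cst_continuous].
  have mgk k : measurable_fun setT (g k : measurableTypeR R -> R) by exact: continuous_measurable_fun.
  have lim (Q : probability (measurableTypeR R) R) :
      (\int[Q]_x (g k x)%:E)%E @[k --> \oo] --> Q `[a, +oo[%classic.
    rewrite -(setIT `[a, +oo[%classic) -integral_indic//.
    have [] // := @dominated_convergence _ _ _ Q setT measurableT
      (fun k x => (g k x)%:E) (fun x => (\1_(`[a, +oo[%classic) x)%:E) (fun=> 1%E).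
    + by move=> k; exact/measurable_EFinP.
    + by apply/measurable_EFinP; exact: measurable_indic.
    + apply: aeW => x _; apply: cvg_near_cst; near=> k.
      rewrite indicE; have [/set_mem|/negP xa] := boolP (x \in _).
        rewrite /= in_itv/= andbT => ax; rewrite /g min_l ?max_r//.
        by rewrite lerDl mulr_ge0// subr_ge0.
      have {}xa : x < a.
        by rewrite ltNge; apply/negP => ax; apply: xa; apply/mem_set; rewrite /= in_itv/= ax.
      rewrite /g max_l// ge_min; apply/orP; right.
      have : (a - x)^-1 <= k%:R by near: k; exact: nbhs_infty_ger.
      by rewrite -[_^-1]mul1r ler_pdivrMr ?subr_gt0//; lra.
    + by apply: (itg_cst Q 1).
    + by apply: aeW => x k _; rewrite lee_fin ger0_norm; have /andP[] := g01 k x.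
  have e k : (\int[Q1]_x (g k x)%:E)%E = (\int[Q2]_x (g k x)%:E)%E.
    have b x : `|g k x| <= 1 by rewrite ger0_norm; have /andP[] := g01 k x.
    rewrite !ExE; try exact: (@itg_bounded _ _ _ _ 1).
    by congr (_%:E); apply: same => //; exists 1.
  have l1 := lim Q1; have l2 := lim Q2.
  have E : (fun k => \int[Q1]_x (g k x)%:E)%E = (fun k => \int[Q2]_x (g k x)%:E)%E.
    by apply/funext => k; exact: e.
  rewrite E in l1.
  exact: (cvg_unique _ l1 l2).
move=> B mB.
apply: (@measure_unique _ R (measurableTypeR R) (@RGenCInfty.G R)
  (fun k => `[(- k%:R)%R, +oo[%classic) (@RGenCInfty.measurableE R)) => //.
- move=> _ _ [a ->] [b ->]; exists (Num.max a b); apply/seteqP.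
  split => x /=; rewrite !in_itv/= !andbT ge_max; first by move=> [-> ->].
  by move=> /andP.
- by move=> k; exists (- k%:R).
- apply/seteqP; split => // x _; exists (Num.truncn `|x|).+1 => //=.
  rewrite in_itv/= andbT lerNl; have /andP[_ /ltW] := truncn_itv (normr_ge0 x).
  by apply: le_trans; rewrite -normrN ler_norm.
- by move=> _ [a ->]; exact: half.
- by move=> k; rewrite (le_lt_trans (probability_le1 Q1 (measurable_itv _)))// ltry.
Unshelve. all: end_near. Qed.

End Uniqueness.

Section Gaussian.
Context {R : realType}.

Definition psd n (S : 'M[R]_n) : Prop :=
  S^T = S /\ forall x : 'cV[R]_n, 0 <= dotv x (S *m x).

(** The characteristic function of a centred normal law is real: c = 0 gives its value, and c = pi/2
    says that the imaginary part vanishes. *)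
Definition gaussian_char n (N : probability (borelV R n) R) (S : 'M[R]_n) : Prop :=
  forall (c : R) (t : 'cV[R]_n), Ex N (fun x => cos (c + dotv t x)) =
    cos c * expR (- (dotv t (S *m t) / 2)).

Lemma psd_line n (S : 'M[R]_n) (x y : 'cV[R]_n) (a : R) : psd S ->
  dotv (x + a *: y) (S *m (x + a *: y)) =
  dotv x (S *m x) + 2 * a * dotv y (S *m x) + a ^+ 2 * dotv y (S *m y).
Proof.
move=> [Ssym _]; rewrite mulmxDr -scalemxAr !(dotvDl, dotvDr, dotvZl, dotvZr).
have -> : dotv x (S *m y) = dotv y (S *m x) by rewrite dotv_mulmx Ssym dotvC.
ring.
Qed.

Lemma psd_CS n (S : 'M[R]_n) (x y : 'cV[R]_n) : psd S ->
  dotv y (S *m x) ^+ 2 <= dotv x (S *m x) * dotv y (S *m y).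
Proof.
move=> pS; have [Ssym S0] := pS.
(* When y^T S y = 0 the form is affine along y, and nonnegativity forces its slope to vanish. *)
have [Sy|Sy] := eqVneq (dotv y (S *m y)) 0.
  rewrite Sy mulr0 le_eqVlt; apply/orP; left; rewrite expf_eq0/=.
  apply: contraT => b0; set b := dotv y (S *m x) in b0 *.
  have := S0 (x + (- (dotv x (S *m x) + 1) / (2 * b)) *: y).
  rewrite psd_line// Sy mulr0 addr0 -/b.
  have -> : 2 * (- (dotv x (S *m x) + 1) / (2 * b)) * b = - (dotv x (S *m x) + 1) by field.
  lra.
have Sy0 : 0 < dotv y (S *m y) by rewrite lt_def Sy S0.
have := S0 (x + (- dotv y (S *m x) / dotv y (S *m y)) *: y).
rewrite psd_line//; set b := dotv y (S *m x); set q := dotv y (S *m y) in Sy Sy0 *.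
have -> : dotv x (S *m x) + 2 * (- b / q) * b + (- b / q) ^+ 2 * q = dotv x (S *m x) - b ^+ 2 / q by field.
by rewrite subr_ge0 ler_pdivrMr.
Qed.

Lemma gaussian_dirac n : gaussian_char (dirac (0 : borelV R n)) 0.
Proof.
move=> c t; rewrite mul0mx dotv0r mul0r oppr0 expR0 mulr1 /Rintegral integral_dirac//.
  by rewrite diracT mul1e/= dotv0r addr0.
by apply/measurable_EFinP; exact: measurable_cos_dotv.
Qed.

(** The law of x + z a for independent x of law N and standard normal z; by Fubini the
    characteristic functions multiply. *)
Lemma gaussian_rank1 n (N : probability (borelV R n) R) (S : 'M[R]_n) (a : 'cV[R]_n) :
  gaussian_char N S -> exists N' : probability (borelV R n) R, gaussian_char N' (S + a *m a^T).
Proof.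
move=> hN; pose Q : probability (measurableTypeR R) R := normal_prob 0 1.
pose NQ : probability (borelV R n * measurableTypeR R)%type R := (N \x Q)%E.
pose phi (z : borelV R n * measurableTypeR R) : borelV R n := (z.1 : 'cV[R]_n) + (z.2 : R) *: a.
have m1 i : measurable_fun setT (fun z : borelV R n * measurableTypeR R => (z.1 : 'cV[R]_n) i 0).
  by apply: (measurableT_comp (measurable_fun_coord i)); exact: measurable_fst.
have m2 : measurable_fun setT (fun z : borelV R n * measurableTypeR R => z.2 : R).
  exact: measurable_snd.
have mphi : measurable_fun setT phi.
  apply: measurable_fun_cV => // i.
  apply: (eq_measurable_fun (fun z : borelV R n * measurableTypeR R =>
    (z.1 : 'cV[R]_n) i 0 + z.2 * a i 0)) => [z _|]; first by rewrite !mxE.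
  by apply: measurable_funD => //; exact: measurable_funM.
exists (image_prob NQ mphi) => c t.
have mc : measurable_fun setT ((fun x : 'cV[R]_n => cos (c + dotv t x)) \o phi).
  by apply: measurableT_comp; [exact: measurable_cos_dotv|exact: mphi].
have ic : itg NQ ((fun x : 'cV[R]_n => cos (c + dotv t x)) \o phi).
  apply: (@itg_bounded _ _ _ NQ 1) => // z.
  by rewrite /= ler_norml cos_geN1 cos_le1.
rewrite Ex_image//; last exact: measurable_cos_dotv.
have inner (x : 'cV[R]_n) : Ex Q (fun z => cos (c + dotv t (phi (x, z)))) =
    cos (c + dotv t x) * expR (- (dotv t a ^+ 2 / 2)).
  have -> : (fun z => cos (c + dotv t (phi (x, z)))) = (fun z => cos ((c + dotv t x) + dotv t a * z)).
    by apply/funext => z; rewrite /phi/= dotvDr dotvZr addrA [z * _]mulrC.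
  by rewrite normal_characteristic ?oner_eq0// expr1n mul1r.
have e : (\int[NQ]_z (cos (c + dotv t (phi z)))%:E)%E =
    (\int[N]_x (cos (c + dotv t x) * expR (- (dotv t a ^+ 2 / 2)))%:E)%E.
  rewrite -(integral12_prod_meas1 ic); apply: eq_integral => x _; rewrite /fubini_F.
  rewrite -inner ExE//; apply: (@itg_bounded _ _ _ Q 1) => [|z].
    exact: (measurableT_comp mc (measurable_pair1 x)).
  by rewrite /= ler_norml cos_geN1 cos_le1.
rewrite {1}/Rintegral [X in fine X]e.
under eq_integral do rewrite mulrC.
rewrite -/(Rintegral _ _ _) ExZ; last exact: itg_cos_dotv.
rewrite hN mulrCA -expRD; congr (_ * expR _).
have -> : dotv t ((S + a *m a^T) *m t) = dotv t (S *m t) + dotv t a ^+ 2.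
  rewrite mulmxDl dotvDr -mulmxA; congr (_ + _).
  rewrite (mx11_scalar (a^T *m t)) mul_mx_scalar dotvZr -/(dotv a t).
  by rewrite (dotvC a t) expr2.
by rewrite mulrDl opprD addrC.
Qed.

(** Cholesky elimination by induction on the number k of rows that may be nonzero. A positive pivot
    is removed with a = S e / sqrt(S o o), leaving a Schur complement that is nonnegative by
    [psd_CS]; [gaussian_rank1] restores each removed term. *)
Lemma gaussian_exists n (S : 'M[R]_n) : psd S ->
  exists N : probability (borelV R n) R, gaussian_char N S.
Proof.
have H k : forall S : 'M[R]_n, psd S -> (forall i j : 'I_n, (k <= i)%N -> S i j = 0) ->
    exists N : probability (borelV R n) R, gaussian_char N S.
  elim: k => [|k IH] {}S pS S0.
    have -> : S = 0 by apply/matrixP => i j; rewrite mxE S0.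
    by exists (dirac (0 : borelV R n)); exact: gaussian_dirac.
  have [kn|kn] := ltnP k n; last first.
    apply: IH => // i j ki; exfalso; have := ltn_ord i; lia.
  pose o := Ordinal kn; pose e : 'cV[R]_n := delta_mx o 0.
  have [Ssym Sge0] := pS.
  have eS x : dotv e (S *m x) = (S *m x) o 0 by rewrite dotv_delta.
  have Se i : (S *m e) i 0 = S i o.
    rewrite mxE (bigD1 o)//= mxE !eqxx mulr1 big1 ?addr0// => j jo.
    by rewrite mxE (negbTE jo) mulr0.
  have Sij i j : S i j = S j i by rewrite -{1}Ssym mxE.
  (* A zero diagonal entry of a nonnegative form kills its whole row, by Cauchy-Schwarz with basis
     vectors. *)
  have [Soo|Soo] := eqVneq (S o o) 0.
    apply: IH => // i j; rewrite leq_eqVlt => /orP[/eqP ki|]; last exact: S0.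
    have -> : i = o by apply/val_inj.
    have := @psd_CS n S (delta_mx j 0) e pS.
    rewrite (eS e) Se Soo mulr0 eS mxE (bigD1 j)//= mxE !eqxx mulr1 big1 ?addr0; last first.
      by move=> l lj; rewrite mxE (negbTE lj) mulr0.
    by move=> h; apply/eqP; rewrite -sqrf_eq0 eq_le h sqr_ge0.
  have Soo0 : 0 < S o o by rewrite lt_def Soo -Se -eS Sge0.
  pose a := (Num.sqrt (S o o))^-1 *: (S *m e).
  have aa : a *m a^T = (S o o)^-1 *: ((S *m e) *m (S *m e)^T).
    rewrite /a linearZ/= -scalemxAl -scalemxAr scalerA -invfM.
    by rewrite -expr2 sqr_sqrtr ?(ltW Soo0).
  have aaij i j : (a *m a^T) i j = (S o o)^-1 * (S i o * S j o).
    by rewrite aa mxE [X in _ * X]mxE big_ord1 [X in _ * (_ * X)]mxE !Se.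
  have -> : S = (S - a *m a^T) + a *m a^T by rewrite subrK.
  have [||N hN] := IH (S - a *m a^T); last by exact: gaussian_rank1 hN.
    split.
      rewrite linearB/= Ssym; congr (_ - _); by rewrite trmx_mul trmxK.
    move=> x; rewrite mulmxBl dotvBr.
    have -> : dotv x (a *m a^T *m x) = (S o o)^-1 * dotv e (S *m x) ^+ 2.
      rewrite -mulmxA (mx11_scalar (a^T *m x)) mul_mx_scalar dotvZr -/(dotv a x) (dotvC x a) -expr2.
      rewrite /a dotvZl exprMn exprVn sqr_sqrtr ?(ltW Soo0)//.
      by rewrite [dotv (S *m e) x]dotvC dotv_mulmx Ssym dotvC.
    have := psd_CS x e pS; rewrite [dotv e (S *m e)]eS Se => h.
    by rewrite subr_ge0 mulrC ler_pdivrMr.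
  move=> i j; rewrite leq_eqVlt => /orP[/eqP ki|ki].
    have -> : i = o by apply/val_inj.
    by rewrite mxE [X in _ + X]mxE aaij mulKf// (Sij o) subrr.
  by rewrite mxE [X in _ + X]mxE aaij (S0 i j ki) (S0 i o ki) mul0r mulr0 subr0.
by move=> pS; apply: (H n) => // i j; rewrite leqNgt ltn_ord.
Qed.

(** The image of N under <t, x> has the characteristic function of the normal law on the line, a
    point mass when the variance is zero; [law_determined] identifies the two. *)
Lemma gaussian_is_normal n (N : probability (borelV R n) R) (S : 'M[R]_n) :
  psd S -> gaussian_char N S -> is_normal N 0 S.
Proof.
move=> pS hN t B mB; rewrite dotv0r /normal1.
have md : measurable_fun setT (fun x : borelV R n => dotv t x : measurableTypeR R).
  by apply: continuous_measurable_borelV; exact: continuous_dotv.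
pose L : probability (measurableTypeR R) R := image_prob N md.
have LE : forall c u : R, Ex L (fun x => cos (c + u * x)) =
    cos c * expR (- (dotv t (S *m t) * u ^+ 2 / 2)).
  move=> c u.
  have mc : measurable_fun setT (fun x : measurableTypeR R => cos (c + u * (x : R))).
    apply: measurableT_comp; first exact: (continuous_measurable_fun (@continuous_cos R)).
    by apply: measurable_funD => //; exact: measurable_funM.
  rewrite Ex_image//; last first.
    apply: (@itg_bounded _ _ _ N 1); first exact: measurableT_comp mc md.
    by move=> x; rewrite /= ler_norml cos_geN1 cos_le1.
  have := hN c (u *: t); rewrite -scalemxAr dotvZl dotvZr.
  have -> : u * (u * dotv t (S *m t)) = dotv t (S *m t) * u ^+ 2 by ring.
  by move=> <-; apply: eq_Ex => x /=; rewrite dotvZl.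
have -> : N [set x : 'cV[R]_n | B (dotv t x)] = L B by [].
have [v0|v0] := eqVneq (dotv t (S *m t)) 0.
  apply: (@law_determined _ L (dirac (0 : measurableTypeR R))) => // c u.
  rewrite LE v0 mul0r mul0r oppr0 expR0 mulr1 /Rintegral integral_dirac//.
    by rewrite diracT mul1e/= mulr0 addr0.
  apply/measurable_EFinP; apply: measurableT_comp.
    exact: (continuous_measurable_fun (@continuous_cos R)).
  by apply: measurable_funD => //; exact: measurable_funM.
have vpos : 0 < dotv t (S *m t) by rewrite lt_def v0 pS.2.
apply: (@law_determined _ L (normal_prob 0 (Num.sqrt (dotv t (S *m t))))) => // c u.
rewrite LE normal_characteristic ?gt_eqF ?sqrtr_gt0//.
by rewrite sqr_sqrtr ?(ltW vpos).
Qed.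

End Gaussian.

(** * Covariance matrices and change of measure *)

Section CovarianceMatrix.
Context {R : realType} d (T : measurableType d) (Q : probability T R) (n : nat).
Variable V : T -> 'cV[R]_n.
Hypotheses (mV : forall i, measurable_fun setT (fun x => V x i 0))
  (iV2 : forall i, itg Q (fun x => V x i 0 ^+ 2)).

Let iV i : itg Q (fun x => V x i 0). Proof. by apply: itg_sqr. Qed.

Let iVV i j : itg Q (fun x => V x i 0 * V x j 0). Proof. by apply: itg_mul. Qed.

Lemma itg_dotv t : itg Q (fun x => dotv t (V x)).
Proof.
apply: (@eq_itg _ _ _ Q (fun x => \sum_i t i 0 * V x i 0)) => [x|]; first by rewrite dotvE.
by apply: itg_sum => i; exact: itgZ.
Qed.

Let dotv_sqrE (t : 'cV[R]_n) x : dotv t (V x) ^+ 2 =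
  \sum_i \sum_j (t i 0 * t j 0) * (V x i 0 * V x j 0).
Proof.
rewrite dotvE expr2 mulr_suml; apply: eq_bigr => i _; rewrite mulr_sumr.
by apply: eq_bigr => j _; ring.
Qed.

Lemma itg_dotv_sqr t : itg Q (fun x => dotv t (V x) ^+ 2).
Proof.
apply: (@eq_itg _ _ _ Q (fun x => \sum_i \sum_j (t i 0 * t j 0) * (V x i 0 * V x j 0))) => [x|].
  by rewrite dotv_sqrE.
by apply: itg_sum => i; apply: itg_sum => j; exact: itgZ.
Qed.

Lemma covmxE i j : covmx Q V i j =
  Ex Q (fun x => V x i 0 * V x j 0) - Ex Q (fun x => V x i 0) * Ex Q (fun x => V x j 0).
Proof.
rewrite mxE covariance.unlock expectation.unlock -/(Ex Q (fun x => V x i 0)) -/(Ex Q (fun x => V x j 0)).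
set a := Ex Q _; set b := Ex Q (fun x => V x j 0).
have e x : (((fun x => V x i 0) \- cst a) * ((fun x => V x j 0) \- cst b)) x =
    V x i 0 * V x j 0 - (a * V x j 0 + b * V x i 0 - a * b).
  by transitivity ((V x i 0 - a) * (V x j 0 - b)) => //; ring.
rewrite -/(Ex Q _) (eq_Ex _ e).
rewrite ExB//; last by apply: itgB; [apply: itgD; exact: itgZ|exact: itg_cst].
rewrite ExB; [|by apply: itgD; exact: itgZ|exact: itg_cst].
rewrite ExD; [|exact: itgZ..].
by rewrite (Ex_cst Q (a * b)) !ExZ// -/a -/b; ring.
Qed.

Lemma dotv_covmx t : dotv t (covmx Q V *m t) =
  Ex Q (fun x => dotv t (V x) ^+ 2) - Ex Q (fun x => dotv t (V x)) ^+ 2.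
Proof.
have -> : Ex Q (fun x => dotv t (V x)) = \sum_i t i 0 * Ex Q (fun x => V x i 0).
  transitivity (Ex Q (fun x => \sum_i t i 0 * V x i 0)).
    by apply: eq_Ex => x; rewrite dotvE.
  by rewrite Ex_sum => [|i]; [apply: eq_bigr => i _; rewrite ExZ|exact: itgZ].
rewrite (eq_Ex _ (dotv_sqrE t)) Ex_sum; last by move=> i; apply: itg_sum => j; exact: itgZ.
rewrite dotvE expr2 mulr_suml -sumrB; apply: eq_bigr => i _.
rewrite Ex_sum; last by move=> j; exact: itgZ.
rewrite mxE !mulr_sumr -sumrB; apply: eq_bigr => j _.
by rewrite ExZ// covmxE; ring.
Qed.

Lemma psd_covmx : psd (covmx Q V).
Proof.
split=> [|t]; first by apply/matrixP => i j; rewrite mxE !covmxE mulrC; congr (_ - _); apply: eq_Ex => x; rewrite mulrC.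
rewrite dotv_covmx; set m := Ex Q (fun x => dotv t (V x)).
have : 0 <= Ex Q (fun x => (dotv t (V x) - m) ^+ 2) by apply: Ex_ge0 => x; exact: sqr_ge0.
have -> : Ex Q (fun x => (dotv t (V x) - m) ^+ 2) =
    Ex Q (fun x => dotv t (V x) ^+ 2 - (2 * m * dotv t (V x) - m ^+ 2)).
  by apply: eq_Ex => x; ring.
have i1 := itg_dotv_sqr t; have i2 := itg_dotv t.
rewrite ExB//; last by apply: itgB; [exact: itgZ|exact: itg_cst].
rewrite ExB; [|exact: itgZ|exact: itg_cst].
rewrite (Ex_cst Q (m ^+ 2)) ExZ// -/m; lra.
Qed.

Lemma mxtrace_covmx : \tr (covmx Q V) =
  Ex Q (fun x => enorm (V x) ^+ 2) - enorm (\col_i Ex Q (fun x => V x i 0)) ^+ 2.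
Proof.
rewrite enorm_sqr dotvE.
have -> : Ex Q (fun x => enorm (V x) ^+ 2) = Ex Q (fun x => \sum_i V x i 0 * V x i 0).
  by apply: eq_Ex => x; rewrite enorm_sqr dotvE.
rewrite Ex_sum// -sumrB; apply: eq_bigr => i _.
by rewrite covmxE !mxE.
Qed.

End CovarianceMatrix.

Section LinearImage.
Context {R : realType} d (T : measurableType d) (Q : probability T R) (n k : nat).
Variables (V : T -> 'cV[R]_n) (B : 'M[R]_(k, n)).
Hypotheses (mV : forall i, measurable_fun setT (fun x => V x i 0))
  (iV2 : forall i, itg Q (fun x => V x i 0 ^+ 2)).

Let mulE i x : (B *m V x) i 0 = dotv (B^T *m delta_mx i 0) (V x).
Proof. by rewrite -dotv_mulmx dotv_delta. Qed.

Lemma itg_mulmx_coord_sqr i : itg Q (fun x => (B *m V x) i 0 ^+ 2).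
Proof.
apply: (@eq_itg _ _ _ Q (fun x => dotv (B^T *m delta_mx i 0) (V x) ^+ 2)) => [x|].
  by rewrite mulE.
exact: itg_dotv_sqr.
Qed.

Lemma dotv_covmx_mulmx t : dotv t (covmx Q (fun x => B *m V x) *m t) =
  dotv (B^T *m t) (covmx Q V *m (B^T *m t)).
Proof.
rewrite !dotv_covmx//; last 2 first.
- by move=> i; exact: measurable_mulmx.
- exact: itg_mulmx_coord_sqr.
by congr (_ - _ ^+ 2); apply: eq_Ex => x; rewrite dotv_mulmx.
Qed.

Lemma Ex_mulmx_coord i : Ex Q (fun x => (B *m V x) i 0) = (B *m (\col_j Ex Q (fun x => V x j 0))) i 0.
Proof.
have iV j : itg Q (fun x => V x j 0) by apply: itg_sqr.
transitivity (Ex Q (fun x => \sum_j B i j * V x j 0)); first by apply: eq_Ex => x; rewrite mxE.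
rewrite Ex_sum => [|j]; last exact: itgZ.
by rewrite mxE; apply: eq_bigr => j _; rewrite ExZ// mxE.
Qed.

End LinearImage.

Section ChangeOfMeasure.
Context {R : realType} d (T : measurableType d) (PP Q : probability T R) (lx : T -> R).
Hypotheses (mlx : measurable_fun setT lx) (lx0 : forall x, 0 <= lx x)
  (PPE : forall B, measurable B -> PP B = (\int[Q]_(x in B) (lx x)%:E)%E).

Let nonneg (g : T -> R) : (forall x, 0 <= g x) -> itg PP g ->
  itg Q (fun x => lx x * g x) /\ Ex Q (fun x => lx x * g x) = Ex PP g.
Proof.
move=> g0 ig; have mg := itg_measurable ig.
have h : (\int[Q]_x (lx x * g x)%:E)%E = (Ex PP g)%:E.
  rewrite -ExE// (ge0_integral_density mlx PPE) => [||x]; last by rewrite lee_fin.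
    by apply: eq_integral => x _; rewrite mulrC EFinM.
  exact/measurable_EFinP.
split; last by rewrite /Rintegral h.
apply/integrableP; split; first by apply/measurable_EFinP; exact: measurable_funM.
under eq_integral do rewrite /= ger0_norm ?mulr_ge0//.
by rewrite h ltry.
Qed.

Lemma itg_density g : itg PP g -> itg Q (fun x => lx x * g x).
Proof.
move=> ig; have in_ := itg_norm ig.
have [i1 _] := nonneg (fun x => normr_ge0 (g x)) in_.
apply: itg_le i1.
  by apply: measurable_funM => //; exact: itg_measurable ig.
by move=> x; rewrite normrM (ger0_norm (lx0 x)).
Qed.

Lemma Ex_density g : itg PP g -> Ex Q (fun x => lx x * g x) = Ex PP g.
Proof.
move=> ig; have in_ := itg_norm ig.
have [i1 e1] := nonneg (fun x => normr_ge0 (g x)) in_.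
(* The signed integrand is |g| + g minus |g|, both nonnegative. *)
have h0 x : 0 <= `|g x| + g x by have := ler_norm (- g x); rewrite normrN; lra.
have [i2 e2] := nonneg h0 (itgD in_ ig).
have e : (fun x => lx x * g x) = (fun x => lx x * (`|g x| + g x) - lx x * `|g x|).
  by apply/funext => x; ring.
by rewrite e ExB// e1 e2 ExD// addrAC subrr add0r.
Qed.

Lemma ge0_integral_lratio (g : T -> R) : measurable_fun setT g -> (forall x, 0 <= g x) ->
  (\int[Q]_x (lx x * g x)%:E = \int[PP]_x (g x)%:E)%E.
Proof.
move=> mg g0; rewrite (ge0_integral_density mlx PPE) => [||x]; last by rewrite lee_fin.
  by apply: eq_integral => x _; rewrite mulrC EFinM.
exact/measurable_EFinP.
Qed.

End ChangeOfMeasure.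

(** * Step sizes *)

Section StepSizes.
Context {R : realType}.

(** [a k] stands for alpha_(k+1). The field [step_inv] reflects gamma < 1, while [step_sqr] and
    [step_sqrt] reflect gamma > 1/2. *)
Record step_sizes (a : nat -> R) : Prop := StepSizes {
  step_gt0 : forall k, 0 < a k;
  step_le : forall k, a k.+1 <= a k;
  step_inv : forall e : R, 0 < e -> exists N, forall k, (N <= k)%N -> (a k.+1)^-1 - (a k)^-1 <= e;
  step_unbounded : unbounded_partial_sums a;
  step_sqr : cauchy_partial_sums (fun k => a k ^+ 2);
  step_sqrt : forall e : R, 0 < e -> exists N, forall k, (N <= k)%N -> a k * Num.sqrt k.+1%:R <= e }.

Variable a : nat -> R.
Hypothesis ha : step_sizes a.
Let a0 := step_gt0 ha.

(** Eventually a_k <= (e/4) / sqrt(k+1), and 1 / sqrt(k+1) is at most twice sqrt(k+1) - sqrt(k),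
    which telescopes. *)
Lemma step_lt_sqrt (e : R) : 0 < e -> exists N, forall n, (N <= n)%N -> \sum_(k < n) a k <= e * Num.sqrt n%:R.
Proof.
move=> e0; have [N hN] := step_sqrt ha (divr_gt0 e0 (ltr0n R 4)).
have step k : (N <= k)%N -> a k <= e / 2 * (Num.sqrt k.+1%:R - Num.sqrt k%:R).
  move=> Nk; have s0 : 0 < Num.sqrt k.+1%:R :> R by rewrite sqrtr_gt0 ltr0n.
  rewrite -(ler_pM2r s0) (le_trans (hN k Nk))//.
  have s1 : 0 <= Num.sqrt k%:R :> R by exact: sqrtr_ge0.
  have e1 : Num.sqrt k.+1%:R ^+ 2 = k%:R + 1 :> R by rewrite sqr_sqrtr ?ler0n// natr1.
  have e2 : Num.sqrt k%:R ^+ 2 = k%:R :> R by rewrite sqr_sqrtr ?ler0n.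
  move: s0 s1 e1 e2; set u := Num.sqrt k.+1%:R; set v := Num.sqrt k%:R => u0 v0 uE vE.
  have h : 1 / 2 <= (u - v) * u.
    have : 0 <= (u - v) ^+ 2 by exact: sqr_ge0.
    rewrite !expr2 in uE vE *; lra.
  by rewrite -mulrA; have := ler_wpM2l (ltW e0) h; lra.
have bound n : (N <= n)%N -> \sum_(k < n) a k <= \sum_(k < N) a k + e / 2 * Num.sqrt n%:R.
  elim: n => [|n IH].
    by rewrite leqn0 => /eqP ->; rewrite lerDl mulr_ge0 ?sqrtr_ge0// divr_ge0// ltW.
  rewrite leq_eqVlt => /orP[/eqP <-|]; first by rewrite lerDl mulr_ge0 ?sqrtr_ge0// divr_ge0// ltW.
  rewrite ltnS => Nn; rewrite big_ord_recr/=; have := IH Nn; have := step n Nn; lra.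
pose C := \sum_(k < N) a k.
have C0 : 0 <= C by apply: sumr_ge0 => k _; exact: ltW.
exists (maxn N (Num.truncn ((2 * C / e) ^+ 2)).+1) => n; rewrite geq_max => /andP[Nn Kn].
have := bound n Nn; suff : C <= e / 2 * Num.sqrt n%:R by rewrite /C; lra.
have h : 2 * C / e <= Num.sqrt n%:R.
  have c0 : 0 <= 2 * C / e by rewrite divr_ge0 ?mulr_ge0// ltW.
  rewrite -[2 * C / e]ger0_norm// -sqrtr_sqr ler_wsqrtr//.
  by rewrite (le_trans (ltW (truncnS_gt _)))// ler_nat.
move: h; rewrite ler_pdivrMr//; lra.
Qed.

Lemma step_inv_sublinear (e : R) : 0 < e -> exists N, forall n, (N <= n)%N -> (a n)^-1 <= e * n%:R.
Proof.
move=> e0; have e20 : 0 < e / 2 by rewrite divr_gt0.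
have [N hN] := step_inv ha e20.
have bound n : (N <= n)%N -> (a n)^-1 <= (a N)^-1 + e / 2 * n%:R.
  elim: n => [|n IH].
    by rewrite leqn0 => /eqP ->; rewrite mulr0 addr0.
  rewrite leq_eqVlt => /orP[/eqP <-|]; first by rewrite lerDl mulr_ge0 ?ler0n// ltW.
  rewrite ltnS => Nn; have := IH Nn; have := hN n Nn.
  rewrite -natr1; set t := (a n.+1)^-1; set t' := (a n)^-1; set t'' := (a N)^-1; lra.
exists (maxn N (Num.truncn (2 * (a N)^-1 / e)).+1) => n; rewrite geq_max => /andP[Nn Kn].
have := bound n Nn.
have : 2 * (a N)^-1 / e <= n%:R by rewrite (le_trans (ltW (truncnS_gt _)))// ler_nat.
rewrite ler_pdivrMr//; set t := (a n)^-1; set t'' := (a N)^-1; lra.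
Qed.

Lemma step_small (e : R) : 0 < e -> exists N, forall k, (N <= k)%N -> a k <= e.
Proof.
move=> e0; have [N hN] := step_sqrt ha e0; exists N => k /hN; apply: le_trans.
rewrite ler_peMr ?(ltW (a0 k))// -[leLHS]sqrtr1 ler_wsqrtr// ler1n//.
Qed.

Lemma step_decrease (c : R) : 0 < c -> exists N, forall k, (N <= k)%N ->
  a k - a k.+1 <= c * a k ^+ 2.
Proof.
move=> c0; have [N hN] := step_inv ha c0; exists N => k Nk.
have -> : a k - a k.+1 = (a k * a k.+1) * ((a k.+1)^-1 - (a k)^-1).
  by field; rewrite !gt_eqF.
rewrite mulrC; apply: ler_pM; [|by rewrite mulr_ge0 ?ltW|exact: hN|].
  by rewrite subr_ge0 lef_pV2 ?posrE// step_le.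
by rewrite expr2 ler_pM2l// step_le.
Qed.

(** A Chung-type recursion: if M <= K c and a_n - a_(n+1) <= c a_n^2, then (1 - 2 c a_n) K a_n + M
    a_n^2 <= K a_n - K c a_n^2 <= K a_(n+1). The constant K is fixed before the sequence d. *)
Lemma step_rate (c M : R) : 0 < c -> 0 <= M -> exists N0, forall N, (N0 <= N)%N ->
  forall D, exists2 K, 0 <= K & forall d : nat -> R, (forall k, 0 <= d k) -> d N <= D ->
  (forall n, (N <= n)%N -> d n.+1 <= (1 - 2 * c * a n) * d n + a n ^+ 2 * M) ->
  forall n, (N <= n)%N -> d n <= K * a n.
Proof.
move=> c0 M0; have [N1 h1] := step_decrease c0.
have [N2 h2] := step_small (divr_gt0 ltr01 (mulr_gt0 (ltr0n R 2) c0)).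
exists (maxn N1 N2) => N; rewrite geq_max => /andP[N1N N2N] D.
(* One entry absorbs the noise level M, the other the initial value at N. *)
pose K := Num.max (M / c) (D / a N).
have KM : M <= K * c by rewrite -ler_pdivrMr// le_max lexx.
have K0 : 0 <= K by rewrite le_max divr_ge0// ltW.
exists K => // d d0 dN hd n; elim: n => [|n IH].
  rewrite leqn0 => /eqP <-; rewrite (le_trans dN)// -ler_pdivrMr// le_max lexx orbT//.
rewrite leq_eqVlt => /orP[/eqP <-|].
  by rewrite (le_trans dN)// -ler_pdivrMr// le_max lexx orbT.
rewrite ltnS => Nn; apply: (le_trans (hd n Nn)).
have an := a0 n.
have s1 : 0 <= 1 - 2 * c * a n.
  have := h2 n (leq_trans N2N Nn); rewrite ler_pdivlMr ?mulr_gt0//; lra.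
have := ler_wpM2l s1 (IH Nn).
have := ler_wpM2l K0 (h1 n (leq_trans N1N Nn)).
have := ler_wpM2l (sqr_ge0 (a n)) KM.
rewrite !expr2; lra.
Qed.

(** With x and y the square roots of 1/a_(k+1) and 1/a_k it reads (x^2 - y^2)/x <= 2 (x - y) for y
    <= x. It sums the Abel increments of 1/a against distances of order sqrt(a). *)
Lemma sqrt_telescope k : Num.sqrt (a k.+1) * ((a k.+1)^-1 - (a k)^-1) <=
  2 * (Num.sqrt (a k.+1)^-1 - Num.sqrt (a k)^-1).
Proof.
have x0 : 0 < Num.sqrt (a k.+1)^-1 by rewrite sqrtr_gt0 invr_gt0.
have y0 : 0 <= Num.sqrt (a k)^-1 by exact: sqrtr_ge0.
have e1 : Num.sqrt (a k.+1) = (Num.sqrt (a k.+1)^-1)^-1 by rewrite -sqrtrV ?ltW ?invr_gt0// invrK.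
have e2 : (a k.+1)^-1 = Num.sqrt (a k.+1)^-1 ^+ 2 by rewrite sqr_sqrtr// ltW// invr_gt0.
have e3 : (a k)^-1 = Num.sqrt (a k)^-1 ^+ 2 by rewrite sqr_sqrtr// ltW// invr_gt0.
have xy : Num.sqrt (a k)^-1 <= Num.sqrt (a k.+1)^-1.
  by rewrite ler_wsqrtr// lef_pV2 ?posrE// step_le.
rewrite e1 [X in X - _]e2 [X in _ - X]e3.
move: x0 y0 xy; move: (Num.sqrt (a k.+1)^-1) (Num.sqrt (a k)^-1) => x y x0 y0 yx.
rewrite mulrC ler_pdivrMr//; nra.
Qed.

End StepSizes.

Section PowerSteps.
Context {R : realType}.
Variables alpha0 gamma : R.
Hypotheses (alpha0_gt0 : 0 < alpha0) (gamma_bounds : 2^-1 < gamma < 1).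

Let a k := alpha0 / k.+1%:R `^ gamma.

Let g0 : 0 < gamma. Proof. by have /andP[h _] := gamma_bounds; rewrite (lt_trans _ h). Qed.

Let powle (x y : R) : 0 < x -> x <= y -> x `^ gamma <= y `^ gamma.
Proof. by move=> x0 xy; apply: ge0_ler_powR => //; rewrite ?nnegrE ltW// (lt_le_trans x0). Qed.

Let pow_inv_small (dl e : R) : 0 < dl -> 0 < e -> exists N, forall k, (N <= k)%N ->
  ((k.+1%:R : R) `^ dl)^-1 <= e.
Proof.
move=> dl0 e0; pose y := e^-1 `^ dl^-1.
have y0 : 0 < y by apply: powR_gt0; rewrite invr_gt0.
exists (Num.truncn y) => k hk.
rewrite -[leRHS]invrK lef_pV2 ?posrE ?invr_gt0 ?powR_gt0 ?ltr0n//.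
have -> : e^-1 = y `^ dl by rewrite /y -powRrM mulVf ?gt_eqF// powRr1// invr_ge0 ltW.
apply: ge0_ler_powR; rewrite ?nnegrE ?(ltW dl0) ?(ltW y0) ?ler0n//.
by rewrite (le_trans (ltW (truncnS_gt _)))// ler_nat.
Qed.

Let pow_sub (x r : R) : 0 < x -> x `^ (1 - r) = x / x `^ r.
Proof. by move=> x0; rewrite powRB ?powRr1 ?(ltW x0)// (gt_eqF x0) implybT. Qed.

(** An integral test in telescoping form: 1/x^(1 + dl) is compared with the decrease of x^(-dl) from
    x - 1 to x, where dl = 2 gamma - 1. *)
Let sqr_telescope k : a k.+1 ^+ 2 <= alpha0 ^+ 2 / (2 * gamma - 1) *
  ((k.+1%:R `^ (2 * gamma - 1))^-1 - (k.+2%:R `^ (2 * gamma - 1))^-1).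
Proof.
have /andP[g2 g1] := gamma_bounds.
set dl := 2 * gamma - 1; have dl0 : 0 < dl by rewrite /dl; lra.
set x : R := k.+2%:R; have x0 : 0 < x by rewrite ltr0n.
have x1 : k.+1%:R = x - 1 :> R by rewrite /x -[in RHS]natr1 addrK.
have x10 : 0 < x - 1 by rewrite -x1 ltr0n.
have e1 : a k.+1 ^+ 2 = alpha0 ^+ 2 * ((x `^ dl)^-1 / x).
  rewrite /a -/x exprMn exprVn -[(x `^ gamma) ^+ 2]powR_mulrn ?powR_ge0// -powRrM -invfM.
  congr (_ * _^-1); rewrite (_ : gamma * 2%:R = dl + 1); last by rewrite /dl; ring.
  by rewrite powRD ?(gt_eqF x0) ?implybT// powRr1 ?(ltW x0).
rewrite e1 -mulrA ler_wpM2l ?sqr_ge0// x1.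
rewrite ler_pdivlMl//.
(* The inequality exp(u) >= 1 + u at u = - dl ln(1 - 1/x), together with ln(1 - 1/x) <= -1/x. *)
have key : (x `^ dl)^-1 * (1 + dl / x) <= ((x - 1) `^ dl)^-1.
  rewrite -[leLHS]mulrC.
  have -> : ((x - 1) `^ dl)^-1 = expR (- dl * ln (1 - x^-1)) * (x `^ dl)^-1.
    have t0 : 0 < 1 - x^-1 by rewrite subr_gt0 invf_lt1//; lra.
    have -> : x - 1 = (1 - x^-1) * x by rewrite mulrBl mul1r mulVf// gt_eqF.
    rewrite powRM ?(ltW t0) ?(ltW x0)// invfM mulNr expRN; congr (_^-1 * _).
    by rewrite /powR gt_eqF.
  rewrite ler_wpM2r ?invr_ge0 ?powR_ge0// (le_trans _ (expR_ge1Dx _))// lerD2l.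
  have := @le_ln1Dx R (- x^-1); rewrite ltrN2 invf_lt1// => h.
  have : ln (1 - x^-1) <= - x^-1 by apply: h; lra.
  by rewrite mulNr -mulrN ler_pM2l// lerNr.
have -> : dl * ((x `^ dl)^-1 / x) = (x `^ dl)^-1 * (1 + dl / x) - (x `^ dl)^-1 by ring.
by rewrite lerD2r.
Qed.

Lemma power_step_sizes : step_sizes a.
Proof.
have /andP[g2 g1] := gamma_bounds.
have a0 k : 0 < a k by rewrite divr_gt0.
have ale k : a k.+1 <= a k by rewrite ler_pM2l// lef_pV2 ?posrE// powle ?ltr0n// ler_nat.
split => //.
- move=> e e0; have g10 : 0 < 1 - gamma by lra.
  have [N hN] := pow_inv_small g10 (mulr_gt0 e0 alpha0_gt0).
  exists N => k Nk; rewrite /a !invfM !invrK -mulrBr mulrC ler_pdivrMr//.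
  apply: le_trans (hN k Nk).
  set x : R := k.+1%:R; have x0 : 0 < x by rewrite ltr0n.
  have -> : k.+2%:R = (1 + x^-1) * x :> R by rewrite mulrDl mul1r mulVf ?gt_eqF// natr1.
  rewrite powRM ?ler0n//; last by rewrite addr_ge0// invr_ge0 ltW.
  (* As gamma <= 1, this bounds the increment of x^gamma by x^(gamma - 1). *)
  have h : (1 + x^-1) `^ gamma <= 1 + x^-1.
    by apply: ler1_powR; [rewrite lerDl invr_ge0 ltW|exact: ltW].
  rewrite pow_sub// invf_div.
  by have := ler_wpM2r (powR_ge0 x gamma) h; rewrite mulrDl mul1r [x^-1 * _]mulrC lerBlDl.
- move=> K; have g10 : 0 < 1 - gamma by lra.
  have K0 : 0 < (`|K| + 1) / alpha0 by rewrite divr_gt0// ltr_pwDr.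
  have [N hN] := pow_inv_small g10 (eqbRL (invr_gt0 _) K0).
  exists N.+1; have := hN N (leqnn _).
  rewrite lef_pV2 ?posrE ?powR_gt0 ?ltr0n// pow_sub ?ltr0n// => h.
  (* The terms decrease, so the sum is at least alpha0 (N+1)^(1 - gamma). *)
  have sm : N.+1%:R * a N <= \sum_(k < N.+1) a k.
    have anti k : (k <= N)%N -> a N <= a k.
      elim: N {hN h} => [|N IH]; first by rewrite leqn0 => /eqP ->.
      rewrite leq_eqVlt => /orP[/eqP -> //|]; rewrite ltnS => /IH; exact: le_trans.
    rewrite mulr_natl -[in leLHS](card_ord N.+1) -sumr_const; apply: ler_sum => k _.
    by apply: anti; rewrite -ltnS.
  apply: le_trans sm; rewrite /a mulrCA -ler_pdivrMl//.
  apply: le_trans h; rewrite mulrC ler_pM2r ?invr_gt0//.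
  by have := ler_norm K; lra.
- have dl0 : 0 < 2 * gamma - 1 by lra.
  move=> e e0; pose C := alpha0 ^+ 2 / (2 * gamma - 1).
  have C0 : 0 < C by rewrite divr_gt0// exprn_gt0.
  have [N hN] := pow_inv_small dl0 (divr_gt0 e0 C0).
  exists N.+1 => [[//|n]] m; rewrite ltnS => Nn nm.
  rewrite ger0_norm; last by apply: sumr_ge0 => k _; exact: sqr_ge0.
  have bound : \sum_(n.+1 <= k < m) a k ^+ 2 <=
      C * ((n.+1%:R `^ (2 * gamma - 1))^-1 - (m%:R `^ (2 * gamma - 1))^-1).
    elim: m nm => [//|m IH]; rewrite leq_eqVlt => /orP[/eqP <-|].
      by rewrite big_geq// subrr mulr0.
    rewrite ltnS => nm; rewrite big_nat_recr//=.
    case: m nm IH => [//|m] nm IH.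
    have := IH nm; have := sqr_telescope m; rewrite -/C; lra.
  apply: (le_trans bound); have := hN n Nn; rewrite ler_pdivlMr// => h.
  have : 0 <= (m%:R `^ (2 * gamma - 1))^-1 by rewrite invr_ge0 powR_ge0.
  move=> h2; rewrite mulrC; have := mulr_ge0 (ltW C0) h2; lra.
- move=> e e0; have g10 : 0 < gamma - 2^-1 by lra.
  have [N hN] := pow_inv_small g10 (divr_gt0 e0 alpha0_gt0).
  exists N => k Nk; have := hN k Nk; rewrite ler_pdivlMr//; apply: le_trans.
  rewrite /a mulrC mulrCA mulrC ler_pM2r//.
  rewrite -powR12_sqrt ?ler0n// powRB ?invf_div//.
  by rewrite pnatr_eq0 implybT.
Qed.

End PowerSteps.

(** * Expansion of the averaged gradient *)

Section DualAveraging.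
Context {R : realType} d (Omega : measurableType d) (P : probability Omega R).
Variables (p s : nat) (A : 'M[R]_(p, s)) (b : 'cV[R]_p) (ts x0 : 'cV[R]_s).
Variables (gens : nat -> set (set Omega)) (a : nat -> R).
Variables (x G : nat -> Omega -> 'cV[R]_s) (g : 'cV[R]_s -> 'cV[R]_s) (Hm : 'M[R]_s).
Variables (c1 c2 c3 D M2 : R).
Let Theta := polyhedron A b.
Let Q := projker (act_mx A b ts).
Let e k w := x k w - ts.
Let eta k w := G k w - g (x k w).

Hypotheses (hf : filtration gens) (ha : step_sizes a).
Hypothesis x_proj : forall k w, is_proj Theta (x0 - \sum_(j < k) a j *: G j w) (x k w).
Hypothesis x_adapted : forall k i, adapted gens k (fun w => x k w i 0).
Hypothesis g_adapted : forall k i, adapted gens k (fun w => g (x k w) i 0).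
Hypothesis eta_md : forall i, martingale_diff P gens (fun k w => eta k w i 0).
Hypothesis G_sqr : forall k, itg P (fun w => enorm (G k w) ^+ 2) /\
  Ex P (fun w => enorm (G k w) ^+ 2) <= M2.
Hypotheses (ts_in : Theta ts) (c1_gt0 : 0 < c1).
Hypothesis growth : forall y, Theta y -> c1 * enorm (y - ts) ^+ 2 <= dotv (g y) (y - ts).
Hypothesis lip : forall y, Theta y -> enorm (g y - g ts) <= c2 * enorm (y - ts).
Hypothesis multiplier : exists lam : 'cV[R]_#|active A b ts|,
  (forall i, 0 < lam i 0) /\ - g ts = (act_mx A b ts)^T *m lam.
Hypothesis taylor : forall y, Theta y ->
  enorm (g y - g ts - Hm *m (y - ts)) <= c3 * enorm (y - ts) ^+ 2.
Variable r0 : R.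
Hypotheses (r0_gt0 : 0 < r0) (cone : forall u, enorm u <= r0 ->
  (forall i, i \in active A b ts -> (A *m u) i 0 <= 0) -> polyhedron A b (ts + u)).
Hypothesis diameter : forall y, Theta y -> enorm (y - ts) <= D.

Let a0 := step_gt0 ha.

Let x_in k w : Theta (x k w). Proof. by have [] := x_proj k w. Qed.

Let e_le k w : enorm (e k w) <= D. Proof. exact: diameter. Qed.

Let D_ge0 : 0 <= D. Proof. by rewrite (le_trans _ (diameter ts_in))// enorm_ge0. Qed.

Let up k (X : Omega -> R) : adapted gens k X -> adapted gens k.+1 X.
Proof. exact: (@adapted_le _ _ _ gens k k.+1 X hf (leqnSn k)). Qed.

Let meas k (X : Omega -> R) : adapted gens k X -> measurable_fun setT X.
Proof. exact: (@adapted_measurable _ _ _ gens k X hf). Qed.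

Let e_adapted k i : adapted gens k (fun w => e k w i 0).
Proof.
apply: (eq_measurable_fun (fun w : g_sigma_algebraType (gens k) => x k w i 0 - ts i 0)) => [w _|].
  by rewrite !mxE.
by apply: measurable_funB => //; exact: x_adapted.
Qed.

Let adapted_dotv k (u v : Omega -> 'cV[R]_s) : (forall i, adapted gens k (fun w => u w i 0)) ->
  (forall i, adapted gens k (fun w => v w i 0)) -> adapted gens k (fun w => dotv (u w) (v w)).
Proof.
move=> hu hv.
apply: (eq_measurable_fun (fun w : g_sigma_algebraType (gens k) => \sum_i u w i 0 * v w i 0)) => [w _|].
  by rewrite dotvE.
have h i : measurable_fun setT (fun w : g_sigma_algebraType (gens k) => u w i 0 * v w i 0).
  by apply: measurable_funM; [exact: hu|exact: hv].
exact: measurable_sum.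
Qed.

Let adapted_enorm2 k (u : Omega -> 'cV[R]_s) : (forall i, adapted gens k (fun w => u w i 0)) ->
  adapted gens k (fun w => enorm (u w) ^+ 2).
Proof.
move=> hu.
apply: (eq_measurable_fun (fun w : g_sigma_algebraType (gens k) => dotv (u w) (u w))) => [w _|].
  by rewrite enorm_sqr.
exact: adapted_dotv.
Qed.

Let adapted_enorm k (u : Omega -> 'cV[R]_s) : (forall i, adapted gens k (fun w => u w i 0)) ->
  adapted gens k (fun w => enorm (u w)).
Proof.
move=> hu; rewrite /adapted /enorm.
apply: measurableT_comp; last exact: adapted_dotv.
apply: continuous_measurable_fun; exact: sqrt_continuous.
Qed.

Let eta_adapted k i : adapted gens k.+1 (fun w => eta k w i 0).
Proof. by have [h _ _] := eta_md i; exact: h. Qed.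

Let eta_sqr k : itg P (fun w => enorm (eta k w) ^+ 2).
Proof.
apply: (@eq_itg _ _ _ P (fun w => \sum_i eta k w i 0 ^+ 2)) => [w|].
  by rewrite enorm_sqr dotvE; apply: eq_bigr => i _; rewrite expr2.
by apply: itg_sum => i; have [_ h _] := eta_md i; exact: h.
Qed.

Let Kg := enorm (g ts) + `|c2| * D.

Let g_le y : Theta y -> enorm (g y) <= Kg.
Proof.
move=> hy; rewrite -[g y](subrK (g ts)) (le_trans (enormD _ _))// addrC lerD2l.
rewrite (le_trans (lip hy))// (le_trans (ler_norm _))// normrM ler_wpM2l//.
by rewrite ger0_norm ?enorm_ge0// diameter.
Qed.

Let KE := 2 * M2 + 2 * Kg ^+ 2.

Let eta_sqr_le k : Ex P (fun w => enorm (eta k w) ^+ 2) <= KE.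
Proof.
have [i1 h1] := G_sqr k.
apply: (@le_trans _ _ (Ex P (fun w => 2 * enorm (G k w) ^+ 2 + 2 * Kg ^+ 2))).
  apply: Ex_le => //; first by apply: itgD; [exact: itgZ|exact: itg_cst].
  move=> w; have h := g_le (x_in k w).
  have := enormB (G k w) (g (x k w)); rewrite -/(eta k w).
  have := enorm_ge0 (eta k w); have := enorm_ge0 (G k w); have := enorm_ge0 (g (x k w)).
  move: h; move: (enorm _) Kg (enorm (G k w)) (enorm (eta k w)) => u K v t uK u0 v0 t0 tuv.
  have : t ^+ 2 <= (v + u) ^+ 2 by rewrite ler_pXn2r ?nnegrE ?addr_ge0.
  have : u ^+ 2 <= K ^+ 2 by rewrite ler_pXn2r ?nnegrE// (le_trans u0).
  have := sqr_ge0 (v - u); rewrite !expr2; lra.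
rewrite ExD; [|exact: itgZ|exact: itg_cst].
by rewrite (Ex_cst P (2 * Kg ^+ 2)) ExZ// /KE; lra.
Qed.

Let dotv_eta_orthogonal k (u : Omega -> 'cV[R]_s) B : (forall i, adapted gens k (fun w => u w i 0)) ->
  (forall w, enorm (u w) <= B) ->
  itg P (fun w => dotv (eta k w) (u w)) /\ Ex P (fun w => dotv (eta k w) (u w)) = 0.
Proof.
move=> hu uB.
have E w : dotv (eta k w) (u w) = \sum_i u w i 0 * eta k w i 0.
  by rewrite dotvE; apply: eq_bigr => i _; rewrite mulrC.
have uB' i w : `|u w i 0| <= B by rewrite (le_trans (normr_le_enorm _ _)).
have ii i : itg P (fun w => u w i 0 * eta k w i 0).
  apply: (itgM_bounded _ (uB' i)); first by apply: (@meas k); exact: hu.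
  exact: (martingale_diff_itg k hf (eta_md i)).
split.
  by apply: (eq_itg (fun w => esym (E w))); exact: itg_sum.
rewrite (eq_Ex _ E) Ex_sum// big1// => i _.
exact: (martingale_diff_orthogonal hf (eta_md i) (hu i) (uB' i)).
Qed.

(** The error e_k is known at time k and bounded by D, so its pairing with the noise is again a
    square-integrable martingale difference. *)
Let dotv_eta_md : martingale_diff P gens (fun k w => a k * dotv (eta k w) (e k w)).
Proof.
split=> [k|k|k B FB].
- have h1 : adapted gens k.+1 (fun w => dotv (eta k w) (e k w)).
    by apply: adapted_dotv => i; [exact: eta_adapted|apply: up; exact: e_adapted].
  exact: measurable_funM (measurable_cst _) h1.
- apply: (itg_le (Y := fun w => (a k ^+ 2 * D ^+ 2) * enorm (eta k w) ^+ 2)).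
  + apply: measurable_funX; apply: measurable_funM => //.
    apply: (@meas k.+1).
    by apply: adapted_dotv => i; [exact: eta_adapted|apply: up; exact: e_adapted].
  + move=> w; rewrite ger0_norm ?sqr_ge0// exprMn -mulrA ler_wpM2l ?sqr_ge0//.
    rewrite -[X in X <= _]real_normK ?num_real// -exprMn ler_pXn2r ?nnegrE ?mulr_ge0 ?enorm_ge0//.
    rewrite (le_trans (dotv_CS _ _))// mulrC ler_wpM2r ?enorm_ge0//; exact: e_le.
  + exact: itgZ.
- have mB : measurable B by case: hf => h _; exact: h FB.
  have hu i : adapted gens k (fun w => (\1_B w *: (a k *: e k w)) i 0).
    apply: (eq_measurable_fun (fun w : g_sigma_algebraType (gens k) => \1_B w * (a k * e k w i 0))) => [w _|].
      by rewrite !mxE.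
    apply: measurable_funM; first exact: (@adapted_indic _ _ _ gens k B FB).
    by apply: measurable_funM => //; exact: e_adapted.
  have [|_ h] := @dotv_eta_orthogonal k (fun w => \1_B w *: (a k *: e k w)) (a k * D) hu.
    move=> w; rewrite !enormZ (ger0_norm (ltW (a0 k))) mulrA -[leRHS]mul1r -mulrA.
    by apply: ler_pM => //; [rewrite mulr_ge0 ?enorm_ge0// ltW|exact: indic_le1|rewrite ler_wpM2l// ?(ltW (a0 k))//; exact: e_le].
  rewrite -[RHS]h; apply: eq_Ex => w; rewrite !dotvZr; ring.
Qed.

Let G_adapted k i : adapted gens k.+1 (fun w => G k w i 0).
Proof.
apply: (eq_measurable_fun (fun w : g_sigma_algebraType (gens k.+1) => eta k w i 0 + g (x k w) i 0)) => [w _|].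
  by rewrite /eta !mxE subrK.
apply: measurable_funD; first exact: eta_adapted.
by apply: up; exact: g_adapted.
Qed.

(** The expectations sum to at most |M2| times the sum of a_k^2, so by monotone convergence the
    random series is integrable, hence almost surely finite. *)
Lemma sqr_steps_ae_cauchy : {ae P, forall w, cauchy_partial_sums (fun k => a k ^+ 2 * enorm (G k w) ^+ 2)}.
Proof.
pose F k w := (a k ^+ 2 * enorm (G k w) ^+ 2)%:E.
have mF k : measurable_fun setT (F k).
  apply/measurable_EFinP; apply: measurable_funM => //.
  by apply: (@meas k.+1); apply: adapted_enorm2 => i; exact: G_adapted.
have F0 k w : (0 <= F k w)%E by rewrite lee_fin mulr_ge0 ?sqr_ge0.
have fin : (\int[P]_w (\sum_(k <oo) F k w) < +oo)%E.
  rewrite integral_nneseries//.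
  have [C hC] : exists C : R, forall n, `|\sum_(k < n) a k ^+ 2| <= C.
    exact: cauchy_partial_sums_bounded (step_sqr ha).
  apply: (@le_lt_trans _ _ (C * `|M2|)%:E); last exact: ltry.
  apply: lime_le; first by apply: is_cvg_nneseries => k _ _; exact: integral_ge0.
  apply: nearW => n; rewrite big_mkord.
  rewrite (@le_trans _ _ (\sum_(k < n) (a k ^+ 2 * `|M2|)%:E)%E)//.
    apply: lee_sum => k _; rewrite /F.
    have [i1 h1] := G_sqr k.
    rewrite ExE; last exact: itgZ.
    by rewrite ExZ// lee_fin ler_wpM2l ?sqr_ge0// (le_trans h1)// ler_norm.
  rewrite sumEFin lee_fin -mulr_suml ler_wpM2r//.
  by rewrite (le_trans _ (hC n))// ler_norm.
have aefin : {ae P, forall w, (\sum_(k <oo) F k w)%E \is a fin_num}.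
  have : P.-integrable setT (fun w => \sum_(k <oo) F k w)%E.
    apply/integrableP; split.
      by apply: ge0_emeasurable_sum => // k w _ _; exact: F0.
    under eq_integral do rewrite gee0_abs ?nneseries_ge0//.
    exact: fin.
  by move/(integrable_ae measurableT); apply: filterS => w; exact.
apply: filterS aefin => w hw u u0.
have : (fun n => \sum_(0 <= k < n) F k w)%E @ \oo --> (\sum_(k <oo) F k w)%E.
  by apply: is_cvg_nneseries => k _ _; exact: F0.
rewrite -(fineK hw) => /fine_cvgP[_ /cvgrPdist_le /(_ _ (divr_gt0 u0 (ltr0n R 2)))[N _ hN]].
exists N => n m Nn nm.
have S k : fine (\sum_(0 <= j < k) F j w)%E = \sum_(0 <= j < k) a j ^+ 2 * enorm (G j w) ^+ 2.
  by rewrite /F sumEFin.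
have := hN n Nn; have := hN m (leq_trans Nn nm); rewrite /= !S.
rewrite (big_cat_nat (n := n) (leq0n n) nm)/=.
set t := fine _; set v := \sum_(0 <= j < n) _; set z := \sum_(n <= j < m) _.
by rewrite !ler_norml => /andP[? ?] /andP[? ?]; apply/andP; split; lra.
Qed.

Lemma identification_ae (r : R) : 0 < r -> {ae P, forall w, exists N, forall k, (N <= k)%N ->
  enorm (e k w) <= r /\ act_mx A b ts *m e k w = 0}.
Proof.
move=> r_gt0.
have h1 : {ae P, forall w, forall i, cauchy_partial_sums (fun k => a k * eta k w i 0)}.
  have h i : {ae P, forall w, cauchy_partial_sums (fun k => a k * eta k w i 0)}.
    have md : martingale_diff P gens (fun k w => a k * eta k w i 0).
      have [m1 m2 m3] := eta_md i; split.
      + by move=> k; apply: measurable_funM => //; exact: m1.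
      + move=> k; apply: (@eq_itg _ _ _ P (fun w => a k ^+ 2 * eta k w i 0 ^+ 2)) => [w|].
          by rewrite exprMn.
        by apply: itgZ; exact: m2.
      + move=> k B FB; rewrite -(mulr0 (a k)) -(m3 k B FB) -ExZ.
          by apply: eq_Ex => w; ring.
        apply: (itgM_bounded _ (indic_le1 B)).
          by apply: measurable_indicT; case: hf => h _; exact: h FB.
        exact: (martingale_diff_itg k hf (eta_md i)).
    apply: (martingale_ae_cauchy hf md (v := fun k => KE * a k ^+ 2)).
      move=> k; rewrite mulrC.
      have -> : Ex P (fun w => (a k * eta k w i 0) ^+ 2) = a k ^+ 2 * Ex P (fun w => eta k w i 0 ^+ 2).
        rewrite -ExZ; last by have [_ h _] := eta_md i; exact: h.
        by apply: eq_Ex => w; rewrite exprMn.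
      rewrite ler_wpM2l ?sqr_ge0// (le_trans _ (eta_sqr_le k))//.
      apply: Ex_le => //; first by have [_ h _] := eta_md i; exact: h.
      by move=> w; rewrite -[X in X <= _]real_normK ?num_real// ler_pXn2r ?nnegrE ?enorm_ge0// normr_le_enorm.
    exact: cauchy_partial_sumsZ (step_sqr ha).
  exact: filter_forall.
have h2 : {ae P, forall w, cauchy_partial_sums (fun k => a k * dotv (eta k w) (e k w))}.
  apply: (martingale_ae_cauchy hf dotv_eta_md (v := fun k => (D ^+ 2 * KE) * a k ^+ 2)).
    move=> k; apply: (@le_trans _ _ (Ex P (fun w => (a k ^+ 2 * D ^+ 2) * enorm (eta k w) ^+ 2))).
      apply: Ex_le => //; [by have [_ h _] := dotv_eta_md; exact: h|exact: itgZ|].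
      move=> w; rewrite exprMn -mulrA ler_wpM2l ?sqr_ge0//.
      rewrite -[X in X <= _]real_normK ?num_real// -exprMn ler_pXn2r ?nnegrE ?mulr_ge0 ?enorm_ge0//.
      rewrite (le_trans (dotv_CS _ _))// mulrC ler_wpM2r ?enorm_ge0//; exact: e_le.
    rewrite ExZ//; have := eta_sqr_le k; set t := Ex P _ => tK.
    have : a k ^+ 2 * D ^+ 2 * t <= a k ^+ 2 * D ^+ 2 * KE by rewrite ler_wpM2l// mulr_ge0 ?sqr_ge0.
    by move=> hh; apply: (le_trans hh); rewrite le_eqVlt; apply/orP; left; apply/eqP; ring.
  exact: cauchy_partial_sumsZ (step_sqr ha).
move: h1 h2 sqr_steps_ae_cauchy; apply: filterS3 => w w1 w2 w3.
have hgrow k : c1 * enorm (x k w - ts) ^+ 2 <= dotv (g (x k w)) (x k w - ts) by exact: growth.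
have hlip k : enorm (g (x k w) - g ts) <= c2 * enorm (x k w - ts) by exact: lip.
apply: (eventually_active ts_in (fun k => ltW (a0 k)) (step_unbounded ha)
   (z := fun k => x0 - \sum_(j < k) a j *: G j w) (eta := fun k => eta k w)
   (g := fun k => g (x k w)) _ _ c1_gt0 hgrow hlip multiplier w1 w2) => //.
- move=> k; have -> : g (x k w) + eta k w = G k w by rewrite /eta addrC subrK.
  by rewrite big_ord_recr/= opprD addrA.
- by move: w3; congr cauchy_partial_sums; apply/funext => k; rewrite /eta [g _ + _]addrC subrK.
Qed.

(** Identification at time k: the error lies in the kernel of the active rows and within the radius
    at which [proj_ker] applies. *)
Let ok k : set Omega := [set w | enorm (e k w) <= r0 / 2 /\ act_mx A b ts *m e k w = 0].

Let ok_adapted k : <<s gens k >> (ok k).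
Proof.
have -> : ok k = [set w | enorm (e k w) <= r0 / 2] `&` [set w | enorm (act_mx A b ts *m e k w) ^+ 2 <= 0].
  apply/seteqP; split => w /= [h1 h2]; split => //.
    by rewrite h2 enorm0 expr0n.
  apply: enorm0_eq0; apply/eqP; rewrite -sqrf_eq0 eq_le h2/=; exact: sqr_ge0.
have mZ : forall i, measurable_fun setT (fun w : g_sigma_algebraType (gens k) => (act_mx A b ts *m e k w) i 0).
  move=> i; apply: (eq_measurable_fun (fun w : g_sigma_algebraType (gens k) =>
    \sum_j act_mx A b ts i j * e k w j 0)) => [w _|]; first by rewrite mxE.
  have h j : measurable_fun setT (fun w : g_sigma_algebraType (gens k) => act_mx A b ts i j * e k w j 0).
    by apply: measurable_funM => //; exact: e_adapted.
  exact: measurable_sum.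
have m1 : measurable_fun setT (fun w : g_sigma_algebraType (gens k) => enorm (e k w)) by exact: adapted_enorm.
have m2 : measurable_fun setT (fun w : g_sigma_algebraType (gens k) => enorm (act_mx A b ts *m e k w) ^+ 2).
  apply: (eq_measurable_fun (fun w : g_sigma_algebraType (gens k) =>
    \sum_i (act_mx A b ts *m e k w) i 0 * (act_mx A b ts *m e k w) i 0)) => [w _|].
    by rewrite enorm_sqr dotvE.
  have h i : measurable_fun setT (fun w : g_sigma_algebraType (gens k) => (act_mx A b ts *m e k w) i 0 * (act_mx A b ts *m e k w) i 0).
    exact: measurable_funM.
  exact: measurable_sum.
apply: (@measurableI _ (g_sigma_algebraType (gens k))).
  exact: (@measurable_ge _ _ (g_sigma_algebraType (gens k))).
exact: (@measurable_ge _ _ (g_sigma_algebraType (gens k))).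
Qed.

(** Identification has held from N to n. Unlike [Einf N] this event is known at time n, so its
    indicator can multiply the noise at time n and the product keeps zero mean. *)
Let E N n : set Omega := [set w | forall k, (N <= k)%N -> (k <= n)%N -> ok k w].

Let E_adapted N n : <<s gens n >> (E N n).
Proof.
pose ok' k := if (N <= k)%N then ok k else setT.
have ok'F k : <<s gens k >> (ok' k).
  rewrite /ok'; case: ifP => _; first exact: ok_adapted.
  exact: (@measurableT _ (g_sigma_algebraType (gens k))).
elim: n => [|n IH].
  have -> : E N 0 = ok' 0%N; last exact: ok'F.
  apply/seteqP; split => w; rewrite /ok'.
    by case: ifP => // N0 h; apply: h.
  by case: ifP => [_ h k _|N0 _ k Nk]; rewrite leqn0 => /eqP k0; [rewrite k0|rewrite k0 N0 in Nk].
have -> : E N n.+1 = E N n `&` ok' n.+1.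
  apply/seteqP; split => w.
    move=> h; split; first by move=> k Nk kn; apply: h => //; exact: leqW.
    by rewrite /ok'; case: ifP => // Nn; exact: h.
  move=> [h1 h2] k Nk; rewrite leq_eqVlt => /orP[/eqP kn|]; last by rewrite ltnS; exact: h1.
  by move: h2; rewrite /ok' -kn Nk.
apply: (@measurableI _ (g_sigma_algebraType (gens n.+1))); last exact: ok'F.
by case: hf => _ h; exact: h IH.
Qed.

Let mE N n : measurable (E N n). Proof. by case: hf => h _; apply: (h n); exact: E_adapted. Qed.

Let Einf N : set Omega := [set w | forall k, (N <= k)%N -> ok k w].

Let mEinf N : measurable (Einf N).
Proof.
rewrite (_ : Einf N = \bigcap_n E N n); first by apply: bigcapT_measurable => n; exact: mE.
apply/seteqP; split => [w h n _ k Nk _|w h k Nk]; first exact: h.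
exact: (h k Logic.I k Nk (leqnn k)).
Qed.

Lemma identification_probability (h : R) : 0 < h -> exists N0, forall N, (N0 <= N)%N ->
  fine (P (~` Einf N)) <= h.
Proof.
move=> h0; have mC N : measurable (~` Einf N) by exact: measurableC.
have r20 : 0 < r0 / 2 by rewrite divr_gt0.
have null : P (\bigcap_N ~` Einf N) = 0%E.
  have [B [mB B0 hB]] := identification_ae r20.
  apply/eqP; rewrite -measure_le0 -B0 le_measure ?inE//; first exact: bigcapT_measurable.
  move=> w hw; apply: hB => /= -[N hN]; exact: (hw N Logic.I hN).
have : P (~` Einf N) @[N --> \oo] --> P (\bigcap_N ~` Einf N).
  apply: nonincreasing_cvg_mu => //.
  - by rewrite (le_lt_trans (probability_le1 P (mC 0%N)))// ltry.
  - exact: bigcapT_measurable.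
  - move=> n m nm; apply/subsetPset; apply: subsetC => w hw k mk; apply: hw.
    exact: leq_trans mk.
rewrite null => /fine_cvgP[_ /cvgrPdist_le /(_ _ h0)[N0 _ hN]].
exists N0 => N /hN; rewrite /= sub0r normrN; apply: le_trans; exact: ler_norm.
Qed.

(** Q kills the dual residual at both times and fixes both errors, so the constrained step is a
    plain gradient step in the kernel of the active rows. *)
Let proj_step k w : ok k w -> ok k.+1 w -> e k.+1 w = e k w - a k *: (Q *m G k w).
Proof.
move=> [h1 h2] [h3 h4].
have p1 := proj_ker cone r0_gt0 (x_proj k w) h1.
have p2 := proj_ker cone r0_gt0 (x_proj k.+1 w) h3.
rewrite -/Q in p1 p2.
have q1 : Q *m e k w = e k w by exact: projker_id.
have q2 : Q *m e k.+1 w = e k.+1 w by exact: projker_id.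
have : Q *m ((x0 - \sum_(j < k.+1) a j *: G j w - x k.+1 w) - (x0 - \sum_(j < k) a j *: G j w - x k w)) = 0.
  by rewrite mulmxBr p1 p2 subrr.
have -> : (x0 - \sum_(j < k.+1) a j *: G j w - x k.+1 w) - (x0 - \sum_(j < k) a j *: G j w - x k w) =
    - (a k *: G k w) - (e k.+1 w - e k w).
  rewrite big_ord_recr/= /e; move: (\sum_(j < k) _) (a k *: _) => u v.
  by apply/matrixP => i j; rewrite !mxE; ring.
rewrite mulmxBr mulmxN -scalemxAr mulmxBr q1 q2 => H.
have -> : e k.+1 w = (e k w - a k *: (Q *m G k w)) - (- (a k *: (Q *m G k w)) - (e k.+1 w - e k w)).
  by apply/matrixP => i j; rewrite !mxE; ring.
by rewrite H subr0.
Qed.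

Let dist2 N n := Ex P (fun w => \1_(E N n) w * enorm (e n w) ^+ 2).

Let b2 N n w : \1_(E N n) w * enorm (e n w) ^+ 2 <= D ^+ 2.
Proof.
rewrite -[leRHS]mul1r ler_pM ?sqr_ge0//.
by rewrite ler_pXn2r ?nnegrE ?enorm_ge0.
Qed.

Let i2 N n : itg P (fun w => \1_(E N n) w * enorm (e n w) ^+ 2).
Proof.
apply: (@itg_bounded _ _ _ P (D ^+ 2)) => [|w].
  apply: measurable_funM; first by apply: measurable_indicT; exact: mE.
  by apply: (@meas n); apply: adapted_enorm2 => i; exact: e_adapted.
by rewrite ger0_norm ?b2// mulr_ge0 ?sqr_ge0// indicE.
Qed.

(** The events [E N n] decrease in n, so [proj_step] and the growth condition give dist2_(n+1) <= (1
    - 2 c1 a_n) dist2_n + a_n^2 M2, the noise term having zero mean; [step_rate] concludes. *)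
Lemma rate : exists N0, forall N, (N0 <= N)%N -> exists2 K, 0 <= K &
  forall n, (N <= n)%N -> dist2 N n <= K * a n.
Proof.
have M20 : 0 <= M2 by have [_] := G_sqr 0%N; apply: le_trans; apply: Ex_ge0 => w; exact: sqr_ge0.
have [N0 hN0] := step_rate ha c1_gt0 M20.
exists N0 => N /hN0 /(_ (D ^+ 2))[K K0 hK]; exists K => // n Nn.
apply: (hK (dist2 N)) => //.
- by move=> k; apply: Ex_ge0 => w; rewrite mulr_ge0 ?sqr_ge0// indicE.
- rewrite -[leRHS](Ex_cst P); apply: Ex_le; [exact: (i2 N N)|exact: itg_cst|exact: b2].
move=> {n Nn} n Nn; have [iG hG] := G_sqr n.
pose u w := \1_(E N n) w *: e n w.
have hu i : adapted gens n (fun w => u w i 0).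
  apply: (eq_measurable_fun (fun w : g_sigma_algebraType (gens n) => \1_(E N n) w * e n w i 0)) => [w _|].
    by rewrite !mxE.
  apply: measurable_funM; last exact: e_adapted.
  exact: (@adapted_indic _ _ _ gens n (E N n) (@E_adapted N n)).
have uD w : enorm (u w) <= D.
  by rewrite enormZ -[leRHS]mul1r ler_pM ?enorm_ge0// indic_le1.
have [iu u0] := dotv_eta_orthogonal hu uD.
have pt w : \1_(E N n.+1) w * enorm (e n.+1 w) ^+ 2 <=
    ((1 - 2 * c1 * a n) * (\1_(E N n) w * enorm (e n w) ^+ 2) - (2 * a n) * dotv (eta n w) (u w))
    + a n ^+ 2 * enorm (G n w) ^+ 2.
  rewrite /u dotvZr !indicE.
  have [/set_mem wE|wE] := boolP (w \in E N n); last first.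
    have -> : (w \in E N n.+1) = false.
      apply/negbTE; apply: contra wE => /set_mem h; apply/mem_set => k Nk kn.
      by apply: h => //; exact: leqW.
    by rewrite !mul0r !mulr0 subr0 add0r mulr_ge0 ?sqr_ge0.
  have [wok1 wok2] := wE n Nn (leqnn n).
  have q1 : Q *m e n w = e n w by exact: projker_id.
  have key : enorm (e n w - a n *: (Q *m G n w)) ^+ 2 <=
      (1 - 2 * c1 * a n) * (1 * enorm (e n w) ^+ 2) - (2 * a n) * (1 * dotv (eta n w) (e n w))
        + a n ^+ 2 * enorm (G n w) ^+ 2.
    have E1 : dotv (e n w) (Q *m G n w) = dotv (G n w) (e n w).
      by rewrite dotv_mulmx projker_sym -/Q q1 dotvC.
    have E2 : dotv (G n w) (e n w) = dotv (eta n w) (e n w) + dotv (g (x n w)) (e n w).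
      by rewrite -dotvDl /eta subrK.
    rewrite enormD_sqr dotvNr dotvZr E1 E2 enormN enormZ exprMn (ger0_norm (ltW (a0 n))).
    have h1 := growth (x_in n w); rewrite -/(e n w) in h1.
    have h2 : enorm (Q *m G n w) ^+ 2 <= enorm (G n w) ^+ 2.
      by rewrite ler_pXn2r ?nnegrE ?enorm_ge0//; exact: enorm_projker.
    have := ler_wpM2l (sqr_ge0 (a n)) h2; have := ler_wpM2l (ltW (a0 n)) h1.
    by rewrite !mul1r mulr2n; lra.
  have [/set_mem wE1|_] := boolP (w \in E N n.+1); last first.
    by rewrite mul0r (le_trans _ key)// sqr_ge0.
  by rewrite mul1r (proj_step (wE n Nn (leqnn n)))//; apply: wE1 => //; exact: leqW.
have iE : itg P (fun w => (1 - 2 * c1 * a n) * (\1_(E N n) w * enorm (e n w) ^+ 2) - (2 * a n) * dotv (eta n w) (u w)).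
  by apply: itgB; apply: itgZ.
apply: (le_trans (Ex_le (i2 N n.+1) (itgD iE (itgZ _ iG)) pt)).
rewrite ExD//; last exact: itgZ.
rewrite ExB; [|exact: itgZ..].
rewrite !ExZ// u0 mulr0 subr0 lerD2l.
by rewrite ler_wpM2l ?sqr_ge0.
Qed.

Let res y := g y - g ts - Hm *m (y - ts).

Hypothesis c3_ge0 : 0 <= c3.
Hypothesis gbar_meas : forall n i, measurable_fun setT (fun w => g (average x n w) i 0).

(** The error of the averaged expansion, to be shown negligible in probability. *)
Let W n w := Num.sqrt n%:R *: (Q *m g (average x n w)) +
  (Num.sqrt n%:R)^-1 *: \sum_(k < n) Q *m eta k w.

Let Qg0 : Q *m g ts = 0.
Proof.
have [lam [_ hl]] := multiplier.
by rewrite -[g ts]opprK hl mulmxN mulmxA projker_mul_trmx mul0mx oppr0.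
Qed.

Let average_in n w : (0 < n)%N -> Theta (average x n w).
Proof.
move=> n0 i; rewrite /average -scalemxAr mulmx_sumr mxE summxE.
rewrite ler_pdivrMl ?ltr0n// mulr_natl -[in leRHS](card_ord n) -sumr_const.
by apply: ler_sum => k _; exact: x_in.
Qed.

Let W_expand n w : (0 < n)%N -> W n w = (Num.sqrt n%:R)^-1 *:
  (\sum_(k < n) Q *m G k w - \sum_(k < n) Q *m res (x k w) + n%:R *: (Q *m res (average x n w))).
Proof.
move=> n0; have nz : n%:R != 0 :> R by rewrite pnatr_eq0 -lt0n.
have s0 : Num.sqrt n%:R != 0 :> R by rewrite sqrtr_eq0 -ltNge ltr0n.
have sE : Num.sqrt n%:R = (Num.sqrt n%:R)^-1 * n%:R :> R.
  by rewrite -[X in _ = _ * X](@sqr_sqrtr R n%:R) ?ler0n// expr2 mulKf.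
have bar : n%:R *: (Q *m (Hm *m (average x n w - ts))) = \sum_(k < n) Q *m (Hm *m e k w).
  rewrite /average; have -> : \sum_(k < n) Q *m (Hm *m e k w) = Q *m (Hm *m (\sum_(k < n) x k w - n%:R *: ts)).
    rewrite -mulmx_sumr -mulmx_sumr; congr (_ *m (_ *m _)).
    by rewrite /e sumrB sumr_const card_ord scaler_nat.
  by rewrite !scalemxAr scalerBr scalerA divff// scale1r.
have gE y : Q *m g y = Q *m (Hm *m (y - ts)) + Q *m res y.
  rewrite -mulmxDr /res addrC subrK mulmxBr Qg0 subr0//.
rewrite /W {1}sE -scalerA -scalerDr; congr (_ *: _).
rewrite gE scalerDr bar addrAC; congr (_ + _).
rewrite -big_split -sumrB; apply: eq_bigr => k _ /=.
by rewrite -[Q *m G k w](subrK (Q *m g (x k w))) -mulmxBr gE /e -/(e k w); apply/matrixP => i j; rewrite !mxE; ring.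
Qed.

Let sqr_sum_le n (u : nat -> R) : (\sum_(k < n) u k) ^+ 2 <= n%:R * \sum_(k < n) u k ^+ 2.
Proof.
elim: n => [|n IH]; first by rewrite !big_ord0 expr0n mul0r.
rewrite !big_ord_recr/=; have [->|n0] := eqVneq n 0%N.
  by rewrite !big_ord0 !add0r mul1r.
set S := \sum_(k < n) u k in IH *; set T := \sum_(k < n) u k ^+ 2 in IH *.
have n1 : 0 < n%:R :> R by rewrite ltr0n lt0n.
have h : 2 * S * u n <= T + n%:R * u n ^+ 2.
  have sq : 0 <= (S - n%:R * u n) ^+ 2 by exact: sqr_ge0.
  rewrite -(ler_pM2l n1); move: IH sq; rewrite !expr2; lra.
by move: IH; rewrite -natr1 !expr2 in h *; lra.
Qed.

Let abel N n w : (N <= n)%N -> (forall k, (N <= k)%N -> ok k w) ->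
  \sum_(N <= k < n) Q *m G k w = (a N)^-1 *: e N w - (a n)^-1 *: e n w +
    \sum_(N <= k < n) ((a k.+1)^-1 - (a k)^-1) *: e k.+1 w.
Proof.
move=> Nn hok; elim: n Nn => [|n IH].
  by rewrite leqn0 => /eqP ->; rewrite !big_geq// subrr addr0.
rewrite leq_eqVlt => /orP[/eqP <-|]; first by rewrite !big_geq// subrr addr0.
rewrite ltnS => Nn; rewrite !big_nat_recr//= IH//.
have -> : Q *m G n w = (a n)^-1 *: (e n w - e n.+1 w).
  rewrite (proj_step (hok n Nn) (hok n.+1 (leqW Nn))) opprB addrCA subrr addr0.
  by rewrite scalerA mulVf ?scale1r// gt_eqF.
by move: (\sum_(_ <= _ < _) _) => S; apply/matrixP => i j; rewrite !mxE; ring.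
Qed.

(** An integrable majorant of sqrt n |W n| on [Einf N]. The first three terms come from times up to
    N and do not depend on n; the next two are the final boundary term and the increments of the
    Abel sum; the last is the Taylor remainder, doubled to cover the iterates and their average.
    Indicators of [E N k] stand in for [Einf N] so that [rate] applies. *)
Let Y N n w := \sum_(k < N) enorm (G k w) + (a N)^-1 * D + 2 * c3 * (N%:R * D ^+ 2)
  + (a n)^-1 * (\1_(E N n) w * enorm (e n w))
  + \sum_(N <= k < n) ((a k.+1)^-1 - (a k)^-1) * (\1_(E N k.+1) w * enorm (e k.+1 w))
  + 2 * c3 * \sum_(N <= k < n) \1_(E N k) w * enorm (e k w) ^+ 2.

Let inv_le k : 0 <= (a k.+1)^-1 - (a k)^-1.
Proof. by rewrite subr_ge0 lef_pV2 ?posrE// step_le. Qed.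

Let W_le N n w : (0 < n)%N -> (N <= n)%N -> Einf N w -> enorm (W n w) <= (Num.sqrt n%:R)^-1 * Y N n w.
Proof.
move=> n0 Nn hok; rewrite W_expand// enormZ ger0_norm ?invr_ge0 ?sqrtr_ge0//.
rewrite ler_wpM2l ?invr_ge0 ?sqrtr_ge0//.
have ind k : \1_(E N k) w = 1 :> R by rewrite indicE mem_set// => j Nj _; exact: hok.
pose S := \sum_(k < n) enorm (e k w) ^+ 2.
have S_le : S <= N%:R * D ^+ 2 + \sum_(N <= k < n) \1_(E N k) w * enorm (e k w) ^+ 2.
  rewrite /S -(big_mkord xpredT (fun k => enorm (e k w) ^+ 2)) (big_cat_nat (n := N) (leq0n N) Nn)/= lerD//.
    rewrite big_mkord mulr_natl -[in leRHS](card_ord N) -sumr_const; apply: ler_sum => k _.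
    by rewrite ler_pXn2r ?nnegrE ?enorm_ge0.
  by apply: ler_sum => k _; rewrite ind mul1r.
have r1 : enorm (\sum_(k < n) Q *m res (x k w)) <= c3 * S.
  rewrite (le_trans (enorm_sum _ _ _))// /S mulr_sumr; apply: ler_sum => k _.
  by rewrite (le_trans (enorm_projker _ _))//; exact: taylor.
have r2 : enorm (n%:R *: (Q *m res (average x n w))) <= c3 * S.
  rewrite enormZ normr_nat (@le_trans _ _ (n%:R * (c3 * enorm (average x n w - ts) ^+ 2)))//.
    by rewrite ler_wpM2l// (le_trans (enorm_projker _ _))//; apply: taylor; exact: average_in.
  rewrite mulrCA ler_wpM2l//.
  have -> : average x n w - ts = n%:R^-1 *: \sum_(k < n) e k w.
    by rewrite /average /e sumrB sumr_const card_ord scalerBr -[ts *+ n]scaler_nat scalerA mulVf ?scale1r// pnatr_eq0 -lt0n.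
  rewrite enormZ exprMn ger0_norm ?invr_ge0//.
  have nz : n%:R != 0 :> R by rewrite pnatr_eq0 -lt0n.
  rewrite mulrA expr2 mulrA mulfV// mul1r ler_pdivrMl ?ltr0n//.
  apply: le_trans (sqr_sum_le n (fun k => enorm (e k w))).
  by rewrite ler_pXn2r ?nnegrE ?enorm_ge0 ?sumr_ge0// ?enorm_sum// => k _; exact: enorm_ge0.
have r3 : enorm (\sum_(k < n) Q *m G k w) <= \sum_(k < N) enorm (G k w) + ((a N)^-1 * D
    + (a n)^-1 * enorm (e n w) + \sum_(N <= k < n) ((a k.+1)^-1 - (a k)^-1) * enorm (e k.+1 w)).
  rewrite -(big_mkord xpredT (fun k => Q *m G k w)) (big_cat_nat (n := N) (leq0n N) Nn)/=.
  rewrite (le_trans (enormD _ _))// lerD//.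
    rewrite big_mkord (le_trans (enorm_sum _ _ _))//; apply: ler_sum => k _; exact: enorm_projker.
  rewrite abel// (le_trans (enormD _ _))// lerD//.
    rewrite (le_trans (enormB _ _))// !enormZ !ger0_norm ?invr_ge0 ?(ltW (a0 _))// lerD2r.
    by rewrite ler_wpM2l// invr_ge0 ltW.
  rewrite (le_trans (enorm_sum _ _ _))//; apply: ler_sum => k _.
  by rewrite enormZ ger0_norm.
rewrite (le_trans (enormD _ _))// (le_trans (lerD (enormB _ _) (lexx _)))//.
rewrite /Y ind mul1r; under [X in _ + X + _]eq_bigr do rewrite ind mul1r.
have := ler_wpM2l c3_ge0 S_le; move: r1 r2 r3 => /=.
set t1 := enorm _; set t2 := enorm _; set t3 := enorm _; set z1 := \sum_(k < N) _.
set z2 := (a N)^-1 * D; set z3 := (a n)^-1 * _; set z4 := \sum_(_ <= _ < _) _; set z5 := \sum_(_ <= _ < _) _.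
set z6 := N%:R * _.
rewrite mulrDr => *; lra.
Qed.

Let W_meas n i : measurable_fun setT (fun w => W n w i 0).
Proof.
have m1 (u : Omega -> 'cV[R]_s) j : (forall l, measurable_fun setT (fun w => u w l 0)) ->
    measurable_fun setT (fun w => (Q *m u w) j 0).
  move=> hu; apply: (eq_measurable_fun (fun w => \sum_l Q j l * u w l 0)) => [w _|]; first by rewrite mxE.
  by apply: measurable_sum => l; exact: measurable_funM.
apply: (eq_measurable_fun (fun w => Num.sqrt n%:R * (Q *m g (average x n w)) i 0 +
  (Num.sqrt n%:R)^-1 * \sum_(k < n) (Q *m eta k w) i 0)) => [w _|].
  by rewrite /W [RHS]mxE [X in _ = X + _]mxE [X in _ = _ + X]mxE summxE.
apply: measurable_funD; apply: measurable_funM => //; first by apply: m1 => l; exact: gbar_meas.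
apply: measurable_sum => k; apply: m1 => l; apply: (@meas k.+1); exact: eta_adapted.
Qed.

Let enorm_W_meas n : measurable_fun setT (fun w => enorm (W n w)).
Proof.
apply: measurable_fun_enorm; by apply: measurable_fun_cV => // i; exact: W_meas.
Qed.

Let Ex_sqr_le (X : Omega -> R) : itg P X -> itg P (fun w => X w ^+ 2) ->
  Ex P X <= Num.sqrt (Ex P (fun w => X w ^+ 2)).
Proof.
move=> iX iX2; set m := Ex P X.
have h : m ^+ 2 <= Ex P (fun w => X w ^+ 2).
  have : 0 <= Ex P (fun w => (X w - m) ^+ 2) by apply: Ex_ge0 => w; exact: sqr_ge0.
  have -> : Ex P (fun w => (X w - m) ^+ 2) = Ex P (fun w => X w ^+ 2 - (2 * m * X w - m ^+ 2)).
    by apply: eq_Ex => w; ring.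
  rewrite ExB//; last by apply: itgB; [exact: itgZ|exact: itg_cst].
  rewrite ExB; [|exact: itgZ|exact: itg_cst].
  by rewrite (Ex_cst P (m ^+ 2)) ExZ// -/m; lra.
by rewrite (le_trans (ler_norm m))// -sqrtr_sqr ler_wsqrtr.
Qed.

Let i1 N n : itg P (fun w => \1_(E N n) w * enorm (e n w)).
Proof.
apply: (@itg_bounded _ _ _ P D) => [|w].
  apply: measurable_funM; first by apply: measurable_indicT; exact: mE.
  by apply: (@meas n); apply: adapted_enorm => i; exact: e_adapted.
rewrite normrM (ger0_norm (enorm_ge0 _)) -[leRHS]mul1r ler_pM ?enorm_ge0//.
exact: indic_le1.
Qed.

Let dist1_le N n K : 0 <= K -> dist2 N n <= K * a n ->
  Ex P (fun w => \1_(E N n) w * enorm (e n w)) <= Num.sqrt K * Num.sqrt (a n).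
Proof.
move=> K0 h.
have E2 w : (\1_(E N n) w * enorm (e n w)) ^+ 2 = \1_(E N n) w * enorm (e n w) ^+ 2.
  by rewrite exprMn; congr (_ * _); rewrite indicE; case: (_ \in _); rewrite ?expr1n ?expr0n.
rewrite -sqrtrM// (le_trans (Ex_sqr_le (i1 N n) _))//.
  by apply: (eq_itg (fun w => esym (E2 w))); exact: i2.
by rewrite (eq_Ex _ E2) ler_wsqrtr.
Qed.

Let iY N n : itg P (Y N n).
Proof.
rewrite /Y; apply: itgD; last first.
  by apply: itgZ; apply: itg_sum => k; exact: i2.
apply: itgD; last by apply: itg_sum => k; apply: itgZ; exact: i1.
apply: itgD; last by apply: itgZ; exact: i1.
apply: itgD; last exact: itg_cst.
apply: itgD; last exact: itg_cst.
apply: itg_sum => k; apply: itg_sqr; last by have [] := G_sqr k.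
by apply: (@meas k.+1); apply: adapted_enorm => i; exact: G_adapted.
Qed.

(** The factor 3 is 1 from the boundary term of the Abel sum plus 2 from [sqrt_telescope]. Distances
    enter with order sqrt(a_k) in mean and a_k in mean square. *)
Let Ex_Y_le N : exists2 C, 0 <= C & forall K, 0 <= K -> (forall n, (N <= n)%N -> dist2 N n <= K * a n) ->
  forall n, (N <= n)%N -> Ex P (Y N n) <= C + 3 * Num.sqrt K * Num.sqrt (a n)^-1 + 2 * c3 * K * \sum_(k < n) a k.
Proof.
have iG k : itg P (fun w => enorm (G k w)).
  apply: itg_sqr; last by have [] := G_sqr k.
  by apply: (@meas k.+1); apply: adapted_enorm => i; exact: G_adapted.
pose C := \sum_(k < N) Ex P (fun w => enorm (G k w)) + (a N)^-1 * D + 2 * c3 * (N%:R * D ^+ 2).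
exists C.
  by rewrite !addr_ge0 ?mulr_ge0 ?invr_ge0 ?sqr_ge0 ?(ltW (a0 _))// sumr_ge0// => k _; apply: Ex_ge0 => w; exact: enorm_ge0.
move=> K K0 hK n Nn.
rewrite /Y ExD; last 2 first.
- apply: itgD; last by apply: itg_sum => k; apply: itgZ; exact: i1.
  apply: itgD; last by apply: itgZ; exact: i1.
  apply: itgD; last exact: itg_cst.
  apply: itgD; last exact: itg_cst.
  exact: itg_sum.
- by apply: itgZ; apply: itg_sum => k; exact: i2.
rewrite ExD; last 2 first.
- apply: itgD; last by apply: itgZ; exact: i1.
  apply: itgD; last exact: itg_cst.
  apply: itgD; last exact: itg_cst.
  exact: itg_sum.
- by apply: itg_sum => k; apply: itgZ; exact: i1.
rewrite ExD; last 2 first.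
- apply: itgD; last exact: itg_cst.
  apply: itgD; last exact: itg_cst.
  exact: itg_sum.
- by apply: itgZ; exact: i1.
rewrite ExD; last 2 first.
- apply: itgD; last exact: itg_cst.
  exact: itg_sum.
- exact: itg_cst.
rewrite ExD; [|exact: itg_sum|exact: itg_cst].
rewrite (Ex_cst P (2 * c3 * (N%:R * D ^+ 2))) (Ex_cst P ((a N)^-1 * D)) Ex_sum// -/C; clearbody C.
rewrite (ExZ (a n)^-1 (i1 N n)).
rewrite [X in _ + X]ExZ; last by apply: itg_sum => k; exact: i2.
rewrite Ex_sum; last by move=> k; apply: itgZ; exact: i1.
rewrite Ex_sum; last by move=> k; exact: i2.
rewrite -!addrA lerD2l addrA lerD//.
  have t1 : (a n)^-1 * Ex P (fun w => \1_(E N n) w * enorm (e n w)) <= Num.sqrt K * Num.sqrt (a n)^-1.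
    have an := a0 n.
    rewrite ler_pdivrMl// (le_trans (dist1_le K0 (hK n Nn)))//.
    rewrite mulrCA ler_wpM2l ?sqrtr_ge0// sqrtrV ?(ltW an)// -[X in _ <= X * _](@sqr_sqrtr R (a n)) ?(ltW an)//.
    by rewrite expr2 mulfK// gt_eqF// sqrtr_gt0.
  have t2 : \sum_(N <= k < n) Ex P (fun w => ((a k.+1)^-1 - (a k)^-1) * (\1_(E N k.+1) w * enorm (e k.+1 w))) <=
      2 * Num.sqrt K * (Num.sqrt (a n)^-1 - Num.sqrt (a N)^-1).
    rewrite -(telescope_sumr (fun k => Num.sqrt (a k)^-1))// mulr_sumr ler_sum_nat// => k /andP[Nk kn].
    rewrite ExZ; last exact: i1.
    rewrite (le_trans (ler_wpM2l (inv_le k) (dist1_le K0 (hK k.+1 (leqW Nk)))))//.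
    have := ler_wpM2l (sqrtr_ge0 K) (sqrt_telescope ha k).
    by set u := Num.sqrt _; set v := Num.sqrt (a k.+1); set z1 := Num.sqrt _; set z2 := Num.sqrt _; lra.
  have := sqrtr_ge0 (a N)^-1; have := sqrtr_ge0 K; move: t1 t2.
  set t1 := _^-1 * _; set t2 := \sum_(_ <= _ < _) _; set u := Num.sqrt K; set v := Num.sqrt (a n)^-1; set z := Num.sqrt _.
  by move=> h1 h2 u0 z0; have := mulr_ge0 u0 z0; lra.
rewrite -(mulrA (2 * c3)) ler_wpM2l ?mulr_ge0// mulr_sumr.
rewrite -(big_mkord xpredT (fun k => K * a k)) (big_cat_nat (n := N) (leq0n N) Nn)/= ler_wpDl//.
  by rewrite sumr_ge0// => k _; rewrite mulr_ge0// ltW.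
by rewrite ler_sum_nat// => k /andP[Nk _]; exact: hK.
Qed.

Theorem remainder_in_probability (e1 h : R) : 0 < e1 -> 0 < h -> exists n0, forall n, (n0 <= n)%N ->
  fine (P [set w | e1 <= enorm (W n w)]) <= h.
Proof.
move=> e10 h0; have h20 : 0 < h / 2 by rewrite divr_gt0.
have [N1 hN1] := identification_probability h20.
have [N2 hN2] := rate.
pose N := maxn N1 N2; have [K K0 hK] := hN2 N (leq_maxr _ _).
have [C C0 hC] := Ex_Y_le N.
(* Three contributions of at most dl sqrt n each; Markov's inequality at level e1 sqrt n turns them
   into h/2. *)
pose dl := h / 2 * e1 / 3; have dl0 : 0 < dl by rewrite divr_gt0// mulr_gt0.
pose K1 := 3 * Num.sqrt K + 1; have K10 : 0 < K1 by rewrite ltr_wpDl// mulr_ge0// sqrtr_ge0.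
pose K2 := 2 * c3 * K + 1; have K20 : 0 < K2 by rewrite ltr_wpDl// !mulr_ge0.
have d1 : 0 < (dl / K1) ^+ 2 by rewrite exprn_gt0// divr_gt0.
have [n1 hn1] := step_inv_sublinear ha d1.
have d2 : 0 < dl / K2 by rewrite divr_gt0.
have [n2 hn2] := step_lt_sqrt ha d2.
pose n3 := (Num.truncn ((C / dl) ^+ 2)).+1.
exists (maxn N (maxn n1 (maxn n2 n3))) => n; rewrite !geq_max => /and4P[Nn' n1n n2n n3n].
have Nn : (N <= n)%N by rewrite geq_max.
have n0 : (0 < n)%N by exact: leq_trans n3n.
have sn : 0 < Num.sqrt n%:R :> R by rewrite sqrtr_gt0 ltr0n.
have bnd1 : C <= dl * Num.sqrt n%:R.
  have cd : 0 <= C / dl by rewrite divr_ge0// ltW.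
  rewrite mulrC -ler_pdivrMr// -[leLHS]ger0_norm// -sqrtr_sqr ler_wsqrtr//.
  by rewrite (le_trans (ltW (truncnS_gt _)))// ler_nat.
(* This is 1/a_n = o(n), taken with accuracy (dl / K1)^2 and under a square root. *)
have bnd2 : 3 * Num.sqrt K * Num.sqrt (a n)^-1 <= dl * Num.sqrt n%:R.
  have : Num.sqrt (a n)^-1 <= dl / K1 * Num.sqrt n%:R.
    have dk : 0 <= dl / K1 by apply: divr_ge0; exact: ltW.
    rewrite -(ger0_norm dk) -sqrtr_sqr -sqrtrM ?sqr_ge0// ler_wsqrtr//; exact: hn1.
  rewrite mulrAC ler_pdivlMr// mulrC; apply: le_trans.
  by rewrite ler_wpM2r ?sqrtr_ge0// /K1 lerDl.
have bnd3 : 2 * c3 * K * \sum_(k < n) a k <= dl * Num.sqrt n%:R.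
  have := hn2 n n2n; rewrite mulrAC ler_pdivlMr// mulrC; apply: le_trans.
  rewrite ler_wpM2r ?lerDl// sumr_ge0// => k _; exact: ltW.
have ExY : Ex P (Y N n) <= 3 * dl * Num.sqrt n%:R.
  rewrite (le_trans (hC K K0 hK n Nn))// (le_trans (lerD (lerD bnd1 bnd2) bnd3))//.
  by rewrite -mulrDl -mulrDl ler_wpM2r ?sqrtr_ge0//; lra.
have Y0 w : 0 <= Y N n w.
  have ind0 B : 0 <= \1_B w :> R by rewrite indicE.
  rewrite /Y !addr_ge0 ?mulr_ge0 ?invr_ge0 ?sqr_ge0 ?enorm_ge0 ?(ltW (a0 _))//.
  - by apply: sumr_ge0 => k _; exact: enorm_ge0.
  - by apply: sumr_ge0 => k _; rewrite !mulr_ge0 ?enorm_ge0.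
  - by apply: sumr_ge0 => k _; rewrite mulr_ge0 ?sqr_ge0.
have mW : measurable [set w | e1 <= enorm (W n w)].
  apply: measurable_ge => //; exact: enorm_W_meas.
have mB : measurable [set w | e1 * Num.sqrt n%:R <= Y N n w].
  by apply: measurable_ge => //; exact: itg_measurable (iY N n).
have mC : measurable (~` Einf N) by exact: measurableC.
apply: (@le_trans _ _ (fine (P (~` Einf N `|` [set w | e1 * Num.sqrt n%:R <= Y N n w])))).
  apply: Pr_le => //; first exact: measurableU.
  move=> w /= hw; have [hE|hE] := pselect (Einf N w); last by left.
  right; rewrite -ler_pdivlMr// mulrC; exact: le_trans hw (W_le n0 Nn hE).
rewrite (le_trans (Pr_setU_le P mC mB))// [leRHS](splitr h) lerD//; first exact: hN1 (leq_maxl _ _).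
have es0 : 0 < e1 * Num.sqrt n%:R by rewrite mulr_gt0.
rewrite (le_trans (markovE (iY N n) Y0 es0))// ler_pdivrMr// (le_trans ExY)//.
by rewrite /dl; set z := Num.sqrt _; lra.
Qed.

End DualAveraging.

(** * Convergence in law from characteristic functions *)

Lemma cos_lipschitz {R : realType} (u v : R) : `|cos u - cos v| <= `|u - v|.
Proof.
have -> : cos u - cos v = - (2 * sin ((u + v) / 2) * sin ((u - v) / 2)).
  have e1 : u = (u + v) / 2 + (u - v) / 2 by field.
  have e2 : v = (u + v) / 2 - (u - v) / 2 by field.
  by rewrite [cos u](congr1 _ e1) [cos v](congr1 _ e2) cosD cosB; ring.
rewrite normrN !normrM (ger0_norm (ler0n R 2)).
have h1 : `|sin ((u + v) / 2)| <= 1 by rewrite ler_norml sin_geN1 sin_le1.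
have h2 := normr_sin_le ((u - v) / 2).
rewrite normrM (ger0_norm (_ : 0 <= 2^-1 :> R)) ?invr_ge0// in h2.
have := ler_pM (normr_ge0 _) (normr_ge0 _) h1 h2; lra.
Qed.

Section Criterion.
Context {R : realType} d (Omega : measurableType d) (P : probability Omega R) (n : nat).
Variables (Z U : nat -> Omega -> 'cV[R]_n) (S : 'M[R]_n) (N : probability (borelV R n) R).
Hypotheses (mZ : forall k, measurable_fun setT (Z k : Omega -> borelV R n))
  (mU : forall k, measurable_fun setT (U k : Omega -> borelV R n)).
Hypothesis close : forall e h : R, 0 < e -> 0 < h -> exists k0, forall k, (k0 <= k)%N ->
  fine (P [set w | e <= enorm (Z k w - U k w)]) <= h.
Hypothesis tight : forall i (h : R), 0 < h -> exists K : R, forall k,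
  fine (P [set w | K <= `|U k w i 0|]) <= h.
Hypothesis hcos : forall (c : R) (t : 'cV[R]_n),
  Ex P (fun w => cos (c + dotv t (U k w))) @[k --> \oo] --> cos c * expR (- (dotv t (S *m t) / 2)).
Hypothesis hN : gaussian_char N S.

Let mcos (V : Omega -> 'cV[R]_n) c t : measurable_fun setT (V : Omega -> borelV R n) ->
  measurable_fun setT (fun w => cos (c + dotv t (V w))).
Proof. by move=> mV; exact: (measurableT_comp (measurable_cos_dotv c t) mV). Qed.

Let icos (V : Omega -> 'cV[R]_n) c t : measurable_fun setT (V : Omega -> borelV R n) ->
  itg P (fun w => cos (c + dotv t (V w))).
Proof.
move=> mV; apply: (@itg_bounded _ _ _ P 1) => [|w]; first exact: mcos.
by rewrite ler_norml cos_geN1 cos_le1.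
Qed.

Let mclose k e : measurable [set w | e <= enorm (Z k w - U k w)].
Proof.
apply: measurable_ge => //; apply: measurable_fun_enorm; apply: measurable_fun_cV => // i.
apply: (eq_measurable_fun (fun w => Z k w i 0 - U k w i 0)) => [w _|]; first by rewrite !mxE.
by apply: measurable_funB; apply: (measurableT_comp (measurable_fun_coord i)).
Qed.

Let cos_close c t (e : R) : 0 < e -> exists k0, forall k, (k0 <= k)%N ->
  `|Ex P (fun w => cos (c + dotv t (Z k w))) - Ex P (fun w => cos (c + dotv t (U k w)))| <= e.
Proof.
move=> e0; pose dl := e / 2 / (enorm t + 1).
have t1 : 0 < enorm t + 1 by rewrite ltr_wpDl// enorm_ge0.
have dl0 : 0 < dl by rewrite !divr_gt0.
have e40 : 0 < e / 4 by rewrite divr_gt0.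
have [k0 hk0] := close dl0 e40.
exists k0 => k /hk0 h.
have iZ := icos c t (mZ k); have iU := icos c t (mU k).
have iB : itg P (fun w => e / 2 + 2 * \1_[set w | dl <= enorm (Z k w - U k w)] w).
  by apply: itgD; [exact: itg_cst|apply: itgZ; exact: itg_indic].
rewrite -ExB// (le_trans (Ex_norm_le (itgB iZ iU) iB _))//.
  move=> w; rewrite indicE; have [_|/negP wn] := boolP (w \in _).
    rewrite mulr1 (le_trans (ler_normB _ _))//.
    have : `|cos (c + dotv t (Z k w))| <= 1 by rewrite ler_norml cos_geN1 cos_le1.
    have : `|cos (c + dotv t (U k w))| <= 1 by rewrite ler_norml cos_geN1 cos_le1.
    lra.
  have hw : enorm (Z k w - U k w) < dl by rewrite ltNge; apply/negP => hw; apply: wn; exact/mem_set.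
  rewrite mulr0 addr0 (le_trans (cos_lipschitz _ _))//.
  have -> : c + dotv t (Z k w) - (c + dotv t (U k w)) = dotv t (Z k w - U k w) by rewrite dotvBr; ring.
  rewrite (le_trans (dotv_CS _ _))// (@le_trans _ _ ((enorm t + 1) * dl))//.
    by rewrite ler_pM ?enorm_ge0 ?lerDl// ltW.
  by rewrite /dl mulrC divfK// gt_eqF.
rewrite ExD; [|exact: itg_cst|by apply: itgZ; exact: itg_indic].
rewrite (Ex_cst P (e / 2)) ExZ; last exact: itg_indic.
by rewrite Ex_indic//; lra.
Qed.

(** Slutsky's lemma and tightness in one: Z inherits the cosine limits of U because cos is
    Lipschitz, and is tight because the coordinates of U are and Z is close to U. *)
Theorem cvg_law_criterion : cvg_in_law P Z N.
Proof.
split => // g cg [B gB].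
pose L k := image_prob P (mZ k).
have mg : measurable_fun [set: borelV R n] g by exact: continuous_measurable_borelV.
have -> : (fun k => \int[P]_w g (Z k w)) = (fun k => Ex (L k) g).
  apply/funext => k; rewrite Ex_image//.
  apply: (@itg_bounded _ _ _ P B) => [|w]; last exact: gB.
  exact: measurableT_comp mg (mZ k).
apply: cvg_law_trig => //; last by exists B.
  move=> c t; rewrite hN.
  apply/cvgrPdist_le => e e0; have e20 : 0 < e / 2 by rewrite divr_gt0.
  have [k0 hk0] := cos_close c t e20.
  have /cvgrPdist_le /(_ _ e20) [k1 _ hk1] := @hcos c t.
  exists (maxn k0 k1) => // k /=; rewrite geq_max => /andP[k0k k1k].
  rewrite Ex_image//; last 2 first.
  - exact: measurable_cos_dotv.
  - exact: icos.
  have := hk0 k k0k; have := hk1 k k1k; rewrite /=.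
  set u := Ex P _; set v := Ex P _; set z := _ * _.
  by rewrite !ler_norml => /andP[? ?] /andP[? ?]; apply/andP; split; lra.
move=> e e0; have [K1 hK1] := probability_tight N e0.
(* Using n + 1 keeps the denominator positive in dimension zero. *)
have h0 : 0 < e / (2 * n.+1%:R) by rewrite divr_gt0// mulr_gt0.
have /choice[KU hKU] i : exists K : R, forall k, fine (P [set w | K <= `|U k w i 0|]) <= e / (2 * n.+1%:R).
  exact: tight.
have e20 : 0 < e / 2 by rewrite divr_gt0.
have [k0 hk0] := close ltr01 e20.
(* A coordinate of Z beyond this K forces |Z - U| >= 1 or a coordinate of U beyond its own bound. *)
pose K := Num.max K1 (\sum_i `|KU i| + 1).
exists K; split; last by apply: hK1; rewrite le_max lexx.
exists k0 => // k /hk0 hk; rewrite image_probE.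
have mUi i c : measurable [set w | c <= `|U k w i 0|].
  apply: measurable_ge => //; apply: measurableT_comp => //.
  exact: (measurableT_comp (measurable_fun_coord i) (mU k)).
have mUU : measurable (\big[setU/set0]_(i < n) [set w | KU i <= `|U k w i 0|]).
  by apply: bigsetU_measurable => i _.
apply: (@le_trans _ _ (fine (P ([set w | 1 <= enorm (Z k w - U k w)] `|`
    \big[setU/set0]_(i < n) [set w | KU i <= `|U k w i 0|])))).
  apply: Pr_le.
  - rewrite -[X in measurable X]setTI; apply: (mZ k) => //; exact: measurable_box_compl.
  - exact: measurableU.
  - move=> w /= [i hi]; have [h|h] := leP 1 (enorm (Z k w - U k w)); first by left.
    right; rewrite (bigD1 i)//=; left => /=.
    have h1 := normr_le_enorm (Z k w - U k w) i; rewrite !mxE in h1.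
    have h2 : KU i <= \sum_j `|KU j|.
      by rewrite (le_trans (ler_norm _))// (bigD1 i)//= lerDl sumr_ge0.
    have h3 : \sum_j `|KU j| + 1 <= K by rewrite le_max lexx orbT.
    have h4 := ler_normD (Z k w i 0 - U k w i 0) (U k w i 0); rewrite subrK in h4.
    lra.
rewrite (le_trans (Pr_setU_le P (mclose k 1) mUU))// [leRHS](splitr e) lerD//.
have : fine (P (\big[setU/set0]_(i < n) [set w | KU i <= `|U k w i 0|])) <= \sum_(i < n) e / (2 * n.+1%:R).
  have : forall r : seq 'I_n, fine (P (\big[setU/set0]_(i <- r) [set w | KU i <= `|U k w i 0|])) <= \sum_(i <- r) e / (2 * n.+1%:R).
    elim=> [|i r IH]; first by rewrite !big_nil measure0.
    rewrite !big_cons (le_trans (Pr_setU_le P (mUi i (KU i)) _)) ?lerD//.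
    by apply: bigsetU_measurable => j _.
  exact.
move=> h; apply: (le_trans h); rewrite sumr_const card_ord -[_ *+ n]mulr_natl.
rewrite mulrA ler_pdivrMr ?mulr_gt0//.
have : n%:R <= n.+1%:R :> R by rewrite ler_nat.
by move=> hn; have := ler_wpM2l (ltW e0) hn; lra.
Qed.

End Criterion.

(** * Gradients on polyhedra *)

Section Gradient.
Context {R : realType} (n : nat).
Implicit Types (f : 'cV[R]_n -> R) (x y v : 'cV[R]_n).

Lemma derive_grad f x v : differentiable f x -> 'D_v f x = dotv (grad f x) v.
Proof.
move=> df; rewrite deriveE// dotvE.
rewrite {1}(_ : v = \sum_i v i 0 *: delta_mx i 0); last first.
  apply/matrixP => i j; rewrite ord1 summxE (bigD1 i)//= !mxE !eqxx mulr1 big1 ?addr0// => k ki.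
  by rewrite !mxE eq_sym (negbTE ki) mulr0.
rewrite linear_sum; apply: eq_bigr => i _.
by rewrite linearZ/= mxE deriveE// mulrC.
Qed.

(** By convexity the difference quotients at steps 1/(k+1) are at most f y - f x; the directional
    derivative is their limit. *)
Lemma convex_gradient_le (D : set 'cV[R]_n) f x y : @convex_function R 'cV[R]_n D f ->
  differentiable f x -> D x -> D y -> dotv (grad f x) (y - x) <= f y - f x.
Proof.
move=> cf df Dx Dy; rewrite -derive_grad//.
have dv : derivable f x (y - x) by exact: diff_derivable.
have lim : (fun h : R => h^-1 * (f (h *: (y - x) + x) - f x)) @ 0^' --> 'D_(y - x) f x by exact: dv.
have /cvgr_dnbhsP/(_ (fun k => k.+1%:R^-1)) h := lim.
have {}h : (k.+1%:R^-1)^-1 * (f (k.+1%:R^-1 *: (y - x) + x) - f x) @[k --> \oo] --> 'D_(y - x) f x.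
  by apply: h; split => //; exact: cvg_harmonic.
apply: (@ler_cvg_to _ _ _ _ _ (fun=> f y - f x) _ _ h (cvg_cst _)).
apply: nearW => k; set t : R := k.+1%:R^-1.
have t0 : 0 < t by rewrite invr_gt0.
have t1 : t <= 1 by rewrite invf_le1// ler1n.
have hc : f (t *: y + (1 - t) *: x) <= t * f y + (1 - t) * f x.
  exact: (@cf (Itv01 (ltW t0) t1) y x (mem_set Dy) (mem_set Dx)).
rewrite ler_pdivrMl//; move: hc.
have -> : t *: (y - x) + x = t *: y + (1 - t) *: x.
  by apply/matrixP => i j; rewrite !mxE; ring.
lra.
Qed.

(** Away from [xs] the remainder is bounded only linearly, but there |x - xs| > e, so dividing by e
    makes the bound quadratic. A bound on all of D applies to the average and to the early iterates
    without localization. *)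
Lemma global_taylor (D : set 'cV[R]_n) (g : 'cV[R]_n -> 'cV[R]_n) xs (H : 'M[R]_n) (c2 c e : R) :
  0 < c -> 0 < e ->
  (forall x, D x -> enorm (g x - g xs) <= c2 * enorm (x - xs)) ->
  (forall x, D x -> enorm (x - xs) <= e ->
     enorm (g x - g xs - H *m (x - xs)) <= c * enorm (x - xs) ^+ 2) ->
  exists2 c' : R, 0 <= c' & forall x, D x ->
     enorm (g x - g xs - H *m (x - xs)) <= c' * enorm (x - xs) ^+ 2.
Proof.
move=> c0 e0 lip loc; have [K K0 hK] := mulmx_bounded H.
have C0 : 0 <= (`|c2| + K) / e by rewrite divr_ge0 ?addr_ge0// ltW.
exists (c + (`|c2| + K) / e) => [|x Dx]; first by rewrite addr_ge0// ltW.
have [xe|xe] := leP (enorm (x - xs)) e.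
  rewrite (le_trans (loc x Dx xe))// ler_wpM2r ?sqr_ge0// lerDl//.
rewrite (@le_trans _ _ ((`|c2| + K) / e * enorm (x - xs) ^+ 2))//; last first.
  by rewrite ler_wpM2r ?sqr_ge0// lerDr ltW.
rewrite (le_trans (enormB _ _))// (le_trans (lerD (lip x Dx) (hK _)))// -mulrDl.
rewrite (@le_trans _ _ ((`|c2| + K) * enorm (x - xs)))//.
  by rewrite ler_wpM2r ?enorm_ge0// lerD2r ler_norm.
rewrite -mulrA ler_wpM2l ?addr_ge0// ler_pdivlMl// expr2 ler_wpM2r ?enorm_ge0//.
exact: ltW.
Qed.

End Gradient.

Section MeasurablePolyhedron.
Context {R : realType} (p n : nat) (A : 'M[R]_(p, n)) (b : 'cV[R]_p).

Lemma measurable_polyhedron : measurable (polyhedron A b : set (borelV R n)).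
Proof.
rewrite (_ : polyhedron A b = \bigcap_(i in [set: 'I_p]) [set x : borelV R n | (A *m (x : 'cV[R]_n)) i 0 <= b i 0]).
  apply: fin_bigcap_measurable => [|i _]; first exact: finite_finset.
  apply: measurable_ge => //; apply: measurable_mulmx => j; exact: measurable_fun_coord.
by apply/seteqP; split => x h i; [move=> _; exact: h|exact: h].
Qed.

Lemma measurable_active (I : {set 'I_p}) : measurable [set x : borelV R n | active A b x == I].
Proof.
rewrite (_ : [set x | _] = \bigcap_(i in [set: 'I_p])
    [set x : borelV R n | ((A *m (x : 'cV[R]_n)) i 0 == b i 0) == (i \in I)]).
  apply: fin_bigcap_measurable => [|i _]; first exact: finite_finset.
  have m1 : measurable_fun setT (fun x : borelV R n => (A *m (x : 'cV[R]_n)) i 0).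
    by apply: measurable_mulmx => j; exact: measurable_fun_coord.
  have meq : measurable [set x : borelV R n | (A *m (x : 'cV[R]_n)) i 0 = b i 0].
    rewrite (_ : [set x | _] = [set x : borelV R n | (A *m (x : 'cV[R]_n)) i 0 <= b i 0] `&`
        [set x : borelV R n | b i 0 <= (A *m (x : 'cV[R]_n)) i 0]).
      by apply: measurableI; exact: measurable_ge.
    apply/seteqP; split => [x /= xE|x [/= h1 h2]]; first by split; rewrite /= xE.
    by apply/le_anti; rewrite h1.
  have [iI|iI] := boolP (i \in I).
    rewrite (_ : [set x | _] = [set x : borelV R n | (A *m (x : 'cV[R]_n)) i 0 = b i 0])//.
    by apply/seteqP; split => x /=; rewrite eqb_id => /eqP.
  rewrite (_ : [set x | _] = ~` [set x : borelV R n | (A *m (x : 'cV[R]_n)) i 0 = b i 0]).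
    exact: measurableC.
  by apply/seteqP; split => x /=; rewrite eqbF_neg => /eqP.
apply/seteqP; split => x /=.
  by move=> /eqP <- i _ /=; rewrite inE eqxx.
by move=> h; apply/eqP/setP => i; have /= /eqP <- := h i Logic.I; rewrite inE.
Qed.

(** The projector jumps when the active set changes. There are finitely many active sets, so the map
    is a sum over them of an indicator times a map with a fixed projector. *)
Lemma measurable_projker_active d (T : measurableType d) (D : set T)
    (th g : T -> 'cV[R]_n) : measurable D ->
  measurable_fun D (th : T -> borelV R n) -> (forall i, measurable_fun D (fun w => g w i 0)) ->
  measurable_fun D (fun w => enorm (projker (act_mx A b (th w)) *m g w)).
Proof.
move=> mD mth mg.
pose B (I : {set 'I_p}) := projker (rowsub (@enum_val 'I_p (mem I)) A).
apply: (eq_measurable_fun (fun w => \sum_(I : {set 'I_p})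
    \1_[set w | active A b (th w) == I] w * enorm (B I *m g w))) => [w _|].
  rewrite (bigD1 (active A b (th w)))//= indicE mem_set//= mul1r big1 ?addr0// => I hI.
  by rewrite indicE memNset ?mul0r//= => /eqP E; rewrite E eqxx in hI.
apply: measurable_sum => I; apply: measurable_funM; last first.
  apply: measurable_fun_enorm; apply: measurable_fun_cV => // i.
  exact: measurable_mulmx.
have m1 : measurable_fun setT (\1_[set x : borelV R n | active A b x == I] : borelV R n -> R).
  exact: measurable_indic (measurable_active I).
apply: (eq_measurable_fun ((\1_[set x : borelV R n | active A b x == I] : borelV R n -> R) \o th)) => //.
exact: (measurableT_comp m1).
Qed.

Lemma closed_average (x : nat -> 'cV[R]_n) k : (0 < k)%N -> (forall j, polyhedron A b (x j)) ->
  polyhedron A b (k%:R^-1 *: \sum_(j < k) x j).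
Proof.
move=> k0 hx i; rewrite -scalemxAr mulmx_sumr mxE summxE.
rewrite ler_pdivrMl ?ltr0n// mulr_natl -[in leRHS](card_ord k) -sumr_const.
by apply: ler_sum => j _; exact: hx.
Qed.

End MeasurablePolyhedron.

Lemma within_continuous_measurable {R : realType} m n (D : set 'cV[R]_n)
    (g : 'cV[R]_n -> 'cV[R]_m) :
  measurable (D : set (borelV R n)) -> {within D, continuous g} ->
  measurable_fun (D : set (borelV R n)) (g : borelV R n -> borelV R m).
Proof.
move=> mD /continuousP cg.
apply: (@measurability _ _ (borelV R n) (borelV R m) D g (@open 'cV[R]_m) erefl) => _ [U oU <-].
have := cg _ oU; move=> /open_subspaceP[V oV VU].
by rewrite setIC -VU; apply: measurableI => //; exact: open_borelV.
Qed.

(** * Measurability and noise of the iterates *)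

Section SignedDisintegration.
Context {R : realType} d d1 d2 (Omega : measurableType d) (T : measurableType d1)
  (S : measurableType d2).
Variables (P : probability Omega R) (Y : Omega -> T) (X : Omega -> S)
  (K : T -> probability S R).
Hypotheses (mY : measurable_fun setT Y) (mX : measurable_fun setT X).
Hypothesis mK : forall B, measurable B -> measurable_fun setT (fun t => K t B).
Hypothesis YXK : forall A B, measurable A -> measurable B ->
  P (Y @^-1` A `&` X @^-1` B) = (\int[P]_(w in Y @^-1` A) K (Y w) B)%E.

Let ge0_Ex (g : T * S -> R) : measurable_fun setT g -> (forall z, 0 <= g z) ->
  (forall t, itg (K t) (fun x => g (t, x))) -> itg P (fun w => g (Y w, X w)) ->
  itg P (fun w => Ex (K (Y w)) (fun x => g (Y w, x))) /\
  Ex P (fun w => g (Y w, X w)) = Ex P (fun w => Ex (K (Y w)) (fun x => g (Y w, x))).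
Proof.
move=> mg g0 ig iPg.
have mg' : measurable_fun setT (EFin \o g) by exact/measurable_EFinP.
have g0' z : (0 <= (EFin \o g) z)%E by rewrite lee_fin.
have E := ge0_disintegration mY mX mK YXK mg' g0'.
have m1 : measurable_fun setT (fun w => Ex (K (Y w)) (fun x => g (Y w, x))).
  have m2 := measurable_fun_kernel_integral mK mg' g0'.
  have m3 := measurableT_comp m2 mY.
  by apply: (measurableT_comp _ m3).
have E2 : (\int[P]_w (Ex (K (Y w)) (fun x => g (Y w, x)))%:E)%E =
    (Ex P (fun w => g (Y w, X w)))%:E.
  rewrite -(ExE iPg) E; apply: eq_integral => w _; rewrite -ExE//.
have [i1 _] : itg P (fun w => Ex (K (Y w)) (fun x => g (Y w, x))) /\
    Ex P (fun w => Ex (K (Y w)) (fun x => g (Y w, x))) <= Ex P (fun w => g (Y w, X w)).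
  by apply: itg_ge0P => // [w|]; [exact: Ex_ge0|rewrite E2].
by split => //; rewrite [RHS]/Rintegral E2.
Qed.

(** The nonnegative case for |h| + h and for |h|, subtracted. *)
Lemma Ex_disintegration (h : T * S -> R) : measurable_fun setT h ->
  (forall t, itg (K t) (fun x => h (t, x))) -> itg P (fun w => h (Y w, X w)) ->
  Ex P (fun w => h (Y w, X w)) = Ex P (fun w => Ex (K (Y w)) (fun x => h (Y w, x))).
Proof.
move=> mh ih iP.
have mn : measurable_fun setT (fun z => `|h z|) by exact: measurableT_comp.
have [i1 e1] := @ge0_Ex _ mn (fun z => normr_ge0 (h z)) (fun t => itg_norm (ih t)) (itg_norm iP).
have h0 z : 0 <= `|h z| + h z by have := ler_norm (- h z); rewrite normrN; lra.
have [i2 e2] := @ge0_Ex _ (measurable_funD mn mh) h0 (fun t => itgD (itg_norm (ih t)) (ih t))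
  (itgD (itg_norm iP) iP).
transitivity (Ex P (fun w => (`|h (Y w, X w)| + h (Y w, X w)) - `|h (Y w, X w)|)).
  by apply: eq_Ex => w; rewrite addrAC subrr add0r.
rewrite ExB; [|by apply: itgD => //; exact: itg_norm|exact: itg_norm].
rewrite e1 e2 -ExB//; apply: eq_Ex => w.
have -> : Ex (K (Y w)) (fun x => `|h (Y w, x)| + h (Y w, x)) =
    Ex (K (Y w)) (fun x => `|h (Y w, x)|) + Ex (K (Y w)) (fun x => h (Y w, x)).
  by rewrite ExD//; apply: itg_norm; exact: ih.
by rewrite addrAC subrr add0r.
Qed.

End SignedDisintegration.

Section History.
Context {R : realType} d (Omega : measurableType d) (r : nat).
Variables (X1 X2 : nat -> Omega -> borelV R r).
Hypotheses (X1_meas : forall k, measurable_fun setT (X1 k))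
  (X2_meas : forall k, measurable_fun setT (X2 k)).

(** The generating family of [history], named so that the history becomes an instance of
    [filtration]. *)
Definition history_gens n := [set E | exists (k : nat) (B : set (borelV R r)),
  [/\ (0 < k <= n)%N, measurable B & E = X1 k @^-1` B \/ E = X2 k @^-1` B]].

Lemma filtration_history : filtration history_gens.
Proof.
split => k.
  apply: smallest_sub; first exact: sigma_algebra_measurable.
  move=> _ [j [B [_ mB [->|->]]]]; rewrite -[X in measurable X]setTI.
    exact: X1_meas.
  exact: X2_meas.
apply: sub_smallest2r; first exact: smallest_sigma_algebra.
move=> E [j [B [jk mB h]]]; exists j, B; split => //.
by case/andP: jk => -> /= /leqW.
Qed.

Lemma history_measurable1 j k : (0 < j <= k)%N ->
  measurable_fun setT (X1 j : g_sigma_algebraType (history_gens k) -> borelV R r).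
Proof.
move=> jk _ B mB; rewrite setTI; apply: sub_sigma_algebra.
by exists j, B; split => //; left.
Qed.

Lemma history_measurable2 j k : (0 < j <= k)%N ->
  measurable_fun setT (X2 j : g_sigma_algebraType (history_gens k) -> borelV R r).
Proof.
move=> jk _ B mB; rewrite setTI; apply: sub_sigma_algebra.
by exists j, B; split => //; right.
Qed.

End History.

(** The joint objective is the sum of a function of theta and a function of mu, so each component of
    the minimizer is minimal by itself. *)
Lemma dual_averaging_is_proj {R : realType} p s q m (A : 'M[R]_(p, s)) b
    (C : 'M[R]_(q, m)) dd alpha Gk Hk theta0 mu0 n th mu :
  is_argmin (polyhedron A b `*` polyhedron C dd)
    (dual_averaging_obj alpha Gk Hk theta0 mu0 n) (th, mu) ->
  is_proj (polyhedron A b) (theta0 - \sum_(k < n.+1) alpha k.+1 *: Gk k) th /\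
  is_proj (polyhedron C dd) (mu0 - \sum_(k < n.+1) alpha k.+1 *: Hk k) mu.
Proof.
move=> [[[/= Dth Dmu] hmin] _].
have objE y z : dual_averaging_obj alpha Gk Hk theta0 mu0 n (y, z) =
    (dotv (\sum_(k < n.+1) alpha k.+1 *: Gk k) y + 2^-1 * enorm (y - theta0) ^+ 2) +
    (dotv (\sum_(k < n.+1) alpha k.+1 *: Hk k) z + 2^-1 * enorm (z - mu0) ^+ 2).
  rewrite /dual_averaging_obj/= !(dotvC (\sum_(k < n.+1) _)) !dotv_sumr.
  under [X in _ = (X + _) + _]eq_bigr do rewrite dotvC dotvZl.
  under [X in _ = _ + (X + _)]eq_bigr do rewrite dotvC dotvZl.
  under eq_bigr do rewrite mulrDr; rewrite big_split/=; ring.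
split; apply: argmin_is_proj; split => // y Dy.
  by have := hmin (y, mu) (conj Dy Dmu); rewrite !objE lerD2r.
by have := hmin (th, y) (conj Dth Dy); rewrite !objE lerD2l.
Qed.

Section Process.
Context {R : realType} {s m r p q : nat} (A : 'M[R]_(p, s)) (b : 'cV[R]_p)
  (C : 'M[R]_(q, m)) (dd : 'cV[R]_q).
Variables (F : 'cV[R]_s -> borelV R r -> R) (l : borelV R r -> 'cV[R]_m -> R).
Let Theta := polyhedron A b.
Let M := polyhedron C dd.
Let G := Gfun F.
Hypothesis G_meas : measurable_fun
  [set z : borelV R s * borelV R r | Theta z.1] (fun z => G z.1 z.2 : borelV R s).
Hypothesis l_meas : measurable_fun
  [set z : borelV R r * borelV R m | M z.2] (fun z => l z.1 z.2).
Hypothesis gradl_meas : measurable_fun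
  [set z : borelV R r * borelV R m | M z.2] (fun z => grad (l z.1) z.2 : borelV R m).

Section Composition.
Context d (T : measurableType d).
Variables (t : T -> 'cV[R]_s) (u : T -> 'cV[R]_m) (y : T -> borelV R r).
Hypotheses (mt : measurable_fun setT (t : T -> borelV R s))
  (mu : measurable_fun setT (u : T -> borelV R m)) (my : measurable_fun setT y)
  (tT : forall w, Theta (t w)) (uM : forall w, M (u w)).

Lemma measurable_gradient i : measurable_fun setT (fun w => G (t w) (y w) i 0).
Proof.
have mD : measurable [set z : borelV R s * borelV R r | Theta z.1].
  by rewrite -[X in measurable X]setTI; exact: (measurable_fst measurableT _ (measurable_polyhedron A b)).
have mp : measurable_fun setT (fun w => (t w : borelV R s, y w)) by exact: measurable_fun_pair.
have h := measurable_comp mD _ G_meas mp.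
apply: (measurableT_comp (measurable_fun_coord i)); apply: h.
by move=> _ [w _ <-]; exact: tT.
Qed.

Let mDl : measurable [set z : borelV R r * borelV R m | M z.2].
Proof.
by rewrite -[X in measurable X]setTI; exact: (measurable_snd measurableT _ (measurable_polyhedron C dd)).
Qed.

Lemma measurable_lratio : measurable_fun setT (fun w => l (y w) (u w)).
Proof.
have mp : measurable_fun setT (fun w => (y w, u w : borelV R m)) by exact: measurable_fun_pair.
have h := measurable_comp mDl _ l_meas mp.
by apply: h => _ [w _ <-]; exact: uM.
Qed.

Lemma measurable_grad_lratio i : measurable_fun setT (fun w => grad (l (y w)) (u w) i 0).
Proof.
have mp : measurable_fun setT (fun w => (y w, u w : borelV R m)) by exact: measurable_fun_pair.
have h := measurable_comp mDl _ gradl_meas mp.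
apply: (measurableT_comp (measurable_fun_coord i)); apply: h.
by move=> _ [w _ <-]; exact: uM.
Qed.

Lemma measurable_Gis i : measurable_fun setT (fun w => Gis F l (u w) (t w) (y w) i 0).
Proof.
apply: (eq_measurable_fun (fun w => l (y w) (u w) * G (t w) (y w) i 0)) => [w _|].
  by rewrite /Gis [RHS]mxE.
by apply: measurable_funM; [exact: measurable_lratio|exact: measurable_gradient].
Qed.

Lemma measurable_Hfun i :
  measurable_fun setT (fun w => Hfun F l A b (t w) (u w) (y w) i 0).
Proof.
apply: (eq_measurable_fun (fun w => enorm (projker (act_mx A b (t w)) *m G (t w) (y w)) ^+ 2 *
    grad (l (y w)) (u w) i 0)) => [w _|].
  by rewrite /Hfun [RHS]mxE.
apply: measurable_funM; last exact: measurable_grad_lratio.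
by apply: measurable_funX; apply: measurable_projker_active => //; exact: measurable_gradient.
Qed.

End Composition.

Variables (alpha : nat -> R) (theta0 : 'cV[R]_s) (mu0 : 'cV[R]_m).
Hypotheses (theta0_in : Theta theta0) (mu0_in : M mu0).
Context d (Omega : measurableType d) (P : probability Omega R).
Variables (X1 X2 : nat -> Omega -> borelV R r).
Hypotheses (X1_meas : forall k, measurable_fun setT (X1 k))
  (X2_meas : forall k, measurable_fun setT (X2 k)).
Variables (theta : nat -> Omega -> 'cV[R]_s) (mu : nat -> Omega -> 'cV[R]_m).
Let gens := history_gens X1 X2.
Let Gk k w := Gis F l (mu k w) (theta k w) (X1 k.+1 w).
Let Hk k w := Hfun F l A b (theta k w) (mu k w) (X2 k.+1 w).
Hypotheses (theta_0 : forall w, theta 0%N w = theta0) (mu_0 : forall w, mu 0%N w = mu0).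
Hypothesis iterates : forall n w, is_argmin (Theta `*` M)
  (dual_averaging_obj alpha (Gk ^~ w) (Hk ^~ w) theta0 mu0 n) (theta n.+1 w, mu n.+1 w).

Lemma iterates_in k w : Theta (theta k w) /\ M (mu k w).
Proof.
case: k => [|k]; first by rewrite theta_0 mu_0.
by have [[[]]] := iterates k w.
Qed.

Lemma iterates_is_proj k w :
  is_proj Theta (theta0 - \sum_(j < k) alpha j.+1 *: Gk j w) (theta k w) /\
  is_proj M (mu0 - \sum_(j < k) alpha j.+1 *: Hk j w) (mu k w).
Proof.
case: k => [|k]; last exact: dual_averaging_is_proj (iterates k w).
by rewrite !big_ord0 !subr0 theta_0 mu_0; split; exact: is_proj_id.
Qed.

Let hf : filtration gens.
Proof. exact: filtration_history. Qed.

Let history_le d' (S : measurableType d') j k (Z : Omega -> S) : (j <= k)%N ->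
  measurable_fun setT (Z : g_sigma_algebraType (gens j) -> S) ->
  measurable_fun setT (Z : g_sigma_algebraType (gens k) -> S).
Proof. by move=> jk mZ _ B mB; exact: (filtration_le hf jk (mZ measurableT B mB)). Qed.

(** Strong induction on k: the iterate is a 1-Lipschitz function of a sum of earlier samples, which
    avoids any measurable selection of minimizers. *)
Lemma iterates_measurable k :
  measurable_fun setT (theta k : g_sigma_algebraType (gens k) -> borelV R s) /\
  measurable_fun setT (mu k : g_sigma_algebraType (gens k) -> borelV R m).
Proof.
elim/ltn_ind: k => k IH.
have mG j i : (j < k)%N -> adapted gens k (fun w => Gk j w i 0).
  move=> jk; have [mt mm] := IH j jk; apply: measurable_Gis => [||||w].
  - exact: history_le (ltnW jk) mt.
  - exact: history_le (ltnW jk) mm.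
  - exact: history_measurable1.
  - by move=> w; have [] := iterates_in j w.
  - by have [] := iterates_in j w.
have mH j i : (j < k)%N -> adapted gens k (fun w => Hk j w i 0).
  move=> jk; have [mt mm] := IH j jk; apply: measurable_Hfun => [||||w].
  - exact: history_le (ltnW jk) mt.
  - exact: history_le (ltnW jk) mm.
  - exact: history_measurable2.
  - by move=> w; have [] := iterates_in j w.
  - by have [] := iterates_in j w.
split.
  apply: (@measurable_fun_lipschitz _ _ (g_sigma_algebraType (gens k)) _ _ _
    (fun w => theta0 - \sum_(j < k) alpha j.+1 *: Gk j w)) => [|w w']; last first.
    by apply: is_proj_lipschitz; exact: (iterates_is_proj _ _).1.
  apply: measurable_fun_cV => // i.
  rewrite [X in measurable_fun _ X](_ : _ = (fun w => theta0 i 0 - \sum_(j < k) alpha j.+1 * Gk j w i 0)); last first.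
    apply/funext => w; rewrite mxE [in X in _ + X]mxE summxE; congr (_ - _).
    by apply: eq_bigr => j _; rewrite mxE.
  apply: measurable_funB => //; apply: measurable_sum => j; apply: measurable_funM => //.
  exact: mG.
apply: (@measurable_fun_lipschitz _ _ (g_sigma_algebraType (gens k)) _ _ _
  (fun w => mu0 - \sum_(j < k) alpha j.+1 *: Hk j w)) => [|w w']; last first.
  by apply: is_proj_lipschitz; exact: (iterates_is_proj _ _).2.
apply: measurable_fun_cV => // i.
rewrite [X in measurable_fun _ X](_ : _ = (fun w => mu0 i 0 - \sum_(j < k) alpha j.+1 * Hk j w i 0)); last first.
  apply/funext => w; rewrite mxE [in X in _ + X]mxE summxE; congr (_ - _).
  by apply: eq_bigr => j _; rewrite mxE.
apply: measurable_funB => //; apply: measurable_sum => j; apply: measurable_funM => //.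
exact: mH.
Qed.

Lemma iterates_adapted k i : adapted gens k (fun w => theta k w i 0).
Proof. exact: (measurableT_comp (measurable_fun_coord i) (iterates_measurable k).1). Qed.

Lemma sampled_gradient_adapted k i : adapted gens k.+1 (fun w => Gk k w i 0).
Proof.
have [mt mm] := iterates_measurable k; apply: measurable_Gis => [||||w].
- exact: history_le (leqnSn k) mt.
- exact: history_le (leqnSn k) mm.
- by apply: history_measurable1; rewrite leqnn.
- by move=> w; have [] := iterates_in k w.
- by have [] := iterates_in k w.
Qed.

Variables (PP : probability (borelV R r) R) (Pmu : 'cV[R]_m -> probability (borelV R r) R).
Hypothesis l_ratio : forall mu, M mu -> is_likelihood_ratio PP (Pmu mu) (l ^~ mu).
Hypothesis sampling : forall k (B1 B2 : set (borelV R r)), measurable B1 -> measurable B2 ->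
  is_cond_exp P (history X1 X2 k) (\1_(X1 k.+1 @^-1` B1 `&` X2 k.+1 @^-1` B2))
    (fun w => fine (Pmu (mu k w) B1) * fine (PP B2)).

(** The conditioning variable is the identity, seen as a map into Omega with the sigma-algebra of
    time k; the kernel is then w -> P_mu at mu = mu_k(w). *)
Let Y k : Omega -> g_sigma_algebraType (gens k) := id.

Let mY k : measurable_fun setT (Y k).
Proof. by have [h _] := hf; move=> _ B mB; rewrite setTI; exact: (h k B mB). Qed.

Let K k (w : g_sigma_algebraType (gens k)) := Pmu (mu k w).

Let mK k B : measurable B -> measurable_fun setT (fun w => @K k w B).
Proof.
(* The second sampling event is the whole space, which leaves the conditional law of the first
   sample. *)
move=> mB; have [_ _ h _] := sampling k mB measurableT.
have m1 : measurable_fun setT ((fun w => fine (Pmu (mu k w) B)) : g_sigma_algebraType (gens k) -> R).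
  move=> _ D mD; rewrite setTI; have := h D mD; congr (<<s _ >> _).
  by apply/seteqP; split => w /=; rewrite probability_setT mulr1.
have := (measurable_EFinP _ _).2 m1; apply: eq_measurable_fun => w _ /=.
by rewrite fineK// fin_num_measure.
Qed.

Let YXK k D B : measurable D -> measurable B ->
  P (Y k @^-1` D `&` X1 k.+1 @^-1` B) = (\int[P]_(w in Y k @^-1` D) K (Y k w) B)%E.
Proof.
move=> mD mB; have [_ _ _ h] := sampling k mB measurableT.
have mD' : measurable (Y k @^-1` D) by rewrite -[X in measurable X]setTI; exact: mY.
have mX : measurable (X1 k.+1 @^-1` B `&` X2 k.+1 @^-1` setT).
  by rewrite preimage_setT setIT -[X in measurable X]setTI; exact: X1_meas.
have := h D mD; rewrite integral_indic// preimage_setT setIT setIC => <-.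
by apply: eq_integral => w _; rewrite probability_setT mulr1 fineK// fin_num_measure.
Qed.

Let T k := (g_sigma_algebraType (gens k) * borelV R r)%type.

Let mGis k i : measurable_fun setT (fun z : T k => Gis F l (mu k z.1) (theta k z.1) z.2 i 0).
Proof.
have [mt mm] := iterates_measurable k.
apply: measurable_Gis => [||||w].
- exact: (measurableT_comp mt measurable_fst).
- exact: (measurableT_comp mm measurable_fst).
- exact: measurable_snd.
- by move=> w; have [] := iterates_in k w.1.
- by have [] := iterates_in k w.1.
Qed.

Let mgrad th i : Theta th -> measurable_fun setT (fun x => G th x i 0).
Proof. by move=> hth; apply: (@measurable_gradient _ _ (fun=> th) id) => //; exact: measurable_cst. Qed.

(** Given the past, the second moment of l G under P_mu equals the l-weighted second moment of G
    under P, by change of measure. *)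
Lemma sampled_gradient_sqr k M2 :
  (forall th u, Theta th -> M u ->
     (\int[PP]_x (enorm (G th x) ^+ 2 * l x u)%:E <= M2%:E)%E) ->
  itg P (fun w => enorm (Gk k w) ^+ 2) /\ Ex P (fun w => enorm (Gk k w) ^+ 2) <= M2.
Proof.
move=> hM2.
pose h (z : T k) := (enorm (Gis F l (mu k z.1) (theta k z.1) z.2) ^+ 2)%:E.
have mh : measurable_fun setT h.
  apply/measurable_EFinP; apply: measurable_funX; apply: measurable_fun_enorm.
  by apply: measurable_fun_cV => //; exact: mGis.
have h0 z : (0 <= h z)%E by rewrite lee_fin sqr_ge0.
apply: itg_ge0P => [|w|]; last 2 first.
- exact: sqr_ge0.
- have -> : (\int[P]_w (enorm (Gk k w) ^+ 2)%:E)%E = (\int[P]_w h (Y k w, X1 k.+1 w))%E by [].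
  rewrite (ge0_disintegration (@mY k) (X1_meas k.+1) (@mK k) (@YXK k) mh h0).
  rewrite (@le_trans _ _ (\int[P]_w (cst M2 w)%:E)%E)//; last first.
    by rewrite (ExE (itg_cst P M2)) Ex_cst.
  apply: ge0_le_integral => //.
  - by move=> w _; apply: integral_ge0.
  - exact: (measurableT_comp (measurable_fun_kernel_integral (@mK k) mh h0) (@mY k)).
  - by apply/measurable_EFinP.
  move=> w _; have [hth hmu] := iterates_in k w; have [ml lge lE] := l_ratio hmu.
  have := hM2 _ _ hth hmu; apply: le_trans; rewrite le_eqVlt; apply/orP; left; apply/eqP.
  rewrite -(ge0_integral_lratio ml lE).
  - by apply: eq_integral => x _; rewrite /h /= enormZ exprMn ger0_norm// expr2; congr EFin; ring.
  - apply: measurable_funM => //; apply: measurable_funX; apply: measurable_fun_enorm.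
    by apply: measurable_fun_cV => // i; exact: mgrad.
  - by move=> x; rewrite mulr_ge0// sqr_ge0.
- apply: measurable_funX; apply: measurable_fun_enorm; apply: measurable_fun_cV => // i.
  exact: (adapted_measurable hf (@sampled_gradient_adapted k i)).
Qed.

(** The weight l undoes the change of sampling law, so the conditional mean of the sampled gradient
    is g(theta_k) whatever mu_k is. *)
Lemma gradient_noise_martingale (g : 'cV[R]_s -> 'cV[R]_s) (M2 B : R) i :
  (forall th u, Theta th -> M u ->
     (\int[PP]_x (enorm (G th x) ^+ 2 * l x u)%:E <= M2%:E)%E) ->
  (forall th, Theta th -> itg PP (fun x => G th x i 0)) ->
  (forall th, Theta th -> g th i 0 = Ex PP (fun x => G th x i 0)) ->
  (forall k, adapted gens k (fun w => g (theta k w) i 0)) ->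
  (forall th, Theta th -> `|g th i 0| <= B) ->
  martingale_diff P gens (fun k w => (Gk k w - g (theta k w)) i 0).
Proof.
move=> hM2 iG gE ag gB.
have aG k := @sampled_gradient_adapted k i.
have mG k := adapted_measurable hf (aG k).
have mg k := adapted_measurable hf (ag k).
have gBw k w : `|g (theta k w) i 0| <= B by apply: gB; have [] := iterates_in k w.
have E k w : (Gk k w - g (theta k w)) i 0 = Gk k w i 0 - g (theta k w) i 0 by rewrite !mxE.
have iG2 k : itg P (fun w => Gk k w i 0 ^+ 2).
  have [h _] := @sampled_gradient_sqr k M2 hM2.
  apply: itg_le h; first exact: measurable_funX.
  by move=> w; rewrite normrX lerXn2r ?nnegrE ?enorm_ge0// normr_le_enorm.
have iGk k : itg P (fun w => Gk k w i 0) by exact: itg_sqr.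
have ig k : itg P (fun w => g (theta k w) i 0) by exact: (@itg_bounded _ _ _ P B).
split=> [k|k|k D FD].
- rewrite /adapted; under eq_fun do rewrite E.
  by apply: measurable_funB; [exact: aG|exact: (@adapted_le _ _ _ gens k k.+1 _ hf (leqnSn k) (ag k))].
- apply: (itg_le (Y := fun w => 2 * Gk k w i 0 ^+ 2 + 2 * B ^+ 2)).
  + apply: measurable_funX; apply: (eq_measurable_fun (fun w => Gk k w i 0 - g (theta k w) i 0)).
      by move=> w _; rewrite E.
    exact: measurable_funB.
  + move=> w; rewrite E ger0_norm ?sqr_ge0//.
    have h1 : g (theta k w) i 0 ^+ 2 <= B ^+ 2.
      rewrite -[leLHS]real_normK ?num_real// lerXn2r ?nnegrE//.
      exact: le_trans (gBw k w).
    have := sqr_ge0 (Gk k w i 0 + g (theta k w) i 0); nra.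
  + by apply: itgD; [exact: itgZ|exact: itg_cst].
- have mD : measurable D by have [h _] := hf; exact: (h k D FD).
  have iD (Z : Omega -> R) : itg P Z -> itg P (fun w => \1_D w * Z w).
    by move=> iZ; apply: itgM_bounded iZ; [exact: measurable_indicT|exact: indic_le1].
  rewrite (@eq_Ex _ _ _ P _ (fun w => \1_D w * Gk k w i 0 - \1_D w * g (theta k w) i 0)); last first.
    by move=> w; rewrite E mulrBr.
  rewrite ExB; [|exact: iD|exact: iD]; apply/eqP; rewrite subr_eq0; apply/eqP.
  pose h (z : T k) := \1_D z.1 * Gis F l (mu k z.1) (theta k z.1) z.2 i 0.
  have mh : measurable_fun setT h.
    apply: measurable_funM; last exact: mGis.
    exact: (measurableT_comp (@adapted_indic _ _ _ gens k D FD) measurable_fst).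
  have inner w : itg (Pmu (mu k w)) (fun x => Gis F l (mu k w) (theta k w) x i 0) /\
      Ex (Pmu (mu k w)) (fun x => Gis F l (mu k w) (theta k w) x i 0) = g (theta k w) i 0.
    have [hth hmu] := iterates_in k w; have [ml lge lE] := l_ratio hmu.
    have e x : l x (mu k w) * G (theta k w) x i 0 = Gis F l (mu k w) (theta k w) x i 0.
      by rewrite /Gis [RHS]mxE.
    split; first by apply: (eq_itg e); exact: itg_density (iG _ hth).
    by rewrite -(eq_Ex _ e) (Ex_density ml lge lE (iG _ hth)) gE.
  transitivity (Ex P (fun w => h (Y k w, X1 k.+1 w))) => //.
  rewrite (Ex_disintegration (@mY k) (X1_meas k.+1) (@mK k) (@YXK k) mh).
  + by apply: eq_Ex => w; rewrite /h/= ExZ ?(inner w).2//; exact: (inner w).1.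
  + by move=> w; exact: (itgZ (\1_D w) (inner w).1).
  + exact: iD (iGk k).
Qed.

End Process.

(** * Limit law *)

Section ReweightedCovariance.
Context {R : realType} d (T : measurableType d) (PP Q : probability T R) (lx : T -> R).
Hypotheses (mlx : measurable_fun setT lx) (lx0 : forall x, 0 <= lx x)
  (PPE : forall B, measurable B -> PP B = (\int[Q]_(x in B) (lx x)%:E)%E).
Variables (n : nat) (V : T -> 'cV[R]_n) (c : R).
Hypotheses (mV : forall i, measurable_fun setT (fun x => V x i 0))
  (iV : forall i, itg PP (fun x => V x i 0))
  (V_sqr : (\int[PP]_x (enorm (V x) ^+ 2 * lx x)%:E <= c%:E)%E).

Let WE x i : (lx x *: V x) i 0 = lx x * V x i 0. Proof. by rewrite mxE. Qed.

Lemma measurable_reweighted i : measurable_fun setT (fun x => (lx x *: V x) i 0).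
Proof. by under eq_fun do rewrite WE; exact: measurable_funM. Qed.

Lemma itg_reweighted_sqr i : itg Q (fun x => (lx x *: V x) i 0 ^+ 2).
Proof.
apply: (eq_itg (X := fun x => lx x * (V x i 0 ^+ 2 * lx x))) => [x|].
  by rewrite WE exprMn; ring.
apply: (itg_ge0P (c := c) _ _ _).1 => [|x|].
- by apply: measurable_funM => //; apply: measurable_funM => //; exact: measurable_funX.
- by rewrite mulr_ge0// mulr_ge0// sqr_ge0.
rewrite (ge0_integral_lratio mlx PPE); last 2 first.
- by apply: measurable_funM => //; exact: measurable_funX.
- by move=> x; rewrite mulr_ge0// sqr_ge0.
apply: le_trans V_sqr; apply: ge0_le_integral => //.
- by move=> x _; rewrite lee_fin mulr_ge0// sqr_ge0.
- by apply/measurable_EFinP; apply: measurable_funM => //; exact: measurable_funX.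
- apply/measurable_EFinP; apply: measurable_funM => //; apply: measurable_funX.
  by apply: measurable_fun_enorm; exact: measurable_fun_cV.
- move=> x _; rewrite lee_fin ler_wpM2r// -[leLHS]real_normK ?num_real//.
  by rewrite lerXn2r ?nnegrE ?enorm_ge0// normr_le_enorm.
Qed.

(** The second moment under Q becomes a weighted one under PP, while the mean does not depend on Q:
    only the first term varies with the sampling law. *)
Lemma mxtrace_covmx_reweighted k (B : 'M[R]_(k, n)) :
  \tr (covmx Q (fun x => B *m (lx x *: V x))) =
  Ex PP (fun x => enorm (B *m V x) ^+ 2 * lx x) -
  enorm (B *m (\col_i Ex PP (fun x => V x i 0))) ^+ 2.
Proof.
have mW := measurable_reweighted; have iW2 := itg_reweighted_sqr.
rewrite mxtrace_covmx; last 2 first.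
- by move=> i; exact: measurable_mulmx.
- by move=> i; exact: itg_mulmx_coord_sqr.
congr (_ - _).
  rewrite /Rintegral; congr fine.
  rewrite -(ge0_integral_lratio mlx PPE).
  - apply: eq_integral => x _; rewrite -scalemxAr enormZ exprMn ger0_norm//; congr EFin; ring.
  - apply: measurable_funM => //; apply: measurable_funX; apply: measurable_fun_enorm.
    by apply: measurable_fun_cV => // i; exact: measurable_mulmx.
  - by move=> x; rewrite mulr_ge0// sqr_ge0.
congr (enorm _ ^+ 2); apply/colP => i; rewrite mxE Ex_mulmx_coord//; congr ((_ *m _) i 0); apply/colP => j.
by rewrite !mxE -(Ex_density mlx lx0 PPE (iV j)); apply: eq_Ex => x; rewrite WE.
Qed.

End ReweightedCovariance.

Section LinearForms.
Context {R : realType} d (T : measurableType d) (P : probability T R).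

Lemma is_cond_exp_sum (gens : set (set T)) (I : finType) (c : I -> R) (Z Y : I -> T -> R) :
  <<s gens >> `<=` @measurable _ T ->
  (forall i, is_cond_exp P <<s gens >> (Z i) (Y i)) ->
  is_cond_exp P <<s gens >> (fun w => \sum_i c i * Z i w) (fun w => \sum_i c i * Y i w).
Proof.
move=> hg h.
have h' i := is_cond_exp_centred hg (h i).
have iZ i : itg P (fun w => c i * Z i w) by apply: itgZ; have [] := h' i.
have iY i : itg P (fun w => c i * Y i w) by apply: itgZ; have [] := h' i.
split => [||B mB|A FA]; [exact: itg_sum|exact: itg_sum| |].
  have mYg : measurable_fun setT ((fun w => \sum_i c i * Y i w) : g_sigma_algebraType gens -> R).
    by apply: measurable_sum => i; apply: measurable_funM => //; have [] := h' i.
  by have := mYg measurableT B mB; rewrite setTI.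
have mA := hg _ FA.
have iA (X : T -> R) : itg P X -> itg P (fun w => \1_A w * X w).
  by move=> iX; apply: itgM_bounded iX; [exact: measurable_indicT|exact: indic_le1].
rewrite !integral_indicE//; [|exact: itg_sum|exact: itg_sum]; congr EFin.
have sumE (X : I -> T -> R) : (forall i, itg P (X i)) ->
    Ex P (fun w => \1_A w * \sum_i c i * X i w) = \sum_i c i * Ex P (fun w => \1_A w * X i w).
  move=> iX; rewrite (@eq_Ex _ _ _ P _ (fun w => \sum_i c i * (\1_A w * X i w))).
    rewrite Ex_sum => [|i]; last by apply: itgZ; exact: iA.
    by apply: eq_bigr => i _; rewrite ExZ//; exact: iA.
  by move=> w; rewrite mulr_sumr; apply: eq_bigr => i _; ring.
rewrite !sumE => [|i|i]; [|by have [] := h' i|by have [] := h' i].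
apply: eq_bigr => i _; congr (_ * _).
have [iZi iYi _ /(_ A FA)] := h' i.
rewrite (@eq_Ex _ _ _ P _ (fun w => \1_A w * Z i w - \1_A w * Y i w)); last by move=> w; rewrite mulrBr.
by rewrite ExB; [move/eqP; rewrite subr_eq0 => /eqP|exact: iA|exact: iA].
Qed.

(** A quadratic form is a finite linear combination of matrix entries, so entrywise versions combine
    linearly. *)
Lemma is_cond_exp_quadratic (gens : set (set T)) n (x : T -> 'cV[R]_n) (V : T -> 'M[R]_n) t :
  <<s gens >> `<=` @measurable _ T ->
  (forall i j, is_cond_exp P <<s gens >> (fun w => (x w *m (x w)^T) i j) (fun w => V w i j)) ->
  is_cond_exp P <<s gens >> (fun w => dotv t (x w) ^+ 2) (fun w => dotv t (V w *m t)).
Proof.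
move=> hg h.
have quadE (S : 'M[R]_n) : dotv t (S *m t) =
    \sum_(ij : 'I_n * 'I_n) (t ij.1 0 * t ij.2 0) * S ij.1 ij.2.
  rewrite dotvE (eq_bigr (fun i => \sum_j (t i 0 * t j 0) * S i j)) => [|i _].
    by rewrite pair_bigA.
  by rewrite mxE mulr_sumr; apply: eq_bigr => j _; ring.
have -> : (fun w => dotv t (x w) ^+ 2) = (fun w => dotv t ((x w *m (x w)^T) *m t)).
  apply/funext => w; rewrite -mulmxA expr2 /dotv mulmxA.
  rewrite [X in _ = X]mxE big_ord1; congr (_ * _).
  exact: dotvC.
have -> : (fun w => dotv t (V w *m t)) = (fun w =>
   \sum_(ij : 'I_n * 'I_n) (t ij.1 0 * t ij.2 0) * V w ij.1 ij.2) by apply/funext => w.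
rewrite (_ : (fun w => dotv t _) = (fun w =>
   \sum_(ij : 'I_n * 'I_n) (t ij.1 0 * t ij.2 0) * (x w *m (x w)^T) ij.1 ij.2)).
  by apply: (@is_cond_exp_sum gens _ _ (fun ij w => (x w *m (x w)^T) ij.1 ij.2)) => // ij; exact: h.
by apply/funext => w.
Qed.

Lemma martingale_diff_dotv (gens : nat -> set (set T)) n (eta : nat -> T -> 'cV[R]_n) t :
  filtration gens -> (forall i, martingale_diff P gens (fun k w => eta k w i 0)) ->
  martingale_diff P gens (fun k w => dotv t (eta k w)).
Proof.
move=> hf he.
have mE i k : measurable_fun setT (fun w => eta k w i 0).
  exact: (@martingale_diff_measurable _ _ _ P gens (fun k w => eta k w i 0) k hf (he i)).
have iE i k : itg P (fun w => eta k w i 0).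
  exact: (@martingale_diff_itg _ _ _ P gens (fun k w => eta k w i 0) k hf (he i)).
split=> [k|k|k A FA].
- rewrite /adapted; under eq_fun do rewrite dotvE.
  by apply: measurable_sum => i; apply: measurable_funM => //; have [h _ _] := he i; exact: (h k).
- by apply: itg_dotv_sqr => // i; have [_ h _] := he i; exact: h.
have mA : measurable A by have [h _] := hf; exact: (h k A FA).
rewrite (@eq_Ex _ _ _ P _ (fun w => \sum_i t i 0 * (\1_A w * eta k w i 0))); last first.
  by move=> w; rewrite dotvE mulr_sumr; apply: eq_bigr => i _; ring.
have iA i : itg P (fun w => \1_A w * eta k w i 0).
  by apply: itgM_bounded (iE i k); [exact: measurable_indicT|exact: indic_le1].
rewrite Ex_sum => [|i]; last exact: itgZ.
rewrite big1// => i _; rewrite ExZ//; have [_ _ h] := he i.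
by rewrite (h k A FA) mulr0.
Qed.

End LinearForms.

Section Normalized.
Context {R : realType} d (Omega : measurableType d) (P : probability Omega R) (s : nat).
Variables (gens : nat -> set (set Omega)) (eta Z : nat -> Omega -> 'cV[R]_s) (Q S : 'M[R]_s).
Variables (N : probability (borelV R s) R) (B : R).
Hypotheses (hf : filtration gens)
  (eta_md : forall i, martingale_diff P gens (fun k w => eta k w i 0))
  (eta_sqr : forall k, itg P (fun w => enorm (eta k w) ^+ 2) /\
     Ex P (fun w => enorm (eta k w) ^+ 2) <= B)
  (Q_sym : Q^T = Q) (mZ : forall n, measurable_fun setT (Z n : Omega -> borelV R s))
  (close : forall e h : R, 0 < e -> 0 < h -> exists n0, forall n, (n0 <= n)%N ->
     fine (P [set w | e <= enorm (Z n w + (Num.sqrt n%:R)^-1 *: \sum_(k < n) Q *m eta k w)]) <= h)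
  (clt : forall c t, (fun n => Ex P (fun w =>
       cos (c + (Num.sqrt n%:R)^-1 * \sum_(k < n) dotv (- (Q *m t)) (eta k w)))) @ \oo -->
     cos c * expR (- (dotv t (S *m t) / 2)))
  (hN : gaussian_char N S).

Let U n w := - ((Num.sqrt n%:R)^-1 *: \sum_(k < n) Q *m eta k w).

Let dotvU t n w : dotv t (U n w) =
  (Num.sqrt n%:R)^-1 * \sum_(k < n) dotv (- (Q *m t)) (eta k w).
Proof.
rewrite /U -scalerN dotvC dotvZl dotvC -sumrN dotv_sumr; congr (_ * _).
by apply: eq_bigr => k _; rewrite -mulmxN dotv_mulmx Q_sym -mulNmx !mulNmx dotvNl dotvNr.
Qed.

Let mU n : measurable_fun setT (U n : Omega -> borelV R s).
Proof.
apply: measurable_fun_cV => // i.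
under eq_fun do rewrite -dotv_delta dotvU.
apply: measurable_funM => //; apply: measurable_sum => k.
have := martingale_diff_dotv (- (Q *m delta_mx i 0)) hf eta_md.
exact: martingale_diff_measurable.
Qed.

(** What remains for [cvg_law_criterion] is tightness of U: a sum of n noise terms is compared with
    the level K sqrt n by Kolmogorov's inequality, which gives B3 / K^2 uniformly in n. *)
Lemma cvg_in_law_normalized : cvg_in_law P Z N.
Proof.
apply: (@cvg_law_criterion _ _ _ P s Z U S N) => //.
- move=> e h e0 h0; have [n0 hn0] := close e0 h0; exists n0 => n /hn0.
  by under eq_set do rewrite -[_ *: _]opprK.
- move=> i h h0.
  pose t : 'cV[R]_s := - (Q *m delta_mx i 0); pose z k w := dotv t (eta k w).
  have zmd : martingale_diff P gens z by exact: martingale_diff_dotv.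
  pose B3 := enorm t ^+ 2 * `|B|.
  have B30 : 0 <= B3 by rewrite mulr_ge0// sqr_ge0.
  have zB k : Ex P (fun w => z k w ^+ 2) <= B3.
    have [i1 h1] := eta_sqr k.
    apply: (@le_trans _ _ (Ex P (fun w => enorm t ^+ 2 * enorm (eta k w) ^+ 2))).
      apply: Ex_le => [||w]; [by case: zmd => _ + _; exact|exact: itgZ|].
      rewrite -exprMn -[leLHS]real_normK ?num_real// lerXn2r ?nnegrE ?mulr_ge0 ?enorm_ge0//.
      exact: dotv_CS.
    by rewrite ExZ// ler_wpM2l ?sqr_ge0// (le_trans h1)// ler_norm.
  (* Adding 1 keeps the level positive when B3 = 0. *)
  exists (Num.sqrt (B3 / h) + 1) => n; set K := _ + 1.
  have K0 : 0 < K by rewrite ltr_wpDl// sqrtr_ge0.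
  have KB : B3 / K ^+ 2 <= h.
    rewrite ler_pdivrMr ?exprn_gt0// mulrC -ler_pdivrMr//.
    have : 0 <= B3 / h by rewrite divr_ge0// ltW.
    by move=> /sqr_sqrtr <-; rewrite lerXn2r ?nnegrE ?sqrtr_ge0 ?lerDl// ltW.
  (* For n = 0 the sum is empty and U vanishes; sqrt n is positive in the other case. *)
  have [->|n0] := eqVneq n 0%N.
    rewrite (_ : [set w | _] = set0) ?measure0 ?ltW//.
    apply/seteqP; split => // w /=; rewrite -dotv_delta dotvU big_ord0 mulr0 normr0.
    by rewrite leNgt K0.
  have sn0 : 0 < Num.sqrt n%:R :> R by rewrite sqrtr_gt0 ltr0n lt0n.
  have a0 : 0 < K * Num.sqrt n%:R by rewrite mulr_gt0.
  have := kolmogorov_maximal hf zmd a0 n => hk.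
  apply: (@le_trans _ _ (fine (P (~` stay_below z (K * Num.sqrt n%:R) n)))).
    apply: Pr_le.
    + apply: measurable_ge => //; apply: measurableT_comp => //.
      exact: (measurableT_comp (measurable_fun_coord i) (mU n)).
    + apply: measurableC; have [h1 _] := hf.
      exact: (h1 n _ (@stay_below_adapted _ _ _ _ _ _ (K * Num.sqrt n%:R) hf zmd n)).
    + move=> w /=; rewrite -dotv_delta dotvU -/t => h1 /(stay_belowP z a0)/(_ n (leqnn _)).
      apply/negP; rewrite -leNgt; move: h1.
      by rewrite normrM ger0_norm ?invr_ge0 ?sqrtr_ge0// mulrC ler_pdivlMr.
  apply: (le_trans hk); apply: le_trans KB.
  apply: (@le_trans _ _ ((\sum_(k < n) B3) / (K * Num.sqrt n%:R) ^+ 2)).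
    by rewrite ler_wpM2r ?invr_ge0 ?sqr_ge0//; apply: ler_sum => k _; exact: zB.
  rewrite sumr_const card_ord exprMn sqr_sqrtr ?ler0n// invfM -(mulr_natr B3 n).
  have nz : n%:R != 0 :> R by rewrite pnatr_eq0.
  by rewrite mulrACA mulfV// mulr1.
- move=> c t; under eq_fun do under eq_fun do rewrite dotvU.
  exact: clt.
Qed.

End Normalized.

Lemma bounded_enorm {R : realType} n (D : set 'cV[R]_n) x0 : bounded_set D ->
  exists B : R, forall x, D x -> enorm (x - x0) <= B.
Proof.
move=> [B [_ hB]]; exists (n%:R * (B + 1) + enorm x0) => x Dx.
rewrite (le_trans (enormB _ _))// lerD2r (le_trans (enorm_le_mx_norm _))//.
by rewrite ler_wpM2l//; apply: (hB (B + 1)) => //; rewrite ltrDl.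
Qed.

Lemma dotv_col_mx {R : realType} m n (a c : 'cV[R]_m) (b e : 'cV[R]_n) :
  dotv (col_mx a b) (col_mx c e) = dotv a c + dotv b e.
Proof. by rewrite /dotv tr_col_mx mul_row_col mxE. Qed.

Theorem corollary5p10 (R : realType) (s m r p q : nat)
  (* constraint sets *)
  (A : 'M[R]_(p, s)) (b : 'cV[R]_p) (C : 'M[R]_(q, m)) (dd : 'cV[R]_q)
  (Theta := polyhedron A b) (M := polyhedron C dd)
  (* the law P on XX, the integrand F, f and G *)
  (PP : probability (borelV R r) R) (XX : set (borelV R r))
  (XX_meas : measurable XX) (PP_XX : PP XX = 1%E)
  (F : 'cV[R]_s -> borelV R r -> R)
  (f := objf PP F) (G := Gfun F)
  (F_integrable : forall theta, Theta theta ->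
     PP.-integrable setT (EFin \o F theta))
  (F_diff : forall theta x, Theta theta -> XX x ->
     differentiable (F ^~ x) theta)
  (G_meas : measurable_fun
     [set z : borelV R s * borelV R r | Theta z.1]
     (fun z => G z.1 z.2 : borelV R s))
  (G_integrable : forall theta i, Theta theta ->
     PP.-integrable setT (fun x => (G theta x i 0)%:E))
  (grad_f : forall theta, Theta theta ->
     grad f theta = \col_i \int[PP]_x G theta x i 0)
  (* the importance sampling family *)
  (Pmu : 'cV[R]_m -> probability (borelV R r) R)
  (l : borelV R r -> 'cV[R]_m -> R)
  (PP_ll_Pmu : forall mu, M mu -> PP `<< Pmu mu)
  (l_ratio : forall mu, M mu -> is_likelihood_ratio PP (Pmu mu) (l ^~ mu))
  (l_meas : measurable_fun
     [set z : borelV R r * borelV R m | M z.2]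
     (fun z => l z.1 z.2))
  (gradl_meas : measurable_fun
     [set z : borelV R r * borelV R m | M z.2]
     (fun z => grad (l z.1) z.2 : borelV R m))
  (Gmu := Gis F l) (v := visobj PP F l A b) (H := Hfun F l A b)
  (v_diff : forall theta mu, Theta theta -> M mu -> differentiable (v theta) mu)
  (* the algorithm *)
  (alpha0 gamma : R) (alpha0_gt0 : 0 < alpha0)
  (gamma_bounds : 2^-1 < gamma < 1)
  (alpha := fun n : nat => alpha0 / n%:R `^ gamma)
  (theta0 : 'cV[R]_s) (mu0 : 'cV[R]_m)
  (theta0_in : Theta theta0) (mu0_in : M mu0)
  (d : measure_display) (Omega : measurableType d) (P : probability Omega R)
  (X1 X2 : nat -> Omega -> borelV R r)
  (X1_meas : forall k, measurable_fun setT (X1 k))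
  (X2_meas : forall k, measurable_fun setT (X2 k))
  (FF := history X1 X2)
  (theta : nat -> Omega -> 'cV[R]_s) (mu : nat -> Omega -> 'cV[R]_m)
  (Gk := fun k w => Gmu (mu k w) (theta k w) (X1 k.+1 w))
  (Hk := fun k w => H (theta k w) (mu k w) (X2 k.+1 w))
  (theta_0 : forall w, theta 0%N w = theta0)
  (mu_0 : forall w, mu 0%N w = mu0)
  (iterates : forall n w,
     is_argmin (Theta `*` M)
       (dual_averaging_obj alpha (Gk ^~ w) (Hk ^~ w) theta0 mu0 n)
       (theta n.+1 w, mu n.+1 w))
  (sampling : forall k (B1 B2 : set (borelV R r)),
     measurable B1 -> measurable B2 ->
     is_cond_exp P (FF k)
       (\1_(X1 k.+1 @^-1` B1 `&` X2 k.+1 @^-1` B2))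
       (fun w => fine (Pmu (mu k w) B1) * fine (PP B2)))
  (* (a) *)
  (f_convex : @convex_function R 'cV[R]_s Theta f)
  (f_diff : forall theta, Theta theta -> differentiable f theta)
  (f_C1 : {within Theta, continuous (grad f)})
  (ts : 'cV[R]_s) (ts_argmin : is_argmin Theta f ts)
  (f_C2 : \forall theta \near ts,
     [/\ differentiable f theta, differentiable (grad f) theta &
         {for theta, continuous (hess f)}])
  (hess_f_posdef : sym_posdef (hess f ts))
  (Theta_bounded : bounded_set Theta)
  (* (b) *)
  (l_log_convex : forall x, log_convex M (l x))
  (l_diff : forall x mu, M mu -> differentiable (l x) mu)
  (* (c) *)
  (ms : 'cV[R]_m) (ms_argmin : is_argmin M (v ts) ms)
  (v_D2 : (\forall mu \near ms, differentiable (v ts) mu) /\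
          differentiable (grad (v ts)) ms)
  (hess_v_posdef : sym_posdef (hess (v ts) ms))
  (M_bounded : bounded_set M)
  (moments : exists GM HM : R, forall theta mu, Theta theta -> M mu ->
     (\int[PP]_x (enorm (G theta x) ^+ 2 * l x mu)%:E <= (GM ^+ 2)%:E)%E /\
     (\int[PP]_x (enorm (projker (act_mx A b theta) *m G theta x) ^+ 4
                  * enorm (grad (l x) mu) ^+ 2)%:E <= (HM ^+ 2)%:E)%E)
  (* (d) *)
  (growth : exists c1 : R, 0 < c1 /\ forall theta mu, Theta theta -> M mu ->
     f theta - f ts >= c1 * enorm (theta - ts) ^+ 2 /\
     v ts mu - v ts ms >= c1 * enorm (mu - ms) ^+ 2)
  (lipschitz : exists c2 c3 : R,
     (forall theta mu, Theta theta -> M mu ->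
        enorm (grad f theta - grad f ts) <= c2 * enorm (theta - ts) /\
        enorm (grad (v ts) mu - grad (v ts) ms) <= c2 * enorm (mu - ms)) /\
     (forall theta mu, Theta theta -> M mu ->
        act_mx A b ts *m theta = act_vec A b ts ->
        (forall i, (inact_mx A b ts *m theta) i 0 < inact_vec A b ts i 0) ->
        enorm (grad (v theta) mu - grad (v ts) mu)
          <= c3 * enorm (theta - ts) ^+ 2))
  (* (e) *)
  (multiplier_theta : exists lambda1 : 'cV[R]_#|active A b ts|,
     (forall i, 0 < lambda1 i 0) /\
     - grad f ts = (act_mx A b ts)^T *m lambda1)
  (multiplier_mu : exists lambda2 : 'cV[R]_#|active C dd ms|,
     (forall i, 0 < lambda2 i 0) /\
     - grad (v ts) ms = (act_mx C dd ms)^T *m lambda2)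
  (* (f) *)
  (taylor_f : exists c e : R, [/\ 0 < c, 0 < e &
     forall theta, Theta theta -> enorm (theta - ts) <= e ->
       enorm (grad f theta - grad f ts - hess f ts *m (theta - ts))
         <= c * enorm (theta - ts) ^+ 2])
  (taylor_v : exists c e : R, [/\ 0 < c, 0 < e &
     forall mu, M mu -> enorm (mu - ms) <= e ->
       enorm (grad (v ts) mu - grad (v ts) ms - hess (v ts) ms *m (mu - ms))
         <= c * enorm (mu - ms) ^+ 2])
  (restricted_convexity : exists rho : R, [/\ 0 < rho,
     forall x : 'cV[R]_s, act_mx A b ts *m x = 0 ->
       dotv x (hess f ts *m x) >= rho * enorm x ^+ 2 &
     forall y : 'cV[R]_m, act_mx C dd ms *m y = 0 ->
       dotv y (hess (v ts) ms *m y) >= rho * enorm y ^+ 2])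
  (* (g) *)
  (xi := noise f v theta mu Gk Hk)
  (Sigma1 := covmx (Pmu ms) (Gmu ms ts)) (Sigma2 := covmx PP (H ts ms))
  (lindeberg : forall (t : 'cV[R]_(s + m)) (e : R), 0 < e ->
     exists Y : nat -> nat -> Omega -> R,
       (forall n k, (k < n)%N ->
          is_cond_exp P (FF k)
            (fun w => dotv t (xi k w) ^+ 2 *
               \1_[set w' | e * Num.sqrt n%:R < `|dotv t (xi k w')|] w)
            (Y n k)) /\
       cvg_in_proba P (fun n w => n%:R^-1 * \sum_(k < n) Y n k w) 0)
  (covariances : exists V : nat -> Omega -> 'M[R]_(s + m),
     (forall k i j,
        is_cond_exp P (FF k) (fun w => (xi k w *m (xi k w)^T) i j)
          (fun w => V k w i j)) /\
     (forall t : 'cV[R]_(s + m),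
        cvg_in_proba P
          (fun n w => dotv t ((n%:R^-1 *: \sum_(k < n) V k w) *m t))
          (dotv t (block_mx Sigma1 0 0 Sigma2 *m t)))) :
  (exists N : probability (borelV R s) R,
     is_normal N 0
       (covmx (Pmu ms) (fun x => projker (act_mx A b ts) *m Gmu ms ts x)) /\
     cvg_in_law P
       (fun n w => Num.sqrt n%:R *:
          (projker (act_mx A b ts) *m grad f (average theta n w)))
       N) /\
  is_argmin M
    (fun mu => \tr (covmx (Pmu mu)
                      (fun x => projker (act_mx A b ts) *m Gmu mu ts x)))
    ms.
Proof.
have hf := filtration_history X1_meas X2_meas.
have iter_in := iterates_in theta0_in mu0_in theta_0 mu_0 iterates.
have iter_proj := iterates_is_proj theta0_in mu0_in theta_0 mu_0 iterates.
have adap := iterates_adapted G_meas l_meas gradl_meas theta0_in mu0_in X1_meas X2_meas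
  theta_0 mu_0 iterates.
have [[ts_in ts_min] _] := ts_argmin.
have [[ms_in _] _] := ms_argmin.
have [GM [HM mom]] := moments.
have momG th u : Theta th -> M u ->
    (\int[PP]_x (enorm (G th x) ^+ 2 * l x u)%:E <= (GM ^+ 2)%:E)%E.
  by move=> hth hu; have [] := mom th u hth hu.
have [c1 [c10 gr]] := growth.
have [c2 [_ [lp _]]] := lipschitz.
(* The hypothesis is stated for pairs; [mu0] fills the second slot. *)
have lpf th : Theta th -> enorm (grad f th - grad f ts) <= c2 * enorm (th - ts).
  by move=> hth; have [] := lp th mu0 hth mu0_in.
have [D diam] := bounded_enorm ts Theta_bounded.
have D0 : 0 <= D by rewrite (le_trans _ (diam _ ts_in))// enorm_ge0.
pose gB := enorm (grad f ts) + `|c2| * D.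
have gB_le th : Theta th -> enorm (grad f th) <= gB.
  move=> hth; rewrite -(subrK (grad f ts) (grad f th)) addrC (le_trans (enormD _ _))// lerD2l.
  rewrite (le_trans (lpf _ hth))// (@le_trans _ _ (`|c2| * enorm (th - ts)))//.
    by rewrite ler_wpM2r ?enorm_ge0// ler_norm.
  by rewrite ler_wpM2l// diam.
have mgrad : measurable_fun (Theta : set (borelV R s)) (grad f : borelV R s -> borelV R s).
  by apply: within_continuous_measurable f_C1; exact: measurable_polyhedron.
have g_comp d' (T : measurableType d') (y : T -> 'cV[R]_s) i : (forall w, Theta (y w)) ->
    measurable_fun setT (y : T -> borelV R s) -> measurable_fun setT (fun w => grad f (y w) i 0).
  move=> yT my; apply: (measurableT_comp (measurable_fun_coord i)).
  apply: (measurable_comp _ _ mgrad my); first exact: measurable_polyhedron.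
  by move=> _ [w _ <-].
have g_adapted k i : adapted (history_gens X1 X2) k (fun w => grad f (theta k w) i 0).
  apply: g_comp => [w|]; first by have [] := iter_in k w.
  exact: measurable_fun_cV (adap k).
have gE th i : Theta th -> grad f th i 0 = Ex PP (fun x => G th x i 0).
  by move=> hth; rewrite grad_f// mxE.
have eta_md i := gradient_noise_martingale G_meas l_meas gradl_meas theta0_in mu0_in
  X1_meas X2_meas theta_0 mu_0 iterates l_ratio sampling momG
  (fun th => G_integrable th i) (gE ^~ i) (g_adapted ^~ i)
  (fun th hth => le_trans (normr_le_enorm (grad f th) i) (gB_le th hth)).
have G_sqr k := @sampled_gradient_sqr _ _ _ _ _ _ _ _ _ _ _ _ G_meas l_meas gradl_meas _ _ _
  theta0_in mu0_in _ _ P _ _ X1_meas X2_meas _ _ theta_0 mu_0 iterates _ _ l_ratio sampling k _ momG.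
have ha := power_step_sizes alpha0_gt0 gamma_bounds.
(* Quadratic growth of f combined with the tangent inequality at y evaluated at [ts]. *)
have growth' y : Theta y -> c1 * enorm (y - ts) ^+ 2 <= dotv (grad f y) (y - ts).
  move=> hy; have [h _] := gr y mu0 hy mu0_in; apply: (le_trans h).
  have := convex_gradient_le f_convex (f_diff y hy) hy ts_in.
  by rewrite -[ts - y]opprB dotvNr; lra.
have [ct [et [ct0 et0 tay]]] := taylor_f.
have [c3 c30 tay'] := global_taylor ct0 et0 lpf tay.
have [r0 r00 cone] := local_cone ts_in.
have avg_in n w : (0 < n)%N -> Theta (average theta n w).
  by move=> n0; exact: (@closed_average _ _ _ A b (theta^~ w) n n0 (fun j => (iter_in j w).1)).
(* At n = 0 the average is 0, possibly outside Theta, but the function is then constant. *)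
have avg_meas n i : measurable_fun setT (fun w => grad f (average theta n w) i 0).
  case: n => [|n].
    rewrite (_ : (fun w => _) = (fun=> grad f 0 i 0)); first exact: measurable_cst.
    by apply/funext => w; rewrite /average big_ord0 scaler0.
  apply: g_comp => [w|]; first exact: avg_in.
  apply: measurable_fun_cV => // j.
  rewrite (_ : (fun w => _) = (fun w => n.+1%:R^-1 * \sum_(k < n.+1) theta k w j 0)); last first.
    by apply/funext => w; rewrite /average mxE summxE.
  apply: measurable_funM => //; apply: measurable_sum => k.
  exact: (adapted_measurable hf (adap k j)).
have rem := remainder_in_probability hf ha (fun k w => (iter_proj k w).1) adap g_adapted eta_md G_sqr
  ts_in c10 growth' lpf multiplier_theta tay' r00 cone diam c30 avg_meas.
pose Q := projker (act_mx A b ts).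
have Q_sym : Q^T = Q by exact: projker_sym.
pose eta k w := Gk k w - grad f (theta k w).
have [ml lge lE] := l_ratio ms ms_in.
have mGts i : measurable_fun setT (fun x => G ts x i 0).
  by apply: itg_measurable; exact: G_integrable.
have mW := measurable_reweighted ml mGts.
have iW2 := itg_reweighted_sqr ml lge lE mGts (momG ts ms ts_in ms_in).
have pS1 : psd Sigma1 by apply: psd_covmx.
pose S := covmx (Pmu ms) (fun x => Q *m Gmu ms ts x).
(* The minus sign matches the noise, which enters the limit with opposite sign; the quadratic form
   is even. *)
have SE t : dotv t (S *m t) = dotv (- (Q *m t)) (Sigma1 *m - (Q *m t)).
  rewrite dotv_covmx_mulmx// Q_sym mulmxN dotvNl dotvNr opprK; congr dotv.
have pS : psd S.
  by apply: psd_covmx => i; [exact: measurable_mulmx|exact: itg_mulmx_coord_sqr].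
have [N hN] := gaussian_exists pS.
have eta_sqr k : itg P (fun w => enorm (eta k w) ^+ 2) /\
    Ex P (fun w => enorm (eta k w) ^+ 2) <= 2 * GM ^+ 2 + 2 * gB ^+ 2.
  have [i1 h1] := G_sqr k.
  have le w : enorm (eta k w) ^+ 2 <= 2 * enorm (Gk k w) ^+ 2 + 2 * gB ^+ 2.
    have hg := gB_le _ (iter_in k w).1.
    have h2 : enorm (grad f (theta k w)) ^+ 2 <= gB ^+ 2.
      by rewrite lerXn2r ?nnegrE ?enorm_ge0// (le_trans _ hg)// enorm_ge0.
    have h3 : enorm (eta k w) ^+ 2 <= (enorm (Gk k w) + enorm (grad f (theta k w))) ^+ 2.
      by rewrite lerXn2r ?nnegrE ?addr_ge0 ?enorm_ge0// enormB.
    have := sqr_ge0 (enorm (Gk k w) - enorm (grad f (theta k w))); nra.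
  have i2 : itg P (fun w => 2 * enorm (Gk k w) ^+ 2 + 2 * gB ^+ 2).
    by apply: itgD; [exact: itgZ|exact: itg_cst].
  have i3 : itg P (fun w => enorm (eta k w) ^+ 2).
    apply: (itg_le _ _ i2) => [|w]; last by rewrite ger0_norm ?sqr_ge0.
    apply: measurable_funX; apply: measurable_fun_enorm; apply: measurable_fun_cV => // i.
    exact: (@martingale_diff_measurable _ _ _ P _ (fun k w => eta k w i 0) k hf (eta_md i)).
  split => //; apply: (le_trans (Ex_le i3 i2 le)).
  rewrite ExD; [|exact: itgZ|exact: itg_cst].
  by rewrite (Ex_cst P (2 * gB ^+ 2)) ExZ// lerD2r ler_wpM2l.
(* A test vector with zero second block sees only the gradient noise, so the joint noise conditions
   apply to [eta] alone. *)
have xiE t k w : dotv (col_mx t 0) (xi k w) = dotv t (eta k w).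
  by rewrite dotv_col_mx dotv0l addr0.
split; last first.
  (* The subtracted norm does not depend on u, so minimality and uniqueness both pass between the
     trace and [v ts]. *)
  have trE u : M u -> \tr (covmx (Pmu u) (fun x => Q *m Gmu u ts x)) =
      v ts u - enorm (Q *m grad f ts) ^+ 2.
    move=> hu; have [ml' lge' lE'] := l_ratio u hu.
    rewrite (mxtrace_covmx_reweighted ml' lge' lE' mGts (fun i => G_integrable ts i ts_in)
      (momG ts u ts_in hu)).
    by rewrite grad_f.
  have [[_ ms_min] ms_uniq] := ms_argmin.
  split=> [|u [hu u_min]].
    by split => // u hu; rewrite !trE// lerD2r; exact: ms_min.
  apply: ms_uniq; split => // u' hu'.
  by have := u_min u' hu'; rewrite !trE// lerD2r.
exists N; split; first exact: gaussian_is_normal.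
apply: (cvg_in_law_normalized hf eta_md eta_sqr Q_sym _ rem _ hN) => [n|c t].
  apply: measurable_fun_cV => // i.
  rewrite (_ : (fun w => _) = (fun w => Num.sqrt n%:R * (Q *m grad f (average theta n w)) i 0)).
    by apply: measurable_funM => //; exact: measurable_mulmx.
  by apply/funext => w; rewrite mxE.
set t' : 'cV[R]_s := - (Q *m t).
rewrite SE -/t'.
apply: (martingale_clt_cos hf (martingale_diff_dotv t' hf eta_md)).
- by have [_] := pS1; exact.
- move=> e e0; have [Y [h1 h2]] := lindeberg (col_mx t' 0) e e0; exists Y; split => // n k kn.
  have E : [set w | e * Num.sqrt n%:R < `|dotv (col_mx t' 0) (xi k w)|] =
      [set w | e * Num.sqrt n%:R < `|dotv t' (eta k w)|].
    by apply/funext => w; rewrite /mkset xiE.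
  by have := h1 n k kn; rewrite E; under eq_fun do rewrite xiE.
- have [V [h1 h2]] := covariances.
  exists (fun k w => dotv (col_mx t' 0) (V k w *m col_mx t' 0)); split => [k|].
    have [hg _] := hf.
    have := @is_cond_exp_quadratic _ _ _ P _ _ (xi k) (V k) (col_mx t' 0) (hg k) (h1 k).
    by under eq_fun do rewrite xiE.
  have := h2 (col_mx t' 0).
  (* Against this vector only the block [Sigma1] contributes to the quadratic form. *)
  rewrite mul_block_col !mulmx0 !mul0mx !addr0 dotv_col_mx dotv0l addr0.
  congr (cvg_in_proba P _ _); apply/funext => n; apply/funext => w.
  rewrite -scalemxAl dotvC dotvZl dotvC; congr (_ * _).
  by rewrite mulmx_suml dotv_sumr.
Qed.
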